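(* Let $X$ be a toric Fano manifold of dimension $n$, with pseudo-index $\iota_X$ and Picard number $\rho_X$. If $3\iota_X\ge n+3$, then $\rho_X(\iota_X-1)\le n$ (and hence $\rho_X\le 3$). If moreover $\rho_X(\iota_X-1)=n$, then $X\simeq(\mathbb{P}^{\iota_X-1})^{\rho_X}$.
   Context: A Fano manifold is a smooth connected projective variety $X$ over $\mathbb{C}$ whose anticanonical bundle $-K_X$ is ample; a toric Fano manifold is a Fano manifold that is a toric variety. The pseudo-index $\iota_X$ is the smallest integer of the form $-K_X\cdot C$, where $C$ is a rational curve in $X$. The Picard number is denoted $\rho_X$. *)

(* Defs.v *)
From mathcomp Require Import all_boot all_order all_algebra.
From mathcomp Require Import complex.
From mathcomp Require Import boolp classical_sets cardinality reals.

Set Implicit Arguments.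
Unset Strict Implicit.
Unset Printing Implicit Defensive.

Import Order.TTheory GRing.Theory Num.Theory.
Local Open Scope classical_set_scope.
Local Open Scope ring_scope.

(** Varieties over an algebraically closed field [K] are treated classically:
    a variety is its set of closed points, with its Zariski open sets and its
    sheaf of [K]-valued regular functions.  An [fspace] carries only this data;
    the axioms (topology, sheaf, ...) hold for every space considered below,
    since it is either constructed explicitly or assumed to be isomorphic to
    a closed subset of a projective space. *)

Record fspace (K : fieldType) := FSpace {
  pt :> Type;
  opn : set (set pt);
  (* [reg U f]: U is open and f restricted to U is a regular function *)
  reg : set pt -> set (pt -> K)
}.

Definition closed_in (K : fieldType) (X : fspace K) (Z : set X) : Prop :=
  opn (~` Z).

Definition regular_at (K : fieldType) (X : fspace K) (p : X)
    (f : X -> K) : Prop :=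
  exists2 U : set X, U p & reg U f.

Definition regular_map (K : fieldType) (X Y : fspace K) (f : X -> Y) : Prop :=
  (forall V : set Y, opn V -> opn (f @^-1` V)) /\
  (forall (V : set Y) (g : Y -> K), reg V g -> reg (f @^-1` V) (g \o f)).

Definition isomorphic (K : fieldType) (X Y : fspace K) : Prop :=
  exists (f : X -> Y) (g : Y -> X),
    [/\ regular_map f, regular_map g, cancel f g & cancel g f].

(** The structure induced on a (locally closed) subset. *)
Definition induced_space (K : fieldType) (X : fspace K) (Z : set X) : fspace K :=
  @FSpace K {x : X | Z x}
    [set U | exists2 V : set X, opn V & forall z, U z <-> V (sval z)]
    (fun U => [set f | forall p, U p -> exists (V : set X) (g : X -> K),
       [/\ V (sval p), reg V g &
           forall q, V (sval q) -> U q /\ f q = g (sval q)]]).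

(** * Spaces glued from affine charts *)

Record atlas (K : fieldType) := Atlas {
  apt : Type;
  aidx : Type;
  adom : aidx -> set apt;
  (* generators of the coordinate ring of the chart *)
  acrd : aidx -> set (apt -> K)
}.

Inductive algebra_gen (K : fieldType) (T : Type) (S : set (T -> K)) :
    (T -> K) -> Prop :=
| AlgIn f : S f -> algebra_gen S f
| AlgCst c : algebra_gen S (fun _ => c)
| AlgAdd f g : algebra_gen S f -> algebra_gen S g ->
    algebra_gen S (fun x => f x + g x)
| AlgMul f g : algebra_gen S f -> algebra_gen S g ->
    algebra_gen S (fun x => f x * g x).

(** The principal open sets [{b <> 0}] of the charts form a basis of the
    topology, and the regular functions are locally of the form [a / b]. *)
Definition glued_space (K : fieldType) (A : atlas K) : fspace K :=
  @FSpace K (apt A)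
    [set U | forall p, U p -> exists (i : aidx A) (b : apt A -> K),
       [/\ algebra_gen (acrd i) b, adom i p, b p != 0 &
           forall q, adom i q -> b q != 0 -> U q]]
    (fun U => [set f | forall p, U p ->
       exists (i : aidx A) (a b : apt A -> K),
       [/\ algebra_gen (acrd i) a /\ algebra_gen (acrd i) b, adom i p, b p != 0 &
           forall q, adom i q -> b q != 0 -> U q /\ f q = a q / b q]]).

Definition atlas_pow (K : fieldType) (A : atlas K) (r : nat) : atlas K :=
  @Atlas K {ffun 'I_r -> apt A} {ffun 'I_r -> aidx A}
    (fun i => [set p | forall j, adom (i j) (p j)])
    (fun i => [set f | exists j (g : apt A -> K),
                        acrd (i j) g /\
                        f = (fun p : {ffun 'I_r -> apt A} => g (p j))]).

(** Points of [P^N] are the lines of [K^(N+1)]. *)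
Definition proj_point (K : fieldType) (N : nat) : Type :=
  {L : {vspace 'rV[K]_N.+1} | \dim L == 1%N}.

(** Homogeneous coordinates, with respect to a chosen vector of the line; only
    their quotients and their vanishing are used. *)
Definition hcoord (K : fieldType) (N : nat) (L : proj_point K N)
  (j : 'I_N.+1) : K := vpick (sval L) 0 j.

Definition proj_atlas (K : fieldType) (N : nat) : atlas K :=
  @Atlas K (proj_point K N) 'I_N.+1
    (fun i => [set L | hcoord L i != 0])
    (fun i => [set f | exists j, f = (fun L => hcoord L j / hcoord L i)]).

Definition proj_space (K : fieldType) (N : nat) : fspace K :=
  glued_space (proj_atlas K N).

(** The product [(P^k)^r]. *)
Definition proj_pow (K : fieldType) (k r : nat) : fspace K :=
  glued_space (atlas_pow (proj_atlas K k) r).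

(** * Projective manifolds *)

(** The partial inverse of [f], from [f(X) `&` V] to [X], is defined and is a
    morphism. *)
Definition invertible_over (K : fieldType) (X Y : fspace K) (f : X -> Y)
    (V : set Y) : Prop :=
  exists2 g : induced_space (range f `&` V) -> X, regular_map g &
    forall x z, f x = sval z -> g z = x.

Definition closed_immersion (K : fieldType) (X Y : fspace K) (f : X -> Y) : Prop :=
  [/\ regular_map f, closed_in (range f) & invertible_over f setT].

Definition projective_variety (K : fieldType) (X : fspace K) : Prop :=
  exists (N : nat) (f : X -> proj_space K N), closed_immersion f.

Definition connected_space (K : fieldType) (X : fspace K) : Prop :=
  (exists x : X, True) /\
  (forall U V : set X, opn U -> opn V -> U `|` V = setT -> U `&` V = set0 ->
     U = set0 \/ V = set0).

Definition irreducible_set (K : fieldType) (X : fspace K) (Z : set X) : Prop :=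
  Z !=set0 /\
  (forall A B : set X, closed_in A -> closed_in B -> Z `<=` A `|` B ->
     Z `<=` A \/ Z `<=` B).

Definition irreducible_chain (K : fieldType) (X : fspace K) (n : nat)
    (Z : nat -> set X) : Prop :=
  (forall i, (i <= n)%N -> closed_in (Z i) /\ irreducible_set (Z i)) /\
  (forall i, (i < n)%N -> Z i `<` Z i.+1).

(** Krull dimension. *)
Definition has_dim (K : fieldType) (X : fspace K) (n : nat) : Prop :=
  (exists Z : nat -> set X, irreducible_chain n Z) /\
  (forall Z : nat -> set X, ~ irreducible_chain n.+1 Z).

(** The germ of [f] at [p] lies in the square of the maximal ideal. *)
Definition in_max_ideal_sq (K : fieldType) (X : fspace K) (p : X) (f : X -> K) :
    Prop :=
  exists (r : nat) (g h : 'I_r -> X -> K),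
    (forall k, [/\ regular_at p (g k), g k p = 0, regular_at p (h k) & h k p = 0]) /\
    (exists U : set X, [/\ opn U, U p &
       forall q, U q -> f q = \sum_(k < r) g k q * h k q]).

(** [d_p f = \sum_i c_i d_p y_i] in the Zariski cotangent space at [p]. *)
Definition differential_at (K : fieldType) (X : fspace K) (n : nat) (p : X)
    (y : 'I_n -> X -> K) (f : X -> K) (c : 'rV[K]_n) : Prop :=
  in_max_ideal_sq p
    (fun q => f q - f p - \sum_(i < n) c 0 i * (y i q - y i p)).

(** The differentials [d_p y_i] form a basis of the Zariski cotangent space. *)
Definition coordinates_at (K : fieldType) (X : fspace K) (n : nat) (p : X)
    (y : 'I_n -> X -> K) : Prop :=
  (forall i, regular_at p (y i)) /\
  (forall f, regular_at p f -> exists! c : 'rV[K]_n, differential_at p y f c).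

(** Smoothness: the Zariski cotangent space has dimension [n = dim X] at every
    point; for connected [X] this also forces [X] to be irreducible. *)
Definition manifold (K : fieldType) (X : fspace K) (n : nat) : Prop :=
  [/\ projective_variety X, connected_space X, has_dim X n &
      forall p : X, exists y : 'I_n -> X -> K, coordinates_at p y].

(** * Line bundles *)

(** A line bundle is given by transition functions on an open covering; its
    sections are the families [s] with [s_i = ltr i j * s_j]. *)
Record line_data (K : fieldType) (X : fspace K) := LineData {
  lidx : Type;
  ldom : lidx -> set X;
  ltr : lidx -> lidx -> X -> K
}.

Definition line_bundle (K : fieldType) (X : fspace K) (L : line_data X) : Prop :=
  [/\ forall i : lidx L, opn (ldom i),
      forall p : X, exists i : lidx L, ldom i p,
      forall i j : lidx L, reg (ldom i `&` ldom j) (ltr i j),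
      forall (i : lidx L) p, ldom i p -> ltr i i p = 1 &
      forall (i j k : lidx L) p, ldom i p -> ldom j p -> ldom k p ->
        ltr i j p * ltr j k p = ltr i k p].

Definition line_iso (K : fieldType) (X : fspace K) (L M : line_data X) : Prop :=
  exists h : lidx L -> lidx M -> X -> K,
    [/\ forall i j, reg (ldom i `&` ldom j) (h i j),
        forall i j p, ldom i p -> ldom j p -> h i j p != 0 &
        forall i i' j j' p, ldom i p -> ldom i' p -> ldom j p -> ldom j' p ->
          h i j p = ltr i i' p * h i' j' p * ltr j' j p].

Definition pullback (K : fieldType) (X Y : fspace K) (f : X -> Y)
    (L : line_data Y) : line_data X :=
  @LineData K X (lidx L) (fun i => f @^-1` ldom i) (fun i j => ltr i j \o f).

(** The tensor product of the [L_t ^ (a_t)]. *)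
Definition line_comb (K : fieldType) (X : fspace K) (r : nat)
    (L : 'I_r -> line_data X) (a : 'I_r -> int) : line_data X :=
  @LineData K X (forall t, lidx (L t))
    (fun i => [set p | forall t, ldom (i t) p])
    (fun i j p => \prod_(t < r) (ltr (i t) (j t) p) ^ (a t)).

Definition line_pow (K : fieldType) (X : fspace K) (L : line_data X) (m : nat) :
    line_data X :=
  @LineData K X (lidx L) (@ldom K X L) (fun i j p => (ltr i j p) ^+ m).

(** [O(1)]: a linear form [l] is the section given by [l / x_i] on [x_i <> 0]. *)
Definition hyperplane_bundle (K : fieldType) (N : nat) :
    line_data (proj_space K N) :=
  @LineData K (proj_space K N) 'I_N.+1
    (fun i => [set L : proj_point K N | hcoord L i != 0])
    (fun i j (L : proj_point K N) => hcoord L j / hcoord L i).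

Definition ample (K : fieldType) (X : fspace K) (L : line_data X) : Prop :=
  exists (m N : nat) (f : X -> proj_space K N),
    [/\ (0 < m)%N, closed_immersion f &
        line_iso (line_pow L m) (pullback f (hyperplane_bundle K N))].

Record coordinate_chart (K : fieldType) (X : fspace K) (n : nat) :=
  CoordinateChart {
  cdom : set X;
  ccoord : 'I_n -> X -> K;
  cdom_open : opn cdom;
  ccoord_reg : forall i, reg cdom (ccoord i);
  ccoordP : forall p, cdom p -> coordinates_at p ccoord
}.

(** The matrix of the [dy_i / dz_j] at [p]. *)
Definition jacobian_at (K : fieldType) (X : fspace K) (n : nat)
    (y z : 'I_n -> X -> K) (p : X) : 'M[K]_n :=
  \matrix_(i < n) xget 0 [set c : 'rV[K]_n | differential_at p z (y i) c].

(** [-K_X], the determinant of the tangent bundle: the local frame attached to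
    the coordinates [y] is the wedge product of the [d/dy_i], and the frame of
    [z] is [det (dy_i / dz_j)] times the frame of [y]. *)
Definition anticanonical (K : fieldType) (X : fspace K) (n : nat) : line_data X :=
  @LineData K X (coordinate_chart X n) (@cdom K X n)
    (fun y z p => \det (jacobian_at (@ccoord K X n y) (@ccoord K X n z) p)).

(** * Curves and intersection numbers *)

(** [d] is the degree of [L] on a smooth projective curve [B]: [L] has a
    nonzero rational section [s] which is regular and nonvanishing outside the
    points [P_a], has order [k_a] at [P_a], and [d = \sum_a k_a]. *)
Definition has_degree (K : fieldType) (B : fspace K) (L : line_data B) (d : int) :
    Prop :=
  exists (m : nat) (P : 'I_m -> B) (k : 'I_m -> int) (s : lidx L -> B -> K),
    [/\ injective P,
        forall i j q, ~ range P q -> ldom i q -> ldom j q ->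
          s i q = ltr i j q * s j q,
        forall i q, ~ range P q -> ldom i q -> regular_at q (s i) /\ s i q != 0,
        forall a : 'I_m, exists (i : lidx L) (t u : B -> K) (W : set B),
          [/\ ldom i (P a),
              coordinates_at (P a) (fun _ : 'I_1 => t) /\ t (P a) = 0,
              regular_at (P a) u /\ u (P a) != 0,
              opn W /\ W (P a) &
              forall q, W q -> ldom i q -> q <> P a -> s i q = u q * t q ^ k a] &
        d = \sum_(a < m) k a].

(** A curve in [X] is given by its normalization: a morphism from a smooth
    connected projective curve that is birational onto its image. *)
Definition curve_in (K : fieldType) (X B : fspace K) (nu : B -> X) : Prop :=
  [/\ manifold B 1, regular_map nu &
      exists V : set X, [/\ opn V, range nu `&` V !=set0 & invertible_over nu V]].

(** [iota] is the smallest [-K_X . C] with [C] a rational curve, i.e. a curve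
    whose normalization is [P^1]. *)
Definition pseudo_index (K : fieldType) (X : fspace K) (n iota : nat) : Prop :=
  (exists nu : proj_space K 1 -> X,
     curve_in nu /\ has_degree (pullback nu (anticanonical X n)) iota%:Z) /\
  (forall (nu : proj_space K 1 -> X) (d : int), curve_in nu ->
     has_degree (pullback nu (anticanonical X n)) d -> iota%:Z <= d).

Definition num_trivial (K : fieldType) (X : fspace K) (L : line_data X) : Prop :=
  forall (B : fspace K) (nu : B -> X), curve_in nu -> has_degree (pullback nu L) 0.

Definition num_independent (K : fieldType) (X : fspace K) (r : nat)
    (L : 'I_r -> line_data X) : Prop :=
  forall a : 'I_r -> int, num_trivial (line_comb L a) -> forall t, a t = 0.

(** The rank of the group of line bundles modulo numerical equivalence. *)
Definition picard_number (K : fieldType) (X : fspace K) (rho : nat) : Prop :=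
  (exists L : 'I_rho -> line_data X,
     (forall t, line_bundle (L t)) /\ num_independent L) /\
  (forall L : 'I_rho.+1 -> line_data X,
     (forall t, line_bundle (L t)) -> ~ num_independent L).

(** * Toric varieties *)

Section Fans.
Context (R : realType) (d : nat).

Definition dual_pairing (u v : 'rV[R]_d) : R := \sum_(i < d) u 0 i * v 0 i.

Definition lattice_vec (m : 'rV[int]_d) : 'rV[R]_d := map_mx intr m.

Definition generated_cone (r : nat) (g : 'I_r -> 'rV[int]_d) : set 'rV[R]_d :=
  [set v | exists c : 'I_r -> R, (forall k, 0 <= c k) /\
     v = \sum_(k < r) c k *: lattice_vec (g k)].

Definition dual_cone (sigma : set 'rV[R]_d) : set 'rV[R]_d :=
  [set u | forall v, sigma v -> 0 <= dual_pairing u v].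

Definition orthogonal_to (sigma : set 'rV[R]_d) : set 'rV[R]_d :=
  [set u | forall v, sigma v -> dual_pairing u v = 0].

Definition is_face (tau sigma : set 'rV[R]_d) : Prop :=
  exists2 u, dual_cone sigma u &
    tau = sigma `&` [set v | dual_pairing u v = 0].

(** A fan in [Z^d]: a finite set of strongly convex rational polyhedral cones. *)
Definition is_fan (Sigma : set (set 'rV[R]_d)) : Prop :=
  [/\ finite_set Sigma,
      forall sigma, Sigma sigma ->
        (exists (r : nat) (g : 'I_r -> 'rV[int]_d), sigma = generated_cone g) /\
        (forall v, sigma v -> sigma (- v) -> v = 0),
      forall sigma tau, Sigma sigma -> is_face tau sigma -> Sigma tau &
      forall sigma sigma', Sigma sigma -> Sigma sigma' ->
        is_face (sigma `&` sigma') sigma /\ is_face (sigma `&` sigma') sigma'].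

(** The points of the toric variety of [Sigma], listed orbit by orbit: the orbit
    of [tau] consists of the group homomorphisms from the lattice of the [m]
    orthogonal to [tau] to [K^*], here extended by zero to all of [Z^d].  The
    affine chart of [sigma] (the semigroup homomorphisms from the lattice points
    of the dual cone of [sigma] to [K]) is the union of the orbits of the faces
    of [sigma], and its coordinate ring is spanned by the characters
    [x |-> x m] for the lattice points [m] of the dual cone of [sigma]. *)
Definition toric_point (K : fieldType) (Sigma : set (set 'rV[R]_d)) : Type :=
  {p : set 'rV[R]_d * ('rV[int]_d -> K) |
    [/\ Sigma p.1,
        forall m, p.2 m <> 0 <-> orthogonal_to p.1 (lattice_vec m),
        p.2 0 = 1 &
        forall m m', orthogonal_to p.1 (lattice_vec m) ->
          orthogonal_to p.1 (lattice_vec m') -> p.2 (m + m') = p.2 m * p.2 m']}.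

Definition toric_atlas (K : fieldType) (Sigma : set (set 'rV[R]_d)) : atlas K :=
  @Atlas K (toric_point K Sigma) {sigma | Sigma sigma}
    (fun sigma => [set p | (sval p).1 `<=` sval sigma])
    (fun sigma => [set f | exists2 m,
       dual_cone (sval sigma) (lattice_vec m) & f = (fun p => (sval p).2 m)]).

End Fans.

Definition toric (R : realType) (K : fieldType) (X : fspace K) : Prop :=
  exists (d : nat) (Sigma : set (set 'rV[R]_d)),
    is_fan Sigma /\ isomorphic X (glued_space (toric_atlas K Sigma)).

Definition toric_fano_manifold (R : realType) (X : fspace R[i]) (n : nat) : Prop :=
  [/\ manifold X n, ample (anticanonical X n) & toric R X].

(* Main.v *)
Require Import Defs.
From mathcomp Require Import all_boot all_order all_algebra.
From mathcomp Require Import perm complex.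
From mathcomp Require Import boolp classical_sets functions cardinality reals.
From mathcomp Require Import ring zify.

(** Let [S] be the fan, with rays [V] and dimension [d = n].  Projectivity makes
    [S] complete and smoothness makes its maximal cones unimodular.  A wall of a
    maximal cone [E] gives a rational curve, whose anticanonical degree is
    [1 - A] if the ray across the wall has coordinates of sum [A] in the basis [E];
    hence [A <= 1 - iota].  Write [ht E v] for the sum of the coordinates of [v]
    in the basis [E].  A ray [v] lies in the cones which maximize [ht _ v], so
    [ht E v <= 1] for every [E], and [ht E v <= 1 - iota] unless [v] is a row of
    [E].  Since [0] is a positive combination of the linear forms [ht E], summing
    over [V] gives [(|V| - d) (iota - 1) <= d] (Casagrande's argument).

    Line bundles are trivial on the charts of maximal cones, which are affine
    spaces, and the units of the torus are monomials; so a line bundle is given by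
    integers on the rays, zero on the rays of a fixed cone, and
    [rho <= |V| - d].

    In the equality case, for some [E] every ray outside [E] is minus a sum of rows
    of [E], over disjoint blocks of [iota - 1] rows: the fan is the one of a
    product of projective spaces, and homogeneous coordinates are Cox coordinates. *)

Set Implicit Arguments.
Unset Strict Implicit.
Unset Printing Implicit Defensive.

Import Order.TTheory GRing.Theory Num.Theory.
Local Open Scope classical_set_scope.
Local Open Scope ring_scope.

(** * Spaces with functions *)

(** The degrees of curves enter only through the inequality [A <= 1 - iota] for walls. With
    [iota > 0] it is a strict convexity: if [v] has a negative coordinate at a wall of [E], crossing
    that wall raises the height of [v] by at least [iota]. This is why a cone of maximal height
    contains [v], and why a single negative coordinate already pushes [ht E v] down to [1 - iota].

    Most of the text is the geometry below these inequalities. A space is only a set of points with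
    functions, so its properties are read off by restricting functions to explicit curves and
    comparing rational functions of the parameter [t]: limits at [t = 0] give completeness,
    derivatives at [t = 0] give coordinates and Jacobians, and exponents of [t] give the weights of
    line bundles. Triviality of line bundles on an affine chart is a statement on Cartier divisors
    of affine space; it rests on the factoriality of polynomial rings and on a Nullstellensatz for a
    single prime element. *)

Section Algebra.
Variables (K : fieldType) (T : Type).
Implicit Types (S : set (T -> K)) (f g : T -> K).

Lemma eq_algebra S f g : f =1 g -> algebra_gen S f -> algebra_gen S g.
Proof. by move=> /funext ->. Qed.

Lemma algebra_prod S (I : Type) (r : seq I) (P : pred I) (F : I -> T -> K) :
  (forall i, P i -> algebra_gen S (F i)) ->
  algebra_gen S (fun x => \prod_(i <- r | P i) F i x).
Proof.
move=> SF; elim: r => [|i r IH].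
  by apply: (eq_algebra _ (AlgCst S 1)) => x; rewrite big_nil.
apply: (@eq_algebra _ (fun x => (if P i then F i x else 1) *
                                \prod_(i <- r | P i) F i x)) => [x|].
  by rewrite big_cons; case: ifP; rewrite ?mul1r.
apply: (AlgMul _ IH); case Pi: (P i); [exact: SF | exact: AlgCst].
Qed.

Lemma algebra_exp S f n : algebra_gen S f -> algebra_gen S (fun x => f x ^+ n).
Proof.
move=> Sf; elim: n => [|n IH].
  by apply: (eq_algebra _ (AlgCst S 1)) => x; rewrite expr0.
by apply: (eq_algebra _ (AlgMul Sf IH)) => x; rewrite exprS.
Qed.

Lemma algebra_comp (T' : Type) S (S' : set (T' -> K)) (h : T' -> T) f :
  (forall g, S g -> algebra_gen S' (g \o h)) -> algebra_gen S f ->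
  algebra_gen S' (f \o h).
Proof.
move=> SS'; elim=> [g /SS' //|c|g1 g2 _ IH1 _ IH2|g1 g2 _ IH1 _ IH2].
- exact: AlgCst.
- exact: AlgAdd IH1 IH2.
- exact: AlgMul IH1 IH2.
Qed.

End Algebra.

Section OkSpace.
Variable K : fieldType.

(** The axioms that the bare data of an [fspace] do not include: a topology, locality of [reg], and
    local rings of germs. They hold for good glued spaces and pass to subsets. *)
Record ok_space (X : fspace K) : Prop := OkSpace {
  okT : opn (setT : set X);
  okI : forall U V : set X, opn U -> opn V -> opn (U `&` V);
  okU : forall U : set X,
    (forall p, U p -> exists V : set X, [/\ opn V, V p & V `<=` U]) -> opn U;
  ok_reg : forall (U : set X) f,
    reg U f <-> opn U /\ forall p, U p -> regular_at p f;
  ok_ext : forall (U : set X) p f g,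
    regular_at p f -> opn U -> U p -> (forall q, U q -> f q = g q) ->
    regular_at p g;
  ok_cst : forall (p : X) c, regular_at p (fun _ => c);
  ok_add : forall (p : X) f g, regular_at p f -> regular_at p g ->
    regular_at p (fun q => f q + g q);
  ok_mul : forall (p : X) f g, regular_at p f -> regular_at p g ->
    regular_at p (fun q => f q * g q);
  ok_inv : forall (p : X) f, regular_at p f -> f p != 0 ->
    regular_at p (fun q => (f q)^-1);
  ok_nz : forall (p : X) f, regular_at p f -> f p != 0 ->
    exists U : set X, [/\ opn U, U p & forall q, U q -> f q != 0]
}.

Section Theory.
Variables (X : fspace K) (okX : ok_space X).
Implicit Types (p : X) (f g : X -> K) (U : set X).

Lemma eq_regular p f g : f =1 g -> regular_at p f -> regular_at p g.
Proof. by move=> /funext ->. Qed.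

Lemma regular_near p f : regular_at p f ->
  exists U : set X, [/\ opn U, U p & forall q, U q -> regular_at q f].
Proof.
by move=> [U Up Uf]; exists U; split=> //; have [] := (ok_reg okX U f).1 Uf.
Qed.

Lemma regular_opp p f : regular_at p f -> regular_at p (fun q => - f q).
Proof.
move=> pf; apply: (@eq_regular _ (fun q => -1 * f q)) => [q|].
  by rewrite mulN1r.
exact: ok_mul (ok_cst okX _ _) pf.
Qed.

Lemma regular_sub p f g : regular_at p f -> regular_at p g ->
  regular_at p (fun q => f q - g q).
Proof. by move=> pf pg; apply: (ok_add okX pf (regular_opp pg)). Qed.

Lemma regular_sum p (I : Type) (r : seq I) (P : pred I) (F : I -> X -> K) :
  (forall i, P i -> regular_at p (F i)) ->
  regular_at p (fun x => \sum_(i <- r | P i) F i x).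
Proof.
move=> SF; elim: r => [|i r IH].
  by apply: (eq_regular _ (ok_cst okX p 0)) => x; rewrite big_nil.
apply: (@eq_regular _ (fun x => (if P i then F i x else 0) +
                                \sum_(i <- r | P i) F i x)) => [x|].
  by rewrite big_cons; case: ifP; rewrite ?add0r.
by apply: (ok_add okX _ IH); case Pi: (P i); [exact: SF | exact: ok_cst].
Qed.

Lemma regular_prod p (I : Type) (r : seq I) (P : pred I) (F : I -> X -> K) :
  (forall i, P i -> regular_at p (F i)) ->
  regular_at p (fun x => \prod_(i <- r | P i) F i x).
Proof.
move=> SF; elim: r => [|i r IH].
  by apply: (eq_regular _ (ok_cst okX p 1)) => x; rewrite big_nil.
apply: (@eq_regular _ (fun x => (if P i then F i x else 1) *
                                \prod_(i <- r | P i) F i x)) => [x|].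
  by rewrite big_cons; case: ifP; rewrite ?mul1r.
by apply: (ok_mul okX _ IH); case Pi: (P i); [exact: SF | exact: ok_cst].
Qed.

Lemma regular_exp p f (n : nat) :
  regular_at p f -> regular_at p (fun q => f q ^+ n).
Proof.
move=> pf; elim: n => [|n IH].
  by apply: (eq_regular _ (ok_cst okX p 1)) => q; rewrite expr0.
by apply: (eq_regular _ (ok_mul okX pf IH)) => q; rewrite exprS.
Qed.

Lemma regular_expz p f (k : int) : regular_at p f ->
  (f p = 0 -> 0 <= k) -> regular_at p (fun q => f q ^ k).
Proof.
move=> pf; case: k => n H; first exact: regular_exp.
apply: (ok_inv okX); first exact: regular_exp.
by rewrite expf_neq0 //; apply/eqP => /H.
Qed.

Lemma open_bigI (I : finType) (p : X) (P : I -> set X -> Prop) :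
  (forall i, exists U, [/\ opn U, U p & P i U]) ->
  (forall i (U V : set X), V `<=` U -> P i U -> P i V) ->
  exists U, [/\ opn U, U p & forall i, P i U].
Proof.
move=> H mono; pose V i := sval (cid (H i)).
have VP i : [/\ opn (V i), V i p & P i (V i)] by rewrite /V; case: cid.
suff [U [oU Up UV]] : exists U : set X,
    [/\ opn U, U p & forall i, i \in enum I -> U `<=` V i].
  exists U; split=> // i; have [_ _] := VP i; apply: mono.
  by apply: UV; rewrite mem_enum.
elim: (enum I) => [|i s [U [oU Up UV]]].
  by exists setT; split=> //; exact: okT.
have [oVi Vip _] := VP i; exists (V i `&` U); split=> //.
  exact: okI.
move=> j; rewrite inE => /orP[/eqP -> q [] //|js q [_ Uq]].
exact: UV Uq.
Qed.

Lemma open_near_finite (I : finType) (p : X) (P : I -> X -> Prop) :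
  (forall i, exists U : set X, [/\ opn U, U p & forall q, U q -> P i q]) ->
  exists U : set X, [/\ opn U, U p & forall q, U q -> forall i, P i q].
Proof.
move=> H; have [] := @open_bigI I p (fun i U => forall q, U q -> P i q) H.
  by move=> i U V VU PU q /VU /PU.
by move=> U [oU Up HU]; exists U; split=> // q Uq i; apply: HU.
Qed.

End Theory.

Lemma regular_comp (X Y : fspace K) (f : X -> Y) p g :
  regular_map f -> regular_at (f p) g -> regular_at p (g \o f).
Proof. by move=> [_ fr] [U Up Ug]; exists (f @^-1` U) => //; apply: fr. Qed.

Lemma ok_induced (X : fspace K) (Z : set X) :
  ok_space X -> ok_space (induced_space Z).
Proof.
move=> okX.
have lift_open (V : set X) : opn V ->
    opn ([set z | V (sval z)] : set (induced_space Z)).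
  by move=> oV; exists V.
have regP (p : induced_space Z) (f : induced_space Z -> K) : regular_at p f <->
    exists (V : set X) (g : X -> K), [/\ V (sval p), reg V g &
       forall q : induced_space Z, V (sval q) -> f q = g (sval q)].
  split=> [[U Up Uf]|[V [g [Vp Vg H]]]].
    have [V [g [Vp Vg H]]] := Uf p Up; exists V, g; split=> // q /H[] //.
  exists ([set z | V (sval z)] : set (induced_space Z)) => // q Vq.
  by exists V, g; split=> // r Vr; split=> //; apply: H.
have binop (op : K -> K -> K) (p : induced_space Z) f g :
    (forall q h k, regular_at q h -> regular_at q k ->
       regular_at (X := X) q (fun r => op (h r) (k r))) ->
    regular_at p f -> regular_at p g -> regular_at p (fun q => op (f q) (g q)).
  move=> Hop /regP[V [h [Vp Vh H]]] /regP[V' [h' [Vp' Vh' H']]].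
  apply/regP; exists (V `&` V'), (fun r => op (h r) (h' r)); split=> //.
    have [oV Rh] := (ok_reg okX _ _).1 Vh.
    have [oV' Rh'] := (ok_reg okX _ _).1 Vh'.
    apply/ok_reg => //; split; first exact: okI.
    by move=> q [Vq Vq']; apply: Hop; [exact: Rh | exact: Rh'].
  by move=> q [Vq Vq']; rewrite H ?H'.
split.
- by exists setT; [exact: okT | move=> z].
- move=> U V [U' oU' HU] [V' oV' HV]; exists (U' `&` V'); first exact: okI.
  by move=> z; split=> [[/HU ? /HV ?]//|[/HU ? /HV ?]].
(* The open set inducing [U] is the largest one, the union of all open sets whose trace lies in [U];
   no neighbourhoods have to be chosen. *)
- move=> U HU; exists [set x | exists W : set X,
    [/\ opn W, W x & forall z : induced_space Z, W (sval z) -> U z]].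
    apply: (okU okX) => x [W [oW Wx WU]]; exists W; split=> // y Wy.
    by exists W.
  move=> z; split=> [/HU[V [[W oW HW] Vz VU]]|[W [_ Wz]]]; last exact.
  by exists W; split=> //; [exact/HW | move=> y /HW /VU].
- move=> U f; split=> [Uf|[[V oV HV] H] p Up].
    split; last by move=> p Up; exists U.
    exists [set x | exists W : set X,
      [/\ opn W, W x & forall z : induced_space Z, W (sval z) -> U z]].
      apply: (okU okX) => x [W [oW Wx WU]]; exists W; split=> // y Wy.
      by exists W.
    move=> z; split=> [/Uf[V [g [Vz Vg H]]]|[W [_ Wz]]]; last exact.
    exists V; split=> //; first by have [] := (ok_reg okX _ _).1 Vg.
    by move=> y /H[].
  have /regP[W [g [Wp Wg H']]] := H p Up.
  have [oW Rg] := (ok_reg okX _ _).1 Wg.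
  exists (V `&` W), g; split=> //.
  + by split=> //; apply/HV.
  + by apply/ok_reg => //; split; [exact: okI | move=> q [_ /Rg]].
  + by move=> q [Vq Wq]; split; [apply/HV | apply: H'].
- move=> U p f g /regP[V [h [Vp Vh H]]] [W oW HW] Up fg.
  have [oV Rh] := (ok_reg okX _ _).1 Vh.
  apply/regP; exists (V `&` W), h; split=> //.
  + by split=> //; apply/HW.
  + by apply/ok_reg => //; split; [exact: okI | move=> q [/Rh]].
  + by move=> q [Vq Wq]; rewrite -fg ?H //; apply/HW.
- move=> p c; apply/regP; exists setT, (fun=> c); split=> //.
  by apply/ok_reg => //; split; [exact: okT | move=> q _; exact: ok_cst].
- by move=> p f g; apply: binop => q h k; apply: ok_add.
- by move=> p f g; apply: binop => q h k; apply: ok_mul.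
- move=> p f /regP[V [h [Vp Vh H]]] fp.
  have [oV Rh] := (ok_reg okX _ _).1 Vh.
  have hp : h (sval p) != 0 by rewrite -H.
  have [W [oW Wp HW]] := ok_nz okX (Rh _ Vp) hp.
  apply/regP; exists (V `&` W), (fun x => (h x)^-1); split=> //.
    apply/ok_reg => //; split; first exact: okI.
    by move=> q [/Rh Rq /HW Wq]; apply: ok_inv.
  by move=> q [Vq Wq]; rewrite H.
- move=> p f /regP[V [h [Vp Vh H]]] fp.
  have [oV Rh] := (ok_reg okX _ _).1 Vh.
  have hp : h (sval p) != 0 by rewrite -H.
  have [W [oW Wp HW]] := ok_nz okX (Rh _ Vp) hp.
  exists ([set z | (V `&` W) (sval z)] : set (induced_space Z)); split=> //.
    by apply: lift_open; exact: okI.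
  by move=> q [Vq /HW Wq]; rewrite H.
Qed.

Lemma regular_map_sval (X : fspace K) (Z : set X) : ok_space X ->
  regular_map (sval : induced_space Z -> X).
Proof.
move=> okX; split=> [V oV|V g Vg]; first by exists V.
by move=> p Vp; exists V, g; split.
Qed.

End OkSpace.

(** * Topology and local rings of glued spaces *)

Section Glued.
Variables (K : fieldType) (A : atlas K).
Local Notation G := (glued_space A).
Local Notation alg i := (algebra_gen (@acrd K A i)).
Implicit Types (i j : aidx A).

Definition local_frac i (p : apt A) (f : apt A -> K) := exists a b,
  [/\ alg i a, alg i b, b p != 0 &
      forall q, adom i q -> b q != 0 -> f q = a q / b q].

(* Every chart around [p] is, near [p], a localization of the chart [i]. *)
Definition good_at (p : apt A) i := adom i p /\ forall j, adom j p ->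
  (exists b, [/\ alg i b, b p != 0 &
     forall q, adom i q -> b q != 0 -> adom j q]) /\
  (forall h, acrd j h -> local_frac i p h).

Definition good_atlas := forall p, exists i, good_at p i.

Lemma local_frac_alg i p f : alg i f -> local_frac i p f.
Proof.
move=> fi; exists f, (fun=> 1); split=> //; first exact: AlgCst.
  exact: oner_neq0.
by move=> q _ _; rewrite divr1.
Qed.

Lemma local_frac_add i p f g : local_frac i p f -> local_frac i p g ->
  local_frac i p (fun q => f q + g q).
Proof.
move=> [a [b [ia ib bp H]]] [a' [b' [ia' ib' bp' H']]].
exists (fun q => a q * b' q + a' q * b q), (fun q => b q * b' q); split.
- by apply: AlgAdd; apply: AlgMul.
- exact: AlgMul.
- by rewrite mulf_neq0.
- move=> q iq; rewrite mulf_eq0 => /norP[bq bq'].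
  by rewrite H // H' //; field; rewrite bq bq'.
Qed.

Lemma local_frac_mul i p f g : local_frac i p f -> local_frac i p g ->
  local_frac i p (fun q => f q * g q).
Proof.
move=> [a [b [ia ib bp H]]] [a' [b' [ia' ib' bp' H']]].
exists (fun q => a q * a' q), (fun q => b q * b' q); split.
- exact: AlgMul.
- exact: AlgMul.
- by rewrite mulf_neq0.
- move=> q iq; rewrite mulf_eq0 => /norP[bq bq'].
  by rewrite H // H' //; field; rewrite bq bq'.
Qed.

Lemma local_frac_inv i p f : adom i p -> local_frac i p f -> f p != 0 ->
  local_frac i p (fun q => (f q)^-1).
Proof.
move=> ip [a [b [ia ib bp H]]] fp.
exists (fun q => b q * b q), (fun q => a q * b q); split.
- exact: AlgMul.
- exact: AlgMul.
- by rewrite mulf_neq0 //; move: fp; rewrite H // mulf_eq0 => /norP[].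
- move=> q iq; rewrite mulf_eq0 => /norP[aq bq].
  by rewrite H //; field; rewrite aq bq.
Qed.

Lemma local_frac_algebra i p (S : set (apt A -> K)) f :
  (forall g, S g -> local_frac i p g) -> algebra_gen S f -> local_frac i p f.
Proof.
move=> SS; elim=> [g /SS //|c|g1 g2 _ IH1 _ IH2|g1 g2 _ IH1 _ IH2].
- by apply: local_frac_alg; exact: AlgCst.
- exact: local_frac_add.
- exact: local_frac_mul.
Qed.

Lemma open_basic i b : alg i b ->
  opn ([set q | adom i q /\ b q != 0] : set G).
Proof.
move=> ib p [ip bp]; exists i, b; split=> //.
Qed.

Lemma open_chart i : opn (adom i : set G).
Proof.
move=> p ip; exists i, (fun=> 1); split=> //; first exact: AlgCst.
exact: oner_neq0.
Qed.

Lemma regular_local_frac i p f : adom i p -> local_frac i p f ->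
  regular_at (X := G) p f.
Proof.
move=> ip [a [b [ia ib bp H]]].
exists [set q | adom i q /\ b q != 0] => // q [iq bq].
by exists i, a, b; split=> // r ir br; split; [split|exact: H].
Qed.

(** A basic neighbourhood of [p] may come from a chart [j] other than [i]. Its equation [b] is a
    fraction over the chart [i], so the product of numerator, denominator and the equation of [j]
    inside [i] cuts out a smaller basic neighbourhood. *)
Lemma good_open p i (U : set G) : good_at p i -> opn U -> U p ->
  exists b, [/\ alg i b, b p != 0 & forall q, adom i q -> b q != 0 -> U q].
Proof.
move=> [ip gi] oU Up; have [j [b [jb jp bp H]]] := oU p Up.
have [[c [ic cp Hc]] Hh] := gi j jp.
have [a [b' [ia ib' bp' H']]] : local_frac i p b.
  exact: local_frac_algebra jb.
exists (fun q => c q * (b' q * a q)); split.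
- by apply: AlgMul => //; apply: AlgMul.
- rewrite !mulf_neq0 //; apply: contra_neq bp => ap.
  by rewrite H' // ap mul0r.
- move=> q iq; rewrite !mulf_eq0 => /norP[cq /norP[bq aq]].
  apply: H; first exact: Hc.
  by rewrite H' // mulf_neq0 // invr_eq0.
Qed.

Lemma good_regular p i f : good_at p i ->
  regular_at (X := G) p f <-> local_frac i p f.
Proof.
move=> gi; have [ip Hi] := gi; split; last exact: regular_local_frac.
move=> [U Up Uf]; have [j [a [b [[ja jb] jp bp H]]]] := Uf p Up.
have [[c [ic cp Hc]] Hh] := Hi j jp.
have La : local_frac i p a by exact: local_frac_algebra ja.
have Lb : local_frac i p b by exact: local_frac_algebra jb.
have [u [v [iu iv vp Huv]]] := local_frac_mul La (local_frac_inv ip Lb bp).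
have [b1 [b2 [ib1 ib2 b2p Hb]]] := Lb.
(* The common factor does not change the fraction; as part of the denominator it confines the
   formula to points of the chart [j] where [b] is nonzero. *)
exists (fun q => u q * (c q * (b2 q * b1 q))),
       (fun q => v q * (c q * (b2 q * b1 q))); split.
- by repeat apply: AlgMul.
- by repeat apply: AlgMul.
- rewrite !mulf_neq0 //; apply: contra_neq bp => ap.
  by rewrite Hb // ap mul0r.
- move=> q iq; rewrite !mulf_eq0 => /norP[vq /norP[cq /norP[b2q b1q]]].
  have bq : b q != 0 by rewrite Hb // mulf_neq0 // invr_eq0.
  have [_ ->] := H q (Hc _ iq cq) bq; rewrite Huv //.
  by field; rewrite vq cq b2q b1q.
Qed.

Lemma ok_glued : good_atlas -> ok_space G.
Proof.
move=> gA.
have regE (U : set G) f :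
    reg U f <-> opn U /\ forall p, U p -> regular_at (X := G) p f.
  split=> [Uf|[oU Uf] p Up].
    split=> [p Up|p Up]; last by exists U.
    have [i [a [b [[ia ib] ip bp H]]]] := Uf p Up.
    by exists i, b; split=> // q iq bq; have [] := H q iq bq.
  have [i gi] := gA p; have [ip _] := gi.
  have [c [ic cp Hc]] := good_open gi oU Up.
  have [a [b [ia ib bp H]]] := (good_regular _ gi).1 (Uf p Up).
  exists i, (fun q => a q * c q), (fun q => b q * c q); split=> //.
  - by split; apply: AlgMul.
  - by rewrite mulf_neq0.
  - move=> q iq; rewrite mulf_eq0 => /norP[bq cq]; split; first exact: Hc.
    by rewrite H //; field; rewrite bq cq.
split=> //.
- move=> p _; have [i [ip _]] := gA p; exists i, (fun=> 1); split=> //.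
    exact: AlgCst.
  exact: oner_neq0.
- move=> U V oU oV p [Up Vp]; have [i gi] := gA p; have [ip _] := gi.
  have [b [ib bp Hb]] := good_open gi oU Up.
  have [c [ic cp Hc]] := good_open gi oV Vp.
  exists i, (fun q => b q * c q); split=> //; first exact: AlgMul.
    by rewrite mulf_neq0.
  by move=> q iq; rewrite mulf_eq0 => /norP[bq cq]; split; auto.
- move=> U HU p Up; have [V [oV Vp VU]] := HU p Up.
  have [i [b [ib ip bp H]]] := oV p Vp; exists i, b; split=> // q iq bq.
  exact/VU/H.
- move=> U p f g pf oU Up fg; have [i gi] := gA p; have [ip _] := gi.
  have [c [ic cp Hc]] := good_open gi oU Up.
  have [a [b [ia ib bp H]]] := (good_regular _ gi).1 pf.
  apply: (regular_local_frac ip); exists (fun q => a q * c q), (fun q => b q * c q).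
  split=> //; try exact: AlgMul; first by rewrite mulf_neq0.
  move=> q iq; rewrite mulf_eq0 => /norP[bq cq]; rewrite -fg; last exact: Hc.
  by rewrite H //; field; rewrite bq cq.
- move=> p c; have [i [ip _]] := gA p; apply: (regular_local_frac ip).
  by apply: local_frac_alg; exact: AlgCst.
- move=> p f g pf pg; have [i gi] := gA p; have [ip _] := gi.
  by apply: (regular_local_frac ip); apply: local_frac_add; exact/(good_regular _ gi).
- move=> p f g pf pg; have [i gi] := gA p; have [ip _] := gi.
  by apply: (regular_local_frac ip); apply: local_frac_mul; exact/(good_regular _ gi).
- move=> p f pf fp; have [i gi] := gA p; have [ip _] := gi.
  by apply: (regular_local_frac ip); apply: local_frac_inv => //; exact/(good_regular _ gi).
- move=> p f pf fp; have [i gi] := gA p; have [ip _] := gi.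
  have [a [b [ia ib bp H]]] := (good_regular _ gi).1 pf.
  exists [set q | adom i q /\ a q * b q != 0]; split=> //.
  + by apply: open_basic; exact: AlgMul.
  + by split=> //; rewrite mulf_neq0 //; move: fp; rewrite H // mulf_eq0 => /norP[].
  + move=> q [iq]; rewrite mulf_eq0 => /norP[aq bq].
    by rewrite H // mulf_neq0 // invr_eq0.
Qed.

Lemma regular_map_glued (Y : fspace K) (f : Y -> G) : ok_space Y ->
  (forall (p : Y) j, adom j (f p) ->
     (exists W : set Y, [/\ opn W, W p & forall q, W q -> adom j (f q)]) /\
     (forall h, acrd j h -> regular_at p (h \o f))) ->
  regular_map f.
Proof.
move=> okY H.
have algr (p : Y) j a : adom j (f p) -> alg j a -> regular_at p (a \o f).
  move=> jp; have [_ Hh] := H p j jp.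
  elim=> [g /Hh //|c|g1 g2 _ IH1 _ IH2|g1 g2 _ IH1 _ IH2].
  - exact: ok_cst.
  - exact: (ok_add okY).
  - exact: (ok_mul okY).
have near (p : Y) j b : adom j (f p) -> alg j b -> b (f p) != 0 ->
    exists W : set Y, [/\ opn W, W p &
      forall q, W q -> adom j (f q) /\ b (f q) != 0].
  move=> jp jb bp; have [[W [oW Wp HW]] _] := H p j jp.
  have [V [oV Vp HV]] := ok_nz okY (algr _ _ _ jp jb) bp.
  exists (W `&` V); split=> //; first exact: okI.
  by move=> q [/HW ? /HV ?].
have fopen (V : set G) : opn V -> opn (f @^-1` V).
  move=> oV; apply: (okU okY) => p Vp; have [j [b [jb jp bp Hb]]] := oV _ Vp.
  have [W [oW Wp HW]] := near _ _ _ jp jb bp.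
  by exists W; split=> // q /HW[jq bq]; exact: Hb.
split=> // V g Vg; apply/ok_reg => //; split.
  apply: fopen => p Vp; have [i [a [b [[ia ib] ip bp Hb]]]] := Vg p Vp.
  by exists i, b; split=> // q iq bq; have [] := Hb q iq bq.
move=> p Vp; have [i [a [b [[ia ib] ip bp Hb]]]] := Vg _ Vp.
have [W [oW Wp HW]] := near _ _ _ ip ib bp.
have R := ok_mul okY (algr _ _ _ ip ia) (ok_inv okY (algr _ _ _ ip ib) bp).
apply: (ok_ext okY R oW Wp) => q /HW[jq bq] /=.
by have [_ ->] := Hb _ jq bq.
Qed.

End Glued.

Lemma good_pow (K : fieldType) (A : atlas K) (r : nat) :
  (forall (p : apt A) i, adom i p -> good_at p i) ->
  forall (p : apt (atlas_pow A r)) i, adom i p -> good_at p i.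
Proof.
move=> gA p i ip; split=> // j jp.
have lift (l : 'I_r) a : algebra_gen (acrd (i l)) a ->
    algebra_gen (@acrd K (atlas_pow A r) i) (fun q => a (q l)).
  apply: (algebra_comp (h := fun q : {ffun 'I_r -> apt A} => q l)) => g ig.
  by apply: AlgIn; exists l, g; split.
split=> [|h [l [g [jg ->]]]].
  have H l : exists b, [/\ algebra_gen (acrd (i l)) b, b (p l) != 0 &
      forall q, adom (i l) q -> b q != 0 -> adom (j l) q].
    by have [_ /(_ _ (jp l))[]] := gA _ _ (ip l).
  pose b l := sval (cid (H l)).
  have bP l : [/\ algebra_gen (acrd (i l)) (b l), b l (p l) != 0 &
      forall q, adom (i l) q -> b l q != 0 -> adom (j l) q].
    by rewrite /b; case: cid.
  exists (fun q : apt (atlas_pow A r) => \prod_l b l (q l)); split.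
  - by apply: algebra_prod => l _; apply: lift; have [] := bP l.
  - by rewrite prodf_seq_neq0; apply/allP => l _; have [] := bP l.
  - move=> q iq; rewrite prodf_seq_neq0 => /allP bq l.
    have [_ _] := bP l; apply; first exact: iq.
    by apply: bq; rewrite mem_index_enum.
have [_ /(_ _ (jp l))[_ /(_ _ jg)[a [b [ia ib bp H]]]]] := gA _ _ (ip l).
exists (fun q : apt (atlas_pow A r) => a (q l)), (fun q : apt (atlas_pow A r) => b (q l)); split=> //.
- exact: lift.
- exact: lift.
- by move=> q iq bq; apply: H => //; exact: iq.
Qed.

(** * Zariski cotangent spaces *)

Section Cotangent.
Variables (K : fieldType) (X : fspace K) (okX : ok_space X) (p : X).
Implicit Types (f g : X -> K).
Local Notation M2 := (in_max_ideal_sq p).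

Lemma max_ideal_sq_ext (U : set X) f g :
  opn U -> U p -> (forall q, U q -> f q = g q) -> M2 f -> M2 g.
Proof.
move=> oU Up fg [r [u [v [uv [V [oV Vp H]]]]]]; exists r, u, v; split=> //.
exists (U `&` V); split=> //; first exact: okI.
by move=> q [Uq Vq]; rewrite -fg // H.
Qed.

Lemma eq_max_ideal_sq f g : f =1 g -> M2 f -> M2 g.
Proof. by move=> /funext ->. Qed.

Lemma max_ideal_sq0 : M2 (fun=> 0).
Proof.
exists 0%N, (fun _ _ => 0), (fun _ _ => 0); split; first by case.
exists setT; split=> //; first exact: okT.
by move=> q _; rewrite big_ord0.
Qed.

Lemma max_ideal_sq_mul f g : regular_at p f -> f p = 0 -> regular_at p g ->
  g p = 0 -> M2 (fun q => f q * g q).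
Proof.
move=> rf f0 rg g0; exists 1%N, (fun=> f), (fun=> g); split=> //.
exists setT; split=> //; first exact: okT.
by move=> q _; rewrite big_ord1.
Qed.

Lemma max_ideal_sq_add f g : M2 f -> M2 g -> M2 (fun q => f q + g q).
Proof.
move=> [r [u [v [uv [U [oU Up H]]]]]] [r' [u' [v' [uv' [U' [oU' Up' H']]]]]].
exists (r + r')%N.
exists (fun k : 'I_(r + r') =>
  match fintype.split k with inl i => u i | inr j => u' j end).
exists (fun k : 'I_(r + r') =>
  match fintype.split k with inl i => v i | inr j => v' j end).
split; first by move=> k; case: splitP => i _; [exact: uv | exact: uv'].
exists (U `&` U'); split=> //; first exact: okI.
move=> q [Uq Uq']; rewrite H // H' // big_split_ord /=; congr (_ + _).
  apply: eq_bigr => i _.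
  by rewrite -[lshift _ _]/(unsplit (inl i)) unsplitK.
apply: eq_bigr => i _.
by rewrite -[rshift _ _]/(unsplit (inr i)) unsplitK.
Qed.

Lemma max_ideal_sq_scale h f :
  regular_at p h -> M2 f -> M2 (fun q => h q * f q).
Proof.
move=> rh [r [u [v [uv [U [oU Up H]]]]]].
exists r, (fun k q => h q * u k q), v; split.
  move=> k; have [ru u0 rv v0] := uv k; split=> //; last by rewrite u0 mulr0.
  exact: ok_mul.
exists U; split=> // q Uq; rewrite H // mulr_sumr.
by apply: eq_bigr => k _; rewrite mulrA.
Qed.

Lemma max_ideal_sq_sum (I : Type) (s : seq I) (F : I -> X -> K) :
  (forall i, M2 (F i)) -> M2 (fun q => \sum_(i <- s) F i q).
Proof.
move=> HF; elim: s => [|i s IH].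
  by apply: (eq_max_ideal_sq _ max_ideal_sq0) => q; rewrite big_nil.
apply: (eq_max_ideal_sq _ (max_ideal_sq_add (HF i) IH)) => q.
by rewrite big_cons.
Qed.

Section Differential.
Variables (n : nat) (y : 'I_n -> X -> K).
Local Notation diff := (differential_at p y).

Lemma diff_ext (U : set X) f g c :
  opn U -> U p -> (forall q : X, U q -> f q = g q) -> diff f c -> diff g c.
Proof.
move=> oU Up fg; apply: (max_ideal_sq_ext oU Up) => q Uq.
by rewrite !fg //.
Qed.

Lemma diff_cst k : diff (fun=> k) 0.
Proof.
apply: (eq_max_ideal_sq _ max_ideal_sq0) => q.
by rewrite subrr big1 ?subr0 // => i _; rewrite mxE mul0r.
Qed.

Lemma diff_add f g c c' : diff f c -> diff g c' ->
  diff (fun q => f q + g q) (c + c').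
Proof.
move=> /max_ideal_sq_add H /H; apply: eq_max_ideal_sq => q /=.
rewrite [X in _ = _ - X](_ : _ = \sum_i c 0 i * (y i q - y i p)
  + \sum_i c' 0 i * (y i q - y i p)); first by ring.
by rewrite -big_split /=; apply: eq_bigr => i _; rewrite mxE mulrDl.
Qed.

Lemma diff_mul f g c c' : regular_at p f -> regular_at p g ->
  diff f c -> diff g c' -> diff (fun q => f q * g q) (f p *: c' + g p *: c).
Proof.
move=> rf rg Hf Hg.
have Hfg : M2 (fun q => (f q - f p) * (g q - g p)).
  by apply: max_ideal_sq_mul; rewrite ?subrr //;
    apply: (regular_sub okX) => //; exact: ok_cst.
have := max_ideal_sq_add (max_ideal_sq_add
  (max_ideal_sq_scale (ok_cst okX p (f p)) Hg)
  (max_ideal_sq_scale (ok_cst okX p (g p)) Hf)) Hfg.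
apply: eq_max_ideal_sq => q /=.
rewrite [X in _ = _ - X](_ : _ = f p * \sum_i c' 0 i * (y i q - y i p)
  + g p * \sum_i c 0 i * (y i q - y i p)); first by ring.
rewrite !mulr_sumr -big_split /=; apply: eq_bigr => i _.
by rewrite !mxE; ring.
Qed.

Lemma diff_inv f c : regular_at p f -> f p != 0 -> diff f c ->
  diff (fun q => (f q)^-1) (- (f p) ^- 2 *: c).
Proof.
move=> rf fp Hf; have ri := ok_inv okX rf fp.
have [U [oU Up Uf]] := ok_nz okX rf fp.
have rs : regular_at p (fun q => f q - f p).
  by apply: (regular_sub okX) => //; exact: ok_cst.
have H1 : M2 (fun q => (f q - f p) * (f q - f p)).
  by apply: max_ideal_sq_mul; rewrite ?subrr.
have := max_ideal_sq_add
  (max_ideal_sq_scale (ok_cst okX p (- (f p) ^- 2)) Hf)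
  (max_ideal_sq_scale (ok_mul okX (ok_cst okX p ((f p) ^- 2)) ri) H1).
apply: (max_ideal_sq_ext oU Up) => q /Uf fq.
rewrite [X in _ = _ - X](_ : _ = - (f p) ^- 2 * \sum_i c 0 i * (y i q - y i p)).
  by field; rewrite fq fp.
by rewrite mulr_sumr; apply: eq_bigr => i _; rewrite !mxE mulrA.
Qed.

Lemma diff_self i : diff (y i) (delta_mx 0 i).
Proof.
apply: (eq_max_ideal_sq _ max_ideal_sq0) => q.
rewrite (bigD1 i) //= mxE !eqxx mul1r big1 ?addr0 ?subrr // => j /negPf ji.
by rewrite mxE ji andbF mul0r.
Qed.

Lemma diff_chain (m : nat) (z : 'I_m -> X -> K) f c C :
  differential_at p z f c ->
  (forall k, diff (z k) (row k C)) -> diff f (c *m C).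
Proof.
move=> Hf Hz.
have Hs : M2 (fun q => \sum_k c 0 k *
   (z k q - z k p - \sum_i C k i * (y i q - y i p))).
  apply: max_ideal_sq_sum => k; apply: max_ideal_sq_scale; first exact: ok_cst.
  apply: eq_max_ideal_sq (Hz k) => q; congr (_ - _).
  by apply: eq_bigr => i _; rewrite mxE.
have := max_ideal_sq_add Hf Hs; apply: eq_max_ideal_sq => q /=.
rewrite -[LHS]addrA; congr (_ + _).
have -> : \sum_k c 0 k * (z k q - z k p - \sum_i C k i * (y i q - y i p)) =
   \sum_k c 0 k * (z k q - z k p)
   - \sum_k \sum_i c 0 k * (C k i * (y i q - y i p)).
  rewrite -sumrB; apply: eq_bigr => k _.
  by rewrite mulrBr mulr_sumr.
rewrite addKr exchange_big /=; congr (- _); apply: eq_bigr => i _.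
by rewrite mxE mulr_suml; apply: eq_bigr => k _; rewrite mulrA.
Qed.

End Differential.

(** Point derivations of the local ring at [p]. Functions are total, so the last clause is what
    makes [D] depend on germs only. *)
Definition derivation_at (D : (X -> K) -> K) : Prop :=
  [/\ forall f g, regular_at p f -> regular_at p g ->
        D (fun q => f q + g q) = D f + D g,
      forall f g, regular_at p f -> regular_at p g ->
        D (fun q => f q * g q) = f p * D g + g p * D f,
      forall c, D (fun=> c) = 0 &
      forall (U : set X) f g, opn U -> U p -> regular_at p f ->
        (forall q, U q -> f q = g q) -> D f = D g].

Lemma derivation_sum D (I : Type) (s : seq I) (F : I -> X -> K) :
  derivation_at D -> (forall i, regular_at p (F i)) ->
  D (fun q => \sum_(i <- s) F i q) = \sum_(i <- s) D (F i).
Proof.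
move=> [DD _ D0 _] rF; elim: s => [|i s IH].
  by rewrite big_nil -[RHS](D0 0); congr D; apply/funext => q; rewrite big_nil.
rewrite big_cons -IH -DD //; last by apply: (regular_sum okX).
by congr D; apply/funext => q; rewrite big_cons.
Qed.

Lemma derivation_max_ideal_sq D f : derivation_at D -> M2 f -> D f = 0.
Proof.
move=> HD [r [u [v [uv [U [oU Up H]]]]]]; have [_ DM _ Dx] := HD.
rewrite -(Dx U (fun q => \sum_k u k q * v k q)) //; last 2 first.
- apply: (regular_sum okX) => k _; have [? _ ? _] := uv k; exact: ok_mul.
- by move=> q Uq; rewrite H.
rewrite derivation_sum //; last first.
  by move=> k; have [? _ ? _] := uv k; exact: ok_mul.
rewrite big1 // => k _; have [? u0 ? v0] := uv k.
by rewrite DM // u0 v0 !mul0r addr0.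
Qed.

Lemma derivation_diff D n (y : 'I_n -> X -> K) f c : derivation_at D ->
  (forall i, regular_at p (y i)) -> regular_at p f ->
  differential_at p y f c -> D f = \sum_i c 0 i * D (y i).
Proof.
move=> HD ry rf /(derivation_max_ideal_sq HD); have [DD DM D0 _] := HD.
have Dsub g h : regular_at p g -> regular_at p h ->
    D (fun q => g q - h q) = D g - D h.
  move=> rg rh; rewrite DD //; last exact: regular_opp.
  congr (_ + _); have := DM _ _ (ok_cst okX p (-1)) rh.
  rewrite D0 mulr0 addr0 mulN1r => <-; congr D.
  by apply/funext => q; rewrite mulN1r.
have rc c0 := ok_cst okX p c0.
have rs i : regular_at p (fun q => c 0 i * (y i q - y i p)).
  by apply: ok_mul => //; apply: regular_sub.
rewrite (Dsub (fun q => f q - f p)); last 2 first.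
- exact: regular_sub.
- by apply: (regular_sum okX) => i _.
rewrite (Dsub f) // D0 subr0 derivation_sum //.
move=> /eqP; rewrite subr_eq0 => /eqP ->; apply: eq_bigr => i _.
rewrite DM //; last exact: regular_sub.
by rewrite D0 mulr0 addr0 Dsub // D0 subr0.
Qed.

(** Derivations dual to [y] read off the coefficients of any differential, which gives uniqueness;
    only existence is left to check in each chart. *)
Lemma coordinates_intro n (y : 'I_n -> X -> K) (D : 'I_n -> (X -> K) -> K) :
  (forall i, regular_at p (y i)) -> (forall k, derivation_at (D k)) ->
  (forall k i, D k (y i) = (k == i)%:R) ->
  (forall f, regular_at p f -> exists c, differential_at p y f c) ->
  coordinates_at p y.
Proof.
move=> ry HD Dy Hex; split=> // f rf; have [c Hc] := Hex f rf.
exists c; split=> // c' Hc'; apply/rowP => k.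
have E c0 : differential_at p y f c0 -> c0 0 k = D k f.
  move=> /(derivation_diff (HD k) ry rf) ->; rewrite (bigD1 k) //= big1.
    by rewrite Dy eqxx mulr1 addr0.
  by move=> i /negPf ik; rewrite Dy eq_sym ik mulr0.
by rewrite (E c) ?(E c').
Qed.

(** The matrices expressing the [d y_i] by the [d z_j] and conversely factor the identity of size
    [n] through size [m]. *)
Lemma coordinates_le_size n m (y : 'I_n -> X -> K) (z : 'I_m -> X -> K) :
  coordinates_at p y -> coordinates_at p z -> (n <= m)%N.
Proof.
move=> [ry Hy] [rz Hz].
have HC i : exists c, differential_at p z (y i) c.
  by have [c []] := Hz _ (ry i); exists c.
have HB j : exists c, differential_at p y (z j) c.
  by have [c []] := Hy _ (rz j); exists c.
pose C := \matrix_i sval (cid (HC i)).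
pose B := \matrix_j sval (cid (HB j)).
have PC i : differential_at p z (y i) (row i C).
  by rewrite rowK; case: cid.
have PB j : differential_at p y (z j) (row j B).
  by rewrite rowK; case: cid.
apply: (@mulmx1_min K n m C B); apply/row_matrixP => i.
rewrite row_mul row1; have := diff_chain (PC i) PB.
have [c [_ Hc]] := Hy _ (ry i) => /Hc <-.
by apply: Hc; exact: diff_self.
Qed.

(** The pairing of the [D i] with the [f j] is an identity matrix of size [k] that factors through
    the [n] coordinates. It serves to bound the number of irreducible characters of a smooth
    cone. *)
Lemma derivations_le_size n (y : 'I_n -> X -> K) k
    (D : 'I_k -> (X -> K) -> K) (f : 'I_k -> X -> K) :
  coordinates_at p y -> (forall i, derivation_at (D i)) ->
  (forall i, regular_at p (f i)) ->
  (forall i j, D i (f j) = (i == j)%:R) -> (k <= n)%N.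
Proof.
move=> [ry Hy] HD rf Df.
have HC i : exists c, differential_at p y (f i) c.
  by have [c []] := Hy _ (rf i); exists c.
pose C := \matrix_i sval (cid (HC i)).
apply: (@mulmx1_min K k n C (\matrix_(i, j) D j (y i))).
apply/matrixP => i j; rewrite !mxE eq_sym -(Df j i).
rewrite (derivation_diff (HD j) ry (rf i) (svalP (cid (HC i)))).
by apply: eq_bigr => l _; rewrite !mxE.
Qed.

Lemma jacobian_row n (y z : 'I_n -> X -> K) i : coordinates_at p z ->
  regular_at p (y i) -> differential_at p z (y i) (row i (jacobian_at y z p)).
Proof.
move=> [rz Hz] ry; rewrite rowK; have [c [Hc _]] := Hz _ ry.
apply: (@xgetPex _ 0 [set c : 'rV[K]_n | differential_at p z (y i) c]).
by exists c.
Qed.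

Lemma jacobian_eq n (y z : 'I_n -> X -> K) (M : 'M[K]_n) :
  coordinates_at p z -> (forall i, regular_at p (y i)) ->
  (forall i, differential_at p z (y i) (row i M)) -> jacobian_at y z p = M.
Proof.
move=> Cz ry HM; apply/row_matrixP => i; have [_ Hz] := Cz.
have [c [_ Hc]] := Hz _ (ry i).
by rewrite -(Hc _ (HM i)) -(Hc _ (jacobian_row Cz (ry i))).
Qed.

Lemma jacobian_mul n (y z w : 'I_n -> X -> K) : coordinates_at p y ->
  coordinates_at p z -> coordinates_at p w ->
  jacobian_at y w p = jacobian_at y z p *m jacobian_at z w p.
Proof.
move=> [ry _] Cz Cw; have [rz _] := Cz.
apply: jacobian_eq => // i; rewrite row_mul.
by apply: diff_chain => [|k]; apply: jacobian_row.
Qed.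

Lemma jacobian_id n (y : 'I_n -> X -> K) :
  coordinates_at p y -> jacobian_at y y p = 1%:M.
Proof.
move=> Cy; have [ry _] := Cy; apply: jacobian_eq => // i.
by rewrite row1; exact: diff_self.
Qed.

Lemma jacobian_det_neq0 n (y z : 'I_n -> X -> K) : coordinates_at p y ->
  coordinates_at p z -> \det (jacobian_at y z p) != 0.
Proof.
move=> Cy Cz; have := jacobian_mul Cy Cz Cy; rewrite jacobian_id //.
move=> /(congr1 determinant); rewrite det1 det_mulmx => /eqP E.
by apply: contraTneq E => ->; rewrite mul0r oner_eq0.
Qed.

End Cotangent.

(** * First order germs of rational functions *)

Section Jets.
Variable K : closedFieldType.
Implicit Types (S : K -> Prop) (P Q Z : {poly K}) (phi psi : K -> K).

(** All but finitely many [t], certified by a polynomial: intersections are then products, and over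
    a closed field such a set is nonempty. *)
Definition cofin S : Prop :=
  exists2 Z : {poly K}, Z != 0 & forall t, Z.[t] != 0 -> S t.

Lemma cofin_ex S : cofin S -> exists t, S t.
Proof. by move=> [Z /closed_nonrootP[t Zt] H]; exists t; exact: H. Qed.

Lemma cofinT S : (forall t, S t) -> cofin S.
Proof. by move=> H; exists 1; rewrite ?oner_neq0. Qed.

Lemma cofin_sub S S' : (forall t, S t -> S' t) -> cofin S -> cofin S'.
Proof. by move=> SS' [Z Z0 H]; exists Z => // t /H /SS'. Qed.

Lemma cofinI S S' : cofin S -> cofin S' -> cofin (fun t => S t /\ S' t).
Proof.
move=> [Z Z0 H] [Z' Z0' H']; exists (Z * Z'); first by rewrite mulf_neq0.
by move=> t; rewrite hornerM mulf_eq0 => /norP[/H ? /H' ?].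
Qed.

Lemma cofin_root P : P != 0 -> cofin (fun t => P.[t] != 0).
Proof. by move=> P0; exists P. Qed.

Lemma cofin_neq a : cofin (fun t => t != a).
Proof.
apply: (@cofin_sub (fun t => ('X - a%:P).[t] != 0)) => [t|].
  by rewrite hornerXsubC subr_eq0.
by apply: cofin_root; rewrite polyXsubC_eq0.
Qed.

Lemma cofin_forall (I : finType) (S : I -> K -> Prop) :
  (forall i, cofin (S i)) -> cofin (fun t => forall i, S i t).
Proof.
move=> H; suff : cofin (fun t => forall i, i \in enum I -> S i t).
  by apply: cofin_sub => t Ht i; apply: Ht; rewrite mem_enum.
elim: (enum I) => [|i s IH]; first exact: cofinT.
apply: cofin_sub (cofinI (H i) IH) => t [Si Ss] j.
by rewrite inE => /orP[/eqP -> //|/Ss].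
Qed.

Lemma cofin_poly_eq P Q : cofin (fun t => P.[t] = Q.[t]) -> P = Q.
Proof.
move=> H; apply/eqP; rewrite -subr_eq0; apply/negPn/negP => PQ.
have [t [E /eqP[]]] := cofin_ex (cofinI H (cofin_root PQ)).
by rewrite hornerD hornerN E subrr.
Qed.

(* [phi] is, up to finitely many values, a rational function defined at [0],
   with value [a0] and derivative [a1] there. *)
Definition jet phi a0 a1 : Prop := exists P Q, [/\ Q.[0] != 0,
  cofin (fun t => phi t * Q.[t] = P.[t]), P.[0] = a0 * Q.[0] &
  P^`().[0] = a1 * Q.[0] + a0 * Q^`().[0]].

Lemma jet_ext phi psi a0 a1 :
  cofin (fun t => phi t = psi t) -> jet phi a0 a1 -> jet psi a0 a1.
Proof.
move=> H [P [Q [Q0 E P0 P1]]]; exists P, Q; split=> //.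
by apply: cofin_sub (cofinI H E) => t [<-].
Qed.

Lemma eq_jet phi psi a0 a1 : phi =1 psi -> jet phi a0 a1 -> jet psi a0 a1.
Proof. by move=> /funext ->. Qed.

Lemma jet_poly P : jet (fun t => P.[t]) P.[0] P^`().[0].
Proof.
exists P, 1%:P; rewrite derivC horner0 !hornerC mulr0 addr0 !mulr1.
split=> //; first exact: oner_neq0.
by apply: cofinT => t; rewrite hornerC mulr1.
Qed.

Lemma jet_cst c : jet (fun=> c) c 0.
Proof.
have := jet_poly c%:P; rewrite derivC horner0 hornerC.
by apply: eq_jet => t; rewrite hornerC.
Qed.

Lemma jet_id : jet id 0 1.
Proof.
have := jet_poly 'X; rewrite derivX hornerC hornerX.
by apply: eq_jet => t; rewrite hornerX.
Qed.

Lemma jet_add phi psi a0 a1 b0 b1 : jet phi a0 a1 -> jet psi b0 b1 ->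
  jet (fun t => phi t + psi t) (a0 + b0) (a1 + b1).
Proof.
move=> [P [Q [Q0 E P0 P1]]] [P' [Q' [Q0' E' P0' P1']]].
exists (P * Q' + P' * Q), (Q * Q'); split.
- by rewrite hornerM mulf_neq0.
- apply: cofin_sub (cofinI E E') => t [Et Et'].
  by rewrite !(hornerM, hornerD) -Et -Et'; ring.
- by rewrite !(hornerM, hornerD) P0 P0'; ring.
- by rewrite !(derivM, derivD, hornerM, hornerD) P0 P0' P1 P1'; ring.
Qed.

Lemma jet_mul phi psi a0 a1 b0 b1 : jet phi a0 a1 -> jet psi b0 b1 ->
  jet (fun t => phi t * psi t) (a0 * b0) (a0 * b1 + b0 * a1).
Proof.
move=> [P [Q [Q0 E P0 P1]]] [P' [Q' [Q0' E' P0' P1']]].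
exists (P * P'), (Q * Q'); split.
- by rewrite hornerM mulf_neq0.
- apply: cofin_sub (cofinI E E') => t [Et Et'].
  by rewrite !(hornerM, hornerD) -Et -Et'; ring.
- by rewrite !(hornerM, hornerD) P0 P0'; ring.
- by rewrite !(derivM, derivD, hornerM, hornerD) P0 P0' P1 P1'; ring.
Qed.

Lemma jet_inv phi a0 a1 : jet phi a0 a1 -> a0 != 0 ->
  jet (fun t => (phi t)^-1) a0^-1 (- a1 / a0 ^+ 2).
Proof.
move=> [P [Q [Q0 E P0 P1]]] a00; exists Q, P; split.
- by rewrite P0 mulf_neq0.
- have PN : P != 0.
    by apply: contra_neq (mulf_neq0 a00 Q0) => P_0; rewrite -P0 P_0 horner0.
  apply: cofin_sub (cofinI E (cofin_root PN)) => t [Et].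
  rewrite -Et mulf_eq0 => /norP[pt _]; field; exact: pt.
- by rewrite P0; field.
- by rewrite P1 P0; field.
Qed.

Lemma jet_uniq phi a0 a1 b0 b1 :
  jet phi a0 a1 -> jet phi b0 b1 -> a0 = b0 /\ a1 = b1.
Proof.
move=> [P [Q [Q0 E P0 P1]]] [P' [Q' [Q0' E' P0' P1']]].
have PQ : P * Q' = P' * Q.
  apply: cofin_poly_eq; apply: cofin_sub (cofinI E E') => t [Et Et'].
  by rewrite !(hornerM, hornerD) -Et -Et'; ring.
have E0 : a0 = b0.
  have /(congr1 (horner^~ 0)) := PQ; rewrite !(hornerM, hornerD) P0 P0' => H.
  by apply: (mulIf (mulf_neq0 Q0 Q0')); rewrite mulrA H; ring.
split=> //; have /(congr1 deriv)/(congr1 (horner^~ 0)) := PQ.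
rewrite !(derivM, derivD, hornerM, hornerD) P0 P0' P1 P1' -E0 => H.
apply: (mulIf (mulf_neq0 Q0 Q0')); apply/eqP; rewrite -subr_eq0; apply/eqP.
transitivity ((a1 * Q.[0] + a0 * Q^`().[0]) * Q'.[0] + a0 * Q.[0] * Q'^`().[0]
  - ((a1 * 0 + b1 * Q'.[0] + a0 * Q'^`().[0]) * Q.[0] + a0 * Q'.[0] * Q^`().[0])).
  by ring.
by rewrite H; ring.
Qed.

Definition jet0 phi a0 : Prop := exists a1, jet phi a0 a1.

Lemma eq_jet0 phi psi a0 : phi =1 psi -> jet0 phi a0 -> jet0 psi a0.
Proof. by move=> /funext ->. Qed.

Lemma jet0_ext phi psi a0 :
  cofin (fun t => phi t = psi t) -> jet0 phi a0 -> jet0 psi a0.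
Proof. by move=> H [a1 J]; exists a1; apply: jet_ext J. Qed.

Lemma jet0_cst c : jet0 (fun=> c) c.
Proof. by exists 0; exact: jet_cst. Qed.

Lemma jet0_add phi psi a b :
  jet0 phi a -> jet0 psi b -> jet0 (fun t => phi t + psi t) (a + b).
Proof. by move=> [a1 Ja] [b1 Jb]; exists (a1 + b1); exact: jet_add. Qed.

Lemma jet0_mul phi psi a b :
  jet0 phi a -> jet0 psi b -> jet0 (fun t => phi t * psi t) (a * b).
Proof. by move=> [a1 Ja] [b1 Jb]; eexists; exact: (jet_mul Ja Jb). Qed.

Lemma jet0_inv phi a :
  jet0 phi a -> a != 0 -> jet0 (fun t => (phi t)^-1) a^-1.
Proof. by move=> [a1 Ja] a0; eexists; exact: (jet_inv Ja a0). Qed.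

Lemma jet0_uniq phi a b : jet0 phi a -> jet0 phi b -> a = b.
Proof. by move=> [a1 Ja] [b1 Jb]; have [] := jet_uniq Ja Jb. Qed.

Lemma jet0_neq0 phi a : jet0 phi a -> a != 0 -> cofin (fun t => phi t != 0).
Proof.
move=> [a1 [P [Q [Q0 E P0 _]]]] a0.
have PN : P != 0.
  by apply: contra_neq (mulf_neq0 a0 Q0) => P_0; rewrite -P0 P_0 horner0.
apply: cofin_sub (cofinI E (cofin_root PN)) => t [Et].
by rewrite -Et mulf_eq0 => /norP[].
Qed.

Lemma jet0_exp phi a (n : nat) : jet0 phi a -> jet0 (fun t => phi t ^+ n) (a ^+ n).
Proof.
move=> J; elim: n => [|n IH].
  by apply: (eq_jet0 _ (jet0_cst 1)) => t; rewrite expr0.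
by rewrite exprS; apply: (eq_jet0 _ (jet0_mul J IH)) => t; rewrite exprS.
Qed.

Lemma jet0_expz phi a (k : int) : jet0 phi a -> (a = 0 -> 0 <= k) ->
  jet0 (fun t => phi t ^ k) (a ^ k).
Proof.
move=> J; case: k => n H; first exact: jet0_exp.
apply: jet0_inv; first exact: jet0_exp.
by rewrite expf_neq0 //; apply/eqP => /H.
Qed.

Lemma jet0_prod (I : Type) (s : seq I) (phi : I -> K -> K) (a : I -> K) :
  (forall i, jet0 (phi i) (a i)) ->
  jet0 (fun t => \prod_(i <- s) phi i t) (\prod_(i <- s) a i).
Proof.
move=> J; elim: s => [|i s IH].
  by rewrite big_nil; apply: (eq_jet0 _ (jet0_cst 1)) => t; rewrite big_nil.
rewrite big_cons; apply: (eq_jet0 _ (jet0_mul (J i) IH)) => t.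
by rewrite big_cons.
Qed.

Lemma jet0_algebra (T : Type) (g : K -> T) (p : T) (S : set (T -> K)) f :
  (forall h, S h -> jet0 (h \o g) (h p)) -> algebra_gen S f ->
  jet0 (f \o g) (f p).
Proof.
move=> SS; elim=> [h /SS //|c|f1 f2 _ IH1 _ IH2|f1 f2 _ IH1 _ IH2].
- exact: jet0_cst.
- exact: (jet0_add IH1 IH2).
- exact: (jet0_mul IH1 IH2).
Qed.

(** This turns limits into statements on lattice pairings: a monomial with a finite limit at [0] has
    nonnegative exponent, and exponent [0] if the limit is nonzero. *)
Lemma jet0_power c (k : int) a : c != 0 -> jet0 (fun t => c * t ^ k) a ->
  0 <= k /\ (a != 0 -> k = 0).
Proof.
move=> c0; case: k => [[|n]|n] [a1 J].
- by [].
- split=> // a0; suff : a = 0 by move/eqP: a0.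
  apply: (@jet0_uniq (fun t => c * t ^+ n.+1)); first by exists a1.
  have -> : (0 : K) = c * 0 ^+ n.+1 by rewrite expr0n mulr0.
  apply: jet0_mul (jet0_cst c) _; apply: jet0_exp.
  by exists 1; exact: jet_id.
- have [P [Q [Q0 E P0 _]]] := J.
  have EP : c *: Q = 'X^(n.+1) * P.
    apply: cofin_poly_eq; apply: cofin_sub (cofinI E (cofin_neq 0)) => t [Et t0].
    rewrite hornerZ hornerM hornerXn -Et /exprz.
    by field; exact: expf_neq0.
  have /eqP := congr1 (horner^~ 0) EP.
  by rewrite hornerZ hornerM hornerXn expr0n mul0r mulf_eq0 (negPf c0) (negPf Q0).
Qed.

(** Regularity at the unit of the torus, where a one-parameter subgroup has [t = 1], already makes a
    function rational in [t], so that its behaviour at [t = 0] can be studied. The variable is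
    shifted because jets live at [0]. *)
Lemma jet_rational phi a : jet0 (fun t => phi (1 + t)) a ->
  exists P Q, Q != 0 /\ cofin (fun t => phi t * Q.[t] = P.[t]).
Proof.
move=> [a1 [P [Q [Q0 [Z Z0 E] _ _]]]].
have cp (W : {poly K}) t : (W \Po ('X - 1%:P)).[t] = W.[t - 1].
  by rewrite horner_comp hornerXsubC.
have cn (W : {poly K}) : W != 0 -> W \Po ('X - 1%:P) != 0.
  move=> W0; apply/eqP => /(congr1 (fun F => F \Po ('X + 1%:P))).
  rewrite -comp_polyA comp_polyB comp_polyX comp_polyC addrK comp_polyXr comp_poly0.
  by move/eqP; rewrite (negPf W0).
exists (P \Po ('X - 1%:P)), (Q \Po ('X - 1%:P)); split.
  by apply: cn; apply: contra_neq Q0 => ->; rewrite horner0.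
exists (Z \Po ('X - 1%:P)); first exact: cn.
by move=> t; rewrite !cp => /E; rewrite addrC subrK.
Qed.

End Jets.

(** * Point derivations defined by dual numbers *)

Section JetDerivation.
Variables (K : closedFieldType) (A : atlas K) (i : aidx A) (p : apt A).
Hypothesis gi : good_at p i.
Local Notation G := (glued_space A).
Local Notation alg := (algebra_gen (@acrd K A i)).

(* A point derivation of the local ring at [p] is given by a ring morphism from
   the coordinate ring of a chart to the dual numbers, here presented as a
   relation [E f f0 f1]. *)
Variable E : (apt A -> K) -> K -> K -> Prop.
Hypothesis E_cst : forall c, E (fun=> c) c 0.
Hypothesis E_add : forall f g a0 a1 b0 b1, E f a0 a1 -> E g b0 b1 ->
  E (fun q => f q + g q) (a0 + b0) (a1 + b1).
Hypothesis E_mul : forall f g a0 a1 b0 b1, E f a0 a1 -> E g b0 b1 ->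
  E (fun q => f q * g q) (a0 * b0) (a0 * b1 + b0 * a1).
Hypothesis E_gen : forall h, acrd i h -> exists a1, E h (h p) a1.
Hypothesis E_uniq : forall b f g a0 a1 b0 b1, alg b -> b p != 0 ->
  (forall q, adom i q -> b q != 0 -> f q = g q) ->
  E f a0 a1 -> E g b0 b1 -> a1 = b1.

Let E_alg f : alg f -> exists a1, E f (f p) a1.
Proof.
elim=> [h /E_gen //|c|f1 f2 _ [a1 IH1] _ [a2 IH2]|f1 f2 _ [a1 IH1] _ [a2 IH2]].
- by exists 0.
- by eexists; exact: (E_add IH1 IH2).
- by eexists; exact: (E_mul IH1 IH2).
Qed.

Definition dual_derivation_rel (f : apt A -> K) (d : K) : Prop :=
  exists a b a1 b1, [/\ [/\ alg a, alg b & b p != 0], E a (a p) a1, E b (b p) b1,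
    forall q, adom i q -> b q != 0 -> f q = a q / b q &
    d = (a1 * b p - a p * b1) / b p ^+ 2].

Definition dual_derivation (f : apt A -> K) : K :=
  xget 0 [set d | dual_derivation_rel f d].

Let rel_uniq f g c d d' : alg c -> c p != 0 ->
  (forall q, adom i q -> c q != 0 -> f q = g q) ->
  dual_derivation_rel f d -> dual_derivation_rel g d' -> d = d'.
Proof.
have [ip _] := gi.
move=> ic cp fg [a [b [a1 [b1 [[ia ib bp] Ea Eb Hf ->]]]]].
move=> [u [v [u1 [v1 [[iu iv vp] Eu Ev Hg ->]]]]].
have H1 : a p / b p = u p / v p by rewrite -Hf // -Hg // fg.
(* [E] is only known to have values on the coordinate ring, so two fractions with the same germ are
   compared after clearing denominators. *)
have H2 : a p * v1 + v p * a1 = u p * b1 + b p * u1.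
  apply: (E_uniq (b := fun q => c q * (b q * v q))
    (f := fun q => a q * v q) (g := fun q => u q * b q)).
  - by do 2!apply: AlgMul => //.
  - by rewrite !mulf_neq0.
  - move=> q iq; rewrite !mulf_eq0 => /norP[cq /norP[bq vq]].
    have := fg q iq cq; rewrite Hf // Hg // => /(congr1 (fun x => x * (b q * v q))) E0.
    transitivity (a q / b q * (b q * v q)); first by field.
    by rewrite E0; field.
  - exact: E_mul.
  - exact: E_mul.
have H3 : a p = u p / v p * b p by rewrite -H1; field.
apply: (mulIf (mulf_neq0 bp vp)).
transitivity ((v p * a1 * b p - a p * b1 * v p) / b p); first by field.
transitivity ((b p * u1 * v p - u p * v1 * b p) / v p); last by field.
have -> : v p * a1 = u p * b1 + b p * u1 - a p * v1 by rewrite -H2; ring.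
by rewrite H3; field; rewrite bp vp.
Qed.

Let rel_ex f : regular_at (X := G) p f ->
  dual_derivation_rel f (dual_derivation f).
Proof.
move=> /(good_regular _ gi)[a [b [ia ib bp H]]].
have [a1 Ea] := E_alg ia; have [b1 Eb] := E_alg ib.
apply: (@xgetPex _ 0 [set d | dual_derivation_rel f d]).
by exists ((a1 * b p - a p * b1) / b p ^+ 2), a, b, a1, b1.
Qed.

Lemma dual_derivationP f a1 : alg f -> E f (f p) a1 -> dual_derivation f = a1.
Proof.
move=> If Ef; have [ip _] := gi.
apply: (@rel_uniq f f (fun=> 1)) => //.
- exact: AlgCst.
- exact: oner_neq0.
- by apply: rel_ex; apply: (regular_local_frac ip); exact: local_frac_alg.
- exists f, (fun=> 1), a1, 0; split=> //.
  + by split=> //; [exact: AlgCst | exact: oner_neq0].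
  + by move=> q _ _; rewrite divr1.
  + by rewrite mulr1 mulr0 subr0 expr1n divr1.
Qed.

Lemma dual_derivation_at : derivation_at (X := G) p dual_derivation.
Proof.
have [ip _] := gi.
have uniq1 f d : regular_at (X := G) p f -> dual_derivation_rel f d ->
    dual_derivation f = d.
  move=> rf; apply: (@rel_uniq f f (fun=> 1)) => //.
  - exact: AlgCst.
  - exact: oner_neq0.
  - exact: rel_ex.
have regL f : local_frac i p f -> regular_at (X := G) p f.
  exact: regular_local_frac.
split.
- move=> f g rf rg.
  have /(good_regular _ gi) Lf := rf; have /(good_regular _ gi) Lg := rg.
  have [a [b [a1 [b1 [[ia ib bp] Ea Eb Hf ->]]]]] := rel_ex rf.
  have [u [v [u1 [v1 [[iu iv vp] Eu Ev Hg ->]]]]] := rel_ex rg.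
  apply: uniq1; first by apply: regL; exact: local_frac_add.
  exists (fun q => a q * v q + u q * b q), (fun q => b q * v q).
  exists (a p * v1 + v p * a1 + (u p * b1 + b p * u1)), (b p * v1 + v p * b1).
  split.
  + split; [by apply: AlgAdd; apply: AlgMul | exact: AlgMul |].
    by rewrite mulf_neq0.
  + by apply: E_add; apply: E_mul.
  + exact: E_mul.
  + move=> q iq; rewrite mulf_eq0 => /norP[bq vq].
    by rewrite Hf // Hg //; field; rewrite bq vq.
  + by field; rewrite bp vp.
- move=> f g rf rg.
  have /(good_regular _ gi) Lf := rf; have /(good_regular _ gi) Lg := rg.
  have [a [b [a1 [b1 [[ia ib bp] Ea Eb Hf ->]]]]] := rel_ex rf.
  have [u [v [u1 [v1 [[iu iv vp] Eu Ev Hg ->]]]]] := rel_ex rg.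
  apply: uniq1; first by apply: regL; exact: local_frac_mul.
  exists (fun q => a q * u q), (fun q => b q * v q).
  exists (a p * u1 + u p * a1), (b p * v1 + v p * b1); split.
  + by split; [exact: AlgMul | exact: AlgMul | rewrite mulf_neq0].
  + exact: E_mul.
  + exact: E_mul.
  + move=> q iq; rewrite mulf_eq0 => /norP[bq vq].
    by rewrite Hf // Hg //; field; rewrite bq vq.
  + by rewrite Hf // Hg //; field; rewrite bp vp.
- move=> c; apply: dual_derivationP => //; exact: AlgCst.
- move=> U f g oU Up rf fg.
  have [c [ic cp Hc]] := good_open gi oU Up.
  have rg : regular_at (X := G) p g.
    have [a [b [ia ib bp H]]] := (good_regular _ gi).1 rf.
    apply: regL; exists (fun q => a q * c q), (fun q => b q * c q).
    split; try exact: AlgMul; first by rewrite mulf_neq0.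
    move=> q iq; rewrite mulf_eq0 => /norP[bq cq].
    by rewrite -fg ?H //; [field; rewrite bq cq | exact: Hc].
  apply: (rel_uniq ic cp _ (rel_ex rf) (rel_ex rg)) => q iq cq.
  by apply: fg; exact: Hc.
Qed.

End JetDerivation.

(** * Projective spaces *)

Section Proj.
Variables (K : fieldType) (N : nat).
Local Notation PN := (proj_point K N).
Implicit Types (L : PN) (z : 'rV[K]_N.+1).

Definition proj_mk z (z0 : z != 0) : PN :=
  exist _ <[z]>%VS (eq_trans (congr1 (fun d => d == 1%N) (dim_vline z))
                             (congr1 (fun b : bool => b == 1%N :> nat) z0)).

Lemma hvec_neq0 L : vpick (sval L) != 0.
Proof.
by case: L => L /= /eqP dL; rewrite vpick0 -dimv_eq0 dL.
Qed.

Lemma hcoord_neq0 L : exists i, hcoord L i != 0.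
Proof.
apply/existsP; apply: contra_neqT (hvec_neq0 L).
rewrite negb_exists => /forallP H; apply/rowP => i; rewrite mxE.
by apply/eqP/negPn/H.
Qed.

Lemma hcoord_mk z (z0 : z != 0) :
  exists2 c, c != 0 & forall j, hcoord (proj_mk z0) j = c * z 0 j.
Proof.
have /vlineP[c Ec] := memv_pick <[z]>%VS.
exists c; last by move=> j; rewrite /hcoord /= Ec mxE.
apply: contra_neq (hvec_neq0 (proj_mk z0)) => c0.
by rewrite /= Ec c0 scale0r.
Qed.

Lemma proj_line L : sval L = <[vpick (sval L)]>%VS.
Proof.
apply/eqP; rewrite eq_sym eqEdim; apply/andP; split.
  by rewrite -memvE memv_pick.
by rewrite dim_vline hvec_neq0; case: L => L /= /eqP ->.
Qed.

Lemma proj_eq L L' c : c != 0 -> (forall j, hcoord L j = c * hcoord L' j) ->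
  L = L'.
Proof.
move=> c0 H; apply: val_inj => /=; rewrite proj_line [RHS]proj_line.
have -> : vpick (sval L) = c *: vpick (sval L').
  by apply/rowP => j; rewrite mxE; exact: H.
apply/eqP; rewrite eqEdim; apply/andP; split.
  by rewrite -memvE memvZ // memv_line.
by rewrite !dim_vline scaler_eq0 (negPf c0) (negPf (hvec_neq0 L')).
Qed.

Lemma proj_eq_ratio L L' i : hcoord L i != 0 -> hcoord L' i != 0 ->
  (forall j, hcoord L j / hcoord L i = hcoord L' j / hcoord L' i) -> L = L'.
Proof.
move=> Li Li' H; apply: (@proj_eq _ _ (hcoord L i / hcoord L' i)).
  by rewrite mulf_neq0 // invr_eq0.
move=> j; have := H j => /(congr1 (fun x => x * hcoord L i)).
by rewrite divfK // => ->; rewrite mulrAC -mulrA mulrC.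
Qed.

Lemma hcoord_mk_ratio z (z0 : z != 0) i j :
  hcoord (proj_mk z0) j / hcoord (proj_mk z0) i = z 0 j / z 0 i.
Proof.
have [c c0 H] := hcoord_mk z0; rewrite !H invfM mulrACA mulfV ?mul1r //.
Qed.

Lemma hcoord_mk_eq0 z (z0 : z != 0) i :
  (hcoord (proj_mk z0) i == 0) = (z 0 i == 0).
Proof.
by have [c c0 H] := hcoord_mk z0; rewrite H mulf_eq0 (negPf c0).
Qed.

Lemma good_proj (p : apt (proj_atlas K N)) (i : aidx (proj_atlas K N)) :
  adom i p -> good_at p i.
Proof.
move=> ip; split=> // j jp.
have gen k : algebra_gen (@acrd K (proj_atlas K N) i)
    (fun L => hcoord L k / hcoord L i) by apply: AlgIn; exists k.
have nz (q : PN) : adom i q -> hcoord q j / hcoord q i != 0 -> hcoord q j != 0.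
  by move=> iq; rewrite mulf_eq0 => /norP[].
split.
  exists (fun L => hcoord L j / hcoord L i); split=> //.
  by rewrite mulf_neq0 // invr_eq0.
move=> h [k ->].
exists (fun L => hcoord L k / hcoord L i), (fun L => hcoord L j / hcoord L i).
split=> //; first by rewrite mulf_neq0 // invr_eq0.
move=> q iq /(nz _ iq) jq; rewrite /= invfM invrK mulrACA mulVf ?mulr1 //.
Qed.

Lemma good_proj_atlas : good_atlas (proj_atlas K N).
Proof.
by move=> p; have [i ip] := hcoord_neq0 p; exists i; exact: good_proj.
Qed.

Lemma ok_proj : ok_space (proj_space K N).
Proof. exact: ok_glued good_proj_atlas. Qed.

End Proj.

Section ProjPow.
Variables (K : fieldType) (k r : nat).

Lemma good_proj_pow (p : apt (atlas_pow (proj_atlas K k) r)) i :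
  adom i p -> good_at p i.
Proof. exact/good_pow/good_proj. Qed.

Lemma proj_pow_chart (p : apt (atlas_pow (proj_atlas K k) r)) :
  exists i, adom i p.
Proof.
have H l : exists i, hcoord (p l) i != 0 by exact: hcoord_neq0.
exists [ffun l => sval (cid (H l))] => l; rewrite /= ffunE.
by case: cid.
Qed.

Lemma ok_proj_pow : ok_space (proj_pow K k r).
Proof.
apply: ok_glued => p; have [i ip] := proj_pow_chart p.
by exists i; exact: good_proj_pow.
Qed.

End ProjPow.

(** * Rational cones *)

Section Lattice.
Variable d : nat.
Implicit Types (u v w m : 'rV[int]_d).

Definition ip u v : int := \sum_(i < d) u 0 i * v 0 i.

Lemma ipC u v : ip u v = ip v u.
Proof. by apply: eq_bigr => i _; rewrite mulrC. Qed.

Lemma ipDl u v w : ip (u + v) w = ip u w + ip v w.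
Proof. by rewrite -big_split; apply: eq_bigr => i _; rewrite mxE mulrDl. Qed.

Lemma ipZl k u w : ip (k *: u) w = k * ip u w.
Proof. by rewrite mulr_sumr; apply: eq_bigr => i _; rewrite mxE mulrA. Qed.

Lemma ipDr u v w : ip w (u + v) = ip w u + ip w v.
Proof. by rewrite !(ipC w) ipDl. Qed.

Lemma ipZr k u w : ip w (k *: u) = k * ip w u.
Proof. by rewrite !(ipC w) ipZl. Qed.

Lemma ip0l w : ip 0 w = 0.
Proof. by rewrite /ip big1 // => i _; rewrite mxE mul0r. Qed.

Lemma ip0r w : ip w 0 = 0.
Proof. by rewrite ipC ip0l. Qed.

Lemma ipNl u w : ip (- u) w = - ip u w.
Proof. by rewrite -scaleN1r ipZl mulN1r. Qed.

Lemma ipNr u w : ip w (- u) = - ip w u.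
Proof. by rewrite !(ipC w) ipNl. Qed.

Lemma ip_suml (I : Type) (s : seq I) (P : pred I) (F : I -> 'rV_d) w :
  ip (\sum_(i <- s | P i) F i) w = \sum_(i <- s | P i) ip (F i) w.
Proof.
elim: s => [|i s IH]; first by rewrite !big_nil ip0l.
by rewrite !big_cons; case: ifP => _; rewrite ?ipDl IH.
Qed.

Lemma ip_sumr (I : Type) (s : seq I) (P : pred I) (F : I -> 'rV_d) w :
  ip w (\sum_(i <- s | P i) F i) = \sum_(i <- s | P i) ip w (F i).
Proof. by rewrite ipC ip_suml; apply: eq_bigr => i _; rewrite ipC. Qed.

Lemma ip_delta u i : ip u (delta_mx 0 i) = u 0 i.
Proof.
rewrite /ip (bigD1 i) //= mxE !eqxx mulr1 big1 ?addr0 // => j /negPf ji.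
by rewrite mxE ji andbF mulr0.
Qed.

Lemma ip_eq0 u : (forall w, ip u w = 0) -> u = 0.
Proof. by move=> H; apply/rowP => i; rewrite -ip_delta H mxE. Qed.

Lemma ip_gt0 u : u != 0 -> 0 < ip u u.
Proof.
move=> u0; rewrite lt_def; apply/andP; split; last first.
  by apply: sumr_ge0 => i _; rewrite -expr2 sqr_ge0.
apply: contra_neq u0 => /eqP.
rewrite psumr_eq0; last by move=> i _; rewrite -expr2 sqr_ge0.
move=> /allP H; apply/rowP => i; rewrite mxE.
by have := H i (mem_index_enum _); rewrite /= mulf_eq0 orbb => /eqP.
Qed.

(* Fourier-Motzkin elimination: project along the last generator. *)
Lemma farkas r (g : 'I_r -> 'rV[int]_d) w :
  (exists N c, [/\ 0 < N, forall k, 0 <= c k & N *: w = \sum_k c k *: g k]) \/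
  (exists2 u, forall k, 0 <= ip u (g k) & ip u w < 0).
Proof.
elim: r g w => [|r IH] g w.
  have [->|w0] := eqVneq w 0.
    by left; exists 1, (fun=> 0); split=> //; rewrite big_ord0 scaler0.
  right; exists (- w) => [[]//|].
  by rewrite ipNl oppr_lt0 ip_gt0.
pose a := g ord0; pose g1 k := g (lift ord0 k).
have [[N [c [N0 c0 E]]]|[u u0 uw]] := IH g1 w.
  left; exists N, (fun k => if unlift ord0 k is Some k' then c k' else 0).
  split=> // [k|]; first by case: unliftP.
  rewrite big_ord_recl unlift_none scale0r add0r E.
  by apply: eq_bigr => k _; rewrite liftK.
have [ua|ua] := leP 0 (ip u a).
  right; exists u => // k.
  by have [k' ->|->] := unliftP ord0 k; [exact: u0 | exact: ua].
pose al := - ip u a; have al0 : 0 < al by rewrite oppr_gt0.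
pose pr x := al *: x + ip u x *: a.
have [[N [c [N0 c0 E]]]|[v v0 vw]] := IH (fun k => pr (g1 k)) (pr w).
  left; exists (N * al).
  exists (fun k => if unlift ord0 k is Some k' then c k' * al
                   else \sum_k c k * ip u (g1 k) - N * ip u w).
  split=> [|k|]; first exact: mulr_gt0.
    case: unliftP => [k' _|_]; first by rewrite mulr_ge0 // ltW.
    rewrite subr_ge0 (@le_trans _ _ 0) //.
      by rewrite mulr_ge0_le0 // ltW.
    by apply: sumr_ge0 => k' _; rewrite mulr_ge0.
  rewrite big_ord_recl unlift_none scalerBl.
  have -> : (N * al) *: w = N *: pr w - (N * ip u w) *: a.
    by rewrite /pr scalerDr !scalerA addrK.
  rewrite E addrAC; congr (_ - _).
  rewrite scaler_suml -big_split /=; apply: eq_bigr => k _.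
  by rewrite liftK /pr scalerDr !scalerA addrC.
right; exists (al *: v + ip v a *: u) => [k|].
  have [k' ->|->] := unliftP ord0 k.
    have := v0 k'; rewrite /pr ipDr !ipZr ipDl !ipZl.
    by rewrite (mulrC (ip u _)).
  by rewrite ipDl !ipZl -/a mulrC -mulrDr /al addNr mulr0.
by move: vw; rewrite /pr ipDr !ipZr ipDl !ipZl (mulrC (ip u _)).
Qed.

End Lattice.

Section Cones.
Variables (R : realType) (d : nat).
Local Notation lat := (@lattice_vec R d).
Implicit Types (u v w m : 'rV[int]_d) (S : set 'rV[R]_d).

Lemma pairing_lat u v : dual_pairing (lat u) (lat v) = (ip u v)%:~R.
Proof.
rewrite /dual_pairing /ip rmorph_sum /=; apply: eq_bigr => i _.
by rewrite !mxE rmorphM.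
Qed.

Lemma pairing_sumr (I : Type) (s : seq I) (P : pred I) (c : I -> R)
    (F : I -> 'rV[R]_d) (u : 'rV[R]_d) :
  dual_pairing u (\sum_(i <- s | P i) c i *: F i) =
  \sum_(i <- s | P i) c i * dual_pairing u (F i).
Proof.
elim: s => [|i s IH].
  rewrite !big_nil /dual_pairing big1 // => j _; by rewrite mxE mulr0.
rewrite !big_cons; case: ifP => _ //; rewrite -IH /dual_pairing mulr_sumr.
by rewrite -big_split; apply: eq_bigr => j _ /=; rewrite !mxE; ring.
Qed.

Lemma latD u v : lat (u + v) = lat u + lat v.
Proof. exact: map_mxD. Qed.

Lemma latZ k u : lat (k *: u) = k%:~R *: lat u.
Proof. by apply/rowP => i; rewrite !mxE rmorphM. Qed.

Lemma latN u : lat (- u) = - lat u.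
Proof. exact: map_mxN. Qed.

Lemma lat0 : lat (0 : 'rV[int]_d) = 0.
Proof. exact: map_mx0. Qed.

Lemma lat_sum (I : Type) (s : seq I) (P : pred I) (F : I -> 'rV[int]_d) :
  lat (\sum_(i <- s | P i) F i) = \sum_(i <- s | P i) lat (F i).
Proof. exact: map_mx_sum. Qed.

Lemma lat_inj : injective lat.
Proof.
by move=> u v /rowP H; apply/rowP => i; have := H i; rewrite !mxE => /intr_inj.
Qed.

(** The selection [P] keeps all generators indexed by one fixed type, so that the faces of a
    simplicial cone are again of this form without reindexing. *)
Definition gcone (A : finType) (v : A -> 'rV[int]_d) (P : pred A) :
    set 'rV[R]_d :=
  [set x | exists c : A -> R, (forall a, 0 <= c a) /\
     x = \sum_(a | P a) c a *: lat (v a)].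

Lemma generated_gcone r (g : 'I_r -> 'rV[int]_d) :
  @generated_cone R d _ g = gcone g predT.
Proof. by []. Qed.

Section Gcone.
Variables (A : finType) (v : A -> 'rV[int]_d).
Implicit Types P : pred A.

Lemma eq_gcone P P' : P =1 P' -> gcone v P = gcone v P'.
Proof. by move=> /funext ->. Qed.

Lemma gcone_gen P a : P a -> gcone v P (lat (v a)).
Proof.
move=> Pa; exists (fun b => (b == a)%:R); split=> [b|].
  by rewrite ler0n.
rewrite (bigD1 a) //= eqxx scale1r big1 ?addr0 // => b /andP[_ /negPf ->].
by rewrite scale0r.
Qed.

Lemma gcone_add P x y : gcone v P x -> gcone v P y -> gcone v P (x + y).
Proof.
move=> [c [c0 ->]] [c' [c0' ->]]; exists (fun a => c a + c' a); split=> [a|].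
  exact: addr_ge0.
by rewrite -big_split; apply: eq_bigr => a _; rewrite scalerDl.
Qed.

Lemma gcone_scale P k x : 0 <= k -> gcone v P x -> gcone v P (k *: x).
Proof.
move=> k0 [c [c0 ->]]; exists (fun a => k * c a); split=> [a|].
  exact: mulr_ge0.
by rewrite scaler_sumr; apply: eq_bigr => a _; rewrite scalerA.
Qed.

Lemma gcone0 P : gcone v P 0.
Proof.
exists (fun=> 0); split=> // ; rewrite big1 // => a _; by rewrite scale0r.
Qed.

Lemma gcone_sum P (I : Type) (s : seq I) (Q : pred I) (F : I -> 'rV[R]_d) :
  (forall i, Q i -> gcone v P (F i)) ->
  gcone v P (\sum_(i <- s | Q i) F i).
Proof.
move=> H; elim: s => [|i s IH]; first by rewrite big_nil; exact: gcone0.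
by rewrite big_cons; case: ifP => // Qi; apply: gcone_add => //; exact: H.
Qed.

Lemma sub_gcone P P' : (forall a, P a -> P' a) -> gcone v P `<=` gcone v P'.
Proof.
move=> PP' _ [c [c0 ->]]; apply: gcone_sum => a Pa.
by apply: gcone_scale => //; apply: gcone_gen; exact: PP'.
Qed.

Lemma dual_gcone P (u : 'rV[R]_d) : dual_cone (gcone v P) u <->
  forall a, P a -> 0 <= dual_pairing u (lat (v a)).
Proof.
split=> [H a Pa|H _ [c [c0 ->]]]; first by apply: H; exact: gcone_gen.
by rewrite pairing_sumr; apply: sumr_ge0 => a Pa; rewrite mulr_ge0 // H.
Qed.

Lemma dual_gconeP P u : dual_cone (gcone v P) (lat u) <->
  forall a, P a -> 0 <= ip u (v a).
Proof.
rewrite dual_gcone; split=> H a Pa; have := H a Pa;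
  by rewrite pairing_lat ler0z.
Qed.

Lemma orth_gconeP P u : orthogonal_to (gcone v P) (lat u) <->
  forall a, P a -> ip u (v a) = 0.
Proof.
split=> [H a Pa|H _ [c [c0 ->]]].
  have /eqP := H _ (gcone_gen Pa).
  by rewrite pairing_lat intr_eq0 => /eqP.
by rewrite pairing_sumr big1 // => a Pa; rewrite pairing_lat H // mulr0.
Qed.

Lemma gcone_face P P' m : (forall a, P' a -> P a) ->
  (forall a, P a -> 0 <= ip m (v a)) ->
  (forall a, P a -> P' a = (ip m (v a) == 0)) ->
  is_face (gcone v P') (gcone v P).
Proof.
move=> PP' m0 mP'; exists (lat m); first exact/dual_gconeP.
apply/seteqP; split=> x.
  move=> H; split; first exact: sub_gcone H.
  have [c [c0 ->]] := H; rewrite /= pairing_sumr big1 // => a Pa.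
  by rewrite pairing_lat; move: (Pa); rewrite mP' ?PP' // => /eqP ->; rewrite mulr0.
move=> [[c [c0 ->]]] /=; rewrite pairing_sumr => /eqP.
rewrite psumr_eq0 => [|a Pa]; last first.
  by apply: mulr_ge0 => //; rewrite pairing_lat ler0z; exact: m0.
move=> /allP H; apply: gcone_sum => a Pa.
have := implyP (H a (mem_index_enum _)) Pa; rewrite pairing_lat mulf_eq0 intr_eq0.
move=> /orP[/eqP ->|ma]; first by rewrite scale0r; exact: gcone0.
by apply: gcone_scale => //; apply: gcone_gen; rewrite mP'.
Qed.

End Gcone.

(** Farkas' lemma over the integers settles membership in a real cone: a positive multiple of [w] in
    the semigroup puts [w] in the cone, and otherwise the separating form is integral. *)
Lemma farkas_cone r (g : 'I_r -> 'rV[int]_d) w :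
  ~ @generated_cone R d _ g (lat w) ->
  exists2 u, dual_cone (@generated_cone R d _ g) (lat u) & ip u w < 0.
Proof.
move=> nw; have [[N [c [N0 c0 E]]]|[u u0 uw]] := farkas g w.
  case: nw; have N0' : (0 : R) < N%:~R by rewrite ltr0z.
  exists (fun k => N%:~R^-1 * (c k)%:~R); split.
    by move=> k; rewrite mulr_ge0 ?invr_ge0 ?ler0z // ltW.
  have := congr1 lat E; rewrite latZ lat_sum.
  move=> /(congr1 (fun x => N%:~R^-1 *: x)); rewrite scalerA mulVf ?gt_eqF //.
  rewrite scale1r => ->; rewrite scaler_sumr; apply: eq_bigr => k _.
  by rewrite latZ scalerA.
by exists u => //; rewrite generated_gcone; apply/dual_gconeP => a _.
Qed.

Definition strongly_convex S := forall x, S x -> S (- x) -> x = 0.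

(** Strong convexity excludes [- g k] from the cone when [g k] is nonzero, so some form is
    nonnegative on the cone and positive on [g k]; the sum of these forms works for all [k]. *)
Lemma strongly_convex_dual r (g : 'I_r -> 'rV[int]_d) :
  strongly_convex (@generated_cone R d _ g) ->
  exists u, forall k, g k != 0 -> 0 < ip u (g k).
Proof.
move=> sc.
have H k : exists u, (forall l, 0 <= ip u (g l)) /\
                     (g k != 0 -> 0 < ip u (g k)).
  have [->|gk] := eqVneq (g k) 0.
    by exists 0; split=> // l; rewrite ip0l.
  have [] := @farkas_cone _ g (- g k).
    move=> H; have := @gcone_gen _ g predT k isT.
    rewrite -generated_gcone => H'.
    have := sc _ H'; rewrite -latN => /(_ H).
    by rewrite -lat0 => /lat_inj /eqP; rewrite (negPf gk).
  move=> u /dual_gconeP u0; rewrite ipNr oppr_lt0 => uk.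
  by exists u; split=> // l; exact: u0.
pose U k := sval (cid (H k)).
have UP k : (forall l, 0 <= ip (U k) (g l)) /\ (g k != 0 -> 0 < ip (U k) (g k)).
  by rewrite /U; case: cid.
exists (\sum_k U k) => k gk; rewrite ip_suml (bigD1 k) //=.
apply: ltr_wpDr; last by have [_] := UP k; exact.
by apply: sumr_ge0 => l _; have [] := UP l.
Qed.

End Cones.

Section Basis.
Variables (R : realType) (d : nat).
Local Notation lat := (@lattice_vec R d).
Implicit Types (u v w m : 'rV[int]_d) (E : 'M[int]_d) (P : pred 'I_d).

Definition dualb E i : 'rV[int]_d := (col i (invmx E))^T.

Lemma ip_dualb v E i : ip (dualb E i) v = (v *m invmx E) 0 i.
Proof. by rewrite mxE; apply: eq_bigr => j _; rewrite !mxE mulrC. Qed.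

Section Unit.
Variables (E : 'M[int]_d) (uE : E \in unitmx).

Lemma ip_dualb_row i j : ip (dualb E i) (row j E) = (i == j)%:R.
Proof.
by rewrite ip_dualb -row_mul mulmxV // row1 mxE eqxx /= eq_sym.
Qed.

Lemma basis_expand v : v = \sum_i ip (dualb E i) v *: row i E.
Proof.
rewrite -[LHS](mulmxKV uE) mulmx_sum_row.
by apply: eq_bigr => i _; rewrite ip_dualb.
Qed.

Lemma dual_expand m : m = \sum_i ip m (row i E) *: dualb E i.
Proof.
apply/eqP; rewrite -subr_eq0; apply/eqP/ip_eq0 => w.
rewrite [w in LHS]basis_expand ip_sumr big1 // => i _; rewrite ipZr.
rewrite ipDl ipNl ip_suml (bigD1 i) //= ipZl ip_dualb_row eqxx mulr1.
rewrite big1 ?addr0 ?subrr ?mulr0 // => j /negPf ji.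
by rewrite ipZl ip_dualb_row ji mulr0.
Qed.

Lemma gcone_basisP P v : @gcone R d _ (fun i => row i E) P (lat v) <->
  (forall i, 0 <= ip (dualb E i) v) /\
  (forall i, ~~ P i -> ip (dualb E i) v = 0).
Proof.
split=> [[c [c0 Ev]]|[H H']].
  have K i : (ip (dualb E i) v)%:~R = if P i then c i else 0.
    rewrite -(pairing_lat R) Ev pairing_sumr.
    have [Pi|Pi] := boolP (P i).
      rewrite (bigD1 i) //= pairing_lat ip_dualb_row eqxx mulr1 big1 ?addr0 //.
      move=> j /andP[_ /negPf ji].
      by rewrite pairing_lat ip_dualb_row eq_sym ji mulr0.
    rewrite big1 // => j Pj; rewrite pairing_lat ip_dualb_row.
    by have [ij|_] := eqVneq i j; [move: Pi; rewrite ij Pj | rewrite mulr0].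
  split=> i; first by rewrite -(ler0z R) K; case: ifP.
  by move=> /negPf Pi; have /eqP := K i; rewrite Pi intr_eq0 => /eqP.
rewrite (basis_expand v) lat_sum; apply: gcone_sum => i _; rewrite latZ.
have [Pi|/H' ->] := boolP (P i); last by rewrite scale0r; exact: gcone0.
by apply: gcone_scale; [rewrite ler0z | exact: gcone_gen].
Qed.

Lemma face_basis P S : is_face S (@gcone R d _ (fun i => row i E) P) ->
  exists2 P' : pred 'I_d, (forall i, P' i -> P i) &
    S = @gcone R d _ (fun i => row i E) P'.
Proof.
move=> [u /dual_gcone u0 ->].
exists (fun i => P i && (dual_pairing u (lat (row i E)) == 0)).
  by move=> i /andP[].
apply/seteqP; split=> x.
  move=> [[c [c0 ->]] /= ]; rewrite pairing_sumr => /eqP.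
  rewrite psumr_eq0 => [/allP H|i Pi]; last by rewrite mulr_ge0 // u0.
  apply: gcone_sum => i Pi.
  have := H i (mem_index_enum _); rewrite Pi /= mulf_eq0.
  move=> /orP[/eqP ->|/eqP uE0]; first by rewrite scale0r; exact: gcone0.
  by apply: gcone_scale => //; apply: gcone_gen; rewrite Pi uE0 eqxx.
move=> [c [c0 ->]]; split.
  apply: gcone_sum => i /andP[Pi _]; apply: gcone_scale => //.
  exact: gcone_gen.
rewrite /= pairing_sumr big1 // => i /andP[_ /eqP ->]; exact: mulr0.
Qed.

Lemma basis_face P P' : (forall i, P' i -> P i) ->
  is_face (@gcone R d _ (fun i => row i E) P') (@gcone R d _ (fun i => row i E) P).
Proof.
move=> PP'.
have K a : ip (\sum_(i | ~~ P' i) dualb E i) (row a E) = (~~ P' a)%:R.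
  rewrite ip_suml; have [Pa|Pa] := boolP (P' a).
    rewrite big1 // => i Pi; rewrite ip_dualb_row.
    by have [ij|//] := eqVneq i a; move: Pi; rewrite ij Pa.
  rewrite (bigD1 a) //= ip_dualb_row eqxx big1 // => i /andP[_ /negPf].
  by rewrite ip_dualb_row => ->.
apply: (@gcone_face _ _ _ _ _ _ (\sum_(i | ~~ P' i) dualb E i)) => // a _.
  by rewrite K ler0n.
by rewrite K; case: (P' a).
Qed.

End Unit.
End Basis.

(** * Charts and Cox coordinates of toric varieties *)

Section Toric.
Variables (R : realType) (K : closedFieldType) (d : nat).
Variable Sg : set (set 'rV[R]_d).
Hypothesis fanS : is_fan Sg.
Variables (T : Type) (phi : T -> toric_point K Sg) (psi : toric_point K Sg -> T).
Hypotheses (phiK : cancel phi psi) (psiK : cancel psi phi).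
Local Notation lat := (@lattice_vec R d).
Implicit Types (p q : T) (m : 'rV[int]_d) (s : {s | Sg s}).

Definition cn p : set 'rV[R]_d := (sval (phi p)).1.
Definition ch p m : K := (sval (phi p)).2 m.

(* The toric atlas, transported along a bijection onto the set of toric points. *)
Definition tatlas : atlas K :=
  @Atlas K T {s | Sg s} (fun s => [set p | cn p `<=` sval s])
    (fun s => [set f | exists2 m, dual_cone (sval s) (lat m) & f = ch ^~ m]).

Local Notation X := (glued_space tatlas).

Lemma cn_fan p : Sg (cn p).
Proof. by rewrite /cn; case: (phi p) => [[c f]] []. Qed.

Lemma ch_neq0 p m : ch p m <> 0 <-> orthogonal_to (cn p) (lat m).
Proof. by rewrite /cn /ch; case: (phi p) => [[c f]] [] /=. Qed.

Lemma ch_zero p : ch p 0 = 1.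
Proof. by rewrite /ch; case: (phi p) => [[c f]] [] /=. Qed.

Lemma ch_add p m m' : orthogonal_to (cn p) (lat m) ->
  orthogonal_to (cn p) (lat m') -> ch p (m + m') = ch p m * ch p m'.
Proof. by rewrite /cn /ch; case: (phi p) => [[c f]] [_ _ _ H] /=; exact: H. Qed.

Lemma tor_ext p q : cn p = cn q -> (forall m, ch p m = ch q m) -> p = q.
Proof.
move=> cpq cpq'; rewrite -(phiK p) -(phiK q); congr psi.
move: cpq cpq'; rewrite /cn /ch; case: (phi p) => [[c f] Hf].
case: (phi q) => [[c' f'] Hf'] /= cc' /funext ff'.
by apply: eq_exist; rewrite cc' ff'.
Qed.

Lemma orth_lat0 p : orthogonal_to (cn p) (lat 0).
Proof.
by move=> x _; rewrite lat0 /dual_pairing big1 // => i _; rewrite mxE mul0r.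
Qed.

Lemma pairingDl (u v x : 'rV[R]_d) :
  dual_pairing (u + v) x = dual_pairing u x + dual_pairing v x.
Proof. by rewrite -big_split; apply: eq_bigr => i _; rewrite mxE mulrDl. Qed.

Lemma pairingNl (u x : 'rV[R]_d) : dual_pairing (- u) x = - dual_pairing u x.
Proof.
rewrite /dual_pairing -sumrN; apply: eq_bigr => i _; by rewrite mxE mulNr.
Qed.

Lemma orth_add p m m' : orthogonal_to (cn p) (lat m) ->
  orthogonal_to (cn p) (lat m') -> orthogonal_to (cn p) (lat (m + m')).
Proof. by move=> o o' x px; rewrite latD pairingDl o // o' // addr0. Qed.

Lemma orth_opp p m : orthogonal_to (cn p) (lat m) ->
  orthogonal_to (cn p) (lat (- m)).
Proof. by move=> o x px; rewrite latN pairingNl o // oppr0. Qed.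

(** Characters are extended by zero outside the orthogonal lattice. The rule survives there because
    two forms that are nonnegative on the cone and add up to zero on it both vanish on it. *)
Lemma ch_add_dual p m m' : dual_cone (cn p) (lat m) ->
  dual_cone (cn p) (lat m') -> ch p (m + m') = ch p m * ch p m'.
Proof.
move=> dm dm'.
have key (a b : 'rV[int]_d) : dual_cone (cn p) (lat a) ->
    dual_cone (cn p) (lat b) -> orthogonal_to (cn p) (lat (a + b)) ->
    orthogonal_to (cn p) (lat a).
  move=> da db o x px; apply/eqP; rewrite eq_le da // andbT.
  have := o x px; rewrite latD pairingDl => /eqP.
  by rewrite addr_eq0 => /eqP ->; rewrite oppr_le0 db.
have [o|no] := pselect (orthogonal_to (cn p) (lat (m + m'))).
  apply: ch_add; first exact: key o.
  by apply: (key m' m) => //; rewrite addrC.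
have -> : ch p (m + m') = 0 by apply: contra_notP no => /ch_neq0.
apply/esym/eqP; rewrite mulf_eq0; apply/orP.
have [o|n] := pselect (orthogonal_to (cn p) (lat m)).
  right; apply/eqP; apply: contra_notP no => /ch_neq0 o'.
  exact: orth_add.
by left; apply/eqP; apply: contra_notP n => /ch_neq0.
Qed.

Lemma ch_opp p m : orthogonal_to (cn p) (lat m) -> ch p (- m) = (ch p m)^-1.
Proof.
move=> o; have /eqP m0 := (ch_neq0 p m).2 o.
by apply: (mulfI m0); rewrite -ch_add ?subrr ?ch_zero ?mulfV //; exact: orth_opp.
Qed.

Lemma ch_scale p m k : orthogonal_to (cn p) (lat m) ->
  ch p (k *: m) = ch p m ^ k.
Proof.
move=> o; have H (n : nat) : orthogonal_to (cn p) (lat (n%:Z *: m)) /\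
    ch p (n%:Z *: m) = ch p m ^+ n.
  elim: n => [|n [IHo IH]].
    by rewrite scale0r ch_zero expr0; split=> //; exact: orth_lat0.
  have -> : n.+1%:Z *: m = n%:Z *: m + m by rewrite intS addrC scalerDl scale1r.
  split; first exact: orth_add.
  by rewrite ch_add // IH exprSr.
case: k => n; first by have [] := H n.
have [o' E] := H n.+1.
by rewrite NegzE scaleNr ch_opp // E.
Qed.

Lemma ch_sum p (I : Type) (r : seq I) (Q : pred I) (F : I -> 'rV[int]_d) :
  (forall i, Q i -> orthogonal_to (cn p) (lat (F i))) ->
  orthogonal_to (cn p) (lat (\sum_(i <- r | Q i) F i)) /\
  ch p (\sum_(i <- r | Q i) F i) = \prod_(i <- r | Q i) ch p (F i).
Proof.
move=> H; elim: r => [|i r [IHo IH]].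
  by rewrite !big_nil ch_zero; split=> //; exact: orth_lat0.
rewrite !big_cons; case: ifP => // Qi; split.
  by apply: orth_add => //; exact: H.
by rewrite ch_add ?IH //; exact: H.
Qed.

(** The smallest chart containing [p]: every chart around [p] contains it, which is why the atlas is
    good. *)
Definition chart_of p : aidx tatlas := exist _ (cn p) (cn_fan p).

Lemma good_chart_of p : @good_at K tatlas p (chart_of p).
Proof.
split=> // s ps; split=> [|h [m dm ->]].
  exists (fun=> 1); split; [exact: AlgCst | exact: oner_neq0 |].
  by move=> q /= pq _ x /pq /ps.
apply: local_frac_alg; apply: AlgIn; exists m => // x /ps; exact: dm.
Qed.

Lemma ok_tor : ok_space X.
Proof. by apply: ok_glued => p; exists (chart_of p); exact: good_chart_of. Qed.

Lemma regular_ch p m : dual_cone (cn p) (lat m) ->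
  regular_at (X := X) p (ch ^~ m).
Proof.
move=> dm; apply: (@regular_local_frac _ tatlas (chart_of p)) => //.
by apply: local_frac_alg; apply: AlgIn; exists m.
Qed.

Lemma open_cn p : opn ([set q | cn q `<=` cn p] : set X).
Proof. exact: (@open_chart _ tatlas (chart_of p)). Qed.

Lemma face_fan p S : Sg S -> S `<=` cn p -> is_face S (cn p).
Proof.
move=> SS Sp; have [_ _ _ H] := fanS.
have [_] := H S (cn p) SS (cn_fan p).
by rewrite (_ : S `&` cn p = S) //; exact: setIidl.
Qed.

Section Cox.
Variables (A : finType) (v : A -> 'rV[int]_d) (z : A -> K).

(** The character [m] in homogeneous (Cox) coordinates. Any nonzero power of [0], even a negative
    one, is [0] here, so the product is also correct on the boundary of the torus: it is nonzero
    exactly for the forms orthogonal to [cox_cone]. *)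
Definition cox_val m : K := \prod_a z a ^ (ip m (v a)).

Definition cox_cone : set 'rV[R]_d := gcone v (fun a => z a == 0).

Lemma cox_val_neq0 m : cox_val m <> 0 <-> orthogonal_to cox_cone (lat m).
Proof.
rewrite orth_gconeP; split=> [H a /eqP za|H].
  apply/eqP; apply: contra_notT H => ma.
  by apply/eqP; rewrite /cox_val (bigD1 a) //= za exp0rz (negPf ma) mul0r.
apply/eqP; rewrite prodf_seq_neq0; apply/allP => a _ /=.
have [z0|z0] := eqVneq (z a) 0; last by rewrite expfz_neq0.
by rewrite z0 H ?z0 // expr0z oner_neq0.
Qed.

Lemma cox_val_prop : Sg cox_cone ->
  [/\ Sg cox_cone, forall m, cox_val m <> 0 <-> orthogonal_to cox_cone (lat m),
      cox_val 0 = 1 &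
      forall m m', orthogonal_to cox_cone (lat m) ->
        orthogonal_to cox_cone (lat m') ->
        cox_val (m + m') = cox_val m * cox_val m'].
Proof.
move=> SC; split=> //; first exact: cox_val_neq0.
  by rewrite /cox_val big1 // => a _; rewrite ip0l expr0z.
move=> m m' /orth_gconeP om /orth_gconeP om'.
rewrite -big_split; apply: eq_bigr => a _ /=; rewrite ipDl.
have [z0|z0] := eqVneq (z a) 0; last by rewrite expfzDr.
by rewrite om ?om' ?z0 // addr0 expr0z mulr1.
Qed.

Definition cox_pt (H : Sg cox_cone) : T :=
  psi (exist _ (cox_cone, cox_val) (cox_val_prop H)).

Lemma cn_cox H : cn (cox_pt H) = cox_cone.
Proof. by rewrite /cn /cox_pt psiK. Qed.

Lemma ch_cox H m : ch (cox_pt H) m = cox_val m.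
Proof. by rewrite /ch /cox_pt psiK. Qed.

End Cox.

(** Maps to [X] may be given locally by regular Cox coordinates. A coordinate nonzero at [y] stays
    nonzero nearby, so cones only shrink and nearby points remain in every chart around [F y]. *)
Lemma regular_map_cox (Y : fspace K) (F : Y -> X) : ok_space Y ->
  (forall y, exists (A : finType) (v : A -> 'rV[int]_d) (z : A -> Y -> K)
     (U : set Y), [/\ opn U, U y, forall a, regular_at y (z a),
       forall y', U y' -> cn (F y') = cox_cone v (z ^~ y') &
       forall y', U y' -> forall m, ch (F y') m = cox_val v (z ^~ y') m]) ->
  regular_map F.
Proof.
move=> okY H; apply: regular_map_glued => // y s ys.
have [A [v [z [U [oU Uy rz cnz chz]]]]] := H y.
split=> [|h [m dm ->]].
  have [V [oV Vy HV]] : exists V : set Y, [/\ opn V, V y &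
      forall y', V y' -> forall a, z a y != 0 -> z a y' != 0].
    apply: open_near_finite => // a.
    have [za|za] := eqVneq (z a y) 0.
      by exists setT; split=> //; exact: okT.
    have [V [oV Vy HV]] := ok_nz okY (rz a) za.
    by exists V; split=> // y' Vy' _; exact: HV.
  exists (U `&` V); split=> //; first exact: okI.
  move=> y' [Uy' Vy'] /=; apply: subset_trans ys.
  rewrite /= !cnz //; apply: sub_gcone => a.
  by apply: contraTT => za; exact: HV.
have R1 : regular_at y (fun y' => cox_val v (z ^~ y') m).
  apply: regular_prod => // a _; apply: regular_expz => // za.
  have : dual_cone (cn (F y)) (lat m) by move=> x /ys; exact: dm.
  by rewrite cnz // => /dual_gconeP; apply; rewrite za.
by apply: (ok_ext okY R1 oU Uy) => y' Uy' /=; rewrite chz.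
Qed.

Section BasisPoint.
Variables (E : 'M[int]_d) (uE : E \in unitmx).
Local Notation bcone P := (@gcone R d _ (fun i => row i E) P).
Local Notation y i := (fun p => ch p (dualb E i)).

Lemma bcone_sub p q (P : pred 'I_d) : cn p = bcone P -> cn q `<=` cn p ->
  exists2 P' : pred 'I_d, (forall i, P' i -> P i) & cn q = bcone P'.
Proof.
by move=> Ep /(face_fan (cn_fan q)); rewrite Ep => /face_basis.
Qed.

Lemma bcone_fan p (P P' : pred 'I_d) : cn p = bcone P ->
  (forall i, P' i -> P i) -> Sg (bcone P').
Proof.
move=> Ep PP'; have [_ _ H _] := fanS; apply: (H (cn p)); first exact: cn_fan.
by rewrite Ep; exact: (basis_face _ uE PP').
Qed.

Section At.
Variables (p : T) (P : pred 'I_d).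
Hypothesis Ep : cn p = bcone P.

Lemma ch_dualb_eq0 i : (ch p (dualb E i) == 0) = P i.
Proof.
have [Pi|Pi] := boolP (P i).
  apply/eqP; apply: contrapT => /ch_neq0; rewrite Ep => /orth_gconeP /(_ i Pi).
  by move/eqP; rewrite ip_dualb_row // eqxx oner_eq0.
apply/negbTE/eqP/ch_neq0; rewrite Ep; apply/orth_gconeP => a Pa.
rewrite ip_dualb_row //; have [ia|//] := eqVneq i a.
by move: Pi; rewrite ia Pa.
Qed.

Lemma ch_coord m : ch p m = \prod_i ch p (dualb E i) ^ ip m (row i E).
Proof.
have Pm a : P a -> ip m (row a E) != 0 ->
    \prod_i ch p (dualb E i) ^ ip m (row i E) = 0.
  move=> Pa ma; have /eqP y0 : ch p (dualb E a) == 0 by rewrite ch_dualb_eq0.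
  by rewrite (bigD1 a) //= y0 exp0rz (negPf ma) mul0r.
have [/orth_gconeP o|no] := pselect (orthogonal_to (bcone P) (lat m)); last first.
  have -> : ch p m = 0 by apply: contra_notP no => /ch_neq0; rewrite Ep.
  have [a [Pa ma]] : exists a, P a /\ ip m (row a E) != 0.
    apply: contra_notP no => H; apply/orth_gconeP => a Pa; apply/eqP.
    by apply: contra_notT H => ma; exists a.
  by rewrite (Pm a).
have oy a : ~~ P a -> orthogonal_to (cn p) (lat (dualb E a)).
  by move=> Pa; apply/ch_neq0/eqP; rewrite ch_dualb_eq0.
have E1 : m = \sum_(i | ~~ P i) ip m (row i E) *: dualb E i.
  rewrite [LHS](dual_expand uE) [RHS]big_mkcond /=; apply: eq_bigr => i _.
  by case: ifPn => // /negPn Pi; rewrite o // scale0r.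
have os a : ~~ P a -> orthogonal_to (cn p) (lat (ip m (row a E) *: dualb E a)).
  move=> /oy H x px; have := H x px; rewrite latZ /dual_pairing => H'.
  transitivity ((ip m (row a E))%:~R * \sum_i lat (dualb E a) 0 i * x 0 i).
    by rewrite mulr_sumr; apply: eq_bigr => i _; rewrite mxE mulrA.
  by rewrite H' mulr0.
rewrite [in LHS]E1; have [_ ->] := ch_sum (index_enum 'I_d) os.
rewrite big_mkcond /=; apply: eq_bigr => i _; case: ifPn => [/oy H|/negPn Pi].
  by rewrite ch_scale.
by rewrite o // expr0z.
Qed.

End At.

Section At.
Variables (p : T) (P : pred 'I_d).
Hypothesis Ep : cn p = bcone P.

Lemma dualb_dual i : dual_cone (cn p) (lat (dualb E i)).
Proof.
by rewrite Ep; apply/dual_gconeP => a _; rewrite ip_dualb_row // ler0n.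
Qed.

Lemma regular_dualb i : regular_at (X := X) p (y i).
Proof. exact: regular_ch (dualb_dual i). Qed.

(* The curve with coordinates [y_i(p) + t w_i]. *)
Section Curve.
Variable w : 'I_d -> K.
Let c t i := ch p (dualb E i) + t * w i.

Definition tcurve (t : K) : T :=
  if pselect (Sg (cox_cone (fun i => row i E) (c t))) is left H
  then cox_pt H else p.

Lemma tcurve_cofin : cofin (fun t =>
  [/\ cn (tcurve t) = cox_cone (fun i => row i E) (c t),
      cn (tcurve t) `<=` cn p,
      forall i, c t i == 0 -> P i,
      forall i, ch (tcurve t) (dualb E i) = c t i &
      forall m, ch (tcurve t) m = \prod_i c t i ^ ip m (row i E)]).
Proof.
have : cofin (fun t => forall i, P i || (c t i != 0)).
  apply: cofin_forall => i; have [Pi|Pi] := boolP (P i).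
    by apply: cofinT => t.
  have J := jet0_add (jet0_cst (ch p (dualb E i)))
    (jet0_mul (ex_intro _ 1 (jet_id K)) (jet0_cst (w i))).
  by apply: (jet0_neq0 J); rewrite mul0r addr0 (ch_dualb_eq0 Ep).
apply: cofin_sub => t Ht.
have Ht' i : c t i == 0 -> P i.
  by move=> ci; have := Ht i; rewrite ci orbF.
have SC : Sg (cox_cone (fun i => row i E) (c t)) by exact: bcone_fan Ep Ht'.
rewrite /tcurve; case: pselect => // SC'; rewrite cn_cox; split=> //.
- by rewrite Ep; apply: sub_gcone.
- move=> i; rewrite ch_cox /cox_val (bigD1 i) //= ip_dualb_row // eqxx expr1z.
  rewrite big1 ?mulr1 // => j /negPf ji.
  by rewrite ip_dualb_row // eq_sym ji expr0z.
- by move=> m; rewrite ch_cox.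
Qed.

Lemma tcurve_ch m : dual_cone (cn p) (lat m) ->
  jet0 (fun t => ch (tcurve t) m) (ch p m).
Proof.
move=> dm; rewrite (ch_coord Ep).
have E1 : cofin (fun t => \prod_i c t i ^ ip m (row i E) = ch (tcurve t) m).
  by apply: cofin_sub tcurve_cofin => t [_ _ _ _ ->].
apply: (jet0_ext E1); apply: jet0_prod => i; apply: jet0_expz.
  have J := jet0_add (jet0_cst (ch p (dualb E i)))
    (jet0_mul (ex_intro _ 1 (jet_id K)) (jet0_cst (w i))).
  by move: J; rewrite mul0r addr0.
move=> /eqP; rewrite (ch_dualb_eq0 Ep) => Pi.
by move: dm; rewrite Ep => /dual_gconeP; exact.
Qed.

Lemma tcurve_alg f : algebra_gen (@acrd K tatlas (chart_of p)) f ->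
  jet0 (f \o tcurve) (f p).
Proof.
apply: jet0_algebra => h [m dm ->]; exact: tcurve_ch.
Qed.

Lemma tcurve_regular f : regular_at (X := X) p f -> jet0 (f \o tcurve) (f p).
Proof.
move=> /(good_regular f (good_chart_of p))[a [b [ia ib bp H]]].
have Jb := tcurve_alg ib; have Ja := tcurve_alg ia.
rewrite H //; apply: jet0_ext (jet0_mul Ja (jet0_inv Jb bp)).
apply: cofin_sub (cofinI (jet0_neq0 Jb bp) tcurve_cofin) => t /= [bt [_ ct _ _ _]].
by rewrite H.
Qed.

Lemma tcurve_open (U : set X) : opn U -> U p -> cofin (fun t => U (tcurve t)).
Proof.
move=> oU Up; have [b [ib bp H]] := good_open (good_chart_of p) oU Up.
apply: cofin_sub (cofinI (jet0_neq0 (tcurve_alg ib) bp) tcurve_cofin).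
by move=> t /= [bt [_ ct _ _ _]]; exact: H.
Qed.

End Curve.

(** The coefficients are regular on a neighbourhood, which will make Jacobian determinants regular.
    The functions with this property contain the [y i] and are closed under ring operations and
    inverses, hence contain all fractions of characters. *)
Lemma local_differential f : regular_at (X := X) p f ->
  exists (U : set X) (c : 'I_d -> T -> K),
    [/\ opn U, U p, forall q, U q -> forall i, regular_at (X := X) q (c i),
        forall q, U q -> regular_at (X := X) q f &
        forall q, U q ->
          differential_at (X := X) q (fun i => y i) f (\row_i c i q)].
Proof.
have okX := ok_tor.
pose df f := exists (U : set X) (c : 'I_d -> T -> K),
    [/\ opn U, U p, forall q, U q -> forall i, regular_at (X := X) q (c i),
        forall q, U q -> regular_at (X := X) q f &
        forall q, U q ->
          differential_at (X := X) q (fun i => y i) f (\row_i c i q)].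
have rowE q (w w' : 'rV[K]_d) g :
    differential_at (X := X) q (fun i => y i) g w -> w' = w ->
    differential_at (X := X) q (fun i => y i) g w'.
  by move=> D ->.
have df_cst c : df (fun=> c).
  exists setT, (fun _ _ => 0); split=> // [|q _ i|q _|q _].
  - exact: okT.
  - exact: ok_cst.
  - exact: ok_cst.
  - by apply: (rowE _ _ _ _ (diff_cst okX _ _ c)); apply/rowP => i; rewrite !mxE.
have df_add f1 f2 : df f1 -> df f2 -> df (fun q => f1 q + f2 q).
  move=> [U1 [c1 [oU1 U1p rc1 rf1 d1]]] [U2 [c2 [oU2 U2p rc2 rf2 d2]]].
  exists (U1 `&` U2), (fun i q => c1 i q + c2 i q).
  split=> // [|q [q1 q2] i|q [q1 q2]|q [q1 q2]].
  - exact: okI.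
  - by apply: (ok_add okX); [exact: rc1 | exact: rc2].
  - by apply: (ok_add okX); [exact: rf1 | exact: rf2].
  - apply: (rowE _ _ _ _ (diff_add okX (d1 q q1) (d2 q q2))); apply/rowP => i; by rewrite !mxE.
have df_mul f1 f2 : df f1 -> df f2 -> df (fun q => f1 q * f2 q).
  move=> [U1 [c1 [oU1 U1p rc1 rf1 d1]]] [U2 [c2 [oU2 U2p rc2 rf2 d2]]].
  exists (U1 `&` U2), (fun i q => f1 q * c2 i q + f2 q * c1 i q).
  split=> // [|q [q1 q2] i|q [q1 q2]|q [q1 q2]].
  - exact: okI.
  - by apply: (ok_add okX); apply: (ok_mul okX);
      [exact: rf1 | exact: rc2 | exact: rf2 | exact: rc1].
  - by apply: (ok_mul okX); [exact: rf1 | exact: rf2].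
  - apply: (rowE _ _ _ _ (diff_mul okX (rf1 q q1) (rf2 q q2) (d1 q q1) (d2 q q2))); apply/rowP => i;
    by rewrite !mxE.
have df_inv g : df g -> g p != 0 -> df (fun q => (g q)^-1).
  move=> [U [c [oU Up rc rf dU]]] gp.
  have [W [oW Wp HW]] := ok_nz okX (rf p Up) gp.
  exists (U `&` W), (fun i q => - ((g q)^-1 ^+ 2) * c i q).
  split=> // [|q [Uq Wq] i|q [Uq Wq]|q [Uq Wq]].
  - exact: okI.
  - apply: (ok_mul okX) (rc q Uq i); apply: (regular_opp okX).
    by apply: (regular_exp okX); apply: (ok_inv okX); [exact: rf | exact: HW].
  - by apply: (ok_inv okX); [exact: rf | exact: HW].
  - apply: (rowE _ _ _ _ (diff_inv okX (rf q Uq) (HW q Wq) (dU q Uq))); apply/rowP => i;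
    by rewrite !mxE exprVn.
have df_exp g n : df g -> df (fun q => g q ^+ n).
  move=> Hf; elim: n => [|n IH].
    by rewrite (_ : (fun q => g q ^+ 0) = fun=> 1) //; apply/funext => q.
  rewrite (_ : (fun q => g q ^+ n.+1) = fun q => g q * g q ^+ n).
    exact: df_mul.
  by apply/funext => q; rewrite exprS.
have df_expz g (k : int) : df g -> (g p = 0 -> 0 <= k) -> df (fun q => g q ^ k).
  move=> Hf; case: k => n H; first exact: df_exp.
  by apply: df_inv; [exact: df_exp | rewrite expf_neq0 //; apply/eqP => /H].
have df_prod (F : 'I_d -> T -> K) : (forall i, df (F i)) ->
    df (fun q => \prod_i F i q).
  move=> HF; elim: (index_enum 'I_d) => [|i r IH].
    rewrite (_ : (fun q => _) = fun=> 1) //; apply/funext => q.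
    by rewrite big_nil.
  rewrite (_ : (fun q => _) = fun q => F i q * \prod_(j <- r) F j q).
    exact: df_mul.
  by apply/funext => q; rewrite big_cons.
have df_y i : df (y i).
  have [U [oU Up HU]] := regular_near okX (regular_dualb i).
  exists U, (fun k _ => (k == i)%:R); split=> // [q Uq k|q Uq].
    exact: ok_cst.
  by apply: (rowE _ _ _ _ (diff_self okX _ _ i)); apply/rowP => k; rewrite !mxE eqxx.
have df_ext (U : set X) g h : opn U -> U p -> (forall q, U q -> g q = h q) ->
    df g -> df h.
  move=> oU Up gh [W [c [oW Wp rc rf dW]]]; exists (U `&` W), c.
  split=> // [|q [Uq Wq]|q [Uq Wq]|q [Uq Wq]].
  - exact: okI.
  - exact: rc.
  - exact: (ok_ext okX (rf q Wq) oU Uq gh).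
  - exact: (diff_ext okX oU Uq gh (dW q Wq)).
have df_alg g : algebra_gen (@acrd K tatlas (chart_of p)) g -> df g.
  elim=> [h [m dm ->]|c|f1 f2 _ IH1 _ IH2|f1 f2 _ IH1 _ IH2].
  - apply: (df_ext [set q | cn q `<=` cn p]
      (fun q => \prod_i y i q ^ ip m (row i E))).
    + exact: open_cn.
    + by [].
    + move=> q qp; have [P' _ Eq] := bcone_sub Ep qp.
      by rewrite (ch_coord Eq).
    + apply: df_prod => i; apply: df_expz => // /eqP.
      rewrite (ch_dualb_eq0 Ep) => Pi.
      by move: dm; rewrite /= Ep => /dual_gconeP; exact.
  - exact: df_cst.
  - exact: df_add.
  - exact: df_mul.
move=> /(good_regular f (good_chart_of p))[a [b [ia ib bp H]]].
apply: (df_ext [set q | adom (chart_of p) q /\ b q != 0]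
  (fun q => a q * (b q)^-1)).
- exact: (@open_basic _ tatlas).
- by split.
- by move=> q [iq bq]; rewrite H.
- by apply: df_mul; [exact: df_alg | apply: df_inv => //; exact: df_alg].
Qed.

(** The derivation dual to [y k] is the derivative at [t = 0] along the curve through [p] that moves
    the coordinate [k] alone. *)
Lemma coord_basis : coordinates_at (X := X) p (fun i => y i).
Proof.
have gp := good_chart_of p.
pose E_ k (f : T -> K) a0 a1 := jet (f \o tcurve (fun i => (i == k)%:R)) a0 a1.
have dE k : [/\ derivation_at (X := X) p
     (@dual_derivation K tatlas (chart_of p) p (E_ k)) &
   forall i, @dual_derivation K tatlas (chart_of p) p (E_ k) (y i) = (k == i)%:R].
  have Ec c : E_ k (fun=> c) c 0 by exact: jet_cst.
  have Ea f g a0 a1 b0 b1 : E_ k f a0 a1 -> E_ k g b0 b1 ->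
    E_ k (fun q => f q + g q) (a0 + b0) (a1 + b1) by exact: jet_add.
  have Em f g a0 a1 b0 b1 : E_ k f a0 a1 -> E_ k g b0 b1 ->
    E_ k (fun q => f q * g q) (a0 * b0) (a0 * b1 + b0 * a1) by exact: jet_mul.
  have Eg h : @acrd K tatlas (chart_of p) h -> exists a1, E_ k h (h p) a1.
    by move=> Hh; have [a1 ?] := tcurve_alg (fun i => (i == k)%:R) (AlgIn Hh); exists a1.
  have Eu b f g a0 a1 b0 b1 : algebra_gen (@acrd K tatlas (chart_of p)) b ->
      b p != 0 -> (forall q, adom (chart_of p) q -> b q != 0 -> f q = g q) ->
      E_ k f a0 a1 -> E_ k g b0 b1 -> a1 = b1.
    move=> ib bp fg Jf Jg.
    have Jb := tcurve_alg (fun i => (i == k)%:R) ib.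
    have [] // := @jet_uniq _ (g \o tcurve (fun i => (i == k)%:R)) a0 a1 b0 b1.
    apply: jet_ext Jf.
    apply: cofin_sub (cofinI (jet0_neq0 Jb bp) (tcurve_cofin (fun i => (i == k)%:R))).
    by move=> t [bt [_ ct _ _ _]]; apply: fg ct bt.
  split; first exact: dual_derivation_at.
  move=> i; apply: dual_derivationP => //.
    by apply: AlgIn; exists (dualb E i) => //; exact: dualb_dual.
  apply: (@jet_ext _ (fun t => ch p (dualb E i) + t * (i == k)%:R)).
    by apply: cofin_sub (tcurve_cofin (fun i => (i == k)%:R)) => t [_ _ _ H _]; rewrite /= H.
  have := jet_add (jet_cst (ch p (dualb E i)))
    (jet_mul (jet_id K) (jet_cst ((i == k)%:R : K))).
  by rewrite mulr0 mulr1 add0r mul0r addr0 add0r eq_sym.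
apply: (coordinates_intro ok_tor (D := fun k =>
  @dual_derivation K tatlas (chart_of p) p (E_ k))).
- exact: regular_dualb.
- by move=> k; have [] := dE k.
- by move=> k; have [] := dE k.
move=> f rf; have [U [c [_ Up _ _ dU]]] := local_differential rf.
by exists (\row_i c i p); exact: dU.
Qed.

End At.
End BasisPoint.
End Toric.

(** The isomorphism is upgraded to an equality of spaces by moving the atlas to the points of [X].
    No notion then has to be shown invariant under isomorphism. *)
Lemma toric_transport (R : realType) (K : closedFieldType) (d : nat)
    (Sg : set (set 'rV[R]_d)) (X : fspace K) :
  isomorphic X (glued_space (toric_atlas K Sg)) ->
  exists (phi : X -> toric_point K Sg) (psi : toric_point K Sg -> X),
    [/\ cancel phi psi, cancel psi phi & X = glued_space (tatlas phi)].
Proof.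
case: X => T o r [f [g [[fo fr] [go gr] fK gK]]].
exists f, g; split=> //.
have algf s b : algebra_gen (@acrd K (tatlas f) s) b ->
    algebra_gen (@acrd K (toric_atlas K Sg) s) (b \o g).
  apply: algebra_comp => h [m dm ->]; apply: AlgIn; exists m => //.
  by apply/funext => p; rewrite /ch /= gK.
have algg s b : algebra_gen (@acrd K (toric_atlas K Sg) s) b ->
    algebra_gen (@acrd K (tatlas f) s) (b \o f).
  by apply: algebra_comp => h [m dm ->]; apply: AlgIn; exists m.
have preK (U : set T) : f @^-1` (g @^-1` U) = U.
  by apply/funext => x /=; rewrite /preimage /= fK.
have fgK (h : T -> K) : (h \o g) \o f = h by apply/funext => x /=; rewrite fK.
have Eo : o = @opn _ (glued_space (tatlas f)).
  apply/funext => U; apply/propext; split=> [/go oU|oU].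
    move=> p Up; have := oU (f p); rewrite /preimage /= fK => /(_ Up).
    move=> [s [b [sb sp bp H]]]; exists s, (b \o f); split=> //.
      exact: algg.
    move=> q sq bq; rewrite -(fK q); exact: H.
  rewrite -(preK U); apply: fo => p Up.
  have [s [b [sb sp bp H]]] := oU _ Up; exists s, (b \o g); split=> //.
  - exact: algf.
  - by move: sp; rewrite /= /cn gK.
  - by move=> q sq bq; apply: H => //; rewrite /= /cn gK.
have Er : r = @reg _ (glued_space (tatlas f)).
  apply/funext => U; apply/funext => h; apply/propext; split=> [/gr rU|rU].
    move=> p Up; have := rU (f p); rewrite /preimage /= fK => /(_ Up).
    move=> [s [a [b [[sa sb] sp bp H]]]]; exists s, (a \o f), (b \o f).
    split=> //; first by split; exact: algg.
    by move=> q sq bq; have := H (f q) sq bq; rewrite /= fK.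
  rewrite -(preK U) -(fgK h); apply: fr => p Up.
  have [s [a [b [[sa sb] sp bp H]]]] := rU _ Up; exists s, (a \o g), (b \o g).
  split=> //.
  - by split; exact: algf.
  - by move: sp; rewrite /= /cn gK.
  - by move=> q sq bq; apply: H => //; rewrite /= /cn gK.
by rewrite /glued_space in Eo Er *; rewrite Eo Er.
Qed.

(** Combined with points whose coordinates are powers of one integer, this produces lattice vectors
    off finitely many hyperplanes. *)
Lemma int_poly_nonroot (I : Type) (s : seq I) (f : I -> {poly int}) :
  exists n : nat, forall i, f i != 0 -> List.In i s -> (f i).[n.+1%:Z] != 0.
Proof.
pose F := \prod_(i <- s | f i != 0) f i.
have F0 : F != 0.
  rewrite /F; elim: (s) => [|i s' IH]; first by rewrite big_nil oner_neq0.
  by rewrite big_cons; case: ifP => // fi; rewrite mulf_neq0.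
pose rs := [seq n.+1%:Z | n <- iota 0 (size F)].
have : ~~ all (root F) rs.
  have U : uniq rs by rewrite map_inj_uniq ?iota_uniq // => m n [].
  apply/negP => Hall; have := max_poly_roots F0 Hall U.
  by rewrite size_map size_iota ltnn.
move=> /allPn[z /mapP[n _ ->] Fn]; exists n => i fi.
move: Fn; rewrite /F; elim: (s) => [//|j s' IH].
rewrite big_cons; case: ifP => fj.
  rewrite rootM negb_or => /andP[fjn /IH H] [<- //|].
  exact: H.
by move=> /IH H [ij|//]; move: fj; rewrite ij fi.
Qed.

(** Cancelling the largest common power of ['X] is how a rational curve in projective space is
    extended to [t = 0]. *)
Lemma poly_family_order (K : closedFieldType) (I : finType) (W : I -> {poly K})
    i : W i != 0 ->
  exists e (V : I -> {poly K}),
    (forall j, W j = 'X^e * V j) /\ exists j, (V j).[0] != 0.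
Proof.
move: {2}(size (W i)) (leqnn (size (W i))) => n.
elim: n W => [|n IH] W; first by rewrite leqn0 size_poly_eq0 => ->.
move=> sW Wi; have [/existsP[j Wj]|] := boolP [exists j, (W j).[0] != 0].
  by exists 0%N, W; split=> [l|]; [rewrite expr0 mul1r | exists j].
rewrite negb_exists => /forallP H0.
have H j : exists V, W j = V * 'X.
  have /factor_theorem[V ->] : root (W j) 0 by apply/negPn/H0.
  by exists V; rewrite subr0.
pose V j := sval (cid (H j)).
have WV j : W j = V j * 'X by rewrite /V; case: cid.
have Vi : V i != 0 by apply: contra_neq Wi => Vi; rewrite WV Vi mul0r.
have [|e [V' [VV' Hj]]] := IH V _ Vi.
  by move: sW; rewrite WV size_mulX.
exists e.+1, V'; split=> // j; rewrite WV VV' exprS; ring.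
Qed.

(** * Completeness of the fan *)

Section FanFacts.
Variables (R : realType) (d : nat).
Variable Sg : set (set 'rV[R]_d).
Hypothesis fanS : is_fan Sg.
Local Notation lat := (@lattice_vec R d).

Lemma fan_generated S : Sg S ->
  exists r (g : 'I_r -> 'rV[int]_d), S = generated_cone g.
Proof. by have [_ H _ _] := fanS; move=> /H[]. Qed.

Lemma fan_convex S x : Sg S -> S x -> S (- x) -> x = 0.
Proof. by have [_ H _ _] := fanS; move=> /H[_]; exact. Qed.

Lemma fan_bidual S v : Sg S ->
  (forall m, dual_cone S (lat m) -> 0 <= ip m v) -> S (lat v).
Proof.
move=> SS H; have [r [g Eg]] := fan_generated SS; apply: contrapT => nv.
have [] := @farkas_cone R d r g v; first by rewrite -Eg.
by move=> u; rewrite -Eg => /H; rewrite leNgt => /negP.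
Qed.

(** A form positive on all nonzero generators of [S] cuts out the face [0]. The conclusion speaks of
    an empty selection of generators because this is how the cone of a torus point appears in Cox
    coordinates. *)
Lemma fan_zero_cone (A : finType) (v : A -> 'rV[int]_d) (P : pred A) S :
  Sg S -> (forall a, ~~ P a) -> Sg (gcone v P).
Proof.
move=> SS P0; have [r [g Eg]] := fan_generated SS; have [_ _ H _] := fanS.
have [u Hu] : exists u, forall k, g k != 0 -> 0 < ip u (g k).
  by apply: (@strongly_convex_dual R) => x; rewrite -Eg; exact: fan_convex.
have uS : dual_cone S (lat u).
  rewrite Eg generated_gcone; apply/dual_gconeP => a _.
  by have [->|/Hu /ltW //] := eqVneq (g a) 0; rewrite ip0r.
have -> : @gcone R d A v P = [set 0].
  apply/seteqP; split=> x /=.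
    move=> [c [_ ->]]; rewrite big_pred0 // => a; exact/negbTE.
  by move=> ->; exact: gcone0.
apply: (H S) => //; exists (lat u) => //; apply/seteqP; split=> x.
  move=> ->; split; first by rewrite Eg generated_gcone; exact: gcone0.
  by rewrite /= /dual_pairing big1 // => i _; rewrite !mxE mulr0.
move=> [/= Sx]; move: (Sx); rewrite {1}Eg => -[c [c0 Ex]].
rewrite Ex pairing_sumr => /eqP.
rewrite psumr_eq0 => [/allP Hc|k _]; last first.
  rewrite mulr_ge0 // pairing_lat ler0z.
  by have [->|/Hu /ltW //] := eqVneq (g k) 0; rewrite ip0r.
rewrite big1 // => k _; have := Hc k (mem_index_enum _).
have [->|/Hu gk] := eqVneq (g k) 0; first by rewrite lat0 scaler0.
rewrite /= pairing_lat mulf_eq0 intr_eq0 => /orP[/eqP ->|/eqP u0].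
  by rewrite scale0r.
by rewrite u0 ltxx in gk.
Qed.

Definition full_cone (S : set 'rV[R]_d) : Prop :=
  forall u, orthogonal_to S (lat u) -> u = 0.

Definition complete_fan : Prop := forall v, exists2 S, Sg S & S (lat v).

(** Otherwise finitely many hyperplanes would contain all lattice points. The vector of powers of a
    large integer avoids them: its pairing with a form is the value of a nonzero polynomial. *)
Lemma complete_full_cone : complete_fan -> exists2 S, Sg S & full_cone S.
Proof.
move=> cf; apply: contrapT => nf; have [fin _ _ _] := fanS.
have [s Es] := (finite_seqP Sg).1 fin.
have H S : exists u, Sg S -> u != 0 /\ orthogonal_to S (lat u).
  have [SS|nS] := pselect (Sg S); last by exists 0.
  have [u [ou u0]] : exists u, orthogonal_to S (lat u) /\ u <> 0.
    apply: contra_notP nf => H; exists S => // u ou.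
    by apply: contra_notP H => u0; exists u.
  by exists u => _; split=> //; exact/eqP.
pose u S := sval (cid (H S)).
have uP S : Sg S -> u S != 0 /\ orthogonal_to S (lat (u S)).
  by rewrite /u; case: cid.
pose f S : {poly int} := \poly_(i < d) (if insub i is Some j then u S 0 j else 0).
have [n Hn] := int_poly_nonroot s f.
pose v : 'rV[int]_d := \row_i (n.+1%:Z) ^+ i.
have Ef S : (f S).[n.+1%:Z] = ip (u S) v.
  rewrite /f horner_poly; apply: eq_bigr => i _.
  by rewrite valK mxE.
have [S SS Sv] := cf v; have [u0 ou] := uP S SS.
have f0 : f S != 0.
  apply: contra_neq u0 => fS; apply/rowP => i; rewrite mxE.
  by have := congr1 (fun F : {poly int} => F`_i) fS; rewrite coef_poly ltn_ord valK coef0.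
have : List.In S s.
  have : S \in s by move: SS; rewrite Es.
  elim: s {Es Hn} => [//|S' s IH]; rewrite inE => /orP[/eqP ->|/IH]; by [left|right].
move=> /(Hn S f0); rewrite Ef => /eqP; apply.
by have /eqP := ou _ Sv; rewrite pairing_lat intr_eq0 => /eqP.
Qed.

End FanFacts.

Section Complete.
Variables (R : realType) (K : closedFieldType) (d : nat).
Variable Sg : set (set 'rV[R]_d).
Hypothesis fanS : is_fan Sg.
Variables (T : Type) (phi : T -> toric_point K Sg) (psi : toric_point K Sg -> T).
Hypotheses (phiK : cancel phi psi) (psiK : cancel psi phi).
Local Notation lat := (@lattice_vec R d).
Local Notation X := (glued_space (tatlas phi)).
Local Notation ch := (ch phi).
Local Notation cn := (cn phi).
Variable t0 : T.

Definition unit_row (i : 'I_d) : 'rV[int]_d := delta_mx 0 i.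

Lemma torus_fan (z : 'I_d -> K) : (forall i, z i != 0) ->
  Sg (cox_cone unit_row z).
Proof. by move=> z0; exact: (fan_zero_cone fanS _ (cn_fan phi t0)). Qed.

Lemma one_param_neq0 (v : 'rV[int]_d) (t : K) (i : 'I_d) :
  (if t == 0 then 1 else t) ^ v 0 i != 0.
Proof. by apply: expfz_neq0; case: (eqVneq t 0) => // _; exact: oner_neq0. Qed.

(* The one-parameter subgroup of the torus attached to [v] (junk at [t = 0]). *)
Definition one_param (v : 'rV[int]_d) (t : K) : T :=
  cox_pt psi (torus_fan (one_param_neq0 v t)).

Lemma cn_one_param v t : cn (one_param v t) `<=` [set 0].
Proof.
rewrite /one_param cn_cox // => x [c [_ ->]]; rewrite big_pred0 // => i.
exact/negbTE/one_param_neq0.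
Qed.

Lemma ch_one_param v t m : t != 0 -> ch (one_param v t) m = t ^ ip m v.
Proof.
move=> t0'; rewrite /one_param ch_cox // /cox_val.
transitivity (\prod_i t ^ (m 0 i * v 0 i)).
  by apply: eq_bigr => i _; rewrite (negPf t0') /unit_row ip_delta exprzAC -exprz_exp.
rewrite /ip; elim: (index_enum _) => [|i s IH]; first by rewrite !big_nil expr0z.
by rewrite !big_cons IH expfzDr.
Qed.

Lemma one_param_chart v t p : cn (one_param v t) `<=` cn p.
Proof.
move=> x /cn_one_param ->; rewrite -lat0; apply: (fan_bidual fanS) => [|m _].
  exact: cn_fan.
by rewrite ip0r.
Qed.

(* The limit at [t = 0] of the one-parameter subgroup exists in the projective
   space, hence in the closed subset [X]; since the inverse of the embedding is
   regular there, the characters of a chart around the limit stay regular. *)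
Lemma projective_complete : projective_variety X -> complete_fan Sg.
Proof.
move=> [N [f [rf cf [g rg gK]]]] v.
have okX := ok_tor phi; pose F t := f (one_param v t).
have [i Fi] := hcoord_neq0 (F 1).
pose p1 := one_param v 1.
have jet1 h : regular_at (X := X) p1 h ->
    jet0 (fun t => h (one_param v (1 + t))) (h p1).
  move=> /(good_regular h (good_chart_of phi p1))[a [b [ia ib bp H]]].
  have Jm k : algebra_gen (@acrd K (tatlas phi) (chart_of phi p1)) k ->
      jet0 (k \o (fun t => one_param v (1 + t))) (k p1).
    apply: jet0_algebra => _ [m _ ->].
    rewrite /p1 ch_one_param ?oner_neq0 // exp1rz.
    apply: (@jet0_ext _ (fun t => (1 + t) ^ ip m v)).
      apply: cofin_sub (cofin_neq (- 1)) => t t1 /=; rewrite ch_one_param //.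
      by apply: contra_neq t1 => E; apply/eqP; rewrite -addr_eq0 addrC E.
    have := jet0_expz (k := ip m v) (jet0_add (jet0_cst 1) (ex_intro _ 1 (jet_id K))).
    by rewrite addr0 exp1rz; apply=> /eqP; rewrite oner_eq0.
  have Jb := Jm _ ib; rewrite H //.
  apply: jet0_ext (jet0_mul (Jm _ ia) (jet0_inv Jb bp)).
  apply: cofin_sub (jet0_neq0 Jb bp) => t bt /=; rewrite H //.
  exact: one_param_chart.
pose ratio i j (L : proj_space K N) : K := hcoord L j / hcoord L i.
have Jr j : jet0 (fun t => ratio i j (F (1 + t))) (ratio i j (F 1)).
  apply: (jet1 (fun p => ratio i j (f p))).
  apply: regular_comp rf _.
  apply: (@regular_local_frac _ (proj_atlas K N) i) => //.
  by apply: local_frac_alg; apply: AlgIn; exists j.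
have HPQ j := @jet_rational _ (fun t => ratio i j (F t)) _ (Jr j).
pose P j := sval (cid (HPQ j)).
have HQ j : exists Q : {poly K}, Q != 0 /\
    cofin (fun t => ratio i j (F t) * Q.[t] = (P j).[t]).
  by rewrite /P; case: cid.
pose Q j := sval (cid (HQ j)).
have PQ j : Q j != 0 /\ cofin (fun t => ratio i j (F t) * (Q j).[t] = (P j).[t]).
  by rewrite /Q; case: cid.
pose QQ := \prod_j Q j; pose W j := P j * \prod_(l | l != j) Q l.
have Q0 : QQ != 0.
  by rewrite prodf_seq_neq0; apply/allP => j _; have [] := PQ j.
have WE : cofin (fun t => forall j, ratio i j (F t) * QQ.[t] = (W j).[t]).
  apply: cofin_forall => j; have [_] := PQ j; apply: cofin_sub => t Et.
  by rewrite /QQ (bigD1 j) //= !hornerM mulrA Et.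
have Fit : cofin (fun t => hcoord (F t) i != 0).
  have [_ [Z Z0 HZ]] := PQ i.
  have [P' [Q' [Q0' H']]] := @jet_rational _ (fun t => ratio i i (F t)) _ (Jr i).
  have := jet0_neq0 (Jr i); rewrite /ratio divff // oner_eq0 => /(_ isT) [Z1 Z10 HZ1].
  exists (Z1 \Po ('X - 1%:P)).
    apply/eqP => /(congr1 (fun G => G \Po ('X + 1%:P))).
    rewrite -comp_polyA comp_polyB comp_polyX comp_polyC addrK comp_polyXr comp_poly0.
    by move/eqP; rewrite (negPf Z10).
  move=> t; rewrite horner_comp hornerXsubC => /HZ1.
  by rewrite addrC subrK mulf_eq0 => /norP[].
have Wi : W i != 0.
  apply: contra_neq Q0 => Wi; apply: cofin_poly_eq.
  apply: cofin_sub (cofinI WE Fit) => t [/(_ i)].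
  by rewrite /ratio Wi horner0 => H Fi'; move: H; rewrite divff // mul1r.
(* After cancelling the common power of ['X], the values at [0] no longer vanish together: they are
   homogeneous coordinates of the limit point [L0]. *)
have [e [V [WV [i0 Vi0]]]] := poly_family_order Wi.
pose z : 'rV[K]_N.+1 := \row_j (V j).[0].
have z0 : z != 0.
  by apply: contra_neq Vi0 => z0; have := congr1 (fun M : 'rV_ _ => M 0 i0) z0; rewrite !mxE.
pose L0 : proj_space K N := proj_mk z0.
have L0E j : (hcoord L0 j == 0) = ((V j).[0] == 0) by rewrite hcoord_mk_eq0 mxE.
have ratL0 j k : ratio j k L0 = (V k).[0] / (V j).[0].
  by rewrite /ratio hcoord_mk_ratio !mxE.
have nearL0 j : (V j).[0] != 0 -> cofin (fun t => hcoord (F t) j != 0 /\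
    forall k, ratio j k (F t) = (V k).[t] / (V j).[t]).
  move=> Vj0.
  have Vj : V j != 0 by apply: contra_neq Vj0 => ->; rewrite horner0.
  apply: cofin_sub (cofinI (cofinI WE Fit)
    (cofinI (cofin_root Vj) (cofinI (cofin_root Q0) (cofin_neq 0)))).
  move=> t [[Wt Ft] [Vt [Qt t0']]].
  have te : t ^+ e != 0 by rewrite expf_neq0.
  have E k : hcoord (F t) k = (V k).[t] * (t ^+ e * hcoord (F t) i / QQ.[t]).
    have := Wt k; rewrite WV hornerM hornerXn /ratio => H.
    have -> : (V k).[t] * (t ^+ e * hcoord (F t) i / QQ.[t]) =
      (t ^+ e * (V k).[t]) * hcoord (F t) i / QQ.[t] by ring.
    by rewrite -H; field; rewrite Ft Qt.
  split; first by rewrite E !mulf_neq0 // invr_eq0.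
  move=> k; rewrite /ratio (E k) (E j); field.
  by rewrite Vt Ft te Qt.
have jetL0 j h : (V j).[0] != 0 -> algebra_gen (@acrd K (proj_atlas K N) j) h ->
    jet0 (h \o F) (h L0).
  move=> Vj0; apply: jet0_algebra => _ [k ->].
  rewrite -[hcoord L0 k / _]/(ratio j k L0) ratL0.
  apply: (@jet0_ext _ (fun t => (V k).[t] / (V j).[t])).
    by apply: cofin_sub (nearL0 j Vj0) => t [_ /(_ k)].
  apply: jet0_mul; first by eexists; exact: jet_poly.
  by apply: jet0_inv => //; eexists; exact: jet_poly.
have openL0 (U : set (proj_space K N)) : opn U -> U L0 -> cofin (fun t => U (F t)).
  move=> oU UL; have gL : good_at (A := proj_atlas K N) L0 i0.
    by apply: good_proj; rewrite /= L0E.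
  have [b [ib bp H]] := good_open gL oU UL.
  apply: cofin_sub (cofinI (jet0_neq0 (jetL0 _ _ Vi0 ib) bp) (nearL0 _ Vi0)).
  by move=> t [bt [Ft _]]; exact: H.
have [x0 _ fx0] : range f L0.
  apply: contrapT => nL; have [t] := cofin_ex (openL0 _ cf nL).
  by apply; exists (one_param v t).
exists (cn x0); first exact: cn_fan.
apply: (fan_bidual fanS) => [|m dm]; first exact: cn_fan.
have RL : (range f `&` setT) L0 by split=> //; exists x0.
pose zL : induced_space (range f `&` setT) := exist _ L0 RL.
have gL : g zL = x0 by apply: gK.
have : regular_at (X := X) (g zL) (ch ^~ m).
  by rewrite gL; apply: regular_ch.
move=> /(regular_comp rg)[U UL HU].
have [V1 [G [VL rG HG]]] := HU zL UL.
have [oV RG] := (ok_reg (ok_proj K N) _ _).1 rG.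
have gL0 : good_at (A := proj_atlas K N) L0 i0.
  by apply: good_proj; rewrite /= L0E.
have [a [b [ia ib bp H]]] := (good_regular _ gL0).1 (RG L0 VL).
have Jb := jetL0 _ _ Vi0 ib; have Ja := jetL0 _ _ Vi0 ia.
have J : jet0 (fun t => 1 * t ^ ip m v) (a L0 * (b L0)^-1).
  apply: jet0_ext (jet0_mul Ja (jet0_inv Jb bp)).
  apply: cofin_sub (cofinI (cofinI (nearL0 _ Vi0) (jet0_neq0 Jb bp))
    (cofinI (cofin_neq 0) (openL0 _ oV VL))) => t [[[Ft _] bt] [t0' Vt]].
  have RF : (range f `&` setT) (F t) by split=> //; exists (one_param v t).
  pose zt : induced_space (range f `&` setT) := exist _ (F t) RF.
  have [_] := HG zt Vt; rewrite /= (gK (one_param v t)) // ch_one_param //.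
  by rewrite mul1r => ->; rewrite -H.
by have [] := jet0_power (oner_neq0 _) J.
Qed.

(** The size of a coordinate system at one point determines [n], and at the unit of the torus the
    standard characters form one of size [d]. *)
Lemma toric_dim n : (forall p : X, exists y : 'I_n -> X -> K, coordinates_at p y) ->
  n = d.
Proof.
move=> sm; pose E : 'M[int]_d := 1%:M; have uE : E \in unitmx by exact: unitmx1.
pose p1 := one_param 0 1.
have Ep : cn p1 = @gcone R d _ (fun i => row i E) xpred0.
  apply/seteqP; split=> x; first by move=> /cn_one_param ->; exact: gcone0.
  move=> [c [_ ->]]; rewrite big_pred0_eq -lat0; apply: (fan_bidual fanS).
    exact: cn_fan.
  by move=> m _; rewrite ip0r.
have C1 := coord_basis fanS psiK uE Ep; have [y C2] := sm p1.
have okX := ok_tor phi.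
by apply/eqP; rewrite eqn_leq (coordinates_le_size okX C2 C1) (coordinates_le_size okX C1 C2).
Qed.

End Complete.

(** * Smooth cones *)

Section Unimodular.
Variables (R : realType) (K : closedFieldType) (d : nat).
Variable Sg : set (set 'rV[R]_d).
Hypothesis fanS : is_fan Sg.
Variables (T : Type) (phi : T -> toric_point K Sg) (psi : toric_point K Sg -> T).
Hypotheses (phiK : cancel phi psi) (psiK : cancel psi phi).
Local Notation lat := (@lattice_vec R d).
Local Notation X := (glued_space (tatlas phi)).
Local Notation ch := (ch phi).
Local Notation cn := (cn phi).
Variable t0 : T.
Variables (S : set 'rV[R]_d) (SS : Sg S) (fullS : full_cone S).
Variables (r : nat) (g : 'I_r -> 'rV[int]_d).
Hypothesis Eg : S = generated_cone g.
Hypothesis smooth :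
  forall p : X, exists y : 'I_d -> X -> K, coordinates_at p y.
Local Notation dual m := (dual_cone S (lat m)).

Lemma dualP m : dual m <-> forall k, 0 <= ip m (g k).
Proof.
rewrite Eg generated_gcone dual_gconeP; split=> H k; last by move=> _; exact: H.
exact: H.
Qed.

Lemma dual_add m m' : dual m -> dual m' -> dual (m + m').
Proof.
by move=> /dualP H /dualP H'; apply/dualP => k; rewrite ipDl addr_ge0.
Qed.

Lemma full_gen m : m != 0 -> exists k, ip m (g k) != 0.
Proof.
move=> m0; apply/existsP; apply: contra_neqT m0.
rewrite negb_exists => /forallP H; apply: fullS.
rewrite Eg generated_gcone; apply/orth_gconeP => k _.
exact/eqP/negPn/H.
Qed.

Lemma dual_neq0 m : dual m -> m != 0 -> exists k, 0 < ip m (g k).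
Proof.
move=> /dualP H /full_gen[k Hk]; exists k.
by rewrite lt_def Hk H.
Qed.

Lemma dual_sharp m m' : dual m -> dual m' -> m + m' = 0 -> m = 0.
Proof.
move=> dm dm' E; apply/eqP; apply: contrapT => /negP /(dual_neq0 dm)[k].
move: E => /eqP; rewrite addr_eq0 => /eqP ->.
by rewrite ipNl oppr_gt0 ltNge (dualP _).1.
Qed.

(** The Hilbert basis of the semigroup of lattice points of the dual cone. *)
Definition irreducible_char m : Prop :=
  [/\ m != 0, dual m & forall a b, dual a -> dual b -> m = a + b ->
      a = 0 \/ b = 0].

Let fixed_prop :
  [/\ Sg S, forall m, ((m == 0)%:R : K) <> 0 <-> orthogonal_to S (lat m),
      (((0 : 'rV[int]_d) == 0)%:R : K) = 1 &
      forall m m', orthogonal_to S (lat m) -> orthogonal_to S (lat m') ->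
        ((m + m' == 0)%:R : K) = (m == 0)%:R * (m' == 0)%:R].
Proof.
split=> //; last first.
- by move=> m m' /fullS -> /fullS ->; rewrite addr0 eqxx mulr1.
- by rewrite eqxx.
move=> m; have [->|m0] := eqVneq m 0.
  split=> [_ x _|_]; last by apply/eqP; rewrite oner_eq0.
  by rewrite lat0 /dual_pairing big1 // => i _; rewrite mxE mul0r.
by split=> [//|/fullS m0']; move: m0; rewrite m0' eqxx.
Qed.

(** The torus-fixed point of the chart of [S], where every nontrivial character vanishes. The
    irreducible characters are independent modulo the square of its maximal ideal. *)
Definition fixed_pt : T :=
  psi (exist _ (S, fun m => ((m == 0)%:R : K)) fixed_prop).

Lemma cn_fixed : cn fixed_pt = S.
Proof. by rewrite /cn /fixed_pt psiK. Qed.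

Lemma ch_fixed m : ch fixed_pt m = (m == 0)%:R.
Proof. by rewrite /ch /fixed_pt psiK. Qed.

Local Notation alg := (algebra_gen (@acrd K (tatlas phi) (chart_of phi fixed_pt))).

Lemma chart_add q m m' : cn q `<=` S -> dual m -> dual m' ->
  ch q (m + m') = ch q m * ch q m'.
Proof.
by move=> qS dm dm'; apply: ch_add_dual => x /qS; [exact: dm | exact: dm'].
Qed.

Section Derivation.
Variables (m : 'rV[int]_d) (irr : irreducible_char m).

(** A product of two nontrivial characters never equals the irreducible [m], so modulo this span the
    coordinate ring becomes the dual numbers, with [m] as the infinitesimal. *)
Definition other_chars (f : T -> K) : Prop :=
  exists s : seq (K * 'rV[int]_d),
    (forall x, x \in s -> [/\ dual x.2, x.2 != 0 & x.2 != m]) /\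
    forall q, cn q `<=` S -> f q = \sum_(x <- s) x.1 * ch q x.2.

Lemma other_add f h : other_chars f -> other_chars h ->
  other_chars (fun q => f q + h q).
Proof.
move=> [s [Hs Ef]] [s' [Hs' Eh]]; exists (s ++ s'); split.
  by move=> x; rewrite mem_cat => /orP[/Hs|/Hs'].
by move=> q qS; rewrite big_cat Ef // Eh.
Qed.

Lemma other_scale c f : other_chars f -> other_chars (fun q => c * f q).
Proof.
move=> [s [Hs Ef]]; exists [seq (c * x.1, x.2) | x <- s]; split.
  by move=> _ /mapP[x xs ->]; exact: (Hs x xs).
move=> q qS; rewrite Ef // big_map mulr_sumr; apply: eq_bigr => x _.
by rewrite mulrA.
Qed.

Lemma other_ext f h : (forall q, cn q `<=` S -> f q = h q) ->
  other_chars f -> other_chars h.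
Proof.
by move=> fh [s [Hs Ef]]; exists s; split=> // q qS; rewrite -fh // Ef.
Qed.

Lemma other0 : other_chars (fun=> 0).
Proof. by exists [::]; split=> // q _; rewrite big_nil. Qed.

Lemma irr_sum a b : dual a -> dual b -> a != 0 -> b != 0 ->
  [/\ dual (a + b), a + b != 0 & a + b != m].
Proof.
move=> da db a0 b0; split; first exact: dual_add.
  by apply: contra_neq a0 => /(dual_sharp da db).
have [_ _ H] := irr; apply/eqP => E.
by have [Ea|Eb] := H a b da db (esym E); [rewrite Ea eqxx in a0 | rewrite Eb eqxx in b0].
Qed.

Lemma other_ch_mul x f : dual x -> x != 0 -> other_chars f ->
  other_chars (fun q => ch q x * f q).
Proof.
move=> dx x0 [s [Hs Ef]]; exists [seq (y.1, x + y.2) | y <- s]; split.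
  by move=> _ /mapP[y /Hs[dy y0 _] ->]; exact: irr_sum.
move=> q qS; rewrite Ef // big_map mulr_sumr.
rewrite !big_seq; apply: eq_bigr => y /Hs[dy _ _] /=.
by rewrite chart_add // mulrCA.
Qed.

Lemma other_mul f h : other_chars f -> other_chars h ->
  other_chars (fun q => f q * h q).
Proof.
move=> [s [Hs Ef]] Hh.
apply: (@other_ext (fun q => \sum_(x <- s) x.1 * (ch q x.2 * h q))).
  move=> q qS; rewrite Ef // mulr_suml; apply: eq_bigr => x _.
  by rewrite mulrA.
elim: s Hs {Ef} => [_|x s IH Hs].
  by apply: other_ext other0 => q _; rewrite big_nil.
apply: (@other_ext (fun q => x.1 * (ch q x.2 * h q)
   + \sum_(x <- s) x.1 * (ch q x.2 * h q))).
  by move=> q _; rewrite big_cons.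
apply: other_add; last by apply: IH => y ys; apply: Hs; rewrite inE ys orbT.
by apply: other_scale; have [dx x0 _] := Hs x (mem_head _ _); exact: other_ch_mul.
Qed.

(* [a1] is the coefficient of the character [m] in [f]. *)
Definition char_coef (f : T -> K) (a0 a1 : K) : Prop :=
  exists2 h, other_chars h &
    forall q, cn q `<=` S -> f q = a0 + a1 * ch q m + h q.

Lemma coef_cst c : char_coef (fun=> c) c 0.
Proof. by exists (fun=> 0); [exact: other0 | move=> q _; rewrite mul0r !addr0]. Qed.

Lemma coef_add f h a0 a1 b0 b1 : char_coef f a0 a1 -> char_coef h b0 b1 ->
  char_coef (fun q => f q + h q) (a0 + b0) (a1 + b1).
Proof.
move=> [u Nu Ef] [v Nv Eh]; exists (fun q => u q + v q); first exact: other_add.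
by move=> q qS; rewrite Ef // Eh //; ring.
Qed.

Lemma coef_mul f h a0 a1 b0 b1 : char_coef f a0 a1 -> char_coef h b0 b1 ->
  char_coef (fun q => f q * h q) (a0 * b0) (a0 * b1 + b0 * a1).
Proof.
have [m0 dm _] := irr.
move=> [u Nu Ef] [v Nv Eh].
have Nmm : other_chars (fun q => ch q m * ch q m).
  exists [:: (1, m + m)]; split=> [x|q qS].
    by rewrite inE => /eqP ->; exact: irr_sum.
  by rewrite big_seq1 mul1r chart_add.
exists (fun q => a1 * b1 * (ch q m * ch q m) + (a0 * v q + b0 * u q) +
  (a1 * (ch q m * v q) + b1 * (ch q m * u q)) + u q * v q).
  apply: other_add (other_mul Nu Nv); apply: other_add.
    apply: other_add (other_scale _ Nmm) _.
    by apply: other_add; exact: other_scale.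
  by apply: other_add; apply: other_scale; exact: other_ch_mul.
by move=> q qS; rewrite Ef // Eh //; ring.
Qed.

Lemma coef_ch x : dual x -> char_coef (ch ^~ x) (ch fixed_pt x) (x == m)%:R.
Proof.
have [m0 _ _] := irr; rewrite ch_fixed => dx.
have [->|x0] := eqVneq x 0.
  rewrite eq_sym (negPf m0); exists (fun=> 0); first exact: other0.
  by move=> q _; rewrite ch_zero mul0r !addr0.
have [->|xm] := eqVneq x m.
  exists (fun=> 0); first exact: other0.
  by move=> q _; rewrite mul1r add0r addr0.
exists (ch ^~ x); last by move=> q _; rewrite mul0r !add0r.
exists [:: (1, x)]; split=> [y|q _]; first by rewrite inE => /eqP ->.
by rewrite big_seq1 mul1r.
Qed.

(** The one-parameter subgroup of an interior [v] tends to the fixed point as [t] tends to [0]. *)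
Lemma one_param_fixed v f : (forall x, dual x -> x != 0 -> 0 < ip x v) ->
  alg f -> jet0 (fun t => f (one_param fanS phi psi t0 v t)) (f fixed_pt).
Proof.
move=> Hv; apply: (jet0_algebra (g := one_param fanS phi psi t0 v)) => _ [x dx ->].
rewrite /= cn_fixed in dx.
apply: (@jet0_ext _ (fun t => t ^ ip x v)).
  by apply: cofin_sub (cofin_neq 0) => t t0'; rewrite /= ch_one_param.
rewrite ch_fixed; have -> : (x == 0)%:R = (0 : K) ^ ip x v.
  have [->|x0] := eqVneq x 0; first by rewrite ip0l expr0z.
  by rewrite exp0rz gt_eqF // Hv.
apply: jet0_expz; first by exists 1; exact: jet_id.
move=> _; have [->|x0] := eqVneq x 0; first by rewrite ip0l.
by rewrite ltW // Hv.
Qed.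

(** The generators are weighted by powers of one integer. Positive weights give an interior vector,
    and each condition [ip x v != 0] excludes only the roots of a nonzero polynomial. *)
Lemma generic_interior (s : seq 'rV[int]_d) :
  exists v, (forall x, dual x -> x != 0 -> 0 < ip x v) /\
    forall x, x \in s -> x != 0 -> ip x v != 0.
Proof.
pose f x : {poly int} := \sum_(k < r) (ip x (g k))%:P * 'X^k.
have [n Hn] := int_poly_nonroot s f.
exists (\sum_(k < r) (n.+1%:Z ^+ k) *: g k).
have E x : ip x (\sum_(k < r) (n.+1%:Z ^+ k) *: g k) = (f x).[n.+1%:Z].
  rewrite ip_sumr /f horner_sum; apply: eq_bigr => k _.
  by rewrite ipZr hornerM hornerC hornerXn mulrC.
split=> x.
  move=> dx /(dual_neq0 dx)[k Hk]; rewrite ip_sumr (bigD1 k) //=.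
  apply: ltr_wpDr.
    apply: sumr_ge0 => l _; rewrite ipZr mulr_ge0 ?exprn_ge0 //.
    exact: (dualP _).1.
  by rewrite ipZr mulr_gt0 // exprn_gt0.
move=> xs x0; rewrite E; apply: Hn.
  have [k Hk] := full_gen x0; apply/eqP => /(congr1 (fun F : {poly int} => F`_k)).
  rewrite coef_sum coef0 (bigD1 k) //= coefCM coefXn eqxx mulr1.
  rewrite big1 ?addr0 => [|l lk]; first by move/eqP; rewrite (negPf Hk).
  by rewrite coefCM coefXn (inj_eq val_inj) eq_sym (negPf lk) mulr0.
elim: (s) xs => [//|x' s' IH].
by rewrite inE => /orP[/eqP ->|/IH]; [left | right].
Qed.

(** The two functions are only known to agree on an open set. Along a one-parameter subgroup that
    gives [m] an exponent different from those of the other characters involved, this becomes an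
    identity of polynomials, whose coefficients can be compared. *)
Lemma coef_uniq b f h a0 a1 b0 b1 : alg b -> b fixed_pt != 0 ->
  (forall q, cn q `<=` S -> b q != 0 -> f q = h q) ->
  char_coef f a0 a1 -> char_coef h b0 b1 -> a1 = b1.
Proof.
have [m0 dm _] := irr.
move=> ib bp fh Cf Ch.
have [u [s [Hs Eu]] Efh] : char_coef (fun q => f q + (-1) * h q)
    (a0 + (-1) * b0) (a1 + (-1) * b1).
  apply: coef_add => //; have := coef_mul (coef_cst (-1)) Ch.
  by rewrite mulr0 addr0.
have [v [Hv Hs']] := generic_interior [seq x.2 - m | x <- s].
have Jb := one_param_fixed Hv ib.
pose F : {poly K} := (a0 + (-1) * b0)%:P + (a1 + (-1) * b1)%:P * 'X^(`|ip m v|)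
   + \sum_(x <- s) x.1%:P * 'X^(`|ip x.2 v|).
have F0 : F = 0.
  apply: cofin_poly_eq; apply: cofin_sub (cofinI (jet0_neq0 Jb bp) (cofin_neq 0)).
  move=> t [bt t0']; rewrite horner0.
  have qS : cn (one_param fanS phi psi t0 v t) `<=` S.
    by rewrite -cn_fixed; exact: one_param_chart.
  have := Efh _ qS; rewrite Eu // fh // mulN1r subrr => E0.
  have pw x : dual x -> x != 0 ->
      ch (one_param fanS phi psi t0 v t) x = t ^+ `|ip x v|.
    move=> dx x0; rewrite ch_one_param // exprnP gez0_abs //.
    exact/ltW/Hv.
  rewrite E0 /F !hornerD hornerM !hornerC hornerXn horner_sum pw //.
  congr (_ + _); rewrite !big_seq; apply: eq_bigr => x /Hs[dx x0 _].
  by rewrite hornerM hornerC hornerXn pw.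
have := congr1 (fun G : {poly K} => G`_`|ip m v|) F0.
rewrite coef0 /F !coefD coefC coefCM coefXn eqxx mulr1.
have mv : 0 < ip m v by exact: Hv.
rewrite absz_eq0 gt_eqF // add0r coef_sum big_seq big1 ?addr0.
  by move=> /eqP; rewrite mulN1r subr_eq0 => /eqP.
move=> x xs; have [dx x0 xm] := Hs x xs; rewrite coefCM coefXn.
suff /negPf -> : `|ip m v|%N != `|ip x.2 v|%N by rewrite mulr0.
have xv : 0 < ip x.2 v by exact: Hv.
apply/eqP => /(congr1 Posz); rewrite !gez0_abs ?ltW // => E.
have := Hs' (x.2 - m) (map_f (fun y : K * 'rV[int]_d => y.2 - m) xs).
by rewrite subr_eq0 xm ipDl ipNl E subrr eqxx => /(_ isT).
Qed.

End Derivation.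

(** Smoothness enters here: taking the coefficient of an irreducible character is a derivation at
    the fixed point, these derivations are dual to the characters, and there are [d] coordinates. *)
Lemma irreducible_count (k : nat) (m : 'I_k -> 'rV[int]_d) :
  injective m -> (forall i, irreducible_char (m i)) -> (k <= d)%N.
Proof.
move=> minj irr; have [y Cy] := smooth fixed_pt.
have gp := good_chart_of phi fixed_pt; have okX := ok_tor phi.
pose D i := @dual_derivation K (tatlas phi) (chart_of phi fixed_pt) fixed_pt
  (char_coef (m i)).
have HD i : derivation_at (X := X) fixed_pt (D i) /\
    forall j, D i (ch ^~ (m j)) = (i == j)%:R.
  have Eg' h : @acrd K (tatlas phi) (chart_of phi fixed_pt) h ->
      exists a1, char_coef (m i) h (h fixed_pt) a1.
    move=> [x dx ->]; rewrite /= cn_fixed in dx; eexists.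
    exact: coef_ch (irr i) _ dx.
  have Eu b f h a0 a1 b0 b1 : alg b -> b fixed_pt != 0 ->
      (forall q, adom (chart_of phi fixed_pt) q -> b q != 0 -> f q = h q) ->
      char_coef (m i) f a0 a1 -> char_coef (m i) h b0 b1 -> a1 = b1.
    move=> ib bp fh; apply: (coef_uniq (irr i) ib bp) => q qS; apply: fh.
    by rewrite /= cn_fixed.
  split.
    apply: dual_derivation_at => //.
    - exact: coef_cst.
    - by move=> *; exact: coef_add.
    - by move=> *; exact: (coef_mul (irr i)).
  move=> j; have [_ dj _] := irr j; apply: dual_derivationP => //.
  - exact: coef_cst.
  - by move=> *; exact: coef_add.
  - by move=> *; exact: (coef_mul (irr i)).
  - by apply: AlgIn; exists (m j) => //; rewrite /= cn_fixed.
  - by rewrite -(inj_eq minj) eq_sym; exact: coef_ch (irr i) _ dj.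
apply: (derivations_le_size okX (D := D) (f := fun i => ch ^~ (m i)) Cy).
- by move=> i; have [] := HD i.
- move=> i; apply: regular_ch; rewrite cn_fixed.
  by have [] := irr i.
- by move=> i j; have [_] := HD i.
Qed.

Lemma irreducible_seq : exists s : seq 'rV[int]_d,
  [/\ uniq s, (size s <= d)%N & forall m, m \in s <-> irreducible_char m].
Proof.
pose P k := `[< exists s : seq 'rV[int]_d,
  [/\ uniq s, size s = k & forall m, m \in s -> irreducible_char m] >].
have Pb k : P k -> (k <= d)%N.
  move=> /asboolP[s [us <- Hs]].
  apply: (@irreducible_count _ (fun i : 'I_(size s) => nth 0 s i)).
    by move=> i j /eqP; rewrite nth_uniq // => /eqP/val_inj.
  by move=> i; apply: Hs; exact: mem_nth.
have P0 : exists k, P k by exists 0%N; apply/asboolP; exists [::].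
case: (ex_maxnP P0 Pb) => k Pk kmax; have kd := Pb k Pk.
move: Pk => /asboolP[s [us sk Hs]]; exists s; split; rewrite ?sk //.
move=> m; split=> [/Hs //|im]; apply/negPn/negP => ms.
suff : (k.+1 <= k)%N by rewrite ltnn.
apply: kmax; apply/asboolP; exists (m :: s); split=> /=; rewrite ?ms ?sk //.
by move=> x; rewrite inE => /orP[/eqP -> //|/Hs].
Qed.

(** At most [d] irreducible characters generate the dual semigroup, and this semigroup generates the
    whole lattice because [S] is strongly convex. So there are exactly [d] of them and they form a
    basis; the rows of [E] are the dual basis. *)
Lemma unimodular_cone : exists2 E : 'M[int]_d, E \in unitmx &
  S = gcone (fun i => row i E) predT.
Proof.
have [s [us sd irrs]] := irreducible_seq.
have [v0 [Hv0 _]] := generic_interior [::].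
pose k := size s.
have spanN m : dual m -> exists c : 'I_k -> int,
    (forall i, 0 <= c i) /\ m = \sum_i c i *: nth 0 s i.
  (* Induction on the value at the interior vector [v0], which is positive on nonzero dual elements:
     both parts of a splitting have smaller value. *)
  move: {2}`|ip m v0|%N (leqnn `|ip m v0|%N) => n.
  elim: n m => [|n IH] m Hn dm.
    exists (fun=> 0); split=> //; rewrite big1 => [|i _]; last exact: scale0r.
    apply/eqP; apply: contraTT Hn => m0; rewrite leqn0 absz_eq0 gt_eqF //.
    exact: Hv0.
  have [->|m0] := eqVneq m 0.
    by exists (fun=> 0); split=> //; rewrite big1 // => i _; rewrite scale0r.
  have [im|] := pselect (irreducible_char m).
    have ms : m \in s by apply/irrs.
    have mk : (index m s < k)%N by rewrite index_mem.
    exists (fun i => (i == Ordinal mk)%:R); split=> [i|]; first exact: ler0n.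
    rewrite (bigD1 (Ordinal mk)) //= eqxx scale1r nth_index // big1 ?addr0 //.
    by move=> i /negPf ->; rewrite scale0r.
  move=> nirr.
  have [a [b [da db Em a0 b0]]] : exists a b,
      [/\ dual a, dual b, m = a + b, a != 0 & b != 0].
    apply: contra_notP nirr => H; split=> // a b da db Em.
    have [->|a0] := eqVneq a 0; first by left.
    have [->|b0] := eqVneq b 0; first by right.
    by case: H; exists a, b.
  have va := Hv0 a da a0; have vb := Hv0 b db b0.
  have Ev : ip m v0 = ip a v0 + ip b v0 by rewrite Em ipDl.
  have [|c [c0 Ec]] := IH a _ da; first by lia.
  have [|c' [c0' Ec']] := IH b _ db; first by lia.
  exists (fun i => c i + c' i); split=> [i|]; first exact: addr_ge0.
  rewrite Em Ec Ec' -big_split; apply: eq_bigr => i _; exact/esym/scalerDl.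
have [m0 Hm0] : exists u, forall k, g k != 0 -> 0 < ip u (g k).
  apply: (@strongly_convex_dual R) => x; rewrite -Eg; exact: fan_convex fanS _ _ SS.
have dm0 : dual m0.
  by apply/dualP => l; have [->|/Hm0/ltW] := eqVneq (g l) 0; rewrite ?ip0r.
have spanZ m : exists c : 'I_k -> int, m = \sum_i c i *: nth 0 s i.
  (* [m0] is at least [1] on every nonzero generator, so adding [N] times it makes [m] nonnegative
     on all generators. *)
  pose N := \sum_l `|ip m (g l)|.
  have dN : dual (m + N *: m0).
    apply/dualP => l; rewrite ipDl ipZl.
    have [->|/Hm0 gl] := eqVneq (g l) 0; first by rewrite !ip0r mulr0.
    have lN : `|ip m (g l)| <= N.
      by rewrite /N (bigD1 l) //= lerDl sumr_ge0.
    have N0 : 0 <= N by apply: sumr_ge0.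
    have NN : N <= N * ip m0 (g l) by rewrite ler_peMr.
    have := ler_norm (- ip m (g l)); rewrite normrN.
    by move: lN NN; lia.
  have [c [_ Ec]] := spanN _ dN; have [c' [_ Ec']] := spanN _ dm0.
  exists (fun i => c i - N * c' i).
  rewrite -[LHS](addrK (N *: m0)) {1}Ec {1}Ec' scaler_sumr -sumrB.
  by apply: eq_bigr => i _; rewrite scalerBl scalerA.
have Ek : k = d.
  apply/eqP; rewrite eqn_leq sd /=.
  pose c j := sval (cid (spanZ (delta_mx 0 j))).
  have cP j : delta_mx 0 j = \sum_i c j i *: nth 0 s i.
    by rewrite /c; case: cid.
  apply: (@mulmx1_min _ d k (\matrix_(j, i) c j i) (\matrix_(i < k) nth 0 s i)).
  apply/row_matrixP => j; rewrite row_mul row1 cP mulmx_sum_row.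
  by apply: eq_bigr => i _; rewrite rowK !mxE.
rewrite Ek in spanN spanZ.
pose SM : 'M[int]_d := \matrix_(i < d) nth 0 s i.
have rSM i : row i SM = nth 0 s i by rewrite rowK.
have uS : SM \in unitmx.
  pose c j := sval (cid (spanZ (delta_mx 0 j))).
  have cP j : delta_mx 0 j = \sum_i c j i *: nth 0 s i.
    by rewrite /c; case: cid.
  have : (\matrix_(j, i) c j i) *m SM = 1%:M.
    apply/row_matrixP => j; rewrite row_mul row1 cP mulmx_sum_row.
    by apply: eq_bigr => i _; rewrite rowK !mxE.
  by move=> /mulmx1_unit[].
pose E := (invmx SM)^T.
have uE : E \in unitmx by rewrite unitmx_tr unitmx_inv.
have dE i : dualb E i = nth 0 s i.
  by rewrite /dualb /E -trmx_inv invmxK -rSM tr_col trmxK.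
have dd i : dual (dualb E i).
  rewrite dE; have /irrs[] // : nth 0 s i \in s.
  by rewrite mem_nth // -/k Ek.
exists E => //; apply/seteqP; split=> x.
  rewrite Eg => -[c [c0 ->]]; apply: gcone_sum => l _.
  apply: gcone_scale => //; apply/(gcone_basisP R uE); split=> // i.
  exact: (dualP _).1.
have Ej j : S (lat (row j E)).
  apply: (fan_bidual fanS SS) => m dm; have [c [c0 ->]] := spanN m dm.
  rewrite ip_suml; apply: sumr_ge0 => i _.
  by rewrite ipZl -dE ip_dualb_row // mulr_ge0 // ler0n.
move=> [c [c0 ->]]; rewrite Eg in Ej *.
by apply: gcone_sum => j _; apply: gcone_scale => //; exact: Ej.
Qed.

End Unimodular.

(** * Walls and rays *)

Section MaxCones.
Variables (R : realType) (d : nat).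
Variable Sg : set (set 'rV[R]_d).
Hypothesis fanS : is_fan Sg.
Local Notation lat := (@lattice_vec R d).
Local Notation bcone E := (@gcone R d _ (fun i => row i E) predT).
Implicit Types (E : 'M[int]_d) (v : 'rV[int]_d).

(* The maximal cones of a smooth complete fan, given by a basis of generators. *)
Definition max_cone E : Prop := E \in unitmx /\ Sg (bcone E).

Lemma bconeP E v : E \in unitmx ->
  bcone E (lat v) <-> forall i, 0 <= ip (dualb E i) v.
Proof. by move=> uE; rewrite gcone_basisP //; split=> [[]//|H]; split. Qed.

Lemma bcone_row E i : bcone E (lat (row i E)).
Proof. exact: gcone_gen. Qed.

Lemma basis_coord E (x : 'I_d -> int) i : E \in unitmx ->
  ip (dualb E i) (\sum_k x k *: row k E) = x i.
Proof.
move=> uE; rewrite ip_sumr (bigD1 i) //= ipZr ip_dualb_row // eqxx mulr1.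
rewrite big1 ?addr0 // => k /negPf ki.
by rewrite ipZr ip_dualb_row // eq_sym ki mulr0.
Qed.

Lemma basis_inj E i j : E \in unitmx -> row i E = row j E -> i = j.
Proof.
move=> uE /(congr1 (ip (dualb E i))); rewrite !ip_dualb_row // eqxx.
by case: eqVneq.
Qed.

Lemma fan_face S S' : Sg S -> Sg S' -> is_face (S `&` S') S.
Proof. by have [_ _ _ H] := fanS => SS SS'; have [] := H _ _ SS SS'. Qed.

(** The intersection of the two cones is a face of the second, so the rows of [E2] that occur in
    [row i E1] lie in the first cone. Nonnegative coordinates there make each of them a multiple of
    [row i E1], and integrality makes the multiple [1]. *)
Lemma ray_unique E1 E2 i : max_cone E1 -> max_cone E2 ->
  bcone E2 (lat (row i E1)) -> exists j, row i E1 = row j E2.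
Proof.
move=> [u1 S1] [u2 S2] H; have /bconeP H2 := H.
pose c a := ip (dualb E2 a) (row i E1).
have Ec : row i E1 = \sum_a c a *: row a E2 by exact: basis_expand.
have [u ud EF] := fan_face S2 S1.
have pu0 a : 0 <= dual_pairing u (lat (row a E2)) by apply: ud; exact: bcone_row.
have Sa a : 0 < c a -> bcone E1 (lat (row a E2)).
  move=> ca; suff [] : (bcone E2 `&` bcone E1) (lat (row a E2)) by [].
  rewrite EF; split; first exact: bcone_row.
  have : (bcone E2 `&` bcone E1) (lat (row i E1)) by split=> //; exact: bcone_row.
  rewrite EF => -[_ /=]; rewrite Ec lat_sum.
  under eq_bigr do rewrite latZ.
  rewrite pairing_sumr => /eqP.
  rewrite psumr_eq0 => [/allP H0|b _]; last first.
    by rewrite mulr_ge0 // ler0z; exact: H2.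
  have := H0 a (mem_index_enum _); rewrite /= mulf_eq0 intr_eq0 gt_eqF //=.
  by move/eqP.
pose D b a := ip (dualb E1 b) (row a E2).
have D0 a b : 0 < c a -> 0 <= D b a by move=> /Sa/bconeP; apply.
have sumD b : \sum_a c a * D b a = (b == i)%:R.
  rewrite -(ip_dualb_row u1 b i) Ec ip_sumr; apply: eq_bigr => a _.
  by rewrite ipZr.
have [a ca] : exists a, 0 < c a.
  apply: contrapT => H0; have := sumD i; rewrite eqxx big1 => [/eqP|a _].
    by rewrite eq_sym oner_eq0.
  have : 0 <= c a by exact: H2.
  rewrite le_eqVlt => /orP[/eqP <-|ca]; first by rewrite mul0r.
  by case: H0; exists a.
have cD0 b a' : 0 <= c a' * D b a'.
  have : 0 <= c a' by exact: H2.
  rewrite le_eqVlt => /orP[/eqP <-|ca']; first by rewrite mul0r.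
  by apply: mulr_ge0; [exact: ltW | exact: D0].
have Db b : b != i -> D b a = 0.
  move=> /negPf bi; have /eqP := sumD b; rewrite bi psumr_eq0 //.
  move=> /allP/(_ a (mem_index_enum _)).
  by rewrite /= mulf_eq0 gt_eqF //= => /eqP.
have Ea : row a E2 = D i a *: row i E1.
  rewrite (basis_expand u1 (row a E2)) (bigD1 i) //= big1 ?addr0 //.
  by move=> b /Db; rewrite /D => ->; rewrite scale0r.
have : D i a * c a = 1.
  by rewrite -(ipZr (D i a)) -Ea ip_dualb_row // eqxx.
move=> E; have D1 : D i a = 1.
  have Dg := D0 a i ca; move: E ca Dg.
  by move: (D i a) (c a) => x y; nia.
by exists a; rewrite Ea D1 scale1r.
Qed.

Lemma pairing_basis_eq0 E (u x : 'rV[R]_d) : E \in unitmx ->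
  (forall i, dual_pairing u (lat (row i E)) = 0) -> dual_pairing u x = 0.
Proof.
move=> uE H; have u0 v : dual_pairing u (lat v) = 0.
  rewrite (basis_expand uE v) lat_sum; under eq_bigr do rewrite latZ.
  by rewrite pairing_sumr big1 // => i _; rewrite H mulr0.
rewrite /dual_pairing big1 // => i _; suff -> : u 0 i = 0 by rewrite mul0r.
have := u0 (delta_mx 0 i); rewrite /dual_pairing (bigD1 i) //= big1.
  by rewrite !mxE !eqxx mulr1 addr0.
by move=> j /negPf ji; rewrite !mxE ji andbF mulr0.
Qed.

(** The intersection is a face of [S] whose supporting form vanishes on a basis, so it is all of
    [S]. *)
Lemma max_cone_maximal E S : max_cone E -> Sg S -> bcone E `<=` S -> S = bcone E.
Proof.
move=> [uE SE] SS ES; have [u _ EF] := fan_face SS SE.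
have E1 : S `&` bcone E = bcone E by exact: setIidr.
rewrite -E1 EF; apply/esym/setIidl => x _ /=.
apply: (pairing_basis_eq0 _ uE) => i.
have : (S `&` bcone E) (lat (row i E)) by rewrite E1; exact: bcone_row.
by rewrite EF => -[].
Qed.

Definition set_row E j v : 'M[int]_d := \matrix_i (if i == j then v else row i E).

Lemma row_set_row E j v i :
  row i (set_row E j v) = if i == j then v else row i E.
Proof. by rewrite rowK. Qed.

Section Walls.
Hypothesis cf : complete_fan Sg.
Hypothesis uni : forall S, Sg S -> full_cone S -> exists2 E : 'M[int]_d,
  E \in unitmx & S = bcone E.

(* Vectors pushed slightly across the wall lie in some cone of the fan; a cone
   containing infinitely many of them is the neighbour. *)
Lemma wall_neighbour E j : max_cone E -> exists a : 'rV[int]_d,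
  a 0 j = -1 /\ max_cone (set_row E j (a *m E)).
Proof.
move=> mE; have [uE SE] := mE; have [fin _ _ _] := fanS.
have [s Es] := (finite_seqP Sg).1 fin.
pose w := \sum_(i | i != j) row i E.
pose v (k : nat) := k.+1%:Z *: w - row j E.
have [S SS Sv] : exists2 S, Sg S & forall N, exists2 k, (N <= k)%N & S (lat (v k)).
  apply: contrapT => H.
  have HN S : exists N, Sg S -> forall k, (N <= k)%N -> ~ S (lat (v k)).
    have [SS|] := pselect (Sg S); last by exists 0%N.
    apply: contrapT => HS; apply: H; exists S => // N; apply: contrapT => HN.
    apply: HS; exists N => _ k Nk Sk; apply: HN; by exists k.
  pose N S := sval (cid (HN S)).
  have NP S : Sg S -> forall k, (N S <= k)%N -> ~ S (lat (v k)).
    by rewrite /N; case: cid.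
  have [S SS Sk] := cf (v (\sum_(S <- s) N S)%N).
  apply: (NP S SS _ _ Sk); have : S \in s by move: SS; rewrite Es.
  elim: s {Es Sk} => [//|S' s IH]; rewrite inE big_cons => /orP[/eqP <-|/IH H'].
    exact: leq_addr.
  exact: leq_trans H' (leq_addl _ _).
(* [w] is the limit direction of the [v k]: a form negative on [w] would be negative on [v k] for
   large [k]. *)
have Sw : S (lat w).
  apply: (fan_bidual fanS) => // m dm; rewrite leNgt; apply/negP => mw.
  have [k Nk Sk] := Sv `|ip m (row j E)|%N.
  have := dm _ Sk; rewrite pairing_lat ler0z /v ipDr ipNr ipZr.
  by move: mw Nk; move: (ip m w) (ip m (row j E)) => x y; nia.
(* The intersection with [S] is a face of the cone of [E]. It contains [w], which is interior to the
   wall, hence every row of the wall. *)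
have Si i : i != j -> S (lat (row i E)).
  move=> ij; have [u ud EF] := fan_face SE SS.
  suff [] : (bcone E `&` S) (lat (row i E)) by [].
  rewrite EF; split; first exact: bcone_row.
  have : (bcone E `&` S) (lat w).
    by split=> //; rewrite lat_sum; apply: gcone_sum => k _; exact: bcone_row.
  rewrite EF => -[_ /=]; rewrite lat_sum.
  under eq_bigr do rewrite -[lat _]scale1r.
  rewrite pairing_sumr => /eqP; rewrite psumr_eq0 => [/allP H0|b _]; last first.
    by rewrite mul1r; apply: ud; exact: bcone_row.
  by have := H0 i (mem_index_enum _); rewrite ij /= mul1r => /eqP.
have [k _ Sk] := Sv 0%N.
have fS : full_cone S.
  move=> m om; have mi i : i != j -> ip m (row i E) = 0.
    by move=> /Si/om/eqP; rewrite pairing_lat intr_eq0 => /eqP.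
  have mw : ip m w = 0 by rewrite ip_sumr big1.
  have mj : ip m (row j E) = 0.
    have /eqP := om _ Sk; rewrite pairing_lat intr_eq0 /v ipDr ipNr ipZr mw.
    by rewrite mulr0 add0r oppr_eq0 => /eqP.
  rewrite (dual_expand uE m) big1 // => i _.
  by have [->|/mi ->] := eqVneq i j; rewrite ?mj scale0r.
have [E2 u2 ES] := uni SS fS.
have mE2 : max_cone E2 by split; rewrite -?ES.
have nj : ~ S (lat (row j E)).
  move=> Sj; have EE : S = bcone E.
    apply: max_cone_maximal => // x [c [c0 ->]]; rewrite ES.
    apply: gcone_sum => i _; apply: gcone_scale => //; rewrite -ES.
    by have [->|/Si] := eqVneq i j.
  move: Sk; rewrite EE bconeP // => /(_ j).
  rewrite /v ipDr ipNr ipZr ip_dualb_row // eqxx ip_sumr big1.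
    by rewrite mulr0 add0r.
  by move=> i ij; rewrite ip_dualb_row // eq_sym (negPf ij).
have Hpi i : exists l, i != j -> row i E = row l E2.
  have [->|ij] := eqVneq i j; first by exists j.
  have [|l El] := @ray_unique E E2 i mE mE2; first by rewrite -ES; exact: Si.
  by exists l.
pose pi0 i := sval (cid (Hpi i)).
have pi0P i : i != j -> row i E = row (pi0 i) E2 by rewrite /pi0; case: cid.
have pi0_inj i l : i != j -> l != j -> pi0 i = pi0 l -> i = l.
  move=> ij lj E0; apply: (basis_inj uE); rewrite (pi0P i ij) (pi0P l lj).
  by rewrite E0.
(* The wall accounts for [d - 1] of the rows of [E2]; the remaining one is the new ray. *)
have [b Hb] : exists b, forall i, i != j -> pi0 i != b.
  apply: contrapT => H.
  have Hsub : #|'I_d| = #|[set pi0 i | i in [set~ j]]%SET|.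
    rewrite -cardsT; apply: eq_card => b; rewrite finset.in_setT; apply/esym.
    apply: contra_notT H => nb; exists b => i ij; apply: contraNneq nb => <-.
    by apply/imsetP; exists i => //; rewrite !finset.inE.
  have := leq_imset_card pi0 [set~ j]%SET; rewrite -Hsub cardsC1 card_ord.
  by move: (ltn_ord j); lia.
pose pi1 i := if i == j then b else pi0 i.
have pi1_inj : injective pi1.
  move=> i l; rewrite /pi1; have [->|ij] := eqVneq i j; have [->|lj] := eqVneq l j => //.
  - by move=> E0; have := Hb l lj; rewrite -E0 eqxx.
  - by move=> E0; have := Hb i ij; rewrite E0 eqxx.
  - exact: pi0_inj.
pose E' := set_row E j (row b E2).
have E'row i : row i E' = row (pi1 i) E2.
  by rewrite row_set_row /pi1; case: eqVneq => // /pi0P.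
have E'E : E' = row_perm (perm.perm pi1_inj) E2.
  by apply/row_matrixP => i; rewrite E'row; apply/rowP => l; rewrite !mxE perm.permE.
have uE' : E' \in unitmx by rewrite E'E row_permE unitmx_mul unitmx_perm u2.
have bE' : bcone E' = S.
  rewrite ES; apply/seteqP; split=> x [c [c0 ->]]; apply: gcone_sum => i _;
    apply: gcone_scale => //.
    by rewrite E'row; exact: bcone_row.
  have [l ->] : exists l, i = pi1 l by have [h _ hK] := injF_bij pi1_inj; exists (h i).
  by rewrite -E'row; exact: bcone_row.
pose a := row b E2 *m invmx E.
have aE : a *m E = row b E2 by rewrite mulmxKV.
have aj : a 0 j = ip (dualb E j) (row b E2) by rewrite ip_dualb.
exists a; split; last by rewrite aE; split; rewrite // -/E' bE'.
(* The coordinate of [v k] at [j] is [-1] in the basis [E], and it is the product of [a 0 j] with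
   the nonnegative coordinate in [E']; hence [a 0 j = -1]. *)
have := Sk; rewrite -bE' bconeP // => /(_ j) cj.
have := basis_expand uE' (v k) => /(congr1 (ip (dualb E j))).
rewrite ip_sumr (bigD1 j) //= ipZr row_set_row eqxx -aj big1 ?addr0; last first.
  by move=> i /negPf ij; rewrite ipZr row_set_row ij ip_dualb_row // eq_sym ij mulr0.
rewrite {1}/v ipDr ipNr ipZr ip_dualb_row // eqxx ip_sumr big1 ?mulr0 ?add0r; last first.
  by move=> i /negPf ij; rewrite ip_dualb_row // eq_sym ij.
rewrite mulr1n; move: cj; move: (a 0 j) (ip _ (v k)) => x y y0 E0.
have [y1|[y1|y2]] : y = 0 \/ y = 1 \/ 2 <= y by lia.
- by move: E0; rewrite y1 mul0r.
- by rewrite E0 y1 mul1r.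
- have x0 : x < 0 by rewrite ltNge; apply/negP => x0; have := mulr_ge0 y0 x0; rewrite -E0.
  have : y * (- x) >= 2 * 1 by apply: ler_pM => //; lia.
  by rewrite mulrN -E0.
Qed.

End Walls.

(** One basis per cone is enough for finiteness: by [ray_unique], any other basis of the same cone
    has the same rows. *)
Lemma rays_ex : exists V : seq 'rV[int]_d, uniq V /\
  forall v, v \in V <-> exists E i, max_cone E /\ v = row i E.
Proof.
have [fin _ _ _] := fanS; have [s Es] := (finite_seqP Sg).1 fin.
have H S : exists E, (exists E', max_cone E' /\ bcone E' = S) ->
    max_cone E /\ bcone E = S.
  have [[E HE]|nE] := pselect (exists E', max_cone E' /\ bcone E' = S).
    by exists E.
  by exists 0.
pose F S := sval (cid (H S)).
have FP S : (exists E', max_cone E' /\ bcone E' = S) ->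
    max_cone (F S) /\ bcone (F S) = S by rewrite /F; case: cid.
pose W := [seq row i (F S0) | S0 <- s, i <- enum 'I_d].
exists (undup [seq v <- W | `[< exists E i, max_cone E /\ v = row i E >]]).
split=> [|v]; first exact: undup_uniq.
rewrite mem_undup mem_filter; split=> [/andP[/asboolP]//|Hv].
apply/andP; split; first exact/asboolP.
have [E [i [mE ->]]] := Hv; have [uE SE] := mE.
have [mF EF] := FP (bcone E) (ex_intro _ E (conj mE erefl)).
have [|j ->] := @ray_unique E (F (bcone E)) i mE mF.
  by rewrite EF; exact: bcone_row.
apply/allpairsPdep; exists (bcone E), j; split=> //; last by rewrite mem_enum.
by move: SE; rewrite Es.
Qed.

(** Each cone occurs with every ordering of its basis, so the list is cut out of the finitely many
    matrices with rows in [V]. *)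
Lemma max_cones_ex (V : seq 'rV[int]_d) :
  (forall v, v \in V <-> exists E i, max_cone E /\ v = row i E) ->
  exists M : seq 'M[int]_d, forall E, E \in M <-> max_cone E.
Proof.
move=> HV.
pose mat (f : {ffun 'I_d -> 'I_(size V)}) : 'M[int]_d :=
  \matrix_i nth 0 V (f i).
exists [seq E <- [seq mat f | f <- enum {ffun 'I_d -> 'I_(size V)}] |
   `[< max_cone E >]] => E.
rewrite mem_filter; split=> [/andP[/asboolP]//|mE].
apply/andP; split; first exact/asboolP.
have iV i : (index (row i E) V < size V)%N.
  by rewrite index_mem; apply/HV; exists E, i.
apply/mapP; exists [ffun i => Ordinal (iV i)]; first by rewrite mem_enum.
apply/row_matrixP => i; rewrite rowK ffunE nth_index //.
by rewrite -index_mem; exact: iV.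
Qed.

End MaxCones.

(** * The anticanonical polytope *)

Section Casagrande.
Variables (R : realType) (d : nat).
Variable Sg : set (set 'rV[R]_d).
Hypothesis fanS : is_fan Sg.
Local Notation lat := (@lattice_vec R d).
Local Notation bcone E := (@gcone R d _ (fun i => row i E) predT).
Local Notation max_cone := (max_cone Sg).
Variables (V : seq 'rV[int]_d) (M : seq 'M[int]_d) (iota : nat).
Hypothesis uniqV : uniq V.
Hypothesis VP : forall v, v \in V <-> exists E i, max_cone E /\ v = row i E.
Hypothesis MP : forall E, E \in M <-> max_cone E.
Hypothesis M_ex : exists E, max_cone E.
Hypothesis wall : forall E j, max_cone E -> exists a : 'rV[int]_d,
  a 0 j = -1 /\ max_cone (set_row E j (a *m E)).
(* [2 - \sum_(i != j) a_i] is the anticanonical degree of the curve attached to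
   the wall [j] of [E]. *)
Hypothesis wall_degree : forall E j (a : 'rV[int]_d), max_cone E ->
  a 0 j = -1 -> max_cone (set_row E j (a *m E)) ->
  \sum_i a 0 i <= 1 - iota%:Z.
Hypothesis iota_gt0 : (0 < iota)%N.
Implicit Types (E : 'M[int]_d) (v w : 'rV[int]_d).

Definition height E v : int := \sum_i ip (dualb E i) v.

(** The form equal to [1] on the rows of [E]; these are vertices of the polytope of forms that are
    at most [1] on all rays. *)
Definition normal E : 'rV[int]_d := \sum_i dualb E i.

Lemma heightE E v : height E v = ip (normal E) v.
Proof. by rewrite ip_suml. Qed.

Lemma row_ray E i : max_cone E -> row i E \in V.
Proof. by move=> mE; apply/VP; exists E, i. Qed.

Lemma height_row E i : max_cone E -> height E (row i E) = 1.
Proof.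
move=> [uE _]; rewrite /height (bigD1 i) //= ip_dualb_row // eqxx.
by rewrite big1 ?addr0 // => j /negPf ji; rewrite ip_dualb_row // ji.
Qed.

Lemma height_wall E j (a : 'rV[int]_d) v : max_cone E -> a 0 j = -1 ->
  max_cone (set_row E j (a *m E)) ->
  height (set_row E j (a *m E)) v =
  height E v + ip (dualb E j) v * (\sum_i a 0 i - 1).
Proof.
move=> [uE _] aj [uE' _]; pose x i := ip (dualb E i) v.
(* As [a 0 j = -1], [row j E] is the combination of the other rows with coefficients [a 0 i], minus
   the new ray; substituting it gives these coordinates. *)
pose y i := if i == j then - x j else x i + x j * a 0 i.
have Ev : v = \sum_i y i *: row i (set_row E j (a *m E)).
  rewrite (bigD1 j) //= row_set_row /y eqxx.
  rewrite (eq_bigr (fun i => x i *: row i E + (x j * a 0 i) *: row i E)); last first.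
    by move=> i /negPf ij; rewrite row_set_row ij scalerDl.
  rewrite big_split /= addrCA.
  have -> : - x j *: (a *m E) =
      x j *: row j E - \sum_(i | i != j) (x j * a 0 i) *: row i E.
    rewrite mulmx_sum_row (bigD1 j) //= aj scaleN1r scalerDr scalerN scaleNr opprK.
    congr (_ + _); rewrite scaleNr scaler_sumr; congr (- _); apply: eq_bigr => i _.
    by rewrite scalerA.
  rewrite subrK addrC [LHS](basis_expand uE v) (bigD1 j) //=.
have E' i : ip (dualb (set_row E j (a *m E)) i) v = y i.
  by rewrite {1}Ev basis_coord.
rewrite /height; under eq_bigr do rewrite E'.
rewrite [LHS](bigD1 j) //= [in RHS](bigD1 j) //= [X in X - 1](bigD1 j) //= aj.
rewrite /y eqxx.
rewrite (eq_bigr (fun i => x i + x j * a 0 i)) => [|i /negPf -> //].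
rewrite big_split /= -mulr_sumr -/(x j); ring.
Qed.

Lemma height_max v : exists E, [/\ max_cone E, forall i, 0 <= ip (dualb E i) v &
  forall E', max_cone E' -> height E' v <= height E v].
Proof.
have [E [mE Hmax]] : exists E, max_cone E /\
    forall E', max_cone E' -> height E' v <= height E v.
  have [E0 /MP E0M] := M_ex.
  have [E EM Hmax] : exists2 E, E \in M &
      forall E', E' \in M -> height E' v <= height E v.
    elim: M E0 E0M => [//|E1 s IH] E0 _.
    case: s IH => [_|E2 s IH].
      by exists E1; rewrite ?mem_head // => E'; rewrite inE => /eqP ->.
    have [E Es Hm] := IH E2 (mem_head _ _).
    have [le|lt] := leP (height E1 v) (height E v).
      exists E; first by rewrite inE Es orbT.
      by move=> E'; rewrite inE => /orP[/eqP ->|/Hm].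
    exists E1; first exact: mem_head.
    move=> E'; rewrite inE => /orP[/eqP ->//|/Hm H].
    exact: le_trans H (ltW lt).
  by exists E; split; [exact/MP | move=> E' /MP; exact: Hmax].
exists E; split=> // j; rewrite leNgt; apply/negP => xj.
have [a [aj mE']] := wall j mE.
have := Hmax _ mE'; rewrite height_wall // gerDl.
have := wall_degree mE aj mE'.
by move: (\sum_i a 0 i) (ip _ v) xj iota_gt0 => A x; nia.
Qed.

Lemma ray_cone E v : max_cone E -> v \in V ->
  (forall i, 0 <= ip (dualb E i) v) -> exists i, v = row i E.
Proof.
move=> mE /VP[E1 [i [mE1 ->]]] H; have [uE _] := mE.
by apply: (ray_unique fanS mE1 mE); apply/bconeP.
Qed.

Lemma height_le1 E v : max_cone E -> v \in V -> height E v <= 1.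
Proof.
move=> mE vV; have [E1 [mE1 H Hm]] := height_max v.
have [i Ei] := ray_cone mE1 vV H.
by have := Hm E mE; rewrite {2}Ei height_row.
Qed.

(** The size of the negative coordinate is kept because the equality case uses it to force the value
    [-1]. *)
Lemma height_neg E v j : max_cone E -> v \in V -> ip (dualb E j) v < 0 ->
  height E v <= 1 + ip (dualb E j) v * iota%:Z.
Proof.
move=> mE vV xj; have [a [aj mE']] := wall j mE.
have := height_le1 mE' vV; rewrite height_wall //.
have := wall_degree mE aj mE'; move: (height E v).
by move: (\sum_i a 0 i) (ip _ v) xj => A x; nia.
Qed.

Lemma ray_neg E v : max_cone E -> v \in V -> (forall i, v != row i E) ->
  exists j, ip (dualb E j) v < 0.
Proof.
move=> mE vV nv; apply: contrapT => H.
have [|i Ei] := ray_cone mE vV.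
  by move=> i; rewrite leNgt; apply/negP => xi; apply: H; exists i.
by have := nv i; rewrite -Ei eqxx.
Qed.

Lemma height_other E v : max_cone E -> v \in V -> (forall i, v != row i E) ->
  height E v <= 1 - iota%:Z.
Proof.
move=> mE vV nv; have [j xj] := ray_neg mE vV nv.
have := height_neg mE vV xj; move: (height E v) => h.
by move: (ip _ v) xj => x; nia.
Qed.

Definition rows E : seq 'rV[int]_d := [seq row i E | i <- enum 'I_d].

Lemma mem_rows E v : (v \in rows E) = [exists i, v == row i E].
Proof.
apply/mapP/existsP => [[i _ ->]|[i /eqP ->]]; first by exists i.
by exists i; rewrite ?mem_enum.
Qed.

Lemma notin_rows E v : v \notin rows E -> forall i, v != row i E.
Proof. by rewrite mem_rows negb_exists => /forallP. Qed.

Lemma perm_rows E : max_cone E -> perm_eq (filter (mem (rows E)) V) (rows E).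
Proof.
move=> mE; have [uE _] := mE; apply: uniq_perm.
- exact: filter_uniq.
- by rewrite map_inj_uniq ?enum_uniq // => i j; exact: basis_inj.
- move=> v; rewrite mem_filter /=; apply: andb_idr.
  by move=> /mapP[i _ ->]; exact: row_ray.
Qed.

Lemma size_rows E : size (rows E) = d.
Proof. by rewrite size_map size_enum_ord. Qed.

Lemma rays_count E : max_cone E ->
  size V = (d + size [seq v <- V | v \notin rows E])%N.
Proof.
move=> mE; rewrite -{1}(count_predC (mem (rows E)) V) !size_filter.
by rewrite -size_filter (perm_size (perm_rows mE)) size_rows.
Qed.

Lemma height_sum E : max_cone E -> \sum_(v <- V) height E v =
  d%:Z + \sum_(v <- V | v \notin rows E) height E v.
Proof.
move=> mE; rewrite (bigID (mem (rows E))) /=; congr (_ + _).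
rewrite -big_filter (perm_big _ (perm_rows mE)) big_map /=.
rewrite big_enum /= (eq_bigr (fun=> 1)); last by move=> i _; exact: height_row.
by rewrite sumr_const card_ord -mulr_natr mul1r natz.
Qed.

Lemma height_sum_le E : max_cone E -> \sum_(v <- V) height E v <=
  d%:Z + (size V - d)%:Z * (1 - iota%:Z).
Proof.
move=> mE; rewrite height_sum // lerD2l (rays_count mE) addKn.
rewrite -big_filter.
have : forall v, v \in [seq v <- V | v \notin rows E] -> height E v <= 1 - iota%:Z.
  move=> v; rewrite mem_filter => /andP[/notin_rows nv vV].
  exact: height_other.
elim: [seq v <- V | v \notin rows E] => [|v s IH] H; first by rewrite big_nil mul0r.
rewrite big_cons /= intS mulrDl mul1r; apply: lerD; first exact/H/mem_head.
by apply: IH => w ws; apply: H; rewrite inE ws orbT.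
Qed.

(* The origin is a positive combination of vertices of the dual polytope. *)
Lemma normal_relation : exists (N : nat) (F : 'I_N -> 'M[int]_d) (c : 'I_N -> int),
  [/\ forall k, max_cone (F k), forall k, 0 <= c k, exists k, 0 < c k &
      \sum_k c k *: normal (F k) = 0].
Proof.
have [E0 mE0] := M_ex; have E0M : E0 \in M by apply/MP.
have k0P : (index E0 M < size M)%N by rewrite index_mem.
pose k0 := Ordinal k0P; pose F (k : 'I_(size M)) := nth 0 M k.
have FM k : max_cone (F k) by apply/MP; exact: mem_nth.
have F0 : F k0 = E0 by rewrite /F nth_index.
have [[N [c [N0 c0 E]]]|[u u0 uw]] :=
  farkas (fun k => normal (F k)) (- normal E0).
  exists (size M), F, (fun k => c k + N * (k == k0)%:R); split=> // [k||].
  - by rewrite addr_ge0 // mulr_ge0 // ?ltW // ler0n.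
  - by exists k0; rewrite eqxx mulr1; apply: ltr_wpDl.
  - under eq_bigr do rewrite scalerDl.
    rewrite big_split /= -E (bigD1 k0) //= eqxx mulr1 F0 scalerN.
    rewrite big1 ?addr0 ?addNr // => k /negPf ->.
    by rewrite mulr0 scale0r.
(* For a separating [u], the vector [- u] has height at most [0] in every basis and nonnegative
   coordinates in a maximizing one, so it is zero. *)
have [E1 [mE1 H _]] := height_max (- u); have [uE1 _] := mE1.
have h0 : height E1 (- u) <= 0.
  rewrite heightE ipNr oppr_le0 ipC; have /MP E1M := mE1.
  have k1P : (index E1 M < size M)%N by rewrite index_mem.
  by have := u0 (Ordinal k1P); rewrite /F nth_index.
have : height E1 (- u) = 0.
  by apply/eqP; rewrite eq_le h0 /=; apply: sumr_ge0 => i _.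
move=> /eqP; rewrite psumr_eq0 // => /allP Hz.
have : - u = 0.
  rewrite (basis_expand uE1 (- u)) big1 // => i _.
  by have /eqP -> := Hz i (mem_index_enum _); rewrite scale0r.
move=> /eqP; rewrite oppr_eq0 => /eqP Eu.
by move: uw; rewrite Eu ip0l ltxx.
Qed.

Lemma rays_bound : ((size V - d) * (iota - 1) <= d)%N /\
  (((size V - d) * (iota - 1))%N = d -> exists E, max_cone E /\
     forall v, v \in V -> v \notin rows E -> height E v = 1 - iota%:Z).
Proof.
have [N [F [c [mF c0 [k0 ck0] E]]]] := normal_relation.
pose B := d%:Z + (size V - d)%:Z * (1 - iota%:Z).
have sum0 : \sum_k c k * \sum_(v <- V) height (F k) v = 0.
  under eq_bigr do rewrite mulr_sumr.
  rewrite exchange_big big1_seq // => v _ /=.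
  under eq_bigr do rewrite heightE -ipZl.
  by rewrite -ip_suml E ip0l.
have BE : B = d%:Z - ((size V - d) * (iota - 1))%:Z.
  by rewrite /B PoszM -(@subzn iota 1) //; ring.
have B0 : 0 <= B.
  rewrite leNgt; apply/negP => B0.
  suff : \sum_k c k * \sum_(v <- V) height (F k) v < 0 by rewrite sum0.
  rewrite (bigD1 k0) //=.
  have H1 : c k0 * \sum_(v <- V) height (F k0) v < 0.
    rewrite pmulr_rlt0 //; exact: le_lt_trans (height_sum_le (mF k0)) B0.
  rewrite -[ltRHS]addr0; apply: ltr_leD => //; apply: sumr_le0 => k _.
  apply: mulr_ge0_le0 => //; exact: le_trans (height_sum_le (mF k)) (ltW B0).
split; first by move: B0; rewrite BE subr_ge0 lez_nat.
move=> Eq; have B00 : B = 0 by rewrite BE Eq subrr.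
exists (F k0); split=> // v vV nv.
(* The sums are nonpositive and their weighted combination is zero, so the sum for [F k0] is zero.
   It thus equals its upper bound, and every ray outside [F k0] attains [1 - iota]. *)
have Sle k : \sum_(v <- V) height (F k) v <= 0.
  by have := height_sum_le (mF k); rewrite -/B B00.
have S0 : \sum_(v <- V) height (F k0) v = 0.
  apply/eqP; move/eqP: sum0; rewrite -oppr_eq0 -sumrN psumr_eq0.
    move=> /allP/(_ k0 (mem_index_enum _)) /=.
    by rewrite oppr_eq0 mulf_eq0 gt_eqF.
  by move=> k _; rewrite oppr_ge0; exact: mulr_ge0_le0.
have nrow w : (w \in V) && (w \notin rows (F k0)) ->
    0 <= 1 - iota%:Z - height (F k0) w.
  by move=> /andP[wV /notin_rows nw]; rewrite subr_ge0; exact: height_other.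
have : \sum_(w <- V | (w \in V) && (w \notin rows (F k0)))
    (1 - iota%:Z - height (F k0) w) = 0.
  rewrite big_split /= sumrN -!big_seq_cond.
  have -> : \sum_(v <- V | v \notin rows (F k0)) height (F k0) v = - d%:Z.
    by move/eqP: S0; rewrite height_sum // addrC addr_eq0 => /eqP.
  rewrite -big_filter big_const_seq count_predT iter_addr_0 -mulr_natr opprK natz.
  have := rays_count (mF k0); move: B00; rewrite /B.
  by move=> H HV; move: H; rewrite HV addKn; move: (size _) => z; lia.
move/eqP; rewrite psumr_eq0 // => /allP/(_ v vV).
by rewrite vV nv /= subr_eq0 => /eqP.
Qed.

(** * The equality case: blocks of rays *)

Section Equality.
Variables (rho b : nat).
Hypothesis sizeV : size V = (d + rho)%N.
Hypothesis iotaE : iota = b.+1.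
Hypothesis rho_b : (rho * b)%N = d.

(** A ray [w] outside [E] has height exactly [1 - iota], which leaves no room: its negative
    coordinates are [-1], and [w] is the new ray across each wall where it is negative. So the sets
    [J w] of these walls partition the rows. Each has at least [b] elements, hence exactly [b] since
    [rho * b = d], and no positive coordinates remain. In [vv], the index [(k, ord0)] is the outer
    ray and the others are the rows of its block. *)
Lemma block_structure : exists vv : 'I_rho * 'I_b.+1 -> 'rV[int]_d,
  [/\ forall k, \sum_i vv (k, i) = 0,
      forall h : 'I_rho * 'I_b.+1 -> int, (forall k, \sum_i h (k, i) = 0) ->
        exists m, forall a, ip m (vv a) = h a,
      forall m, (forall a, ip m (vv a) = 0) -> m = 0 &
      forall v, v \in V <-> exists a, v = vv a].
Proof.
have [_ HE] := rays_bound.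
have [|E [mE hE]] := HE; first by rewrite sizeV addKn iotaE subn1.
have [uE _] := mE; pose W := [seq v <- V | v \notin rows E].
have sW : size W = rho by have := rays_count mE; rewrite sizeV => /addnI.
pose x (w : 'rV[int]_d) j := ip (dualb E j) w.
have WP w : w \in W -> [/\ w \in V, w \notin rows E & height E w = 1 - iota%:Z].
  by rewrite mem_filter => /andP[nw wV]; split=> //; exact: hE.
have negW w j (a : 'rV[int]_d) : w \in W -> x w j < 0 -> a 0 j = -1 ->
    max_cone (set_row E j (a *m E)) -> x w j = -1 /\ w = a *m E.
  move=> /WP[wV nw hw] xj aj mE'.
  have x1 : x w j = -1.
    have := height_neg mE wV xj; rewrite hw -/(x w j).
    by move: (x w j) xj iota_gt0 => y; nia.
  split=> //; have := height_wall w mE aj mE'; rewrite hw -/(x w j) x1.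
  have A1 := wall_degree mE aj mE'; move=> hE'.
  (* In the neighbouring basis [w] has height at least [1], too much for a ray outside it; being no
     row of [E], it is the new row. *)
  have : ~ forall i, w != row i (set_row E j (a *m E)).
    move=> /(height_other mE' wV); rewrite hE'.
    by move: (\sum_i a 0 i) A1 iota_gt0 => A; lia.
  move=> /existsNP[i /negP]; rewrite negbK row_set_row; case: (eqVneq i j) => [_ /eqP //|_].
  by have /negPf -> := notin_rows nw i.
have exW j : exists2 w, w \in W & x w j < 0.
  have [a [aj mE']] := wall j mE; exists (a *m E).
    rewrite mem_filter; apply/andP; split; last first.
      by apply/VP; exists (set_row E j (a *m E)), j; rewrite row_set_row eqxx.
    rewrite mem_rows negb_exists; apply/forallP => i; apply/eqP => Ei.
    have := congr1 (ip (dualb E j)) Ei.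
    rewrite ip_dualb mulmxK // aj ip_dualb_row //.
    by case: (j == i).
  by rewrite /x ip_dualb mulmxK // aj.
have unW w w' j : w \in W -> w' \in W -> x w j < 0 -> x w' j < 0 -> w = w'.
  move=> wW wW' xj xj'; have [a [aj mE']] := wall j mE.
  by have [_ ->] := negW w j a wW xj aj mE'; have [_ ->] := negW w' j a wW' xj' aj mE'.
have x1 w j : w \in W -> x w j < 0 -> x w j = -1.
  by move=> wW xj; have [a [aj mE']] := wall j mE; have [] := negW w j a wW xj aj mE'.
pose J w := [set j | x w j < 0]%SET.
have hJ w : w \in W -> 1 - iota%:Z = - #|J w|%:Z + \sum_(j | j \notin J w) x w j.
  move=> wW; have [_ _ <-] := WP w wW; rewrite /height (bigID (mem (J w))) /=.
  congr (_ + _); rewrite (eq_bigr (fun=> -1)); last first.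
    by move=> j; rewrite finset.inE => /(x1 _ _ wW).
  by rewrite sumr_const mulNrn natz.
have pos w j : j \notin J w -> 0 <= x w j by rewrite finset.inE -leNgt.
have sum_pos w : 0 <= \sum_(j | j \notin J w) x w j.
  by apply: sumr_ge0 => j; exact: pos.
have Jge w : w \in W -> 0 <= #|J w|%:Z - b%:Z.
  move=> wW; have := hJ w wW; have := sum_pos w; rewrite iotaE.
  by move: (\sum_(j | _) _) => z; lia.
have uniqW : uniq W by exact: filter_uniq.
have sumJ : (\sum_(w <- W) #|J w| = d)%N.
  under eq_bigr do rewrite -sum1_card big_mkcond /=.
  rewrite exchange_big /= -[RHS]card_ord -sum1_card.
  apply: eq_bigr => j _; have [w wW xj] := exW j.
  rewrite (bigD1_seq w) //= finset.inE xj big1_seq // => w' /andP[nw wW'].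
  rewrite finset.inE; case: ifP => // xj'.
  by move: nw; rewrite (unW w' w j) ?eqxx.
have Jb w : w \in W -> #|J w| = b.
  move=> wW; have : \sum_(w <- W | w \in W) (#|J w|%:Z - b%:Z) = 0.
    rewrite sumrB -!big_seq big_const_seq count_predT iter_addr_0 sW.
    rewrite -(big_morph Posz PoszD (erefl _)) sumJ -rho_b PoszM -mulr_natr natz mulrC.
    by rewrite subrr.
  move/eqP; rewrite psumr_eq0 // => /allP/(_ w wW).
  by rewrite wW /= subr_eq0 => /eqP[].
have x0 w j : w \in W -> j \notin J w -> x w j = 0.
  move=> wW jJ; have := hJ w wW; rewrite Jb // iotaE => H.
  have : \sum_(j | j \notin J w) x w j = 0.
    by move: H; move: (\sum_(j | _) _) => z; lia.
  move/eqP; rewrite psumr_eq0; last by move=> i; exact: pos.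
  by move/allP/(_ j (mem_index_enum _)); rewrite jJ /= => /eqP.
have EW w : w \in W -> w = - \sum_(j in J w) row j E.
  move=> wW; rewrite [LHS](basis_expand uE) (bigID (mem (J w))) /=.
  rewrite [X in _ + X]big1 ?addr0 => [|j /(x0 _ _ wW)]; last first.
    by rewrite /x => ->; rewrite scale0r.
  rewrite -sumrN; apply: eq_bigr => j; rewrite finset.inE => /(x1 _ _ wW).
  by rewrite /x => ->; rewrite scaleN1r.
pose wk (k : 'I_rho) := nth 0 W k.
have wkW k : wk k \in W by rewrite mem_nth // sW.
have wk_inj : injective wk.
  by move=> k k' /eqP; rewrite nth_uniq ?sW // => /eqP/val_inj.
have cJ k : b = #|J (wk k)| by rewrite Jb.
pose jj k l : 'I_d := enum_val (cast_ord (cJ k) l).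
have jjJ k l : jj k l \in J (wk k) by exact: enum_valP.
have jj_inj k l k' l' : jj k l = jj k' l' -> k = k' /\ l = l'.
  move=> Ej; have kk : k = k'.
    apply: wk_inj; apply: (unW _ _ (jj k l)) => //.
      by have := jjJ k l; rewrite finset.inE.
    by have := jjJ k' l'; rewrite -Ej finset.inE.
  split=> //; move: Ej; rewrite /jj -kk => /enum_val_inj/cast_ord_inj //.
have jj_surj j : exists k l, j = jj k l.
  have [w wW xj] := exW j.
  have kP : (index w W < rho)%N by rewrite -sW index_mem.
  have Ewk : wk (Ordinal kP) = w by rewrite /wk nth_index.
  have jJ : j \in J (wk (Ordinal kP)) by rewrite Ewk finset.inE.
  exists (Ordinal kP), (cast_ord (esym (cJ _)) (enum_rank_in jJ j)).
  by rewrite /jj cast_ordKV enum_rankK_in.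
have sumjj k (G : 'I_d -> 'rV[int]_d) :
    \sum_(j in J (wk k)) G j = \sum_(l < b) G (jj k l).
  rewrite big_enum_val /= (reindex (cast_ord (cJ k))) //=.
  by exists (cast_ord (esym (cJ k))) => l _; rewrite ?cast_ordK ?cast_ordKV.
pose vv (a : 'I_rho * 'I_b.+1) :=
  if unlift ord0 a.2 is Some l then row (jj a.1 l) E else wk a.1.
have vv0 k : vv (k, ord0) = wk k by rewrite /vv unlift_none.
have vvS k l : vv (k, lift ord0 l) = row (jj k l) E by rewrite /vv liftK.
have wkE k : wk k = - \sum_l row (jj k l) E by rewrite [LHS]EW // sumjj.
exists vv; split.
- move=> k; rewrite big_ord_recl vv0; under eq_bigr do rewrite vvS.
  by rewrite wkE addNr.
- move=> h h0; exists (\sum_k \sum_l h (k, lift ord0 l) *: dualb E (jj k l)).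
  have mS k l : ip (\sum_k \sum_l h (k, lift ord0 l) *: dualb E (jj k l))
      (row (jj k l) E) = h (k, lift ord0 l).
    rewrite ip_suml (bigD1 k) //= [X in _ + X]big1 ?addr0 => [|k' kk']; last first.
      rewrite ip_suml big1 // => l' _; rewrite ipZl ip_dualb_row //.
      by case: eqVneq => [/jj_inj[E1 _]|_]; [rewrite E1 eqxx in kk' | rewrite mulr0].
    rewrite ip_suml (bigD1 l) //= [X in _ + X]big1 ?addr0 => [|l' ll']; last first.
      rewrite ipZl ip_dualb_row //.
      by case: eqVneq => [/jj_inj[_ E1]|_]; [rewrite E1 eqxx in ll' | rewrite mulr0].
    by rewrite ipZl ip_dualb_row // eqxx mulr1.
  move=> [k i]; have [l ->|->] := unliftP ord0 i; first by rewrite vvS mS.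
  rewrite vv0 wkE ipNr ip_sumr; under eq_bigr do rewrite mS.
  by have /eqP := h0 k; rewrite big_ord_recl addr_eq0 => /eqP.
- move=> m Hm; rewrite (dual_expand uE m) big1 // => j _.
  have [k [l ->]] := jj_surj j.
  by rewrite -vvS Hm scale0r.
- move=> v; split=> [vV|[[k i] ->]]; last first.
    have [l ->|->] := unliftP ord0 i; first by rewrite vvS row_ray.
    by rewrite vv0; have [] := WP _ (wkW k).
  have [vr|nv] := boolP (v \in rows E).
    move: vr; rewrite mem_rows => /existsP[j /eqP ->].
    by have [k [l ->]] := jj_surj j; exists (k, lift ord0 l).
  have vW : v \in W by rewrite mem_filter nv.
  have kP : (index v W < rho)%N by rewrite -sW index_mem.
  by exists (Ordinal kP, ord0); rewrite vv0 /wk nth_index.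
Qed.

Section Blocks.
Variable vv : 'I_rho * 'I_b.+1 -> 'rV[int]_d.
Hypothesis vv_sum : forall k, \sum_i vv (k, i) = 0.
Hypothesis vv_char : forall h : 'I_rho * 'I_b.+1 -> int,
  (forall k, \sum_i h (k, i) = 0) -> exists m, forall a, ip m (vv a) = h a.
Hypothesis vv_zero : forall m, (forall a, ip m (vv a) = 0) -> m = 0.
Hypothesis vvP : forall v, v \in V <-> exists a, v = vv a.

(** A strongly convex cone cannot contain a whole block, since the block adds up to zero. So every
    block misses a generator, and having [d = rho * b] rows allows only one omission per block. *)
Lemma max_cone_block E : max_cone E ->
  exists (s : 'I_rho -> 'I_b.+1) (al : 'I_d -> 'I_rho * 'I_b.+1),
    [/\ injective al, forall i, row i E = vv (al i) &
        forall a, (a.2 != s a.1) <-> exists i, a = al i].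
Proof.
move=> mE; have [uE SE] := mE.
have Hal i : exists a, row i E = vv a by apply/vvP/row_ray.
pose al i := sval (cid (Hal i)).
have alP i : row i E = vv (al i) by rewrite /al; case: cid.
have al_inj : injective al.
  by move=> i j Eij; apply: (basis_inj uE); rewrite !alP Eij.
have Hs k : exists i, forall j, (k, i) != al j.
  apply: contrapT => H.
  have Hk i : exists j, (k, i) = al j.
    apply: contra_notP H => Hi; exists i => j; apply/eqP => E1; apply: Hi.
    by exists j.
  have Sv i : bcone E (lat (vv (k, i))).
    by have [j ->] := Hk i; rewrite -alP; exact: bcone_row.
  have Z : lat (vv (k, ord0)) = 0.
    apply: (fan_convex fanS SE) => //.
    rewrite -latN; have := vv_sum k; rewrite big_ord_recl => /eqP.
    rewrite addrC addr_eq0 => /eqP <-; rewrite lat_sum.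
    by apply: gcone_sum.
  have [j Ej] := Hk ord0; move: Z; rewrite Ej -alP -lat0 => /lat_inj Z.
  have := ip_dualb_row uE j j; rewrite Z ip0r eqxx => /eqP.
  by rewrite eq_sym oner_eq0.
pose s k := sval (cid (Hs k)).
have sP k j : (k, s k) != al j by rewrite /s; case: cid.
exists s, al; split=> // a; split=> [as_|[i ->]]; last first.
  by apply/eqP => E1; have := sP (al i).1 i; rewrite -E1 -surjective_pairing eqxx.
have sub : [set al i | i in 'I_d]%SET \subset [set a | a.2 != s a.1]%SET.
  apply/fintype.subsetP => _ /imsetP[i _ ->]; rewrite finset.inE; apply/eqP => E1.
  by have := sP (al i).1 i; rewrite -E1 -surjective_pairing eqxx.
have /eqP EE : [set al i | i in 'I_d]%SET == [set a | a.2 != s a.1]%SET.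
  rewrite eqEcard sub /= card_imset // card_ord.
  have -> : [set a | a.2 != s a.1]%SET = ~: [set (k, s k) | k in 'I_rho]%SET.
    apply/setP => -[k i]; rewrite !finset.inE /=; congr (~~ _).
    apply/eqP/imsetP => [->|[k' _ [-> ->]] //]; by exists k.
  rewrite cardsCs finset.setCK card_imset ?card_prod ?card_ord; last by move=> k k' [].
  by rewrite -rho_b; lia.
have : a \in [set a | a.2 != s a.1]%SET by rewrite finset.inE.
by rewrite -EE => /imsetP[i _ ->]; exists i.
Qed.

Lemma block_cone E (s : 'I_rho -> 'I_b.+1) (al : 'I_d -> 'I_rho * 'I_b.+1) :
  injective al -> (forall i, row i E = vv (al i)) ->
  (forall a, (a.2 != s a.1) <-> exists i, a = al i) ->
  bcone E = @gcone R d _ vv (fun a => a.2 != s a.1).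
Proof.
move=> al_inj alP sal; apply/seteqP; split=> x [c [c0 ->]]; apply: gcone_sum.
  move=> i _; apply: gcone_scale => //; rewrite alP; apply: gcone_gen.
  by apply/sal; exists i.
move=> a /sal[i ->]; apply: gcone_scale => //; rewrite -alP; exact: bcone_row.
Qed.

(** Some maximal cone contains the sum [w] of the selected generators; let [s'] be its omissions. If
    [s k] and [s' k] differ, the form that is [1] at [(k, s' k)], [-1] at [(k, s k)] and [0] on the
    other generators is positive on [w] but nonpositive on that cone. *)
Lemma block_fan (s : 'I_rho -> 'I_b.+1) :
  Sg (@gcone R d _ vv (fun a => a.2 != s a.1)).
Proof.
pose w := \sum_(a | a.2 != s a.1) vv a.
have [E [mE Hw _]] := height_max w; have [uE SE] := mE.
have [s' [al [al_inj alP sal]]] := max_cone_block mE.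
have EC := block_cone al_inj alP sal.
have : bcone E (lat w) by apply/bconeP.
rewrite EC => Cw.
suff -> : s = s' by rewrite -EC.
apply/funext => k; apply/eqP; apply: contrapT => /negP sk.
have [m Hm] : exists m, forall a, ip m (vv a) =
    if a.1 == k then (a.2 == s' k)%:R - (a.2 == s k)%:R else 0.
  apply: vv_char => k'; have [->|_] := eqVneq k' k; last by rewrite big1.
  rewrite big_split /= sumrN (bigD1 (s' k)) //= eqxx big1 ?addr0; last first.
    by move=> i /negPf ->.
  rewrite (bigD1 (s k)) //= eqxx big1 ?addr0 ?subrr // => i /negPf -> //.
have mw : 0 < ip m w.
  rewrite ip_sumr (bigD1 (k, s' k)) /=; last by rewrite eq_sym.
  rewrite Hm /= !eqxx eq_sym (negPf sk) subr0; apply: ltr_wpDr => //.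
  apply: sumr_ge0 => -[k' i] /andP[/= ai _]; rewrite Hm /=.
  case: eqVneq => // kk; rewrite kk in ai.
  by rewrite (negPf ai) subr0 ler0n.
have : (0 : R) <= (ip (- m) w)%:~R.
  rewrite -(pairing_lat R); move: Cw; move: (lat w) => x [c [c0 ->]].
  rewrite pairing_sumr; apply: sumr_ge0 => -[k' i] /= ai.
  apply: mulr_ge0 => //; rewrite pairing_lat ler0z ipNl Hm /= oppr_ge0.
  case: eqVneq => // kk; rewrite kk in ai.
  by rewrite (negPf ai) sub0r oppr_le0 ler0n.
by rewrite ler0z ipNl oppr_ge0 leNgt mw.
Qed.

End Blocks.
End Equality.
End Casagrande.

(** * The projective line *)

Section ProjLine.
Variable K : closedFieldType.
Local Notation P1 := (proj_space K 1).
Local Notation alg i := (algebra_gen (@acrd K (proj_atlas K 1) i)).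
Implicit Types (L : P1) (i j : 'I_2).

Definition other_ix i : 'I_2 := rev_ord i.

Lemma ix2P i j : j = i \/ j = other_ix i.
Proof.
case: i j => [[|[|//]] ?] [[|[|//]] ?]; by [left; apply: val_inj|right; apply: val_inj].
Qed.

Lemma other_ix_neq i : (other_ix i == i) = false.
Proof. by case: i => [[|[|//]] ?]; rewrite -val_eqE. Qed.

Lemma line_pt_neq0 i (t : K) :
  \row_j (if j == i then 1 else t) != 0 :> 'rV[K]_2.
Proof.
apply/eqP => /rowP/(_ i); rewrite !mxE eqxx => /eqP; by rewrite oner_eq0.
Qed.

Definition line_pt i (t : K) : P1 := proj_mk (line_pt_neq0 i t).

Lemma line_pt_chart i t : hcoord (line_pt i t) i != 0.
Proof. by rewrite hcoord_mk_eq0 mxE eqxx oner_eq0. Qed.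

Lemma line_pt_ratio i t j :
  hcoord (line_pt i t) j / hcoord (line_pt i t) i = if j == i then 1 else t.
Proof. by rewrite hcoord_mk_ratio !mxE eqxx divr1. Qed.

Lemma line_pt_surj i L : hcoord L i != 0 ->
  L = line_pt i (hcoord L (other_ix i) / hcoord L i).
Proof.
move=> Li; apply: (proj_eq_ratio Li (line_pt_chart i _)) => j.
rewrite line_pt_ratio; have [->|->] := ix2P i j; first by rewrite eqxx divff.
by rewrite other_ix_neq.
Qed.

Lemma line_pt_alg i b : alg i b -> exists P : {poly K}, forall t,
  b (line_pt i t) = P.[t].
Proof.
elim=> [_ [j ->]|c|f g _ [P HP] _ [Q HQ]|f g _ [P HP] _ [Q HQ]].
- exists (if j == i then 1 else 'X) => t; rewrite line_pt_ratio.
  by case: ifP; rewrite ?hornerC ?hornerX.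
- by exists c%:P => t; rewrite hornerC.
- by exists (P + Q) => t; rewrite hornerD HP HQ.
- by exists (P * Q) => t; rewrite hornerM HP HQ.
Qed.

Lemma line_open_cofin i (U : set P1) L : opn U -> U L -> hcoord L i != 0 ->
  cofin (fun t => U (line_pt i t)).
Proof.
move=> oU UL Li.
have [b [ib bp H]] := good_open (good_proj (i := i) Li) oU UL.
have [P HP] := line_pt_alg ib.
have P0 : P != 0.
  by apply: contra_neq bp => P0; rewrite (line_pt_surj Li) HP P0 horner0.
apply: cofin_sub (cofin_root P0) => t Pt; apply: H; first exact: line_pt_chart.
by rewrite HP.
Qed.

Lemma line_open (U : set P1) : opn U -> U !=set0 ->
  cofin (fun t => U (line_pt ord0 t)).
Proof.
move=> oU [L UL]; have [L0|L0] := eqVneq (hcoord L ord0) 0; last first.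
  exact: line_open_cofin L0.
have [i Li] := hcoord_neq0 L.
have io : other_ix i = ord0.
  have [E|//] := ix2P i ord0; by move: Li; rewrite -E L0 eqxx.
have [t [Ut t0]] := cofin_ex (cofinI (line_open_cofin oU UL Li) (cofin_neq 0)).
apply: (line_open_cofin oU Ut).
by rewrite hcoord_mk_eq0 mxE -io other_ix_neq.
Qed.

Lemma line_irreducible : irreducible_set (setT : set P1).
Proof.
split; first by exists (line_pt ord0 0).
move=> A B cA cB AB.
have [|nA] := pselect (setT `<=` A); first by left.
have [|nB] := pselect (setT `<=` B); first by right.
have exC (C : set P1) : ~ setT `<=` C -> ~` C !=set0.
  by move=> /existsNP[x /not_implyP[_ nx]]; exists x.
have [t [nAt nBt]] :=
  cofin_ex (cofinI (line_open cA (exC _ nA)) (line_open cB (exC _ nB))).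
by have [] := AB (line_pt ord0 t) I.
Qed.

Lemma line_closed_pt L : closed_in (X := P1) [set L].
Proof.
have okP := ok_proj K 1.
apply: (okU okP) => M ML; have [i Mi] := hcoord_neq0 M.
have [Li|Li] := eqVneq (hcoord L i) 0.
  exists [set Q : P1 | hcoord Q i != 0]; split=> //.
    exact: (@open_chart _ (proj_atlas K 1) i).
  by move=> Q /= Qi QL; move: Qi; rewrite QL Li eqxx.
pose b (Q : P1) := hcoord Q (other_ix i) / hcoord Q i +
  - (hcoord L (other_ix i) / hcoord L i).
have ib : alg i b.
  by apply: AlgAdd; [apply: AlgIn; exists (other_ix i) | exact: AlgCst].
exists [set Q : P1 | hcoord Q i != 0 /\ b Q != 0]; split.
- exact: (@open_basic _ (proj_atlas K 1) i).
- split=> //; rewrite subr_eq0; apply/eqP => E; apply: ML.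
  by rewrite /= (line_pt_surj Mi) E -(line_pt_surj Li).
- by move=> Q /= [_ bQ] QL; move: bQ; rewrite /b QL subrr eqxx.
Qed.

Lemma line_finite_closed (s : seq P1) : closed_in (X := P1) [set L | List.In L s].
Proof.
have okP := ok_proj K 1.
elim: s => [|L s IH].
  rewrite /closed_in (_ : ~` _ = setT); first exact: (okT okP).
  by apply/seteqP; split=> // x _ [].
rewrite /closed_in (_ : ~` _ = ~` [set L] `&` ~` [set M | List.In M s]).
  by apply: (okI okP) => //; exact: line_closed_pt.
apply/seteqP; split=> M /=; first by move=> H; split=> H'; apply: H; [left|right].
by move=> [H1 H2] [/esym //|//].
Qed.

Lemma line_proper_closed (Z : set P1) : closed_in Z -> Z <> setT ->
  exists s : seq P1, Z `<=` [set L | List.In L s].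
Proof.
move=> cZ ZT; have exC : ~` Z !=set0.
  apply: contra_notP ZT => H; apply/seteqP; split=> // x _.
  by apply: contrapT => nx; apply: H; exists x.
have [P P0 HP] := line_open cZ exC.
have [r Pr] := closed_field_poly_normal P.
exists (line_pt (other_ix ord0) 0 :: map (line_pt ord0) r) => L ZL /=.
have [L0|L0] := eqVneq (hcoord L ord0) 0.
  left; have [i Li] := hcoord_neq0 L.
  have E : i = other_ix ord0.
    by have [E|//] := ix2P ord0 i; move: Li; rewrite E L0 eqxx.
  have oo : other_ix (other_ix ord0) = ord0 by exact: val_inj.
  by rewrite E in Li; rewrite [RHS](line_pt_surj Li) oo L0 mul0r.
right; rewrite (line_pt_surj L0).
set t := _ / _; have : P.[t] = 0.
  apply/eqP; apply: contraPT ZL => Pt; rewrite (line_pt_surj L0); exact: HP.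
rewrite Pr hornerZ horner_prod => /eqP; rewrite mulf_eq0 lead_coef_eq0 (negPf P0) /=.
elim: r {Pr} => [|x r IH]; first by rewrite big_nil oner_eq0.
rewrite big_cons mulf_eq0 hornerXsubC subr_eq0 => /orP[/eqP ->|/IH]; by [left|right].
Qed.

Lemma line_finite_irreducible (s : seq P1) (Z : set P1) :
  irreducible_set Z -> Z `<=` [set L | List.In L s] -> exists L, Z `<=` [set L].
Proof.
move=> [[L ZL] irr]; elim: s => [/(_ L ZL) //|M s IH] Zs.
have HZ : Z `<=` [set M] `|` [set Q | List.In Q s].
  by move=> Q /Zs /= [->|]; [left | right].
have [ZM|/IH //] := irr _ _ (@line_closed_pt M) (@line_finite_closed s) HZ.
by exists M.
Qed.

(** Proper closed subsets of the line are finite, so the irreducible ones are points and a chain has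
    at most two terms. *)
Lemma line_dim : has_dim P1 1.
Proof.
split.
  exists (fun k : nat => if k == 0%N then [set line_pt ord0 0] else setT : set P1); split.
    move=> [_|i _]; split.
    - exact: line_closed_pt.
    - split; first by exists (line_pt ord0 0).
      by move=> A B _ _ H; have [] := H _ (erefl (line_pt ord0 0)) => HH;
        [left | right] => x ->.
    - rewrite /closed_in setCT => p [].
    - exact: line_irreducible.
  move=> [|//] _; split=> // /(_ (line_pt ord0 1) I) /= E.
  have := line_pt_ratio ord0 1 (other_ix ord0).
  rewrite E line_pt_ratio other_ix_neq => /eqP.
  by rewrite eq_sym oner_eq0.
move=> Z [H1 H2].
have [cZ1 iZ1] := H1 1%N isT; have [_ [[x Zx] _]] := H1 0%N isT.
have [|s Zs] := line_proper_closed cZ1.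
  by move=> E; have [_ ] := H2 1%N isT; rewrite E; apply.
have [L ZL] := line_finite_irreducible iZ1 Zs.
have [Z01 nZ] := H2 0%N isT; apply: nZ => y Zy.
by rewrite (ZL _ Zy) -(ZL _ (Z01 _ Zx)).
Qed.

Definition line_coord i (L : P1) : K := hcoord L (other_ix i) / hcoord L i.

Lemma line_coordinates i L : hcoord L i != 0 ->
  coordinates_at L (fun _ : 'I_1 => line_coord i).
Proof.
move=> Li; have okP := ok_proj K 1; have gL := good_proj (i := i) Li.
have ay : alg i (line_coord i) by apply: AlgIn; exists (other_ix i).
have ry : regular_at L (line_coord i).
  by apply: (regular_local_frac (A := proj_atlas K 1) Li); exact: local_frac_alg.
pose c t := line_pt i (line_coord i L + t).
have c0 : c 0 = L by rewrite /c addr0 -line_pt_surj.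
pose E_ (f : P1 -> K) a0 a1 := jet (f \o c) a0 a1.
have jalg f : alg i f -> exists a1, E_ f (f L) a1.
  move=> /line_pt_alg[P HP].
  have [P1' HP1] : exists Q : {poly K}, forall t, f (c t) = Q.[t].
    exists (P \Po ('X + (line_coord i L)%:P)) => t.
    by rewrite HP horner_comp hornerD hornerX hornerC addrC.
  exists P1'^`().[0]; rewrite -{1}c0 HP1.
  by apply: (eq_jet _ (jet_poly P1')) => t; rewrite /= HP1.
have Eu b f g a0 a1 b0 b1 : alg i b -> b L != 0 ->
    (forall q, adom (a := proj_atlas K 1) i q -> b q != 0 -> f q = g q) ->
    E_ f a0 a1 -> E_ g b0 b1 -> a1 = b1.
  move=> ib bp fg Jf Jg; have Jb := jalg _ ib.
  have [] // := @jet_uniq _ (g \o c) a0 a1 b0 b1.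
  apply: jet_ext Jf; apply: cofin_sub (jet0_neq0 Jb bp) => t bt.
  by apply: fg => //; exact: line_pt_chart.
have Ec k : E_ (fun=> k) k 0 by exact: jet_cst.
have Ea f g a0 a1 b0 b1 : E_ f a0 a1 -> E_ g b0 b1 ->
  E_ (fun q => f q + g q) (a0 + b0) (a1 + b1) by exact: jet_add.
have Em f g a0 a1 b0 b1 : E_ f a0 a1 -> E_ g b0 b1 ->
  E_ (fun q => f q * g q) (a0 * b0) (a0 * b1 + b0 * a1) by exact: jet_mul.
have Eg h : @acrd K (proj_atlas K 1) i h -> exists a1, E_ h (h L) a1.
  by move=> Hh; apply: jalg; exact: AlgIn.
apply: (coordinates_intro okP (D := fun _ =>
  @dual_derivation K (proj_atlas K 1) i L E_)) => //.
- by move=> _; exact: dual_derivation_at.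
- move=> k l; rewrite !ord1 eqxx; apply: dual_derivationP => //.
  apply: (@jet_ext _ (fun t => line_coord i L + t)).
    apply: cofinT => t; rewrite /= /line_coord line_pt_ratio other_ix_neq //.
  have := jet_add (jet_cst (line_coord i L)) (jet_id K).
  by rewrite addr0 add0r.
have dfa f : alg i f -> exists k, differential_at L (fun _ : 'I_1 => line_coord i) f k.
  elim=> [_ [j ->]|k|f1 f2 a1 [k1 d1] a2 [k2 d2]|f1 f2 a1 [k1 d1] a2 [k2 d2]].
  - have [->|->] := ix2P i j; last by exists (delta_mx 0 0); exact: (diff_self okP _ _ 0).
    exists 0; have := diff_cst okP L (fun _ : 'I_1 => line_coord i) 1.
    apply: (diff_ext okP (U := [set Q : P1 | hcoord Q i != 0])) => //.
      exact: (@open_chart _ (proj_atlas K 1) i).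
    by move=> Q Qi; rewrite divff.
  - by exists 0; exact: diff_cst.
  - by exists (k1 + k2); exact: diff_add.
  - eexists; apply: (diff_mul okP _ _ d1 d2);
      by apply: (regular_local_frac (A := proj_atlas K 1) Li); exact: local_frac_alg.
move=> f /(good_regular (A := proj_atlas K 1) f gL)[a [b [ia ib bp H]]].
have [k1 d1] := dfa _ ia; have [k2 d2] := dfa _ ib.
have ra h : alg i h -> regular_at L h.
  by move=> ih; apply: (regular_local_frac (A := proj_atlas K 1) Li); exact: local_frac_alg.
have D := diff_mul okP (ra _ ia) (ok_inv okP (ra _ ib) bp) d1
  (diff_inv okP (ra _ ib) bp d2).
eexists; apply: (diff_ext okP _ _ _ D).
- exact: (@open_basic _ (proj_atlas K 1) i _ ib).
- by split.
- by move=> q [iq bq]; rewrite H.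
Qed.

Lemma line_manifold : manifold P1 1.
Proof.
have okP := ok_proj K 1; split.
- exists 1%N, id; split=> //.
    have -> : range (id : P1 -> P1) = setT by apply/seteqP; split=> // x _; exists x.
    by rewrite /closed_in setCT => p [].
  exists (sval : induced_space (range (id : P1 -> P1) `&` setT) -> P1) => //.
  exact: regular_map_sval.
- split; first by exists (line_pt ord0 0).
  move=> U V oU oV UV UV0.
  have [U0|/set0P U0] := eqVneq U set0; first by left.
  have [V0|/set0P V0] := eqVneq V set0; first by right.
  have [t [Ut Vt]] := cofin_ex (cofinI (line_open oU U0) (line_open oV V0)).
  by have : (U `&` V) (line_pt ord0 t) by []; rewrite UV0.
- exact: line_dim.
- move=> L; have [i Li] := hcoord_neq0 L.
  by exists (fun=> line_coord i); exact: line_coordinates.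
Qed.

End ProjLine.

Lemma big_option (K : comPzSemiRingType) (I : finType) (F : option I -> K) :
  \prod_o F o = F None * \prod_i F (Some i).
Proof.
rewrite (bigD1 None) //=; congr (_ * _).
rewrite (reindex_omap (fun i => Some i) id) => [|[i|] //].
by apply: eq_bigl => i; rewrite eqxx.
Qed.

(** * Curves attached to the walls *)

Section WallCurve.
Variables (R : realType) (K : closedFieldType) (d : nat).
Variable Sg : set (set 'rV[R]_d).
Hypothesis fanS : is_fan Sg.
Variables (T : Type) (phi : T -> toric_point K Sg) (psi : toric_point K Sg -> T).
Hypotheses (phiK : cancel phi psi) (psiK : cancel psi phi).
Local Notation lat := (@lattice_vec R d).
Local Notation X := (glued_space (tatlas phi)).
Local Notation ch := (ch phi).
Local Notation cn := (cn phi).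
Local Notation bcone E := (@gcone R d _ (fun i => row i E) predT).
Local Notation P1 := (proj_space K 1).

Definition chart_coord (E : 'M[int]_d) i (p : T) : K := ch p (dualb E i).

Lemma bcone_chart E p : max_cone Sg E -> cn p `<=` bcone E ->
  exists P : pred 'I_d, cn p = @gcone R d _ (fun i => row i E) P.
Proof.
move=> [uE SE] pE; have [_ _ _ H] := fanS.
have [_] := H _ _ (cn_fan phi p) SE.
by rewrite (setIidl pE) => /face_basis[P _ EP]; exists P.
Qed.

Lemma chart_coordinates E p : max_cone Sg E -> cn p `<=` bcone E ->
  coordinates_at (X := X) p (chart_coord E).
Proof.
move=> mE pE; have [P EP] := bcone_chart mE pE; have [uE _] := mE.
exact: (coord_basis fanS psiK uE EP).
Qed.

Lemma open_bcone E : max_cone Sg E -> opn ([set q | cn q `<=` bcone E] : set X).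
Proof. by move=> [_ SE]; exact: (@open_chart _ (tatlas phi) (exist _ _ SE)). Qed.

(** [jacobian_at] selects coefficients point by point; uniqueness in the coordinates of [E]
    identifies them with the regular ones of [local_differential]. *)
Lemma regular_jacobian E (y : coordinate_chart X d) p : max_cone Sg E ->
  cn p `<=` bcone E -> cdom y p ->
  regular_at (X := X) p
    (fun q => \det (jacobian_at (@ccoord _ _ _ y) (chart_coord E) q)).
Proof.
move=> mE pE yp; have okX := ok_tor phi; have [uE _] := mE.
have [P EP] := bcone_chart mE pE.
have ry q : cdom y q -> forall i, regular_at q (@ccoord _ _ _ y i).
  by move=> yq i; have [] := ccoordP yq.
have H i := local_differential fanS uE EP (ry p yp i).
pose U i := sval (cid (H i)).
have HU i : exists c : 'I_d -> T -> K,
    [/\ opn (U i : set X), U i p,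
        forall q, U i q -> forall k, regular_at (X := X) q (c k),
        forall q, U i q -> regular_at (X := X) q (@ccoord _ _ _ y i) &
        forall q, U i q -> differential_at (X := X) q (chart_coord E)
          (@ccoord _ _ _ y i) (\row_k c k q)].
  by rewrite /U; case: cid.
pose c i := sval (cid (HU i)).
have cP i : [/\ opn (U i : set X), U i p,
        forall q, U i q -> forall k, regular_at (X := X) q (c i k),
        forall q, U i q -> regular_at (X := X) q (@ccoord _ _ _ y i) &
        forall q, U i q -> differential_at (X := X) q (chart_coord E)
          (@ccoord _ _ _ y i) (\row_k c i k q)].
  by rewrite /c; case: cid.
have [W [oW Wp HW]] : exists W : set X, [/\ opn W, W p &
    forall q, W q -> forall i, U i q].
  by apply: open_near_finite => // i; have [oU Up _ _ _] := cP i; exists (U i).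
have R1 : regular_at (X := X) p (fun q => \det (\matrix_(i, k) c i k q)).
  apply: (regular_sum okX) => s _; apply: (ok_mul okX); first exact: ok_cst.
  apply: (eq_regular (X := X) (f := fun q => \prod_i c i (s i) q)).
    by move=> q; apply: eq_bigr => i _; rewrite mxE.
  apply: (regular_prod okX) => i _; have [_ Up H' _ _] := cP i; exact: H'.
have oW' := okI okX (okI okX oW (open_bcone mE)) (cdom_open y).
apply: (ok_ext okX R1 oW') => // q [[Wq qE] yq]; congr determinant.
apply/esym; apply: jacobian_eq; first exact: chart_coordinates.
  exact: ry.
move=> i; have [_ _ _ _ /(_ q (HW q Wq i))] := cP i.
by congr differential_at; apply/rowP => k; rewrite !mxE.
Qed.

Variables (E : 'M[int]_d) (j : 'I_d) (a : 'rV[int]_d).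
Hypotheses (mE : max_cone Sg E) (aj : a 0 j = -1).
Local Notation E' := (set_row E j (a *m E)).
Hypothesis mE' : max_cone Sg E'.
Let uE : E \in unitmx. Proof. by have [] := mE. Qed.
Let uE' : E' \in unitmx. Proof. by have [] := mE'. Qed.

Definition wall_ray (o : option 'I_d) : 'rV[int]_d :=
  if o is Some i then row i E else a *m E.

(** Cox coordinates of the curve: zero on the rays of the wall, and the homogeneous coordinates of
    the line on the two rays on either side of it. *)
Definition wall_coord (L : P1) (o : option 'I_d) : K :=
  if o is Some i then (if i == j then hcoord L ord0 else 0) else hcoord L ord_max.

Lemma hcoord2_neq0 (L : P1) : hcoord L ord0 = 0 -> hcoord L ord_max != 0.
Proof.
move=> L0; have [i Li] := hcoord_neq0 L.
have [Ei|Ei] : i = ord0 \/ i = ord_max.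
  by case: i {Li} => [[|[|//]] ?]; [left|right]; exact: val_inj.
- by move: Li; rewrite Ei L0 eqxx.
- by rewrite -Ei.
Qed.

Lemma ip_new_ray m : ip m (a *m E) = \sum_i a 0 i * ip m (row i E).
Proof. by rewrite mulmx_sum_row ip_sumr; apply: eq_bigr => i _; rewrite ipZr. Qed.

Lemma wall_cone_affine (L : P1) : hcoord L ord_max != 0 ->
  cox_cone wall_ray (wall_coord L) =
  @gcone R d _ (fun i => row i E) (fun i => (i != j) || (hcoord L ord0 == 0)).
Proof.
move=> L1; apply/seteqP; split=> x [c [c0 ->]]; apply: gcone_sum.
  case=> [i|] /=; last by rewrite (negPf L1).
  move=> H; apply: gcone_scale => //; apply: (@gcone_gen R d _ (fun i => row i E)).
  by move: H; case: (eqVneq i j) => //= _ ->.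
move=> i H; apply: gcone_scale => //.
apply: (@gcone_gen R d _ wall_ray _ (Some i)) => /=.
by move: H; case: (eqVneq i j) => //= _ _; rewrite eqxx.
Qed.

Lemma wall_cone_infinity (L : P1) : hcoord L ord0 != 0 ->
  cox_cone wall_ray (wall_coord L) =
  @gcone R d _ (fun i => row i E') (fun i => (i != j) || (hcoord L ord_max == 0)).
Proof.
move=> L0; apply/seteqP; split=> x [c [c0 ->]]; apply: gcone_sum.
  case=> [i|] /=.
    case: ifP => [_|ij _]; first by rewrite (negPf L0).
    apply: gcone_scale => //.
    have <- : row i E' = row i E by rewrite row_set_row ij.
    by apply: (@gcone_gen R d _ (fun i => row i E') _ i); rewrite ij.
  move=> L1; apply: gcone_scale => //.
  have Ej : row j E' = a *m E by rewrite row_set_row eqxx.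
  rewrite -[X in lat X]Ej.
  by apply: (@gcone_gen R d _ (fun i => row i E') _ j); rewrite L1 orbT.
move=> i; rewrite row_set_row; have [_ /= L1|ij _] := eqVneq i j.
  by apply: gcone_scale => //; exact: (@gcone_gen R d _ wall_ray _ None).
apply: gcone_scale => //; apply: (@gcone_gen R d _ wall_ray _ (Some i)) => /=.
by rewrite (negPf ij) eqxx.
Qed.

Lemma wall_cone_fan (L : P1) : Sg (cox_cone wall_ray (wall_coord L)).
Proof.
have [_ _ H _] := fanS; have [_ SE] := mE; have [_ SE'] := mE'.
have [L0|L0] := eqVneq (hcoord L ord0) 0.
  rewrite wall_cone_affine; last exact: hcoord2_neq0.
  by apply: (H _ _ SE); exact: basis_face.
by rewrite wall_cone_infinity //; apply: (H _ _ SE'); exact: basis_face.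
Qed.

(* The closure of the torus orbit of the wall, parametrized by [P^1]. *)
Definition wall_curve (L : P1) : X := cox_pt psi (wall_cone_fan L).

Lemma ch_wall L m : ch (wall_curve L) m =
  hcoord L ord_max ^ ip m (a *m E) *
  \prod_i (if i == j then hcoord L ord0 else 0) ^ ip m (row i E).
Proof.
by rewrite /wall_curve ch_cox // /cox_val big_option.
Qed.

Lemma cn_wall L : cn (wall_curve L) = cox_cone wall_ray (wall_coord L).
Proof. by rewrite /wall_curve cn_cox. Qed.

Lemma cn_wall_affine L : hcoord L ord_max != 0 -> cn (wall_curve L) `<=` bcone E.
Proof. by move=> L1; rewrite cn_wall wall_cone_affine //; exact: sub_gcone. Qed.

Lemma cn_wall_infinity L : hcoord L ord0 != 0 -> cn (wall_curve L) `<=` bcone E'.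
Proof. by move=> L0; rewrite cn_wall wall_cone_infinity //; exact: sub_gcone. Qed.

Lemma wall_affine_chart L : cn (wall_curve L) `<=` bcone E -> hcoord L ord_max != 0.
Proof.
move=> H; apply/eqP => L1; have : bcone E (lat (a *m E)).
  apply: H; rewrite cn_wall; apply: (@gcone_gen R d _ wall_ray _ None).
  by rewrite /= L1.
by rewrite bconeP // => /(_ j); rewrite ip_dualb mulmxK // aj.
Qed.

Lemma coord_wall L i : hcoord L ord_max != 0 ->
  chart_coord E i (wall_curve L) =
  if i == j then hcoord L ord0 / hcoord L ord_max else 0.
Proof.
move=> L1; rewrite /chart_coord ch_wall ip_dualb mulmxK //.
rewrite (bigD1 i) //= ip_dualb_row // eqxx expr1z big1 ?mulr1; last first.
  by move=> k /negPf ki; rewrite ip_dualb_row // [i == k]eq_sym ki expr0z.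
have [->|_] := eqVneq i j; last by rewrite mulr0.
by rewrite aj mulrC exprN1.
Qed.

Lemma line_ixE : other_ix ord0 = ord_max :> 'I_2.
Proof. exact: val_inj. Qed.

Lemma regular_hratio i k (L : P1) : hcoord L i != 0 ->
  regular_at L (fun M => hcoord M k / hcoord M i).
Proof.
move=> Li; apply: (regular_local_frac (A := proj_atlas K 1) (i := i)) => //.
by apply: local_frac_alg; apply: AlgIn; exists k.
Qed.

Lemma wall_regular : regular_map wall_curve.
Proof.
apply: regular_map_cox => [|L0]; first exact: ok_proj.
have [i Li] := hcoord_neq0 L0.
exists (option 'I_d), wall_ray, (fun o L => wall_coord L o / hcoord L i).
exists [set L | hcoord L i != 0]; split=> //.
- exact: (@open_chart _ (proj_atlas K 1) i).
- case=> [k|] /=; last exact: regular_hratio.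
  case: (k == j); first exact: regular_hratio.
  apply: (eq_regular (X := P1) (f := fun=> 0)) => [M|]; first by rewrite mul0r.
  exact: (ok_cst (ok_proj K 1)).
- move=> L Hi; rewrite cn_wall /cox_cone; congr gcone; apply/funext => o.
  by rewrite mulf_eq0 invr_eq0 (negPf Hi) orbF.
- move=> L Hi m; rewrite /wall_curve ch_cox //.
  (* Rescaling the homogeneous coordinates is harmless: if [m] vanishes on the wall, [aj] makes its
     values on the two remaining rays opposite; otherwise both products are zero. *)
  have [H|H] := pselect (forall i, i != j -> ip m (row i E) = 0); last first.
    have [i0 [ij i0m]] : exists i, i != j /\ ip m (row i E) <> 0.
      apply: contra_notP H => H k kj; apply: contra_notP H => km; by exists k.
    transitivity (0 : K); first rewrite /cox_val (bigD1 (Some i0)) //= (negPf ij).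
      by move/eqP/negPf: i0m; rewrite exp0rz => ->; rewrite mul0r.
    rewrite /cox_val (bigD1 (Some i0)) //= (negPf ij) mul0r.
    by move/eqP/negPf: i0m; rewrite exp0rz => ->; rewrite mul0r.
  have mN : ip m (a *m E) = - ip m (row j E).
    rewrite ip_new_ray (bigD1 j) //= aj mulN1r big1 ?addr0 // => k /H ->.
    exact: mulr0.
  have Ec (h0 h1 : K) : cox_val wall_ray (fun o : option 'I_d =>
      if o is Some k then (if k == j then h0 else 0) else h1) m =
      h1 ^ (- ip m (row j E)) * h0 ^ ip m (row j E).
    rewrite /cox_val big_option /= mN (bigD1 j) //= eqxx big1 ?mulr1 //.
    by move=> k kj; rewrite (negPf kj) H // expr0z.
  have E1 : (fun o => wall_coord L o / hcoord L i) = (fun o : option 'I_d =>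
     if o is Some k then (if k == j then hcoord L ord0 / hcoord L i else 0)
     else hcoord L ord_max / hcoord L i).
    apply/funext => -[k|] //=; by case: ifP => // _; rewrite mul0r.
  rewrite E1 !Ec !expfzMl mulrACA.
  rewrite -[LHS]mulr1; congr (_ * _).
  by rewrite -expfzDr ?invr_eq0 // addNr expr0z.
Qed.

(** Over the chart of [E], the coordinate [j] inverts the curve, which is therefore birational onto
    its image. *)
Lemma wall_curve_in : curve_in wall_curve.
Proof.
split; [exact: line_manifold | exact: wall_regular |].
have okX := ok_tor phi.
exists [set q : X | cn q `<=` bcone E]; split; first exact: open_bcone.
  exists (wall_curve (line_pt ord_max 0)); split; first by eexists.
  apply: cn_wall_affine; exact: line_pt_chart.
pose Y := induced_space (range wall_curve `&` [set q : X | cn q `<=` bcone E]).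
have zn (z : Y) : \row_i (if i == ord_max then 1 else chart_coord E j (sval z))
    != 0 :> 'rV[K]_2 by exact: line_pt_neq0.
pose g (z : Y) : P1 := line_pt ord_max (chart_coord E j (sval z)).
exists g.
  have okY : ok_space Y by exact: ok_induced.
  have ry (z : Y) : regular_at z (fun z : Y => chart_coord E j (sval z)).
    have [_ zE] := svalP z; have [rz _] := chart_coordinates mE zE.
    have rs := @regular_map_sval _ X
      (range wall_curve `&` [set q : X | cn q `<=` bcone E]) okX.
    by have := regular_comp rs (rz j).
  have rc (z : Y) k : regular_at z (fun z : Y =>
      (\row_i (if i == ord_max then 1 else chart_coord E j (sval z)) : 'rV[K]_2) 0 k).
    apply: (eq_regular (X := Y) (f := fun z : Y => if k == ord_max then 1 else chart_coord E j (sval z))).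
      by move=> q; rewrite mxE.
    by case: (k == ord_max); [exact: ok_cst | exact: ry].
  apply: regular_map_glued => // z k.
  rewrite /= /g hcoord_mk_eq0 => zk; split.
    have [W [oW Wz HW]] := ok_nz okY (rc z k) zk.
    by exists W; split=> // q /HW; rewrite hcoord_mk_eq0.
  move=> h [l ->]; apply: (eq_regular (X := Y) (f := fun z : Y =>
    (\row_i (if i == ord_max then 1 else chart_coord E j (sval z)) : 'rV[K]_2) 0 l /
    (\row_i (if i == ord_max then 1 else chart_coord E j (sval z)) : 'rV[K]_2) 0 k)).
    by move=> q; rewrite /= /g hcoord_mk_ratio.
  by apply: (ok_mul okY) => //; apply: (ok_inv okY).
move=> L z Ez; have [_ zE] := svalP z.
have L1 : hcoord L ord_max != 0 by apply: wall_affine_chart; rewrite Ez.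
rewrite /g -Ez coord_wall // eqxx; apply/esym.
rewrite [LHS](line_pt_surj L1); congr (line_pt _ (hcoord L _ / _)).
exact: val_inj.
Qed.

Lemma dualb_new i : dualb E' i =
  if i == j then - dualb E j else dualb E i + a 0 i *: dualb E j.
Proof.
apply/eqP; rewrite -subr_eq0; apply/eqP/ip_eq0 => w.
rewrite [w](basis_expand uE') ip_sumr big1 // => k _; rewrite ipZr.
rewrite ipDl ipNl ip_dualb_row // row_set_row.
suff -> : ip (if i == j then - dualb E j else dualb E i + a 0 i *: dualb E j)
    (if k == j then a *m E else row k E) = (i == k)%:R by rewrite subrr mulr0.
have na l : ip (dualb E l) (a *m E) = a 0 l by rewrite ip_dualb mulmxK.
have [->|kj] := eqVneq k j.
  have [_|ij] := eqVneq i j; first by rewrite ipNl na aj opprK.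
  by rewrite ipDl ipZl !na aj mulrN1 subrr.
have [->|ij] := eqVneq i j.
  by rewrite ipNl ip_dualb_row // eq_sym (negPf kj) oppr0.
rewrite ipDl ipZl !ip_dualb_row // [j == k]eq_sym (negPf kj) mulr0 addr0.
by [].
Qed.

(** On the curve the coordinates of [E] other than [y_j] vanish. The new coordinates are [1 / y_j]
    and the [y_i * y_j ^ (a 0 i)], so their differentials there are multiples of [dy_j] and [dy_i]:
    the Jacobian is diagonal. *)
Lemma wall_jacobian L : hcoord L ord0 != 0 -> hcoord L ord_max != 0 ->
  \det (jacobian_at (X := X) (chart_coord E') (chart_coord E) (wall_curve L)) =
  - (hcoord L ord_max / hcoord L ord0) ^ (1 - \sum_i a 0 i).
Proof.
move=> L0 L1; pose p := wall_curve L; pose t := hcoord L ord0 / hcoord L ord_max.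
have okX := ok_tor phi.
have t0 : t != 0 by rewrite mulf_neq0 // invr_eq0.
have pE := cn_wall_affine L1; have pE' := cn_wall_infinity L0.
have C := chart_coordinates mE pE; have C' := chart_coordinates mE' pE'.
have yp i : chart_coord E i p = if i == j then t else 0 by exact: coord_wall.
have [ry Hy] := C; have [ry' _] := C'.
pose D : 'rV[K]_d := \row_i (if i == j then - t ^- 2 else t ^ a 0 i).
have -> : jacobian_at (X := X) (chart_coord E') (chart_coord E) p = diag_mx D.
  apply: jacobian_eq => // i; rewrite row_diag_mx mxE.
  have [P EP] := bcone_chart mE pE.
  have Eq q : cn q `<=` cn p -> chart_coord E' i q =
      if i == j then (chart_coord E j q)^-1
      else chart_coord E i q * chart_coord E j q ^ a 0 i.
    move=> qp; have [P' EP'] := bcone_chart mE (subset_trans qp pE).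
    rewrite {1}/chart_coord (ch_coord uE EP') dualb_new.
    have [_|ij] := eqVneq i j.
      rewrite (bigD1 j) //= ipNl ip_dualb_row // eqxx exprN1 big1 ?mulr1 //.
      by move=> k kj; rewrite ipNl ip_dualb_row // eq_sym (negPf kj) oppr0 expr0z.
    rewrite (bigD1 i) //= (bigD1 j) 1?eq_sym //= big1 ?mulr1; last first.
      move=> k /andP[ki kj]; rewrite ipDl ipZl !ip_dualb_row //.
      by rewrite eq_sym (negPf ki) eq_sym (negPf kj) mulr0 addr0 expr0z.
    rewrite !ipDl !ipZl !ip_dualb_row // !eqxx (negPf ij) [j == i]eq_sym (negPf ij).
    by rewrite mulr0 addr0 add0r mulr1 expr1z.
  apply: (@diff_ext _ X okX p _ _ [set q | cn q `<=` cn p] (fun q =>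
      if i == j then (chart_coord E j q)^-1
      else chart_coord E i q * chart_coord E j q ^ a 0 i)) => //.
  - exact: open_cn.
  - by move=> q qp; rewrite Eq.
  have [->|ij] := eqVneq i j.
    have jp0 : chart_coord E j p != 0 by rewrite yp eqxx.
    have := diff_inv okX (ry j) jp0 (diff_self okX p (chart_coord E) j).
    by rewrite yp eqxx.
  have rz : regular_at (X := X) p (fun q => chart_coord E j q ^ a 0 i).
    apply: (regular_expz okX (ry j)) => /eqP.
    by rewrite yp eqxx (negPf t0).
  have [c [dc _]] := Hy _ rz.
  have := diff_mul okX (ry i) rz (diff_self okX p (chart_coord E) i) dc.
  by rewrite !yp (negPf ij) eqxx scale0r add0r.
rewrite det_diag (bigD1 j) //= mxE eqxx (eq_bigr (fun i => t ^ a 0 i)); last first.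
  by move=> i /negPf ij; rewrite mxE ij.
have tE : hcoord L ord_max / hcoord L ord0 = t^-1 by rewrite invf_div.
have -> : \prod_(i | i != j) t ^ a 0 i = t ^ (\sum_(i | i != j) a 0 i).
  by elim/big_rec2: _ => [|i x y _ ->]; rewrite ?expr0z // expfzDr.
rewrite tE [\sum_i a 0 i](bigD1 j) //= aj mulNr; congr (- _).
rewrite exprnN -expfzDr // exprz_inv; congr (t ^ _).
by move: (\sum_(i | _) _) => z; lia.
Qed.

(** The rational section is the frame of the anticanonical bundle given by the coordinates of [E].
    It has neither zero nor pole on that chart, and its order at the one remaining point of the
    curve is the exponent found in [wall_jacobian]. *)
Lemma wall_degree_curve : has_degree
  (pullback wall_curve (anticanonical X d)) (1 - \sum_i a 0 i).
Proof.
have okX := ok_tor phi; have okP := ok_proj K 1.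
pose infty : P1 := line_pt ord0 0.
have i0 : hcoord infty ord0 != 0 by exact: line_pt_chart.
have i1 : hcoord infty ord_max = 0.
  by apply/eqP; rewrite hcoord_mk_eq0 mxE.
have notinf q : ~ range (fun _ : 'I_1 => infty) q -> hcoord q ord_max != 0.
  move=> H; apply/eqP => q1; apply: H; exists ord0 => //.
  have q0 : hcoord q ord0 != 0 by apply: contraPneq q1 => /hcoord2_neq0/eqP.
  by rewrite [RHS](line_pt_surj q0) line_ixE q1 mul0r.
exists 1%N, (fun=> infty), (fun=> 1 - \sum_i a 0 i).
exists (fun (y : coordinate_chart X d) q =>
  \det (jacobian_at (X := X) (@ccoord _ _ _ y) (chart_coord E) (wall_curve q))).
have JM (y : coordinate_chart X d) q z w : cdom y (wall_curve q) ->
    coordinates_at (wall_curve q) z -> coordinates_at (wall_curve q) w ->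
    \det (jacobian_at (X := X) (@ccoord _ _ _ y) w (wall_curve q)) =
    \det (jacobian_at (X := X) (@ccoord _ _ _ y) z (wall_curve q)) *
    \det (jacobian_at (X := X) z w (wall_curve q)).
  move=> yq zq wq; rewrite -det_mulmx -jacobian_mul //; exact: ccoordP.
split.
- by move=> k l _; rewrite !ord1.
- move=> y z q /notinf q1 /= yq zq; apply: JM => //; first exact: ccoordP.
  by apply: chart_coordinates => //; exact: cn_wall_affine.
- move=> y q /notinf q1 /= yq; have qE := cn_wall_affine q1; split.
    exact: (regular_comp wall_regular (regular_jacobian mE qE yq)).
  by apply: (jacobian_det_neq0 okX); [exact: ccoordP | exact: chart_coordinates].
- move=> k; have iE := cn_wall_infinity i0.
  have C := chart_coordinates mE' iE.
  have Cd : forall p, [set q : X | cn q `<=` bcone E'] p ->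
      coordinates_at (X := X) p (chart_coord E').
    by move=> p pE'; exact: chart_coordinates.
  have Cr i : reg ([set q | cn q `<=` bcone E'] : set X) (chart_coord E' i).
    apply/ok_reg => //; split; first exact: open_bcone.
    by move=> p /Cd[].
  pose y0 : coordinate_chart X d := CoordinateChart (open_bcone mE') Cr Cd.
  exists y0, (fun q => hcoord q ord_max / hcoord q ord0).
  exists (fun q => - \det (jacobian_at (X := X) (chart_coord E')
                        (chart_coord E') (wall_curve q))).
  exists [set q : P1 | hcoord q ord0 != 0]; split.
  + exact: iE.
  + split; last by rewrite i1 mul0r.
    by have := line_coordinates i0; rewrite /line_coord line_ixE.
  + split; last by rewrite oppr_eq0 (jacobian_det_neq0 okX).
    apply: (regular_opp okP).
    exact: (regular_comp wall_regular (regular_jacobian (y := y0) mE' iE iE)).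
  + split=> //; exact: (@open_chart _ (proj_atlas K 1) ord0).
  + move=> q /= q0 qE' qi.
    have q1 : hcoord q ord_max != 0.
      by apply: notinf => -[_ _ Eq]; apply: qi.
    have C1 := chart_coordinates mE (cn_wall_affine q1).
    have C2 := chart_coordinates mE' (cn_wall_infinity q0).
    rewrite (@JM y0 q (chart_coord E') (chart_coord E)) // wall_jacobian //.
    by rewrite mulrN mulNr.
- by rewrite big_ord1.
Qed.

End WallCurve.

(** * Factorial polynomial rings *)

Section Divides.
Variable A : idomainType.
Implicit Types (a b q : A) (s : seq A).

Definition divides a b : Prop := exists c, b = c * a.

Definition prime_elt q : Prop := [/\ q != 0, q \isn't a GRing.unit &
  forall a b, divides q (a * b) -> divides q a \/ divides q b].

Definition factorial_elt a : Prop := exists (s : seq A) (u : A),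
  [/\ forall q, q \in s -> prime_elt q, u \is a GRing.unit &
      a = u * \prod_(q <- s) q].

Definition factorial_ring : Prop := forall a, a != 0 -> factorial_elt a.

Lemma divides_mull a b c : divides a b -> divides a (c * b).
Proof. by move=> [e ->]; exists (c * e); rewrite mulrA. Qed.

Lemma divides_trans a b c : divides a b -> divides b c -> divides a c.
Proof. by move=> [e ->] [f ->]; exists (f * e); rewrite mulrA. Qed.

Lemma divides_add a b c : divides a b -> divides a c -> divides a (b + c).
Proof. by move=> [e ->] [f ->]; exists (e + f); rewrite mulrDl. Qed.

Lemma divides0 a : divides a 0.
Proof. by exists 0; rewrite mul0r. Qed.

Lemma divides_unit a u : u \is a GRing.unit -> divides a u -> a \is a GRing.unit.
Proof. by move=> uu [c E]; move: uu; rewrite E unitrM => /andP[]. Qed.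

Lemma unit_neq0 a : a \is a GRing.unit -> a != 0.
Proof. by apply: contraTneq => ->; rewrite unitr0. Qed.

Lemma prime_assoc p q : prime_elt p -> prime_elt q -> divides q p ->
  exists2 v, v \is a GRing.unit & p = v * q.
Proof.
move=> [p0 _ Pp] [q0 qu _] [v Ev].
have [|[w Ew]|[w Ew]] := Pp v q; first by exists 1; rewrite mul1r Ev.
- have v0 : v != 0 by apply: contra_neq p0 => v0; rewrite Ev v0 mul0r.
  case/negP: qu; apply/unitrPr; exists w.
  by apply: (mulIf v0); rewrite mul1r {2}Ew Ev; ring.
- exists v => //; apply/unitrPr; exists w; apply: (mulIf q0).
  by rewrite mul1r {2}Ew Ev; ring.
Qed.

Lemma prime_dvd_prod q s u : prime_elt q -> u \is a GRing.unit ->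
  divides q (u * \prod_(p <- s) p) -> exists2 p, p \in s & divides q p.
Proof.
move=> Pq uu; have [q0 qu Hq] := Pq; elim: s => [|p s IH].
  by rewrite big_nil mulr1 => /(divides_unit uu); rewrite (negPf qu).
rewrite big_cons mulrCA => /Hq[H|/IH[p' ps H]].
  by exists p; rewrite ?mem_head.
by exists p'; rewrite // inE ps orbT.
Qed.

(** The length of a prime factorization drops by one; it is the induction measure for contents,
    valuations and lowest terms. *)
Lemma prime_extract q c s u : prime_elt q -> (forall p, p \in s -> prime_elt p) ->
  u \is a GRing.unit -> u * \prod_(p <- s) p = c * q ->
  exists s' u', [/\ forall p, p \in s' -> prime_elt p, u' \is a GRing.unit,
    c = u' * \prod_(p <- s') p & size s = (size s').+1].
Proof.
move=> Pq Hs uu Ec; have [q0 _ _] := Pq.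
have [p ps qp] : exists2 p, p \in s & divides q p.
  by apply: (prime_dvd_prod Pq uu); rewrite Ec; exists c.
have [v vu Ep] := prime_assoc (Hs p ps) Pq qp.
exists (rem p s), (u * v); split.
- by move=> r /mem_rem; exact: Hs.
- by rewrite unitrM uu.
- apply: (mulIf q0); rewrite -Ec (perm_big _ (perm_to_rem ps)) big_cons /=.
  by set PP := \prod_(_ <- _) _; rewrite Ep; ring.
- by rewrite size_rem // prednK // (perm_size (perm_to_rem ps)).
Qed.

Lemma prime_dvd_exp q a n : prime_elt q -> divides q (a ^+ n) -> divides q a.
Proof.
move=> [q0 qu Hq]; elim: n => [|n IH].
  by rewrite expr0 => /(divides_unit (unitr1 _)); rewrite (negPf qu).
by rewrite exprS => /Hq[].
Qed.

Lemma factorial_elt_mul a b :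
  factorial_elt a -> factorial_elt b -> factorial_elt (a * b).
Proof.
move=> [s [u [Hs uu ->]]] [s' [u' [Hs' uu' ->]]]; exists (s ++ s'), (u * u').
split; first by move=> q; rewrite mem_cat => /orP[/Hs|/Hs'].
  by rewrite unitrM uu.
by rewrite big_cat /=; ring.
Qed.

End Divides.

Section FactorialPoly.
Variable A : idomainType.
Hypothesis facA : factorial_ring A.
Implicit Types (f g h : {poly A}) (q c : A).

Lemma divides_polyC q f : divides q%:P f <-> forall i, divides q f`_i.
Proof.
split=> [[g ->] i|H]; first by exists g`_i; rewrite coefMC.
pose F i := sval (cid (H i)).
exists (\poly_(i < size f) F i); apply/polyP => i; rewrite coefMC coef_poly.
case: ltnP => [_|le]; last by rewrite mul0r nth_default.
by rewrite /F; case: cid.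
Qed.

(** Gauss' argument: if [i] and [j] are the least indices of coefficients of [f] and [g] not
    divisible by [q], every other term in the coefficient [i + j] of the product is divisible by
    [q]. *)
Lemma prime_polyC q : prime_elt q -> prime_elt q%:P.
Proof.
move=> [q0 qu Hq]; split.
- by rewrite polyC_eq0.
- by rewrite poly_unitE coefC eqxx (negPf qu) andbF.
move=> f g Hfg; apply: contrapT => /not_orP[nf ng].
have min h : ~ divides q%:P h -> exists i, ~ divides q h`_i /\
    forall j, (j < i)%N -> divides q h`_j.
  move=> nh; have ex : exists i, `[< ~ divides q h`_i >].
    apply: contrapT => H; apply: nh; apply/divides_polyC => i.
    by apply: contrapT => ni; apply: H; exists i; apply/asboolP.
  case: (ex_minnP ex) => i /asboolP ni Hmin; exists i; split=> // j ji.
  apply: contrapT => nj; have := Hmin j; rewrite leqNgt ji => H.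
  by have := H (asboolT nj).
have [i [ni Hi]] := min f nf; have [j [nj Hj]] := min g ng.
have /divides_polyC/(_ (i + j)%N) := Hfg; rewrite coefM.
have ij : (i < (i + j).+1)%N by rewrite ltnS leq_addr.
rewrite (bigD1 (Ordinal ij)) //= addKn => H.
have [/ni //|/nj //] : divides q f`_i \/ divides q g`_j.
apply: Hq; rewrite -[_ * _](addrK (\sum_(k < (i + j).+1 | k != Ordinal ij)
  f`_k * g`_(i + j - k))); apply: divides_add => //.
rewrite -mulN1r; apply: divides_mull.
elim/big_rec: _ => [|k x kij Hx]; first exact: divides0.
apply: divides_add => //; have : (k != i :> nat) by [].
rewrite neq_ltn => /orP[ki|ik].
  by rewrite mulrC; apply: divides_mull; exact: Hi.
apply: divides_mull; apply: Hj.
by have := ltn_ord k; lia.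
Qed.

Definition primitive f : Prop := forall q, prime_elt q -> ~ divides q%:P f.

(** A prime constant dividing [f] divides its leading coefficient, so the content is removed prime
    by prime, by induction on a factorization of that coefficient. *)
Lemma primitive_part f : f != 0 ->
  exists c f1, [/\ c != 0, primitive f1 & f = c%:P * f1].
Proof.
move=> f0; have lf : lead_coef f != 0 by rewrite lead_coef_eq0.
have [s [u [Hs uu Ef]]] := facA lf.
move: {2}(size s) (erefl (size s)) => n.
elim: n f f0 s u lf Hs uu Ef => [|n IH] f f0 s u lf Hs uu Ef sn.
  exists 1, f; split; rewrite ?oner_neq0 ?mul1r // => q Pq [g Eg].
  have : divides q u.
    move: Ef; rewrite (size0nil sn) big_nil mulr1 => <-.
    by exists (lead_coef g); rewrite Eg lead_coefM lead_coefC.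
  by move=> /(divides_unit uu); have [_ /negPf ->] := Pq.
have [pf|npf] := pselect (primitive f).
  by exists 1, f; split; rewrite ?oner_neq0 ?mul1r.
have [q [Pq [g Eg]]] : exists q, prime_elt q /\ divides q%:P f.
  apply: contra_notP npf => H q Pq Hd; by apply: H; exists q.
have [q0 _ _] := Pq.
have g0 : g != 0 by apply: contra_neq f0 => g0; rewrite Eg g0 mul0r.
have lg : lead_coef g != 0 by rewrite lead_coef_eq0.
have Elf : u * \prod_(p <- s) p = lead_coef g * q.
  by rewrite -Ef Eg lead_coefM lead_coefC.
have [s' [u' [Hs' uu' Es' ss]]] := prime_extract Pq Hs uu Elf.
have [|c [f1 [c0 pf1 Ef1]]] := IH g g0 s' u' lg Hs' uu' Es'.
  by apply: succn_inj; rewrite -ss.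
by exists (q * c), f1; split; rewrite ?mulf_neq0 // Eg Ef1 polyCM; ring.
Qed.

Lemma primitive_cancel h c f : primitive h -> c != 0 ->
  divides h (c%:P * f) -> divides h f.
Proof.
move=> ph c0; have [s [u [Hs uu ->]]] := facA c0.
elim: s Hs => [|q s IH] Hs.
  rewrite big_nil mulr1 => /(divides_mull (u^-1)%:P).
  by rewrite mulrA -polyCM mulVr // mul1r.
rewrite big_cons mulrCA polyCM -mulrA => -[t Et].
have Pq : prime_elt q by apply: Hs; rewrite mem_head.
have [q0 _ _] := Pq; have [_ _ HqP] := prime_polyC Pq.
have [[t' Et']|/(ph q Pq) //] : divides q%:P t \/ divides q%:P h.
  by apply: HqP; exists ((u * \prod_(j <- s) j)%:P * f); rewrite -Et mulrC.
apply: IH; first by move=> r rs; apply: Hs; rewrite inE rs orbT.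
exists t'; have qP0 : q%:P != 0 by rewrite polyC_eq0.
by apply: (mulfI qP0); rewrite Et Et'; ring.
Qed.

Lemma primitive_const f c : primitive f -> c != 0 -> divides c%:P f ->
  c \is a GRing.unit.
Proof.
move=> pf c0 cf; have [s [u [Hs uu Ec]]] := facA c0.
case: s Hs Ec => [|q s] Hs Ec; first by rewrite Ec big_nil mulr1.
have Pq : prime_elt q by apply: Hs; rewrite mem_head.
case: (pf q Pq); apply: divides_trans cf.
by exists (u * \prod_(r <- s) r)%:P; rewrite -polyCM Ec big_cons mulrCA mulrC.
Qed.

(** Pseudo-division by a nonzero element [r] of least degree in the ideal of [f] and [g] shows that
    the primitive part of [r] divides both. As [f] is irreducible and does not divide [g], that part
    is constant, and then so is [r]. *)
Lemma primitive_bezout f g : f != 0 -> primitive f ->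
  (forall g h, f = g * h -> (size g <= 1)%N \/ (size h <= 1)%N) ->
  ~ divides f g -> exists e (a b : {poly A}), e != 0 /\ e%:P = a * f + b * g.
Proof.
move=> f0 pf irr nfg.
pose I r := exists a b : {poly A}, r = a * f + b * g.
have ex : exists n, `[< exists r, [/\ I r, r != 0 & size r = n] >].
  exists (size f); apply/asboolP; exists f; split=> //.
  by exists 1, 0; rewrite mul1r mul0r addr0.
case: (ex_minnP ex) => n /asboolP[r [Ir r0 sr]] Hmin.
have red x : I x -> exists k, divides r ((lead_coef r ^+ k)%:P * x).
  move=> [a [b Ex]]; exists (scalp x r); rewrite mul_polyC Pdiv.Idomain.divp_eq.
  suff -> : x %% r = 0 by rewrite addr0; exists (x %/ r).
  apply/eqP; apply: contrapT => /negP rem0; have [a' [b' Er]] := Ir.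
  have := Hmin (size (x %% r)); rewrite leqNgt -sr ltn_modp r0 => H.
  suff : false by []; apply: H; apply/asboolP; exists (x %% r); split=> //.
  have -> : x %% r = (lead_coef r ^+ scalp x r)%:P * x - x %/ r * r.
    by rewrite mul_polyC Pdiv.Idomain.divp_eq addrC addKr.
  exists ((lead_coef r ^+ scalp x r)%:P * a - x %/ r * a').
  exists ((lead_coef r ^+ scalp x r)%:P * b - x %/ r * b').
  set Q := x %/ r; set L := (lead_coef r ^+ _)%:P.
  by rewrite Ex Er; ring.
have [c [r1 [c0 pr1 Er]]] := primitive_part r0.
have r1r : divides r1 r by exists c%:P.
have lc k : lead_coef r ^+ k != 0 by rewrite expf_neq0 // lead_coef_eq0.
have If : I f by exists 1, 0; rewrite mul1r mul0r addr0.
have Ig : I g by exists 0, 1; rewrite mul1r mul0r add0r.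
have r1f : divides r1 f.
  by have [k /(divides_trans r1r)] := red f If; exact: primitive_cancel.
have r1g : divides r1 g.
  by have [k /(divides_trans r1r)] := red g Ig; exact: primitive_cancel.
have [t Et] := r1f; have [st|sr1] := irr t r1 Et.
  have [t0 Et0] : exists t0, t = t0%:P by exists t`_0; exact: size1_polyC.
  have t00 : t0 != 0.
    by apply: contra_neq f0 => t00; rewrite Et Et0 t00 mul0r.
  have tu : t0 \is a GRing.unit.
    by apply: (primitive_const pf t00); exists r1; rewrite Et Et0 mulrC.
  case: nfg; apply: divides_trans r1g; exists (t0^-1)%:P.
  by rewrite Et Et0 mulrA -polyCM mulVr // mul1r.
have [a [b Eab]] := Ir.
exists (c * r1`_0), a, b; split.
  apply: contra_neq r0 => E0; rewrite Er (size1_polyC sr1) -polyCM E0.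
  by rewrite polyC0.
by rewrite -Eab Er {2}(size1_polyC sr1) polyCM.
Qed.

Lemma primitive_irreducible_prime f : primitive f -> (1 < size f)%N ->
  (forall g h, f = g * h -> (size g <= 1)%N \/ (size h <= 1)%N) -> prime_elt f.
Proof.
move=> pf sf irr; have f0 : f != 0 by rewrite -size_poly_gt0 ltnW.
split=> //.
- by rewrite poly_unitE gtn_eqF.
move=> g h fgh; have [|nfg] := pselect (divides f g); first by left.
right; have [e [a [b [e0 E]]]] := primitive_bezout f0 pf irr nfg.
apply: (primitive_cancel pf e0); rewrite E mulrDl; apply: divides_add.
  by exists (a * h); ring.
by rewrite -mulrA; exact: divides_mull.
Qed.

Lemma factorial_poly : factorial_ring {poly A}.
Proof.
move=> f; move: {2}(size f) (leqnn (size f)) => n.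
elim: n f => [|n IH] f; first by rewrite leqn0 size_poly_eq0 => /eqP ->; rewrite eqxx.
move=> sf f0; have [c [f1 [c0 pf1 Ef]]] := primitive_part f0.
have f10 : f1 != 0 by apply: contra_neq f0 => E; rewrite Ef E mulr0.
have s1 : size f = size f1 by rewrite Ef size_Cmul.
rewrite Ef; apply: factorial_elt_mul.
  have [s [u [Hs uu ->]]] := facA c0; exists [seq q%:P | q <- s], u%:P; split.
  - by move=> _ /mapP[q /Hs Pq ->]; exact: prime_polyC.
  - by rewrite poly_unitE size_polyC (unit_neq0 uu) coefC eqxx uu.
  - by rewrite big_map polyCM rmorph_prod.
have [sf1|sf1] := leqP (size f1) 1.
  exists [::], f1; split=> //; last by rewrite big_nil mulr1.
  have E1 := size1_polyC sf1; have c1 : f1`_0 != 0.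
    by apply: contra_neq f10 => E; rewrite E1 E polyC0.
  have cu : f1`_0 \is a GRing.unit.
    by apply: (primitive_const pf1 c1); exists 1; rewrite mul1r.
  by rewrite poly_unitE cu E1 size_polyC c1.
have [irr|nirr] := pselect (forall g h, f1 = g * h ->
    (size g <= 1)%N \/ (size h <= 1)%N).
  exists [:: f1], 1; split; rewrite ?unitr1 ?big_seq1 ?mul1r // => q.
  by rewrite inE => /eqP ->; exact: primitive_irreducible_prime.
have [g [h [Egh sg sh]]] : exists g h, [/\ f1 = g * h, (1 < size g)%N & (1 < size h)%N].
  apply: contra_notP nirr => H g h E.
  have [|sg] := leqP (size g) 1; first by left.
  have [|sh] := leqP (size h) 1; first by right.
  by case: H; exists g, h.
have g0 : g != 0 by rewrite -size_poly_gt0 ltnW.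
have h0 : h != 0 by rewrite -size_poly_gt0 ltnW.
have := size_mul g0 h0; rewrite -Egh -s1 => E.
rewrite Egh; apply: factorial_elt_mul; apply: IH => //; lia.
Qed.

Lemma prime_primitive f : prime_elt f -> (1 < size f)%N -> primitive f /\
  forall g h, f = g * h -> (size g <= 1)%N \/ (size h <= 1)%N.
Proof.
move=> Pf sf; have [f0 _ Hf] := Pf; split.
  move=> q Pq /(prime_assoc Pf (prime_polyC Pq))[v vu E].
  move: sf; rewrite E mulrC size_Cmul; last by have [] := Pq.
  by move: vu; rewrite poly_unitE => /andP[/eqP ->].
have key g h : f = g * h -> divides f g -> (size h <= 1)%N.
  move=> E [w Ew]; have g0 : g != 0.
    by apply: contra_neq f0 => g0; rewrite E g0 mul0r.
  have : w * h = 1 by apply: (mulfI g0); rewrite mulr1 {2}Ew E; ring.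
  move=> E1; have : h \is a GRing.unit by apply/unitrPr; exists w; rewrite mulrC.
  by rewrite poly_unitE => /andP[/eqP ->].
move=> g h E; have [|H|H] := Hf g h; first by exists 1; rewrite mul1r E.
  by right; exact: key E H.
by left; apply: (key h g) => //; rewrite mulrC.
Qed.

End FactorialPoly.

(** * Iterated polynomial rings and the zeros of prime elements *)

Section IterPoly.
Variable K : closedFieldType.

(** Variables are added one at a time, so that factoriality and evaluation follow by induction.
    Evaluation takes an infinite list of values, of which [ev x n] uses the first [n]. *)
Fixpoint mpol (n : nat) : idomainType :=
  if n is n'.+1 then {poly (mpol n')} : idomainType else K.

Fixpoint ev (x : nat -> K) (n : nat) : {rmorphism mpol n -> K} :=
  match n return {rmorphism mpol n -> K} with
  | 0 => idfun : {rmorphism K -> K}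
  | n'.+1 =>
    (horner_eval (x n') \o map_poly (ev x n') : {rmorphism {poly mpol n'} -> K})
  end.

Lemma evS x n (P : mpol n.+1) : ev x n.+1 P = (map_poly (ev x n) P).[x n].
Proof. by []. Qed.

Lemma ev_ext x x' n (P : mpol n) : (forall i, (i < n)%N -> x i = x' i) ->
  ev x n P = ev x' n P.
Proof.
elim: n P => [//|n IH] P H; rewrite !evS H //.
suff -> : map_poly (ev x n) P = map_poly (ev x' n) P by [].
by apply: eq_map_poly => Q; apply: IH => i ni; apply: H; rewrite ltnW.
Qed.

Definition upd (x : nat -> K) n t : nat -> K := fun i => if i == n then t else x i.

Lemma ev_upd x n t (P : mpol n.+1) :
  ev (upd x n t) n.+1 P = (map_poly (ev x n) P).[t].
Proof.
rewrite evS {2}/upd eqxx; congr horner; apply: eq_map_poly => Q.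
by apply: ev_ext => i ni; rewrite /upd ltn_eqF.
Qed.

Lemma ev_neq0 n (P : mpol n) : P != 0 -> exists x, ev x n P != 0.
Proof.
elim: n P => [|n IH] P P0; first by exists (fun=> 0).
have [x Hx] : exists x, ev x n (lead_coef (P : {poly mpol n})) != 0.
  by apply: IH; rewrite lead_coef_eq0.
have : map_poly (ev x n) P != 0.
  by rewrite -lead_coef_eq0 lead_coef_map_eq.
move=> /closed_nonrootP[t Ht]; exists (upd x n t); by rewrite ev_upd.
Qed.

Lemma mpol_factorial n : factorial_ring (mpol n).
Proof.
elim: n => [|n IH]; last exact: factorial_poly.
move=> a a0; exists [::], a; split=> //; last by rewrite big_nil mulr1.
by rewrite unitfE.
Qed.

(** If [q] involves the last variable and does not divide [a], a combination [e] of [q] and [a] is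
    free of that variable. At a point where [e] and the leading coefficient of [q] are nonzero, a
    root of [q] in the last variable is not a zero of [a]. If [q] is constant in it, induction
    applies to the coefficients of [a]. *)
Lemma prime_nullstellensatz n (q a : mpol n) : prime_elt q ->
  (forall x, ev x n q = 0 -> ev x n a = 0) -> divides q a.
Proof.
elim: n q a => [|n IH] q a Pq Hqa.
  by have [q0 qu _] := Pq; case/negP: qu; rewrite unitfE.
have facn := @mpol_factorial n.
have [sq|sq] := leqP (size (q : {poly mpol n})) 1.
  have Eq : q = ((q : {poly mpol n})`_0)%:P by exact: size1_polyC.
  set q0 := (q : {poly mpol n})`_0 in Eq; rewrite Eq; apply/divides_polyC => i.
  have Pq0 : prime_elt q0.
    have [qn0 qu Hq] := Pq; split.
    - by apply: contra_neq qn0 => E; rewrite Eq E polyC0.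
    - apply: contra qu => uq; rewrite Eq poly_unitE size_polyC coefC eqxx uq.
      by rewrite (unit_neq0 uq).
    move=> b c Hbc; have H1 : divides q (b%:P * c%:P : {poly mpol n}).
      rewrite Eq -polyCM; apply/divides_polyC => k; rewrite coefC.
      by case: ifP => _ //; exact: divides0.
    have [|] := Hq b%:P c%:P H1; rewrite Eq => /divides_polyC/(_ 0%N);
      rewrite coefC eqxx; by [left|right].
  apply: IH => // x Hx.
  have : map_poly (ev x n) (a : {poly mpol n}) = 0.
    apply/eqP; apply: contrapT => /negP/closed_nonrootP[t].
    rewrite /root -ev_upd Hqa ?eqxx // ev_upd Eq map_polyC /= hornerC.
    exact: Hx.
  by move=> /(congr1 (fun P : {poly K} => P`_i)); rewrite coef_map coef0.
apply: contrapT => nqa.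
have [pq irr] := prime_primitive Pq sq; have [q_neq0 _ _] := Pq.
have [e [b [c [e0 E]]]] := primitive_bezout facn q_neq0 pq irr nqa.
have lq : lead_coef (q : {poly mpol n}) != 0.
  by rewrite lead_coef_eq0; have [] := Pq.
have [x] := ev_neq0 (mulf_neq0 lq e0).
rewrite rmorphM mulf_eq0 => /norP[xq xe].
have sm : size (map_poly (ev x n) q) = size (q : {poly mpol n}).
  exact: size_map_poly_id0.
have /closed_rootP[t /eqP Ht] : size (map_poly (ev x n) q) != 1%N.
  by rewrite sm gtn_eqF.
have Eq0 : ev (upd x n t) n.+1 q = 0 by rewrite ev_upd.
have := congr1 (ev (upd x n t) n.+1) E.
rewrite rmorphD !rmorphM Eq0 (Hqa _ Eq0) !mulr0 addr0 ev_upd map_polyC /= hornerC.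
by move/eqP: xe.
Qed.

End IterPoly.

Section Factorial.
Variable A : idomainType.
Hypothesis facA : factorial_ring A.
Implicit Types (a b q : A).

Lemma prime_valuation q a : prime_elt q -> a != 0 ->
  exists n u, a = q ^+ n * u /\ ~ divides q u.
Proof.
move=> Pq a0; have [s [u [Hs uu ->]]] := facA a0.
move: {2}(size s) (erefl (size s)) => n.
elim: n s u Hs uu => [|n IH] s u Hs uu sn.
  exists 0%N, u; rewrite (size0nil sn) big_nil mulr1 expr0 mul1r; split=> //.
  by move=> /(divides_unit uu); have [_ /negPf ->] := Pq.
have [[c Ec]|nd] := pselect (divides q (u * \prod_(p <- s) p)); last first.
  by exists 0%N; eexists; rewrite expr0 mul1r.
have [s' [u' [Hs' uu' Ec' ss]]] := prime_extract Pq Hs uu Ec.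
have [|k [v [Ev nv]]] := IH s' u' Hs' uu'; first by apply: succn_inj; rewrite -ss.
by exists k.+1, v; split=> //; rewrite Ec Ec' Ev exprS; ring.
Qed.

Lemma lowest_terms a b : a != 0 -> b != 0 -> exists g u v,
  [/\ g != 0, a = g * u, b = g * v &
      forall q, prime_elt q -> divides q u -> ~ divides q v].
Proof.
move=> a0 b0; have [s [u [Hs uu Ea]]] := facA a0; rewrite Ea; rewrite Ea in a0.
clear Ea; move: {2}(size s) (erefl (size s)) => n.
elim: n s u b Hs uu a0 b0 => [|n IH] s u b Hs uu a0 b0 sn.
  exists 1, u, b; rewrite (size0nil sn) big_nil !mul1r mulr1 oner_neq0; split=> //.
  by move=> q [_ /negPf qu _] /(divides_unit uu); rewrite qu.
have [H|H] := pselect (forall q, prime_elt q ->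
    divides q (u * \prod_(p <- s) p) -> ~ divides q b).
  by exists 1; eexists; exists b; rewrite !mul1r oner_neq0; split.
have [q [Pq [c Ec] [b1 Eb]]] : exists q, [/\ prime_elt q,
    divides q (u * \prod_(p <- s) p) & divides q b].
  by apply: contra_notP H => H q Pq da db; apply: H; exists q.
have [s' [u' [Hs' uu' Ec' ss]]] := prime_extract Pq Hs uu Ec.
have [||| g [x [y [g0 Ex Ey Hxy]]]] := IH s' u' b1 Hs' uu'.
- by rewrite -Ec'; apply: contra_neq a0 => c0; rewrite Ec c0 mul0r.
- by apply: contra_neq b0 => b10; rewrite Eb b10 mul0r.
- by apply: succn_inj; rewrite -ss.
have [q0 _ _] := Pq; exists (g * q), x, y; split=> //.
- by rewrite mulf_neq0.
- by rewrite Ec Ec' Ex; ring.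
- by rewrite Eb Ey; ring.
Qed.

End Factorial.

(** * Cartier divisors of affine spaces *)

Section CoherentDivisor.
Variables (K : closedFieldType) (n : nat).
Local Notation P := (mpol K n).
Let fac := @mpol_factorial K n.

Lemma unit_ev_neq0 (u : P) x : u \is a GRing.unit -> ev x n u != 0.
Proof. by move=> uu; rewrite -unitfE; exact: rmorph_unit. Qed.

Lemma ev_divides (q f : P) x : divides q f -> ev x n q = 0 -> ev x n f = 0.
Proof. by move=> [g ->] Hq; rewrite rmorphM Hq mulr0. Qed.

Lemma mpol_eq_generic (f g w : P) : w != 0 ->
  (forall x, ev x n w != 0 -> ev x n f = ev x n g) -> f = g.
Proof.
move=> w0 H; apply/eqP; rewrite -subr_eq0; apply: contraT => fg.
have [x] := ev_neq0 (mulf_neq0 fg w0).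
by rewrite rmorphM rmorphB mulf_eq0 => /norP[/eqP + /H E]; rewrite E subrr.
Qed.

Lemma prime_factor_at (f : P) x : f != 0 -> ev x n f = 0 ->
  exists q, [/\ prime_elt q, divides q f & ev x n q = 0].
Proof.
move=> f0; have [s [u [Hs uu ->]]] := fac f0.
move=> /eqP; rewrite rmorphM mulf_eq0 (negPf (unit_ev_neq0 x uu)) /=.
rewrite rmorph_prod /= prodf_seq_eq0 => /hasP[q qs /eqP Eq].
exists q; split=> //; first exact: Hs.
apply: divides_mull; exists (\prod_(p <- rem q s) p).
by rewrite (perm_big _ (perm_to_rem qs)) big_cons mulrC.
Qed.

Lemma prime_zero_avoid (q f : P) : prime_elt q -> ~ divides q f ->
  exists x, ev x n q = 0 /\ ev x n f != 0.
Proof.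
move=> Pq nd; apply: contrapT => H; apply: nd; apply: prime_nullstellensatz => //.
by move=> x Hx; apply/eqP; apply: contrapT => /negP Hf; apply: H; exists x.
Qed.

(* Local equations [a p / b p], near each point [p], of a Cartier divisor of the
   affine space: it has a global equation [f / g]. *)
Variables (a b w : (nat -> K) -> P).
Hypothesis a0 : forall p, a p != 0.
Hypothesis b0 : forall p, b p != 0.
Hypothesis wp : forall p, ev p n (w p) != 0.
Hypothesis coh : forall p q x, ev x n (w p) != 0 -> ev x n (w q) != 0 ->
  exists c d, [/\ ev x n c != 0, ev x n d != 0 & a p * b q * d = b p * a q * c].

Let w0 p : w p != 0.
Proof. by apply: contra_neq (wp p) => ->; rewrite rmorph0. Qed.

(** [f / g] has the same order along [q] as the local equation at some [p] whose domain meets the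
    zeros of [q]. *)
Let good (q f g : P) : Prop := exists p u v x,
  [/\ ev x n q = 0, ev x n (w p) != 0, ~ divides q u, ~ divides q v &
      a p * g * v = b p * f * u].

Let good_assoc q q' f g : prime_elt q -> prime_elt q' -> divides q q' ->
  good q f g -> good q' f g.
Proof.
move=> Pq Pq' qq' [p [u [v [x [Hx wx nu nv E]]]]].
have [t tu Et] := prime_assoc Pq' Pq qq'.
exists p, u, v, x; split=> //.
- by rewrite Et rmorphM Hx mulr0.
- by move=> /(divides_trans qq').
- by move=> /(divides_trans qq').
Qed.

(** The orders are corrected one prime at a time by powers of [q]; these do not disturb a prime [r]
    already treated, because [r] divides no power of [q] unless the two are associated. *)
Let good_list (s : seq P) : (forall q, q \in s -> prime_elt q) ->
  exists f g, [/\ f != 0, g != 0, forall q, q \in s -> good q f g &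
    forall q, prime_elt q -> divides q (f * g) ->
      exists2 r, r \in s & divides q r].
Proof.
elim: s => [_|q s IH Hs].
  exists 1, 1; rewrite oner_neq0; split=> // q [_ /negPf qu _].
  by rewrite mulr1 => /(divides_unit (unitr1 _)); rewrite qu.
have Pq : prime_elt q by apply: Hs; rewrite mem_head.
have [|f [g [f0 g0 Hfg Hd]]] := IH.
  by move=> r rs; apply: Hs; rewrite inE rs orbT.
have [Gq|nG] := pselect (good q f g).
  exists f, g; split=> // r; first by rewrite inE => /orP[/eqP ->|/Hfg].
  by move=> Pr /(Hd r Pr)[t ts rt]; exists t; rewrite // inE ts orbT.
have [x [Hx _]] : exists x, ev x n q = 0 /\ ev x n (1 : P) != 0.
  apply: prime_zero_avoid => // /(divides_unit (unitr1 _)).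
  by have [_ /negPf ->] := Pq.
have [i [u [Eu nu]]] := prime_valuation fac Pq (mulf_neq0 (a0 x) g0).
have [j [v [Ev nv]]] := prime_valuation fac Pq (mulf_neq0 (b0 x) f0).
have [q0 _ Hq] := Pq.
exists (f * q ^+ i), (g * q ^+ j); split.
- by rewrite mulf_neq0 // expf_neq0.
- by rewrite mulf_neq0 // expf_neq0.
- move=> r; rewrite inE => /orP[/eqP ->|rs].
    exists x, u, v, x; split=> //; rewrite !mulrA Eu Ev; ring.
  have [p [u' [v' [y [Hy wy nu' nv' E]]]]] := Hfg r rs.
  have Pr : prime_elt r by apply: Hs; rewrite inE rs orbT.
  have [_ _ Hr] := Pr.
  have nrq k : ~ divides r (q ^+ k).
    move=> /(prime_dvd_exp Pr) rq; apply: nG.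
    exact: good_assoc Pr Pq rq (Hfg r rs).
  exists p, (u' * q ^+ j), (v' * q ^+ i), y; split=> //.
  + by move=> /Hr[//|]; exact: nrq.
  + by move=> /Hr[//|]; exact: nrq.
  + transitivity ((a p * g * v') * (q ^+ i * q ^+ j)); first by ring.
    by rewrite E; ring.
- move=> r Pr; have [_ _ Hr] := Pr.
  have -> : f * q ^+ i * (g * q ^+ j) = (f * g) * (q ^+ i * q ^+ j) by ring.
  move=> /Hr[/(Hd r Pr)[t ts rt]|]; first by exists t; rewrite // inE ts orbT.
  by rewrite -exprD => /(prime_dvd_exp Pr) rq; exists q; rewrite ?mem_head.
Qed.

(** Only the primes of [a p0 * b p0 * w p0] need a correction: along the others the equation at [p0]
    has order zero. Then [a p * g] and [b p * f], in lowest terms, are nonzero at [p]: a prime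
    through [p] dividing one of them would contradict the equality of orders, which [coh] carries
    over to the equation at [p]. *)
Lemma coherent_divisor : exists f g : P, [/\ f != 0, g != 0 & forall p,
  exists c d, [/\ ev p n c != 0, ev p n d != 0 & a p * g * d = b p * f * c]].
Proof.
pose p0 : nat -> K := fun=> 0.
have N0 : a p0 * b p0 * w p0 != 0 by rewrite !mulf_neq0.
have [s [u0 [Hs uu0 E0]]] := fac N0.
have [f [g [f0 g0 Hfg Hd]]] := good_list Hs.
have allgood q : prime_elt q -> good q f g.
  move=> Pq; have [_ _ Hq] := Pq.
  have [[r rs qr]|nr] := pselect (exists2 r, r \in s & divides q r).
    have Pr := Hs r rs; have [t tu Et] := prime_assoc Pr Pq qr.
    apply: (good_assoc Pr Pq _ (Hfg r rs)); exists t^-1.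
    by rewrite Et mulrA mulVr // mul1r.
  have n1 : ~ divides q (f * g) by move=> /(Hd q Pq).
  have n2 : ~ divides q (a p0 * b p0 * w p0).
    by rewrite E0 => /(prime_dvd_prod Pq uu0).
  have [x [Hx wx]] : exists x, ev x n q = 0 /\ ev x n (w p0) != 0.
    by apply: prime_zero_avoid => // /(divides_mull (a p0 * b p0)).
  exists p0, (a p0 * g), (b p0 * f), x; split=> //; last by ring.
  - move=> /Hq[H|H]; last by apply: n1; exact: divides_mull.
    apply: n2; rewrite -mulrA mulrC; exact: divides_mull.
  - move=> /Hq[H|H]; last by apply: n1; rewrite mulrC; exact: divides_mull.
    by apply: n2; rewrite mulrAC; exact: divides_mull.
exists f, g; split=> // p.
have [h [u [v [h0 Eu Ev Huv]]]] :=
  lowest_terms fac (mulf_neq0 (a0 p) g0) (mulf_neq0 (b0 p) f0).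
have u0' : u != 0.
  by apply: contra_neq (mulf_neq0 (a0 p) g0) => u0'; rewrite Eu u0' mulr0.
have v0' : v != 0.
  by apply: contra_neq (mulf_neq0 (b0 p) f0) => v0'; rewrite Ev v0' mulr0.
have key q : prime_elt q -> ev p n q = 0 -> exists c d u' v',
    [/\ ~ divides q c, ~ divides q d, ~ divides q u', ~ divides q v' &
        u * d * v' = v * c * u'].
  move=> Pq qp; have [_ _ Hq] := Pq.
  have [p' [u' [v' [x [Hx wx nu' nv' E]]]]] := allgood q Pq.
  have [y [Hy]] : exists y, ev y n q = 0 /\ ev y n (w p * w p') != 0.
    apply: prime_zero_avoid => // /Hq[H|H].
      by have /eqP := wp p; apply; exact: ev_divides H qp.
    by move/eqP: wx; apply; exact: ev_divides H Hx.
  rewrite rmorphM mulf_eq0 => /norP[wpy wpy'].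
  have [c [d [cy dy Ecd]]] := coh wpy wpy'.
  exists c, d, u', v'; split=> //.
  - by move=> H; move/eqP: cy; apply; exact: ev_divides H Hy.
  - by move=> H; move/eqP: dy; apply; exact: ev_divides H Hy.
  have N1 : h * (b p' * (f * (b p * (a p' * g)))) != 0.
    by rewrite !mulf_neq0.
  apply: (mulIf N1).
  transitivity ((h * u) * d * (a p' * g * v') * (b p' * (f * b p))); first by ring.
  rewrite -Eu E.
  transitivity ((a p * b p' * d) * (b p' * f * u' * f * b p * g)); first by ring.
  rewrite Ecd.
  transitivity ((b p * f) * (c * u' * (b p' * (f * (b p * (a p' * g)))))); first by ring.
  by rewrite Ev; ring.
exists u, v; split; last by rewrite Eu Ev; ring.
- apply/eqP => up; have [q [Pq qu qp]] := prime_factor_at u0' up.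
  have [_ _ Hq] := Pq.
  have [c [d [u' [v' [nc nd nu nv E]]]]] := key q Pq qp.
  have : divides q (v * c * u').
    by rewrite -E -mulrA mulrC; exact: divides_mull.
  by move=> /Hq[/Hq[/(Huv q Pq qu)|]|].
- apply/eqP => vp; have [q [Pq qv qp]] := prime_factor_at v0' vp.
  have [_ _ Hq] := Pq.
  have [c [d [u' [v' [nc nd nu nv E]]]]] := key q Pq qp.
  have : divides q (u * d * v').
    by rewrite E -mulrA mulrC; exact: divides_mull.
  by move=> /Hq[/Hq[qu|]|] //; apply: (Huv q Pq qu).
Qed.

End CoherentDivisor.

(** * Functions without zeros on the torus *)

Section TorusUnits.
Variable K : closedFieldType.

Lemma poly_root_free (p : {poly K}) : (forall t, t != 0 -> p.[t] != 0) ->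
  exists c k, c != 0 /\ p = c *: 'X^k.
Proof.
move=> H; have p0 : p != 0.
  by apply: contra_neq (H 1 (oner_neq0 _)) => ->; rewrite horner0.
have [e [V [/(_ tt) HV [[] V0]]]] := @poly_family_order K unit (fun=> p) tt p0.
have sV : size (V tt) == 1%N.
  apply: contraT => /closed_rootP[t /eqP Ht].
  have t0 : t != 0 by apply: contra_neq V0 => E; rewrite E in Ht.
  by have := H t t0; rewrite HV hornerM Ht mulr0 eqxx.
have /size_poly1P[c c0 Ec] := sV.
by exists c, e; split=> //; rewrite HV Ec mulrC mul_polyC.
Qed.

(** At a fixed torus point, [P] is a monomial in the last variable. Two nonzero coefficients of [P]
    would both be nonzero at some torus point, so [P] itself has a single term, whose coefficient
    falls under the induction hypothesis. *)
Lemma torus_nonvanishing n (P : mpol K n) :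
  (forall x, (forall i, (i < n)%N -> x i != 0) -> ev x n P != 0) ->
  exists c (k : nat -> nat), c != 0 /\
    forall x, ev x n P = c * \prod_(i < n) x i ^+ k i.
Proof.
elim: n P => [|n IH] P HP.
  exists P, (fun=> 0%N); split; first exact: (HP (fun=> 0)).
  by move=> x; rewrite big_ord0 mulr1.
have HPt x : (forall i, (i < n)%N -> x i != 0) ->
    exists c k, c != 0 /\ map_poly (ev x n) P = c *: 'X^k.
  move=> Hx; apply: poly_root_free => t t0; rewrite -ev_upd; apply: HP => i.
  rewrite /upd ltnS leq_eqVlt; case: eqVneq => //= _; exact: Hx.
have Hx1 : forall i, (i < n)%N -> (fun=> 1 : K) i != 0 by move=> *; exact: oner_neq0.
have [c1 [k [c10 E1]]] := HPt (fun=> 1) Hx1.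
have coefE x i : (map_poly (ev x n) P)`_i = ev x n ((P : {poly mpol K n})`_i).
  by rewrite coef_map.
have xprod m : exists X : mpol K m, forall x, ev x m X = \prod_(i < m) x i.
  elim: m => [|m [X HX]]; first by exists 1 => x; rewrite rmorph1 big_ord0.
  exists ((X : mpol K m)%:P * 'X : {poly mpol K m}) => x.
  transitivity (ev x m X * x m); last by rewrite HX big_ord_recr.
  by rewrite rmorphM /= /horner_eval map_polyC map_polyX hornerC hornerX.
have [XX HXX] := xprod n.
have XX0 : XX != 0.
  apply/eqP => E; have := HXX (fun=> 1); rewrite E rmorph0 big1 // => /eqP.
  by rewrite eq_sym oner_eq0.
have Pk0 : (P : {poly mpol K n})`_k != 0.
  apply: contra_neq c10 => Pk; have := coefE (fun=> 1) k.
  by rewrite E1 coefZ coefXn eqxx mulr1 Pk rmorph0.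
have Pi i : i != k -> (P : {poly mpol K n})`_i = 0.
  move=> ik; apply/eqP; apply: contraT => Pi0.
  have [x] := ev_neq0 (mulf_neq0 XX0 (mulf_neq0 Pk0 Pi0)).
  rewrite !rmorphM !mulf_eq0 HXX => /norP[Hx /norP[xk xi]].
  have Hx' l : (l < n)%N -> x l != 0.
    move=> ln; apply: contraNneq Hx => xl.
    by rewrite prodf_seq_eq0; apply/hasP; exists (Ordinal ln);
      rewrite ?mem_index_enum //= xl.
  have [c [k' [c0 E]]] := HPt x Hx'.
  move: xk xi; rewrite -!coefE E !coefZ !coefXn !mulf_eq0 (negPf c0) /=.
  have [Ek|_] := eqVneq k k'; last by rewrite eqxx.
  have [Ei|_] := eqVneq i k'; last by rewrite eqxx.
  by rewrite Ei Ek eqxx in ik.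
have EP : P = ((P : {poly mpol K n})`_k)%:P * 'X^k :> {poly mpol K n}.
  apply/polyP => i; rewrite coefCM coefXn.
  by have [->|/Pi ->] := eqVneq i k; rewrite ?mulr1 ?mulr0.
have [c [l [c0 Hl]]] : exists c (l : nat -> nat), c != 0 /\
    forall x, ev x n ((P : {poly mpol K n})`_k) = c * \prod_(i < n) x i ^+ l i.
  apply: IH => x Hx; rewrite -coefE; have [c [k' [c0 E]]] := HPt x Hx.
  have Ek : k' = k.
    apply/eqP; apply: contraT => kk; have := coefE x k'.
    rewrite (Pi _ kk) rmorph0 E coefZ coefXn eqxx mulr1 => /eqP.
    by rewrite (negPf c0).
  by rewrite E coefZ coefXn Ek eqxx mulr1.
exists c, (fun i => if i == n then k else l i); split=> // x.
transitivity (ev x n ((P : {poly mpol K n})`_k) * x n ^+ k).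
  by rewrite [in LHS]EP rmorphM /= /horner_eval map_polyC map_polyXn hornerC hornerXn.
rewrite Hl big_ord_recr /= eqxx mulrA; congr (_ * _ * _).
by apply: eq_bigr => i _; rewrite ltn_eqF.
Qed.

End TorusUnits.

Lemma int_kernel (r k : nat) (N : 'M[int]_(r, k)) : (k < r)%N ->
  exists a : 'rV[int]_r, a != 0 /\ a *m N = 0.
Proof.
move=> kr; pose M : 'M[rat]_(r, k) := map_mx intr N; pose u := nz_row (kermx M).
have u0 : u != 0.
  rewrite nz_row_eq0 -mxrank_eq0 mxrank_ker subn_eq0 -ltnNge.
  exact: leq_ltn_trans (rank_leq_col M) kr.
have uM : u *m M = 0 by apply/sub_kermxP; exact: nz_row_sub.
pose D : rat := \prod_i (denq (u 0 i))%:~R.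
pose a : 'rV[int]_r := \row_i (numq (u 0 i) * \prod_(j | j != i) denq (u 0 j)).
have D0 : D != 0.
  by rewrite prodf_seq_neq0; apply/allP => i _; rewrite /= intr_eq0 denq_neq0.
have aE : map_mx intr a = D *: u.
  apply/rowP => i; rewrite !mxE rmorphM rmorph_prod /= numqE /D.
  by rewrite [in RHS](bigD1 i) //=; ring.
exists a; split.
  apply: contra_neq u0 => a0; have := aE; rewrite a0 map_mx0 => /esym/eqP.
  by rewrite scaler_eq0 (negPf D0) => /eqP.
have : map_mx intr (a *m N) = 0 :> 'M[rat]_(1, k).
  by rewrite map_mxM aE -scalemxAl uM scaler0.
move=> /matrixP H; apply/matrixP => i j; have := H i j.
by rewrite !mxE => /eqP; rewrite intr_eq0 => /eqP.
Qed.

(** * Line bundles on affine charts *)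

Section ChartPoly.
Variables (R : realType) (K : closedFieldType) (d : nat).
Variable Sg : set (set 'rV[R]_d).
Hypothesis fanS : is_fan Sg.
Variables (T : Type) (phi : T -> toric_point K Sg) (psi : toric_point K Sg -> T).
Hypotheses (phiK : cancel phi psi) (psiK : cancel psi phi).
Local Notation lat := (@lattice_vec R d).
Local Notation X := (glued_space (tatlas phi)).
Local Notation ch := (ch phi).
Local Notation cn := (cn phi).
Local Notation bcone E := (@gcone R d _ (fun i => row i E) predT).
Local Notation max_cone := (max_cone Sg).
Let okX : ok_space X := ok_tor phi.

Definition torus (p : T) : Prop := cn p `<=` [set 0].

Section Chart.
Variables (E : 'M[int]_d) (mE : max_cone E).
Let uE : E \in unitmx. Proof. by have [] := mE. Qed.
Let SE : Sg (bcone E). Proof. by have [] := mE. Qed.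
Local Notation y := (chart_coord phi E).
Local Notation chart := (exist (fun s => Sg s) (bcone E) SE : aidx (tatlas phi)).

Lemma chart_ch p m : cn p `<=` bcone E ->
  ch p m = \prod_i y i p ^ ip m (row i E).
Proof. by move=> /(bcone_chart fanS mE)[P EP]; exact: (ch_coord uE EP). Qed.

Lemma chart_cn p : cn p `<=` bcone E ->
  cn p = @gcone R d _ (fun i => row i E) (fun i => y i p == 0).
Proof.
move=> /(bcone_chart fanS mE)[P EP]; rewrite EP; apply: eq_gcone => i.
by rewrite -(ch_dualb_eq0 uE EP).
Qed.

Lemma chart_inj p q : cn p `<=` bcone E -> cn q `<=` bcone E ->
  (forall i, y i p = y i q) -> p = q.
Proof.
move=> pE qE H; apply: (tor_ext phiK).
  by rewrite (chart_cn pE) (chart_cn qE); apply: eq_gcone => i; rewrite H.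
by move=> m; rewrite (chart_ch m pE) (chart_ch m qE); under eq_bigr do rewrite H.
Qed.

Lemma chart_pt_ex (x : 'I_d -> K) :
  exists p, cn p `<=` bcone E /\ forall i, y i p = x i.
Proof.
have [_ _ HF _] := fanS.
have SC : Sg (cox_cone (fun i => row i E) x).
  by apply: (HF _ _ SE); exact: basis_face.
exists (cox_pt psi SC); split=> [|i]; first by rewrite cn_cox //; exact: sub_gcone.
rewrite /chart_coord ch_cox // /cox_val (bigD1 i) //= ip_dualb_row // eqxx expr1z.
rewrite big1 ?mulr1 // => j /negPf ji.
by rewrite ip_dualb_row // eq_sym ji expr0z.
Qed.

Definition env (p : T) : nat -> K :=
  fun i => if insub i is Some j then y j p else 0.

Lemma env_ord p (i : 'I_d) : env p i = y i p.
Proof. by rewrite /env valK. Qed.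

Lemma torus_chart p : torus p -> cn p `<=` bcone E.
Proof. by move=> tp x /tp ->; exact: gcone0. Qed.

Lemma torus_coord p i : torus p -> y i p != 0.
Proof.
move=> tp; apply/eqP/ch_neq0 => x /tp ->.
by rewrite /dual_pairing big1 // => k _; rewrite !mxE mulr0.
Qed.

Lemma coord_torus p : cn p `<=` bcone E -> (forall i, y i p != 0) -> torus p.
Proof.
move=> pE H; rewrite /torus chart_cn // => x [c [_ ->]]; rewrite big_pred0 // => i.
exact/negbTE.
Qed.

Lemma pt_env (x : nat -> K) : exists p, cn p `<=` bcone E /\
  forall i, (i < d)%N -> env p i = x i.
Proof.
have [p [pE Hp]] := chart_pt_ex (fun i => x i); exists p; split=> // i id.
by rewrite (env_ord p (Ordinal id)) Hp.
Qed.

Lemma chart_generic (P Q W : mpol K d) : W != 0 ->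
  (forall p, cn p `<=` bcone E -> ev (env p) d W != 0 ->
     ev (env p) d P = ev (env p) d Q) -> P = Q.
Proof.
move=> W0 H; apply: (mpol_eq_generic W0) => x.
have [p [pE Hp]] := pt_env x.
rewrite -(ev_ext W Hp) -(ev_ext P Hp) -(ev_ext Q Hp); exact: H.
Qed.

Lemma mpol_var n i : (i < n)%N -> exists P : mpol K n, forall x, ev x n P = x i.
Proof.
elim: n => [//|n IH]; rewrite ltnS leq_eqVlt => /orP[/eqP ->|/IH[P HP]].
  by exists ('X : {poly mpol K n}) => x; rewrite evS map_polyX hornerX.
exists (P%:P : {poly mpol K n}) => x.
by rewrite evS map_polyC hornerC; exact: HP.
Qed.

Lemma chart_poly f : algebra_gen (acrd chart) f -> exists P : mpol K d,
  forall p, cn p `<=` bcone E -> f p = ev (env p) d P.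
Proof.
elim=> [_ [m dm ->]|c|f1 f2 _ [P HP] _ [Q HQ]|f1 f2 _ [P HP] _ [Q HQ]].
- have HX (i : 'I_d) : exists P : mpol K d, forall x, ev x d P = x i.
    exact: mpol_var.
  pose X_ i := sval (cid (HX i)).
  have XP i x : ev x d (X_ i) = x i by rewrite /X_; case: cid.
  exists (\prod_i X_ i ^+ `|ip m (row i E)|) => p pE.
  rewrite rmorph_prod chart_ch //=; apply: eq_bigr => i _.
  rewrite rmorphXn /= XP env_ord exprnP gez0_abs //.
  by move: dm => /dual_gconeP; exact.
- have [P HP] : exists P : mpol K d, forall x, ev x d P = c.
    elim: (d) => [|n [P HP]]; first by exists c.
    by exists (P%:P : {poly mpol K n}) => x; rewrite evS map_polyC hornerC; exact: HP.
  by exists P => p _; rewrite HP.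
- by exists (P + Q) => p pE; rewrite rmorphD HP // HQ.
- by exists (P * Q) => p pE; rewrite rmorphM HP // HQ.
Qed.

(** A chart around [p] contains the locus of this one where the coordinates nonzero at [p] stay
    nonzero, and there its characters are Laurent monomials with denominators in those
    coordinates. *)
Lemma good_bcone p : cn p `<=` bcone E -> good_at (A := tatlas phi) p chart.
Proof.
move=> pE; split=> // s ps.
have gy i : algebra_gen (acrd chart) (y i).
  apply: AlgIn; exists (dualb E i) => //; apply/dual_gconeP => k _.
  by rewrite ip_dualb_row // ler0n.
split.
  exists (fun q => \prod_(i | y i p != 0) y i q); split.
  - by apply: algebra_prod => i _; exact: gy.
  - by rewrite prodf_seq_neq0; apply/allP => i _; apply/implyP.
  move=> q qE; rewrite prodf_seq_neq0 => /allP Hq /=.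
  apply: subset_trans ps; rewrite (chart_cn qE) (chart_cn pE); apply: sub_gcone => i.
  by apply: contraTT => yi; exact: (implyP (Hq i (mem_index_enum _))).
move=> h [m dm ->].
exists (fun q => \prod_i (if 0 <= ip m (row i E) then y i q ^+ `|ip m (row i E)| else 1)).
exists (fun q => \prod_i (if 0 <= ip m (row i E) then 1 else y i q ^+ `|ip m (row i E)|)).
split.
- apply: algebra_prod => i _; case: (0 <= _); last exact: AlgCst.
  exact: algebra_exp.
- apply: algebra_prod => i _; case: (0 <= _); first exact: AlgCst.
  exact: algebra_exp.
- rewrite prodf_seq_neq0; apply/allP => i _; apply/implyP => _.
  case: ifP => [_|/negbT mi]; first exact: oner_neq0.
  rewrite expf_neq0 //; apply: contraNneq mi => yi.
  have : dual_cone (cn p) (lat m) by move=> x /ps; exact: dm.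
  by rewrite (chart_cn pE) => /dual_gconeP; apply; rewrite yi.
move=> q qE; rewrite prodf_seq_neq0 => /allP Hq; rewrite chart_ch // -prodf_div.
apply: eq_bigr => i _; have := implyP (Hq i (mem_index_enum _)) isT.
case: ifP => [mi _|/negbT mi yi]; first by rewrite divr1 exprnP gez0_abs.
rewrite -ltNge in mi.
by rewrite mul1r exprnP ltz0_abs // invr_expz opprK.
Qed.

Lemma regular_ev p (P : mpol K d) : cn p `<=` bcone E ->
  regular_at (X := X) p (fun q => ev (env q) d P).
Proof.
move=> pE; suff H n : (n <= d)%N -> forall P : mpol K n,
    regular_at (X := X) p (fun q => ev (env q) n P) by exact: H.
elim: n => [_ c|n IH nd]; first exact: ok_cst.
elim/poly_ind => [|Q c IHQ].
  apply: (eq_regular (X := X) (f := fun=> 0)); last exact: ok_cst.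
  by move=> q; rewrite rmorph0.
apply: (eq_regular (X := X) (f := fun q => ev (env q) n.+1 Q * y (Ordinal nd) q
    + ev (env q) n c)).
  move=> q; rewrite -env_ord !evS rmorphD rmorphM /=.
  by rewrite map_polyX map_polyC hornerD hornerM hornerX hornerC.
apply: (ok_add okX); last exact/IH/ltnW.
apply: (ok_mul okX IHQ).
by have [] := chart_coordinates fanS psiK mE pE.
Qed.

Lemma chart_frac p f : cn p `<=` bcone E -> regular_at (X := X) p f ->
  exists P Q : mpol K d, ev (env p) d Q != 0 /\ forall q, cn q `<=` bcone E ->
    ev (env q) d Q != 0 -> f q = ev (env q) d P / ev (env q) d Q.
Proof.
move=> pE /(good_regular f (good_bcone pE))[a [b [ia ib bp H]]].
have [P HP] := chart_poly ia; have [Q HQ] := chart_poly ib.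
exists P, Q; rewrite -HQ //; split=> // q qE; rewrite -HQ // => bq.
by rewrite H // HP.
Qed.

Lemma chart_open p (U : set X) : cn p `<=` bcone E -> opn U -> U p ->
  exists W : mpol K d, ev (env p) d W != 0 /\ forall q, cn q `<=` bcone E ->
    ev (env q) d W != 0 -> U q.
Proof.
move=> pE oU Up; have [b [ib bp H]] := good_open (good_bcone pE) oU Up.
have [P HP] := chart_poly ib; exists P; rewrite -HP //; split=> // q qE.
by rewrite -HP //; exact: H.
Qed.

Lemma ev_nonzero p (Q : mpol K d) : ev (env p) d Q != 0 -> Q != 0.
Proof. by apply: contra_neq => ->; rewrite rmorph0. Qed.

Lemma torus_poly : exists W : mpol K d, W != 0 /\ forall p, cn p `<=` bcone E ->
  ev (env p) d W != 0 -> torus p.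
Proof.
have HX (i : 'I_d) : exists P : mpol K d, forall x, ev x d P = x i.
  exact: mpol_var.
pose X_ i := sval (cid (HX i)).
have XP i x : ev x d (X_ i) = x i by rewrite /X_; case: cid.
exists (\prod_i X_ i); split.
  rewrite prodf_seq_neq0; apply/allP => i _; apply/implyP => _.
  apply/eqP => X0; have := XP i (fun=> 1); rewrite X0 rmorph0 => /eqP.
  by rewrite eq_sym oner_eq0.
move=> p pE; rewrite rmorph_prod prodf_seq_neq0 => /allP H.
apply: coord_torus => // i; rewrite -env_ord -XP.
exact: (implyP (H i (mem_index_enum _))).
Qed.

Lemma torus_dense p (U : set X) f : cn p `<=` bcone E -> opn U -> U p ->
  regular_at (X := X) p f -> (forall q, U q -> torus q -> f q = 0) -> f p = 0.
Proof.
move=> pE oU Up rf H; have [P [Q [Qp HPQ]]] := chart_frac pE rf.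
have [W [Wp HW]] := chart_open pE oU Up; have [Z [Z0 HZ]] := torus_poly.
suff P0 : P = 0 by rewrite HPQ // P0 rmorph0 mul0r.
apply: (@chart_generic _ _ (W * Z * Q)).
  by rewrite !mulf_neq0 // (ev_nonzero Wp, ev_nonzero Qp).
move=> q qE; rewrite !rmorphM !mulf_eq0 => /norP[/norP[Wq Zq] Qq].
have := H q (HW q qE Wq) (HZ q qE Zq); rewrite HPQ // => /eqP.
by rewrite mulf_eq0 invr_eq0 (negPf Qq) orbF rmorph0 => /eqP.
Qed.

(** All local fractions of [f] have the same lowest terms [A / B]. A prime factor of [A] or [B] with
    a zero on the torus would give [f] a zero or a pole there, so [A] and [B] have no zeros on the
    torus and are monomials. *)
Lemma torus_unit (f : T -> K) :
  (forall p, torus p -> regular_at (X := X) p f /\ f p != 0) ->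
  exists m c, c != 0 /\ forall p, torus p -> f p = c * ch p m.
Proof.
move=> H.
have HPQ p : exists P Q : mpol K d, torus p -> [/\ ev (env p) d P != 0,
    ev (env p) d Q != 0 & forall q, cn q `<=` bcone E ->
    ev (env q) d Q != 0 -> f q = ev (env q) d P / ev (env q) d Q].
  have [tp|] := pselect (torus p); last by exists 0, 0.
  have [rf fp] := H p tp; have pE := torus_chart tp.
  have [P [Q [Qp HPQ]]] := chart_frac pE rf; exists P, Q => _; split=> //.
  by move: fp; rewrite HPQ // mulf_eq0 => /norP[].
have [p1 [p1E Hp1]] := chart_pt_ex (fun=> 1).
have t1 : torus p1 by apply: coord_torus => // i; rewrite Hp1 oner_neq0.
have [P1 [Q1 /(_ t1)[P1p Q1p H1]]] := HPQ p1.
have [g [A [B [g0 EA EB HAB]]]] := lowest_terms (@mpol_factorial K d)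
  (ev_nonzero P1p) (ev_nonzero Q1p).
have A0 : A != 0 by apply: contra_neq (ev_nonzero P1p) => A0; rewrite EA A0 mulr0.
have B0 : B != 0 by apply: contra_neq (ev_nonzero Q1p) => B0; rewrite EB B0 mulr0.
have Eid p : torus p -> exists P Q : mpol K d, [/\ ev (env p) d P != 0,
    ev (env p) d Q != 0, f p = ev (env p) d P / ev (env p) d Q & A * Q = P * B].
  move=> tp; have [P [Q /(_ tp)[Pp Qp HP]]] := HPQ p.
  exists P, Q; split=> //; first by apply: HP => //; exact: torus_chart.
  apply: (mulfI g0); rewrite mulrA -EA mulrCA -EB.
  apply: (@chart_generic _ _ (Q1 * Q)).
    by rewrite mulf_neq0 // (ev_nonzero Q1p, ev_nonzero Qp).
  move=> q qE; rewrite !rmorphM mulf_eq0 => /norP[q1 q2].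
  have : ev (env q) d P1 / ev (env q) d Q1 = ev (env q) d P / ev (env q) d Q.
    by rewrite -H1 // HP.
  move=> /(congr1 (fun x => x * (ev (env q) d Q1 * ev (env q) d Q))) E1.
  transitivity (ev (env q) d P1 / ev (env q) d Q1 *
    (ev (env q) d Q1 * ev (env q) d Q)); first by field.
  by rewrite E1; field.
have nz (C : mpol K d) : C != 0 -> (forall p, torus p -> forall q, prime_elt q ->
    divides q C -> ev (env p) d q != 0) ->
    forall x, (forall i, (i < d)%N -> x i != 0) -> ev x d C != 0.
  move=> C0 HC x Hx; have [p [pE Hp]] := pt_env x.
  rewrite -(ev_ext C Hp); apply/eqP => Cp.
  have tp : torus p by apply: coord_torus => // i; rewrite -env_ord Hp // Hx.
  have [q [Pq qC /eqP]] := prime_factor_at C0 Cp.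
  by apply/negP; exact: HC qC.
have nA : forall x, (forall i, (i < d)%N -> x i != 0) -> ev x d A != 0.
  apply: nz => // p tp q Pq qA; apply/eqP => qp; have [_ _ Hq] := Pq.
  have [P [Q [Pp Qp _ E1]]] := Eid p tp.
  have [|qP|qB] := Hq P B; first by rewrite -E1 mulrC; exact: divides_mull.
    by move/eqP: Pp; apply; exact: ev_divides qP qp.
  exact: (HAB q Pq qA).
have nB : forall x, (forall i, (i < d)%N -> x i != 0) -> ev x d B != 0.
  apply: nz => // p tp q Pq qB; apply/eqP => qp; have [_ _ Hq] := Pq.
  have [P [Q [Pp Qp _ E1]]] := Eid p tp.
  have [|qA|qQ] := Hq A Q; first by rewrite E1; exact: divides_mull.
    exact: (HAB q Pq qA).
  by move/eqP: Qp; apply; exact: ev_divides qQ qp.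
have [c [k [c0 Hk]]] := torus_nonvanishing nA.
have [c' [k' [c0' Hk']]] := torus_nonvanishing nB.
exists (\sum_(i < d) ((k i)%:Z - (k' i)%:Z) *: dualb E i), (c / c').
split; first by rewrite mulf_neq0 // invr_eq0.
move=> p tp; have pE := torus_chart tp; have [P [Q [Pp Qp -> E1]]] := Eid p tp.
have Bp : ev (env p) d B != 0.
  by apply: nB => i id; rewrite (env_ord p (Ordinal id)); exact: torus_coord.
have -> : ev (env p) d P / ev (env p) d Q = ev (env p) d A / ev (env p) d B.
  have := congr1 (ev (env p) d) E1; rewrite !rmorphM => E2.
  apply: (mulIf (mulf_neq0 Qp Bp)).
  transitivity (ev (env p) d P * ev (env p) d B); first by field.
  by rewrite -E2; field.
rewrite Hk Hk' invfM mulrACA; congr (_ * _); rewrite chart_ch // -prodf_div.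
apply: eq_bigr => i _; rewrite !env_ord.
have -> : ip (\sum_(l < d) ((k l)%:Z - (k' l)%:Z) *: dualb E l) (row i E) =
    (k i)%:Z - (k' i)%:Z.
  rewrite ip_suml (bigD1 i) //= ipZl ip_dualb_row // eqxx mulr1 big1 ?addr0 //.
  by move=> l /negPf li; rewrite ipZl ip_dualb_row // li mulr0.
by rewrite expfzDr ?torus_coord // -invr_expz.
Qed.

(** The transition functions to one fixed index are fractions [a x / b x], the local equations of a
    Cartier divisor on affine space. A global equation differs from each of them by a unit near the
    point, and these units correct the transition functions to a nowhere vanishing section. *)
Lemma line_trivial (L : line_data X) : line_bundle L ->
  exists s : lidx L -> T -> K, forall (i : lidx L) (p : X), cn p `<=` bcone E -> ldom i p ->
    [/\ s i p != 0, regular_at (X := X) p (s i) &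
        forall j, ldom j p -> s i p = ltr i j p * s j p].
Proof.
move=> [oL covL regL L1 LM].
have nzL (i j : lidx L) (p : X) : ldom i p -> ldom j p -> ltr i j p != 0.
  move=> ip jp; have := LM i j i p ip jp ip; rewrite L1 // => /eqP.
  by apply: contraTneq => ->; rewrite mul0r eq_sym oner_eq0.
have regLp (i j : lidx L) (p : X) : ldom i p -> ldom j p -> regular_at (X := X) p (ltr i j).
  by move=> ip jp; exists (ldom i `&` ldom j).
pose pt x := sval (cid (pt_env x)).
have ptP x : cn (pt x) `<=` bcone E /\ forall i, (i < d)%N -> env (pt x) i = x i.
  by rewrite /pt; case: cid.
have ev_pt x (P : mpol K d) : ev (env (pt x)) d P = ev x d P.
  by apply: ev_ext; have [] := ptP x.
have pt_env_id p : cn p `<=` bcone E -> pt (env p) = p.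
  move=> pE; have [xE Hx] := ptP (env p); apply: chart_inj => // i.
  by rewrite -!env_ord Hx.
pose jx x := sval (cid (covL (pt x))).
have jxP x : ldom (jx x) (pt x) by rewrite /jx; case: cid.
pose wx x := sval (cid (chart_open (proj1 (ptP x)) (oL (jx x)) (jxP x))).
have wxP x : ev x d (wx x) != 0 /\ forall q, cn q `<=` bcone E ->
    ev (env q) d (wx x) != 0 -> ldom (jx x) q.
  by rewrite /wx; case: cid => W [Wp HW] /=; rewrite -ev_pt.
have wx0 x : wx x != 0.
  by apply: contra_neq (proj1 (wxP x)) => ->; rewrite rmorph0.
pose x0 : nat -> K := fun=> 0; pose j0 := jx x0.
have Hab x : exists a b : mpol K d, [/\ a != 0, b != 0 &
    forall q, cn q `<=` bcone E -> ev (env q) d b != 0 ->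
      ltr (jx x) j0 q = ev (env q) d a / ev (env q) d b].
  have [z] := ev_neq0 (mulf_neq0 (wx0 x) (wx0 x0)).
  rewrite rmorphM mulf_eq0 => /norP[z1 z2].
  have [zE _] := ptP z.
  have d1 : ldom (jx x) (pt z) by apply: (proj2 (wxP x)); rewrite ?ev_pt.
  have d2 : ldom j0 (pt z) by apply: (proj2 (wxP x0)); rewrite ?ev_pt.
  have [P [Q [Qz HPQ]]] := chart_frac zE (regLp _ _ _ d1 d2).
  exists P, Q; split=> //; last exact: ev_nonzero Qz.
  have := nzL _ _ _ d1 d2; rewrite HPQ // mulf_eq0 => /norP[Pz _].
  exact: ev_nonzero Pz.
pose a x := sval (cid (Hab x)).
have Hb x : exists b : mpol K d, [/\ a x != 0, b != 0 &
    forall q, cn q `<=` bcone E -> ev (env q) d b != 0 ->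
      ltr (jx x) j0 q = ev (env q) d (a x) / ev (env q) d b].
  by rewrite /a; case: cid.
pose b x := sval (cid (Hb x)).
have abP x : [/\ a x != 0, b x != 0 &
    forall q, cn q `<=` bcone E -> ev (env q) d (b x) != 0 ->
      ltr (jx x) j0 q = ev (env q) d (a x) / ev (env q) d (b x)].
  by rewrite /b; case: cid.
have a0 x : a x != 0 by have [] := abP x.
have b0 x : b x != 0 by have [] := abP x.
have coh x y q : cn q `<=` bcone E -> ldom (jx x) q -> ldom (jx y) q ->
    exists g h : mpol K d, [/\ ev (env q) d g != 0, ev (env q) d h != 0,
      ltr (jx x) (jx y) q = ev (env q) d g / ev (env q) d h &
      a x * b y * h = b x * a y * g].
  move=> qE xq yq; have [P [Q [Qq HPQ]]] := chart_frac qE (regLp _ _ _ xq yq).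
  exists P, Q; split; last 1 first.
  - apply: (@chart_generic _ _ (b x * b y * Q * wx x * wx y * wx x0)).
      by rewrite !mulf_neq0 // (ev_nonzero Qq).
    move=> r rE; rewrite !rmorphM !mulf_eq0.
    move=> /norP[/norP[/norP[/norP[/norP[bx by'] Qr] wr1] wr2] wr3].
    have r1 := proj2 (wxP x) r rE wr1; have r2 := proj2 (wxP y) r rE wr2.
    have r3 := proj2 (wxP x0) r rE wr3.
    have := LM _ _ _ r r1 r2 r3; rewrite HPQ //.
    have [_ _ ->] // := abP x; have [_ _ ->] // := abP y => E1.
    transitivity ((ev (env r) d (a x) / ev (env r) d (b x)) *
      (ev (env r) d (b x) * ev (env r) d (b y) * ev (env r) d Q)).
      by field.
    by rewrite -E1; field; rewrite ?bx ?by' ?Qr.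
  - by have := nzL _ _ _ xq yq; rewrite HPQ // mulf_eq0 => /norP[].
  - by [].
  exact: HPQ.
have wp x : ev x d (wx x) != 0 by have [] := wxP x.
have cohz x y z : ev z d (wx x) != 0 -> ev z d (wx y) != 0 -> exists g h : mpol K d,
    [/\ ev z d g != 0, ev z d h != 0 & a x * b y * h = b x * a y * g].
  move=> xz yz; have [zE _] := ptP z.
  have d1 : ldom (jx x) (pt z) by apply: (proj2 (wxP x)); rewrite ?ev_pt.
  have d2 : ldom (jx y) (pt z) by apply: (proj2 (wxP y)); rewrite ?ev_pt.
  have [g [h [gz hz _ E1]]] := coh x y (pt z) zE d1 d2.
  by exists g, h; rewrite -(ev_pt z g) -(ev_pt z h).
have [F [G [F0 G0 HFG]]] := @coherent_divisor K d a b wx a0 b0 wp cohz.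
pose c x := sval (cid (HFG x)).
have Hd x : exists e : mpol K d, [/\ ev x d (c x) != 0, ev x d e != 0 &
    a x * G * e = b x * F * c x] by rewrite /c; case: cid.
pose e x := sval (cid (Hd x)).
have ceP x : [/\ ev x d (c x) != 0, ev x d (e x) != 0 &
    a x * G * e x = b x * F * c x] by rewrite /e; case: cid.
pose s (i : lidx L) (p : X) := ltr i (jx (env p)) p * (ev (env p) d (c (env p)) / ev (env p) d (e (env p))).
have domE p : cn p `<=` bcone E -> ldom (jx (env p)) p.
  by move=> pE; have := jxP (env p); rewrite pt_env_id.
exists s => i p pE ip; split.
- have [cp ep _] := ceP (env p).
  by rewrite !mulf_neq0 ?invr_eq0 // nzL //; exact: domE.
- have [cp ep _] := ceP (env p); have jp := domE p pE.
  (* The section makes new choices at every point; near [p] it agrees with the expression built from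
     the choices at [p] alone, which is visibly regular. *)
  pose x := env p.
  have R1 : regular_at (X := X) p (fun q => ltr i (jx x) q *
      (ev (env q) d (c x) * (ev (env q) d (e x))^-1)).
    apply: (ok_mul okX); first exact: regLp.
    by apply: (ok_mul okX); [|apply: (ok_inv okX) => //]; exact: regular_ev.
  have [U [oU Up HU]] := ok_nz okX (regular_ev (e x) pE) ep.
  have oV := okI okX (okI okX oU (oL i)) (okI okX (oL (jx x)) (open_bcone (phi := phi) mE)).
  apply: (ok_ext okX R1 oV) => // q [[Uq iq] [xq qE]].
  have yq := domE q qE; rewrite /s -(LM i (jx x) (jx (env q)) q iq xq yq) -mulrA.
  congr (_ * _); have [g [h [gq hq -> E1]]] := coh x (env q) q qE xq yq.
  have [cq eq Eq] := ceP (env q); have [_ _ Ex] := ceP x.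
  have E2 : g * c (env q) * e x = h * e (env q) * c x.
    have N : a x * b (env q) * (b x * a (env q)) * (G * F) != 0.
      by rewrite !mulf_neq0.
    apply: (mulfI N).
    transitivity ((b x * a (env q) * g) * (b (env q) * F * c (env q)) *
      (a x * G * e x)); first by ring.
    by rewrite -E1 -Eq Ex; ring.
  have := congr1 (ev (env q) d) E2; rewrite !rmorphM => E3.
  have exq := HU q Uq.
  apply: (mulIf (mulf_neq0 (mulf_neq0 hq eq) exq)).
  transitivity (ev (env q) d h * ev (env q) d (e (env q)) * ev (env q) d (c x)).
    by field.
  by rewrite -E3; field; rewrite ?hq ?eq.
- move=> j jp; rewrite /s mulrA; congr (_ * _).
  by rewrite LM //; exact: domE.
Qed.

End Chart.
End ChartPoly.

(** * The Picard number *)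

Section Picard.
Variables (R : realType) (K : closedFieldType) (d : nat).
Variable Sg : set (set 'rV[R]_d).
Hypothesis fanS : is_fan Sg.
Variables (T : Type) (phi : T -> toric_point K Sg) (psi : toric_point K Sg -> T).
Hypotheses (phiK : cancel phi psi) (psiK : cancel psi phi).
Local Notation lat := (@lattice_vec R d).
Local Notation X := (glued_space (tatlas phi)).
Local Notation ch := (ch phi).
Local Notation cn := (cn phi).
Local Notation bcone E := (@gcone R d _ (fun i => row i E) predT).
Local Notation max_cone := (max_cone Sg).
Local Notation torus := (torus phi).
Let okX : ok_space X := ok_tor phi.

Definition trivializes (L : line_data X) (E : 'M[int]_d) (s : lidx L -> T -> K) :
    Prop := forall (i : lidx L) (p : X), cn p `<=` bcone E -> ldom i p ->
  [/\ s i p != 0, regular_at (X := X) p (s i) &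
      forall j, ldom j p -> s i p = ltr i j p * s j p].

Lemma torus_bcone (E : 'M[int]_d) p : torus p -> cn p `<=` bcone E.
Proof. by move=> tp x /tp ->; exact: gcone0. Qed.

(** The quotient of two trivializations does not depend on the local index, so it is a unit on the
    torus, hence a monomial. *)
Lemma line_ratio (L : line_data X) E E' s s' : line_bundle L ->
  max_cone E -> trivializes E s -> trivializes E' s' ->
  exists m c, c != 0 /\ forall (i : lidx L) (p : X), torus p -> ldom i p ->
    s i p = c * ch p m * s' i p.
Proof.
move=> [oL covL _ _ _] mE tE tE'; pose ix p := sval (cid (covL p)).
have ixP p : ldom (ix p) p by rewrite /ix; case: cid.
have indep (i j : lidx L) (p : X) : torus p -> ldom i p -> ldom j p ->
    s i p / s' i p = s j p / s' j p.
  move=> tp ip jp; have pE E1 := torus_bcone E1 tp.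
  have [ni _ /(_ j jp) Ei] := tE i p (pE _) ip; have [nj _ _] := tE j p (pE _) jp.
  have [ni' _ /(_ j jp) Ei'] := tE' i p (pE _) ip.
  have [nj' _ _] := tE' j p (pE _) jp.
  move: ni ni'; rewrite Ei Ei' !mulf_eq0 => /norP[tn _] _.
  by rewrite invfM mulrACA mulfV // mul1r.
have [p tp|m [c [c0 H]]] := torus_unit (f := fun p => s (ix p) p / s' (ix p) p)
    fanS psiK mE.
  have ip := ixP p; have pE E1 := torus_bcone E1 tp.
  have [ni ri _] := tE _ p (pE _) ip; have [ni' ri' _] := tE' _ p (pE _) ip.
  split; last by rewrite mulf_neq0 ?invr_eq0.
  have R1 := ok_mul okX ri (ok_inv okX ri' ni').
  have [uE SE] := mE.
  have tO : opn (torus : set X).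
    have S0 : Sg (@gcone R d _ (fun i => row i E) xpred0).
      exact: (fan_zero_cone fanS _ SE).
    suff -> : torus = [set q | cn q `<=` @gcone R d _ (fun i => row i E) xpred0].
      exact: (@open_chart _ (tatlas phi) (exist _ _ S0)).
    apply/funext => q; apply/propext; split=> H x /H.
      by move=> ->; exact: gcone0.
    by move=> [e [_ ->]]; rewrite big_pred0.
  apply: (ok_ext okX R1 (okI okX (oL (ix p)) tO)) => // q [iq tq] /=.
  exact: indep.
exists m, c; split=> // i p tp ip.
have [ni' _ _] := tE' i p (torus_bcone _ tp) ip.
by rewrite -H // -(indep i) // divfK.
Qed.

(* Compare the two trivializations along a curve crossing the divisor of the ray
   transversally: both are units at its origin, so the exponent there is zero. *)
Lemma weight_ray (L : line_data X) E E' s s' m c i j : line_bundle L ->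
  max_cone E -> max_cone E' -> trivializes E s -> trivializes E' s' -> c != 0 ->
  (forall (l : lidx L) (p : X), torus p -> ldom l p ->
     s l p = c * ch p m * s' l p) ->
  row i E = row j E' -> ip m (row i E) = 0.
Proof.
move=> [oL covL _ _ _] mE mE' tE tE' c0 H Eij.
have [p [pE Hp]] := chart_pt_ex fanS (phi := phi) psiK mE (fun k => (k != i)%:R).
have Ep := chart_cn fanS mE pE; have [uE _] := mE.
have pE' : cn p `<=` bcone E'.
  rewrite Ep => x [e [e0 ->]]; apply: gcone_sum => k; rewrite Hp.
  case: (eqVneq k i) => [-> _|ki]; last by rewrite oner_eq0.
  by apply: gcone_scale => //; rewrite Eij; exact: gcone_gen.
have [l lp] := covL p.
have [n1 r1 _] := tE l p pE lp; have [n2 r2 _] := tE' l p pE' lp.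
have rf := ok_mul okX r1 (ok_inv okX r2 n2).
pose w k : K := (k == i)%:R; pose g := tcurve phi psi E p w.
have J := tcurve_regular fanS psiK uE Ep w rf.
have Hc := tcurve_cofin fanS psiK uE Ep w.
have Hl := tcurve_open fanS psiK uE Ep w (oL l) lp.
have oE' := tcurve_open fanS psiK uE Ep w (open_bcone (phi := phi) mE') pE'.
have ct t k : ch p (dualb E k) + t * w k = if k == i then t else 1.
  have -> : ch p (dualb E k) = (k != i)%:R by exact: Hp.
  by rewrite /w; case: (k == i); rewrite /= ?add0r ?mulr1 ?mulr0 ?addr0.
have J' : jet0 (fun t => c * t ^ ip m (row i E)) (s l p / s' l p).
  apply: jet0_ext J; have := cofinI (cofinI Hc oE') (cofinI Hl (cofin_neq 0)).
  apply: cofin_sub => t [[[ct1 ct2 _ ct4 ct5] tE1] [lt t0]] /=.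
  have qE : cn (g t) `<=` bcone E by move=> x /ct2 /pE.
  have tg : torus (g t).
    apply: (coord_torus fanS mE qE) => k; rewrite /chart_coord /g ct4 ct.
    by case: ifP => // _; exact: oner_neq0.
  have [n3 _ _] := tE' l (g t) tE1 lt.
  rewrite (H l (g t) tg lt) mulfK // ct5 (bigD1 i) //= ct eqxx big1 ?mulr1 //.
  by move=> k /negPf ki; rewrite ct ki exp1rz.
have [_ ->] // := jet0_power c0 J'.
by rewrite mulf_neq0 // invr_eq0.
Qed.

Variables (V : seq 'rV[int]_d).
Hypothesis uniqV : uniq V.
Hypothesis VP : forall v, v \in V <-> exists E i, max_cone E /\ v = row i E.
Hypothesis M_ex : exists E, max_cone E.
Hypothesis cover : forall p : X, exists E, max_cone E /\ cn p `<=` bcone E.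

(** [h] lists the coefficients of a torus-invariant divisor representing [L]. They depend on the ray
    alone because, by [weight_ray], the quotient of two trivializations has exponent zero along a
    common ray; comparing everything with [E0] makes them vanish on its rows. *)
Lemma line_weights (L : line_data X) E0 : line_bundle L -> max_cone E0 ->
  exists (s : 'M[int]_d -> lidx L -> T -> K) (c : 'M[int]_d -> K)
    (m : 'M[int]_d -> 'rV[int]_d) (h : 'rV[int]_d -> int),
  [/\ forall E, max_cone E -> trivializes E (s E) /\ c E != 0,
      forall E (i : lidx L) (p : X), max_cone E -> torus p -> ldom i p ->
        s E i p = c E * ch p (m E) * s E0 i p,
      forall E i, max_cone E -> ip (m E) (row i E) = h (row i E) &
      forall i, h (row i E0) = 0].
Proof.
move=> lL mE0.
have Hs E : exists s : lidx L -> T -> K, max_cone E -> trivializes E s.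
  have [mE|nE] := pselect (max_cone E); last by exists (fun _ _ => 0).
  by have [s Hs] := line_trivial fanS phiK psiK mE lL; exists s.
pose s E := sval (cid (Hs E)).
have sP E : max_cone E -> trivializes E (s E) by rewrite /s; case: cid.
have Hm E : exists m c, max_cone E -> c != 0 /\ forall (i : lidx L) (p : X),
    torus p -> ldom i p -> s E i p = c * ch p m * s E0 i p.
  have [mE|nE] := pselect (max_cone E); last by exists 0, 0.
  by have [m [c H]] := line_ratio lL mE (sP E mE) (sP _ mE0); exists m, c.
pose m E := sval (cid (Hm E)).
have Hc E : exists c, max_cone E -> c != 0 /\ forall (i : lidx L) (p : X),
    torus p -> ldom i p -> s E i p = c * ch p (m E) * s E0 i p.
  by rewrite /m; case: cid.
pose c E := sval (cid (Hc E)).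
have cP E : max_cone E -> c E != 0 /\ forall (i : lidx L) (p : X),
    torus p -> ldom i p -> s E i p = c E * ch p (m E) * s E0 i p.
  by rewrite /c; case: cid.
have mray E E' i j : max_cone E -> max_cone E' -> row i E = row j E' ->
    ip (m E) (row i E) = ip (m E') (row j E').
  move=> mE mE' Eij; have [c0 H] := cP E mE; have [c0' H'] := cP E' mE'.
  apply/eqP; rewrite -Eij -subr_eq0 -ipNl -ipDl; apply/eqP.
  apply: (@weight_ray L E E' (s E) (s E') _ (c E / c E') i j) => //; try exact: sP.
    by rewrite mulf_neq0 // invr_eq0.
  move=> l p tp lp; rewrite H // H' // -[RHS]mulrA.
  rewrite (mulrA (ch p _)) (mulrCA (ch p _)) -(mulrA (c E)) -!mulrA.
  rewrite mulKf //; congr (_ * _); rewrite mulrA; congr (_ * _).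
  have or u : orthogonal_to (cn p) (lat u).
    by move=> x /tp ->; rewrite /dual_pairing big1 // => k _; rewrite !mxE mulr0.
  by rewrite -ch_add // subrK.
have m0 i : ip (m E0) (row i E0) = 0.
  have [c0 H] := cP E0 mE0.
  exact: (@weight_ray L E0 E0 (s E0) (s E0) _ (c E0) i i lL mE0 mE0 (sP _ mE0)
    (sP _ mE0) c0 H).
have Hh v : exists k : int, forall E i, max_cone E -> v = row i E ->
    ip (m E) (row i E) = k.
  have [[E [i [mE ->]]]|nv] := pselect (exists E i, max_cone E /\ v = row i E).
    exists (ip (m E) (row i E)) => E' i' mE' Ei.
    by apply: mray => //; rewrite Ei.
  by exists 0 => E i mE Ev; case: nv; exists E, i.
pose h v := sval (cid (Hh v)).
have hP v E i : max_cone E -> v = row i E -> ip (m E) (row i E) = h v.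
  by rewrite /h; case: cid => k Hk /=; exact: Hk.
exists s, c, m, h; split.
- by move=> E mE; have [c0 _] := cP E mE; split=> //; exact: sP.
- by move=> E i p mE; have [_ H] := cP E mE; exact: H.
- by move=> E i mE; exact: hP.
- by move=> i; rewrite -(hP _ E0 i).
Qed.

(** A nowhere vanishing section, pulled back to a curve, computes the degree with an empty list of
    special points. *)
Lemma line_comb_section r (L : 'I_r -> line_data X) (a : 'I_r -> int) :
  (forall t, line_bundle (L t)) ->
  (exists s : lidx (line_comb L a) -> T -> K,
     forall (i : lidx (line_comb L a)) (p : X), ldom i p ->
     [/\ s i p != 0, regular_at (X := X) p (s i) &
        forall j : lidx (line_comb L a), ldom j p -> s i p = ltr i j p * s j p]) ->
  num_trivial (line_comb L a).
Proof.
move=> lL [s Hs] B nu [_ [nuo nur] _].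
exists 0, (fun i : 'I_0 => match i with @Ordinal _ _ H => False_rect _ (notF H) end),
  (fun=> 0), (fun i q => s i (nu q)).
split; first by case.
- by move=> i j q _ iq jq; have [_ _ H] := Hs i (nu q) iq; exact: (H j jq).
- move=> i q _ iq; have [si [U Up rU] _] := Hs i (nu q) iq; split=> //.
  by exists (nu @^-1` U) => //; exact: (nur U (s i)).
- by case.
by rewrite big_ord0.
Qed.

(** There are more line bundles than rays outside [E0], so some nonzero integral combination has
    weight zero on every ray. Its trivializations over the charts, normalized by the constants [c],
    agree on the torus, hence glue to a nowhere vanishing section. *)
Lemma picard_bound r (L : 'I_r -> line_data X) : (size V < d + r)%N ->
  (forall t, line_bundle (L t)) -> ~ num_independent L.
Proof.
move=> Vr lL ind; have [E0 mE0] := M_ex.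
have W1 t := line_weights (lL t) mE0.
pose s t := sval (cid (W1 t)).
have W2 t : exists (c : 'M[int]_d -> K)
    (m : 'M[int]_d -> 'rV[int]_d) (h : 'rV[int]_d -> int),
  [/\ forall E, max_cone E -> trivializes E (s t E) /\ c E != 0,
      forall E (i : lidx (L t)) (p : X), max_cone E -> torus p -> ldom i p ->
        s t E i p = c E * ch p (m E) * s t E0 i p,
      forall E i, max_cone E -> ip (m E) (row i E) = h (row i E) &
      forall i, h (row i E0) = 0].
  by rewrite /s; case: cid.
pose c t := sval (cid (W2 t)).
have W3 t : exists (m : 'M[int]_d -> 'rV[int]_d) (h : 'rV[int]_d -> int),
  [/\ forall E, max_cone E -> trivializes E (s t E) /\ c t E != 0,
      forall E (i : lidx (L t)) (p : X), max_cone E -> torus p -> ldom i p ->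
        s t E i p = c t E * ch p (m E) * s t E0 i p,
      forall E i, max_cone E -> ip (m E) (row i E) = h (row i E) &
      forall i, h (row i E0) = 0].
  by rewrite /c; case: cid.
pose m t := sval (cid (W3 t)).
have W4 t : exists (h : 'rV[int]_d -> int),
  [/\ forall E, max_cone E -> trivializes E (s t E) /\ c t E != 0,
      forall E (i : lidx (L t)) (p : X), max_cone E -> torus p -> ldom i p ->
        s t E i p = c t E * ch p (m t E) * s t E0 i p,
      forall E i, max_cone E -> ip (m t E) (row i E) = h (row i E) &
      forall i, h (row i E0) = 0].
  by rewrite /m; case: cid.
pose h t := sval (cid (W4 t)).
have W t : [/\ forall E, max_cone E -> trivializes E (s t E) /\ c t E != 0,
      forall E (i : lidx (L t)) (p : X), max_cone E -> torus p -> ldom i p ->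
        s t E i p = c t E * ch p (m t E) * s t E0 i p,
      forall E i, max_cone E -> ip (m t E) (row i E) = h t (row i E) &
      forall i, h t (row i E0) = 0].
  by rewrite /h; case: cid.
pose V' := [seq v <- V | v \notin rows E0].
have sV : size V = (d + size V')%N by exact: rays_count.
have kr : (size V' < r)%N by rewrite sV ltn_add2l in Vr.
pose N : 'M[int]_(r, size V') := \matrix_(t, k) h t (nth 0 V' k).
have [a [a0 aN]] := int_kernel N kr.
have ah E i : max_cone E -> \sum_t a 0 t * h t (row i E) = 0.
  move=> mE; have [vE0|nE0] := boolP (row i E \in rows E0).
    move: vE0; rewrite mem_rows => /existsP[j /eqP ->].
    by rewrite big1 // => t _; have [_ _ _ ->] := W t; rewrite mulr0.
  have vV' : row i E \in V'.
    by rewrite mem_filter nE0; apply/VP; exists E, i.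
  have kV : (index (row i E) V' < size V')%N by rewrite index_mem.
  have := congr1 (fun M : 'M[int]_(1, _) => M 0 (Ordinal kV)) aN; rewrite !mxE => E1.
  rewrite -[RHS]E1; apply: eq_bigr => t _.
  by rewrite mxE /= nth_index.
suff : num_trivial (line_comb L (fun t => a 0 t)).
  move=> /ind H; case/eqP: a0; apply/rowP => t; rewrite mxE; exact: H.
apply: line_comb_section => //.
pose f E (i : forall t, lidx (L t)) p : K :=
  \prod_t (s t E (i t) p / c t E) ^ a 0 t.
have f_reg E (i : forall t, lidx (L t)) (p : X) : max_cone E -> cn p `<=` bcone E ->
    (forall t, ldom (i t) p) -> regular_at (X := X) p (f E i) /\ f E i p != 0.
  move=> mE pE ip.
  have nt t : s t E (i t) p / c t E != 0.
    have [Ht _ _ _] := W t; have [tE cE] := Ht E mE.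
    by have [n _ _] := tE _ p pE (ip t); rewrite mulf_neq0 ?invr_eq0.
  split; last first.
    rewrite prodf_seq_neq0; apply/allP => t _; apply/implyP => _.
    exact: expfz_neq0.
  apply: (regular_prod okX) => t _; apply: (regular_expz okX) => [|/eqP]; last first.
    by rewrite (negPf (nt t)).
  have [Ht _ _ _] := W t; have [tE cE] := Ht E mE.
  have [_ rt _] := tE _ p pE (ip t).
  exact: (ok_mul okX rt (ok_cst okX p _)).
have f_torus E (i : forall t, lidx (L t)) (p : X) : max_cone E -> torus p ->
    (forall t, ldom (i t) p) -> f E i p = \prod_t (s t E0 (i t) p) ^ a 0 t.
  move=> mE tp pi.
  have or u : orthogonal_to (cn p) (lat u).
    by move=> x /tp ->; rewrite /dual_pairing big1 // => k _; rewrite !mxE mulr0.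
  have E1 : \prod_t ch p (m t E) ^ a 0 t = 1.
    have [uE _] := mE; have pE := torus_bcone E tp.
    have y0 k : chart_coord phi E k p != 0 by apply: torus_coord.
    transitivity (\prod_k chart_coord phi E k p ^ (\sum_t a 0 t * ip (m t E) (row k E))).
      under eq_bigr do rewrite (chart_ch fanS mE _ pE) (big_morph _ (fun x y => expfzMl x y _) (exp1rz _ _)).
      rewrite exchange_big /=; apply: eq_bigr => k _.
      elim: (index_enum _) => [|t l IH]; first by rewrite !big_nil expr0z.
      rewrite !big_cons IH exprz_exp [in RHS]expfzDr //.
      by rewrite [_ * a 0 t]mulrC.
    rewrite big1 // => k _.
    have -> : \sum_t a 0 t * ip (m t E) (row k E) = 0; last exact: expr0z.
    by rewrite -[RHS](ah E k mE); apply: eq_bigr => t _; have [_ _ ->] := W t.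
  rewrite -[RHS]mul1r -[X in X * _]E1 -big_split; apply: eq_bigr => t _ /=.
  have [Ht Hm _ _] := W t; have [tE cE] := Ht E mE.
  rewrite -expfzMl.
  by rewrite Hm // -(mulrA (c t E)) (mulrC (c t E)) mulfK.
have oi (i : forall t, lidx (L t)) (p : X) : (forall t, ldom (i t) p) ->
    exists U : set X, [/\ opn U, U p & forall q, U q -> forall t, ldom (i t) q].
  move=> ip; apply: (open_near_finite okX) => t.
  by exists (ldom (i t)); split=> //; have [] := lL t.
have f_indep E E' (i : forall t, lidx (L t)) (p : X) : max_cone E -> max_cone E' ->
    cn p `<=` bcone E -> cn p `<=` bcone E' -> (forall t, ldom (i t) p) ->
    f E i p = f E' i p.
  move=> mE mE' pE pE' ip; apply/eqP; rewrite -subr_eq0; apply/eqP.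
  have [U [oU Up HU]] := oi i p ip.
  have rf := regular_sub okX (f_reg E i p mE pE ip).1 (f_reg E' i p mE' pE' ip).1.
  apply: (torus_dense fanS psiK mE pE oU Up rf) => q Uq tq.
  by rewrite !f_torus ?subrr //; exact: HU.
pose Ex p := sval (cid (cover p)).
have ExP p : max_cone (Ex p) /\ cn p `<=` bcone (Ex p) by rewrite /Ex; case: cid.
exists (fun i p => f (Ex p) i p) => i p ip; have [mE pE] := ExP p.
have [rf fn] := f_reg _ i p mE pE ip; split=> //.
  have [U [oU Up HU]] := oi i p ip.
  apply: (ok_ext okX rf (okI okX oU (open_bcone (phi := phi) mE))) => // q [Uq qE].
  by have [mq qEq] := ExP q; apply: f_indep => //; exact: HU.
move=> j jp; rewrite /= /f -big_split; apply: eq_bigr => t _ /=.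
have [Ht _ _ _] := W t; have [tE cE] := Ht _ mE.
have [_ _ Hj] := tE (i t) p pE (ip t); rewrite (Hj (j t) (jp t)).
by rewrite -mulrA expfzMl.
Qed.

End Picard.

(** The sum of the generators is interior to [S], so a maximal cone containing it meets [S] in a
    face that is all of [S]. *)
Lemma cone_cover (R : realType) (d : nat) (Sg : set (set 'rV[R]_d)) S :
  is_fan Sg ->
  (forall v : 'rV[int]_d, exists E, max_cone Sg E /\
     @gcone R d _ (fun i => row i E) predT (lattice_vec R v)) ->
  Sg S -> exists E, max_cone Sg E /\ S `<=` @gcone R d _ (fun i => row i E) predT.
Proof.
move=> fanS cov SS; have [r [g Eg]] := fan_generated fanS SS.
have [E [mE vE]] := cov (\sum_k g k); have [uE SE] := mE.
exists E; split=> // x Sx.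
have [u du Eu] := fan_face fanS SS SE.
have Sgk k : S (lattice_vec R (g k)) by rewrite Eg; exact: (@gcone_gen R d _ g predT).
have : (S `&` @gcone R d _ (fun i => row i E) predT) (lattice_vec R (\sum_k g k)).
  by split=> //; rewrite lat_sum Eg; apply: (@gcone_sum R d _ g predT) => k _; exact: (@gcone_gen R d _ g predT).
rewrite Eu => -[_ /=].
have -> : dual_pairing u (lattice_vec R (\sum_k g k)) =
    \sum_k 1 * dual_pairing u (lattice_vec R (g k)).
  by rewrite -pairing_sumr lat_sum; under [in RHS]eq_bigr do rewrite scale1r.
move=> /eqP; rewrite psumr_eq0 => [/allP H|k _]; last by rewrite mul1r; exact: du.
suff : (S `&` @gcone R d _ (fun i => row i E) predT) x by case.
rewrite Eu; split=> //=; move: Sx; rewrite Eg => -[c [c0 ->]].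
rewrite pairing_sumr big1 // => k _.
by have := H k (mem_index_enum _); rewrite mul1r => /eqP ->; rewrite mulr0.
Qed.

(** * Products of projective spaces *)

Section ProductOfProjectiveSpaces.
Variables (R : realType) (K : closedFieldType) (d : nat).
Variable Sg : set (set 'rV[R]_d).
Hypothesis fanS : is_fan Sg.
Variables (T : Type) (phi : T -> toric_point K Sg) (psi : toric_point K Sg -> T).
Hypotheses (phiK : cancel phi psi) (psiK : cancel psi phi).
Local Notation lat := (@lattice_vec R d).
Local Notation X := (glued_space (tatlas phi)).
Local Notation ch := (ch phi).
Local Notation cn := (cn phi).
Local Notation bcone E := (@gcone R d _ (fun i => row i E) predT).
Local Notation max_cone := (max_cone Sg).
Let okX : ok_space X := ok_tor phi.
Variables (rho b : nat) (vv : 'I_rho * 'I_b.+1 -> 'rV[int]_d).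
Hypothesis vv_sum : forall k, \sum_i vv (k, i) = 0.
Hypothesis vv_char : forall h : 'I_rho * 'I_b.+1 -> int,
  (forall k, \sum_i h (k, i) = 0) -> exists m, forall a, ip m (vv a) = h a.
Hypothesis vv_zero : forall m, (forall a, ip m (vv a) = 0) -> m = 0.
Local Notation pcone s := (@gcone R d _ vv (fun a => a.2 != s a.1)).
Hypothesis pcone_fan : forall s : 'I_rho -> 'I_b.+1, Sg (pcone s).
Hypothesis pcone_cover : forall p : X, exists E s (al : 'I_d -> 'I_rho * 'I_b.+1),
  [/\ max_cone E, cn p `<=` bcone E, bcone E = pcone s /\ injective al,
      forall i, row i E = vv (al i) &
      forall i, (al i).2 != s (al i).1].
Local Notation PP := {ffun 'I_rho -> proj_point K b}.
Local Notation Y := (proj_pow K b rho).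

Lemma ratio_char_ex k i j : exists m, forall a, ip m (vv a) =
  if a.1 == k then (a.2 == i)%:R - (a.2 == j)%:R else 0.
Proof.
apply: vv_char => k'; have [->|_] := eqVneq k' k; last by rewrite big1.
rewrite big_split /= sumrN (bigD1 i) //= eqxx big1 ?addr0; last first.
  by move=> l /negPf ->.
by rewrite (bigD1 j) //= eqxx big1 ?addr0 ?subrr // => l /negPf ->.
Qed.

(* In homogeneous coordinates, the quotient [z_(k, i) / z_(k, j)]. *)
Definition ratio_char k i j := sval (cid (ratio_char_ex k i j)).

Lemma ratio_charE k i j a : ip (ratio_char k i j) (vv a) =
  if a.1 == k then (a.2 == i)%:R - (a.2 == j)%:R else 0.
Proof. by rewrite /ratio_char; case: cid. Qed.

Lemma ratio_char_dual s k i : dual_cone (pcone s) (lat (ratio_char k i (s k))).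
Proof.
apply/dual_gconeP => a ai; rewrite ratio_charE; case: eqP => // ak.
by rewrite ak in ai; rewrite (negPf ai) subr0 ler0n.
Qed.

Definition hom_coord (L : PP) a : K := hcoord (L a.1) a.2.

Lemma hom_coord_neq0 L k : exists i, hom_coord L (k, i) != 0.
Proof. by have [i Li] := hcoord_neq0 (L k); exists i; rewrite /hom_coord. Qed.

Lemma hom_cone_fan L : Sg (cox_cone vv (hom_coord L)).
Proof.
pose s k := sval (cid (hom_coord_neq0 L k)).
have sP k : hom_coord L (k, s k) != 0 by rewrite /s; case: cid.
have [_ _ HF _] := fanS; apply: (HF _ _ (pcone_fan s)).
(* Away from the omitted generators, [h] is [1] where the coordinate is nonzero and [0] elsewhere;
   at an omitted generator it makes the block sum zero. So it comes from a form, which supports the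
   face of the vanishing coordinates. *)
pose h a : int := if a.2 == s a.1 then - \sum_(i | i != s a.1) (hom_coord L (a.1, i) != 0)%:R
  else (hom_coord L a != 0)%:R.
have [m Hm] : exists m, forall a, ip m (vv a) = h a.
  apply: vv_char => k; rewrite (bigD1 (s k)) //= /h /= eqxx; apply/eqP.
  by rewrite addrC subr_eq0; apply/eqP/eq_bigr => i /negPf ->.
apply: (@gcone_face _ _ _ _ _ _ m) => -[k i] /=.
- by apply: contraTneq => ->.
- by move=> ik; rewrite Hm /h /= (negPf ik) ler0n.
- move=> ik; rewrite Hm /h /= (negPf ik).
  by case: (hom_coord L (k, i) == 0).
Qed.

Definition from_proj (L : PP) : T := cox_pt psi (hom_cone_fan L).

Lemma cn_from_proj L : cn (from_proj L) = cox_cone vv (hom_coord L).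
Proof. exact: cn_cox. Qed.

Lemma ch_from_proj L m : ch (from_proj L) m = cox_val vv (hom_coord L) m.
Proof. exact: ch_cox. Qed.

Lemma cox_val_ratio (z : 'I_rho * 'I_b.+1 -> K) k i j : z (k, j) != 0 ->
  cox_val vv z (ratio_char k i j) = z (k, i) / z (k, j).
Proof.
move=> zj; rewrite /cox_val; have [->|ij] := eqVneq i j.
  rewrite mulfV // big1 // => a _; rewrite ratio_charE.
  by case: eqP => _; rewrite ?subrr expr0z.
rewrite (bigD1 (k, i)) //= (bigD1 (k, j)) /=; last first.
  by apply: contra_neq ij => -[->].
rewrite !ratio_charE /= !eqxx (negPf ij) eq_sym (negPf ij) /= subr0 sub0r.
rewrite expr1z -[z (k, j) ^ _]/((z (k, j) ^+ 1)^-1) expr1.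
rewrite big1 ?mulr1 // => -[k' l] /andP[/= li lj]; rewrite ratio_charE /=.
case: eqP => [kk|_]; last exact: expr0z.
rewrite kk in li lj.
have -> : (l == i) = false by apply: contraNF li => /eqP ->.
have -> : (l == j) = false by apply: contraNF lj => /eqP ->.
by rewrite subrr expr0z.
Qed.

Lemma proj_ratio L s k : cn (from_proj L) `<=` pcone s ->
  hom_coord L (k, s k) != 0 /\ forall i,
  hom_coord L (k, i) / hom_coord L (k, s k) = ch (from_proj L) (ratio_char k i (s k)).
Proof.
move=> Ls; have nz : hom_coord L (k, s k) != 0.
  have [i Li] := hom_coord_neq0 L k.
  have [<- //|si] := eqVneq i (s k); apply/eqP => z0.
  have : (pcone s) (lat (vv (k, s k))).
    apply: Ls; rewrite cn_from_proj; apply: (@gcone_gen R d _ vv _ (k, s k)).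
    by rewrite z0.
  move=> /(@ratio_char_dual s k i); rewrite pairing_lat ler0z ratio_charE /=.
  by rewrite !eqxx eq_sym (negPf si).
by split=> // i; rewrite ch_from_proj cox_val_ratio.
Qed.

Lemma pcone_point L s : (forall k, hom_coord L (k, s k) != 0) ->
  cn (from_proj L) `<=` pcone s.
Proof.
move=> H; rewrite cn_from_proj; apply: sub_gcone => -[k i] /=.
by apply: contraTneq => ->; exact: H.
Qed.

Lemma from_proj_inj : injective from_proj.
Proof.
move=> L L' E; apply/ffunP => k.
pose s l := sval (cid (hom_coord_neq0 L l)).
have sP l : hom_coord L (l, s l) != 0 by rewrite /s; case: cid.
have Ls := pcone_point sP; have L's := Ls; rewrite E in L's.
have [n1 E1] := proj_ratio k Ls; have [n2 E2] := proj_ratio k L's.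
apply: (proj_eq_ratio n1 n2) => i.
by rewrite -/(hom_coord L (k, i)) -/(hom_coord L' (k, i)) E1 E E2.
Qed.

Lemma from_proj_surj p : exists L, from_proj L = p.
Proof.
have [E [s [al [mE pE [EC al_inj] alE als]]]] := pcone_cover p; have [uE _] := mE.
pose x k : 'rV[K]_b.+1 := \row_i ch p (ratio_char k i (s k)).
have xs k : x k 0 (s k) = 1.
  rewrite mxE (_ : ratio_char _ _ _ = 0) ?ch_zero //; apply: vv_zero => a.
  by rewrite ratio_charE subrr if_same.
have x0 k : x k != 0.
  by apply/eqP => /rowP/(_ (s k)); rewrite xs mxE => /eqP; rewrite oner_eq0.
exists [ffun k => proj_mk (x0 k)]; set L := [ffun k => _].
have Ls k : hom_coord L (k, s k) != 0.
  by rewrite /hom_coord ffunE hcoord_mk_eq0 xs oner_eq0.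
have LE := pcone_point Ls; have LE' := LE; rewrite -EC in LE'.
apply: (chart_inj fanS phiK mE LE' pE) => i; rewrite /chart_coord.
(* In this chart the dual basis consists of the characters of the quotients
   [z_(k, i) / z_(k, s k)]. *)
have -> : dualb E i = ratio_char (al i).1 (al i).2 (s (al i).1).
  apply/eqP; rewrite -subr_eq0; apply/eqP/ip_eq0 => w.
  rewrite [w](basis_expand uE) ip_sumr big1 // => j _.
  rewrite ipZr ipDl ipNl ip_dualb_row // alE ratio_charE.
  have -> : (if (al j).1 == (al i).1 then ((al j).2 == (al i).2)%:R -
     ((al j).2 == s (al i).1)%:R else 0) = (i == j)%:R :> int.
    have [<-|ij] := eqVneq i j; first by rewrite !eqxx (negPf (als i)) subr0.
    case: eqP => // e1; rewrite -e1 (negPf (als j)) subr0.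
    case: eqP => // e2; case/eqP: ij; apply: al_inj.
    by rewrite (surjective_pairing (al j)) e1 e2 -surjective_pairing.
  by rewrite subrr mulr0.
have [_ <-] := proj_ratio (al i).1 LE.
by rewrite /hom_coord !ffunE hcoord_mk_ratio xs divr1 mxE.
Qed.

Lemma regular_from_proj : regular_map (from_proj : Y -> X).
Proof.
have okY := ok_proj_pow K b rho.
apply: regular_map_cox => // L; have [s Ls] := proj_pow_chart L.
exists _, vv, (fun a (L' : Y) => hcoord (L' a.1) a.2 / hcoord (L' a.1) (s a.1)).
exists [set L' : Y | adom s L'].
have nz L' k : adom s L' -> hcoord (L' k) (s k) != 0 by apply.
split=> //.
- exact: (@open_chart _ (atlas_pow (proj_atlas K b) rho) s).
- move=> a; apply: (@regular_local_frac _ (atlas_pow (proj_atlas K b) rho) s) => //.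
  apply: local_frac_alg; apply: AlgIn; exists a.1.
  by exists (fun L' => hcoord L' a.2 / hcoord L' (s a.1)); split=> //; exists a.2.
- move=> L' L's; rewrite cn_from_proj; apply: eq_gcone => a.
  by rewrite mulf_eq0 invr_eq0 (negPf (nz _ _ L's)) orbF.
move=> L' L's m; rewrite ch_from_proj /cox_val.
under [RHS]eq_bigr do rewrite expfzMl.
(* Rescaling the coordinates of a block multiplies the character [m] by a power whose exponent is
   the value of [m] on the sum of the block, which is zero. *)
rewrite big_split /= -[LHS]mulr1; congr (_ * _); apply/esym.
rewrite (eq_bigr (fun a => (hcoord (L' a.1) (s a.1))^-1 ^ ip m (vv (a.1, a.2)))).
  rewrite -(pair_bigA _ (fun k i => (hcoord (L' k) (s k))^-1 ^ ip m (vv (k, i)))) /=.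
  rewrite big1 // => k _.
  transitivity ((hcoord (L' k) (s k))^-1 ^ (\sum_i ip m (vv (k, i)))).
    elim: (index_enum _) => [|i l IH]; first by rewrite !big_nil expr0z.
    by rewrite !big_cons IH expfzDr // invr_eq0 nz.
  by rewrite -ip_sumr vv_sum ip0r expr0z.
by move=> [k i].
Qed.

Lemma isomorphic_proj_pow : isomorphic X Y.
Proof.
pose f p := sval (cid (from_proj_surj p)).
have fK p : from_proj (f p) = p by rewrite /f; case: cid.
exists f, from_proj; split=> //; last by move=> L; exact: from_proj_inj.
  2: exact: regular_from_proj.
apply: (regular_map_glued (A := atlas_pow (proj_atlas K b) rho)) => // p s ps.
have pE : cn p `<=` pcone s by rewrite -[p]fK; apply: pcone_point => k; exact: ps.
have oC : opn ([set q | cn q `<=` pcone s] : set X).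
  exact: (@open_chart _ (tatlas phi) (exist _ _ (pcone_fan s))).
split.
  exists [set q | cn q `<=` pcone s]; split=> // q qE k.
  by have [] := @proj_ratio (f q) s k; rewrite ?fK.
move=> _ [k [_ [[i ->] ->]]].
have rc : regular_at (X := X) p (ch ^~ (ratio_char k i (s k))).
  by apply: regular_ch => x /pE; exact: ratio_char_dual.
apply: (ok_ext okX rc oC) => // q qE /=.
by have [|_ ->] := @proj_ratio (f q) s k; rewrite fK.
Qed.

End ProductOfProjectiveSpaces.

(** * The bound and the equality case *)

Lemma toric_pseudo_index_bound (R : realType) (K : closedFieldType) (d : nat)
    (Sg : set (set 'rV[R]_d)) (T : Type) (phi : T -> toric_point K Sg)
    (psi : toric_point K Sg -> T) (n iota rho : nat) :
  is_fan Sg -> cancel phi psi -> cancel psi phi ->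
  manifold (glued_space (tatlas phi)) n ->
  pseudo_index (glued_space (tatlas phi)) n iota ->
  picard_number (glued_space (tatlas phi)) rho ->
  (n + 3 <= 3 * iota)%N ->
  ((rho * (iota - 1) <= n)%N /\ (rho <= 3)%N) /\
  ((rho * (iota - 1))%N = n ->
     isomorphic (glued_space (tatlas phi)) (proj_pow K (iota - 1) rho)).
Proof.
move=> fanS phiK psiK [pv [[t0 _] _] _ sm] [_ hiota] [[L [lL indL]] _] hn.
have nd := toric_dim fanS psiK t0 sm; subst n.
have cf := projective_complete fanS psiK t0 pv.
have uni S : Sg S -> full_cone S -> exists2 E : 'M[int]_d, E \in unitmx &
    S = @gcone R d _ (fun i => row i E) predT.
  move=> SS fS; have [r [g Eg]] := fan_generated fanS SS.
  exact: (unimodular_cone fanS psiK t0 SS fS Eg sm).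
have M_ex : exists E, max_cone Sg E.
  have [S SS fS] := complete_full_cone fanS cf.
  by have [E uE ES] := uni S SS fS; exists E; rewrite /max_cone -ES.
have [V [uniqV VP]] := rays_ex fanS.
have [M MP] := max_cones_ex VP.
have wall E j := @wall_neighbour R d Sg fanS cf uni E j.
have wall_degree E j (a : 'rV[int]_d) : max_cone Sg E -> a 0 j = -1 ->
    max_cone Sg (set_row E j (a *m E)) -> \sum_i a 0 i <= 1 - iota%:Z.
  move=> mE aj mE'.
  have := hiota _ _ (wall_curve_in fanS psiK mE aj mE')
    (wall_degree_curve fanS psiK mE aj mE').
  by move: (\sum_i a 0 i) => A; lia.
have iota_gt0 : (0 < iota)%N by lia.
have cover p : exists E, max_cone Sg E /\
    cn phi p `<=` @gcone R d _ (fun i => row i E) predT.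
  apply: (cone_cover fanS) => [v|]; last exact: cn_fan.
  have [E [mE Hv _]] := height_max uniqV MP M_ex wall wall_degree iota_gt0 v.
  by exists E; split=> //; apply/bconeP => //; have [] := mE.
have sizeV_rho : (d + rho <= size V)%N.
  rewrite leqNgt; apply/negP => Vr.
  exact: (picard_bound fanS phiK psiK uniqV VP M_ex cover Vr lL indL).
have V0 : d = 0%N -> size V = 0%N.
  move=> d0; apply/eqP; rewrite size_eq0; case: V uniqV VP {sizeV_rho} => // v V' _ VP.
  have [E [i _]] := (VP v).1 (mem_head _ _); exfalso.
  by move: i; rewrite d0 => -[].
have [bound _] := rays_bound fanS uniqV VP MP M_ex wall wall_degree iota_gt0.
split.
  split; first by apply: leq_trans bound; rewrite leq_mul2r; apply/orP; right; lia.
  (* With [rho >= 4] the bound gives [4 * (iota - 1) <= d], while the hypothesis says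
     [d <= 3 * (iota - 1)]. These agree only for [d = 0], and then there are no rays. *)
  rewrite leqNgt; apply/negP => r4.
  have [/V0|d0] := posnP d; first lia.
  suff : (4 * (iota - 1) <= d)%N by lia.
  by apply: leq_trans bound; rewrite leq_mul2r; apply/orP; right; lia.
move=> rd; have sizeV : size V = (d + rho)%N.
  (* For [iota = 1] the factor [iota - 1] cannot be cancelled, but then [d = 0] and there are no
     rays. *)
  have [i1|i1] := posnP (iota - 1)%N.
    have d0 : d = 0%N by rewrite -rd i1 muln0.
    by move: (V0 d0) sizeV_rho; lia.
  suff : (size V - d <= rho)%N by lia.
  by rewrite -(leq_pmul2r i1) rd.
have iotaE : iota = (iota - 1).+1 by lia.
have [vv [vv_sum vv_char vv_zero vvP]] := block_structure fanS uniqV VP MP M_ex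
  wall wall_degree iota_gt0 sizeV iotaE rd.
apply: (isomorphic_proj_pow fanS phiK psiK vv_sum vv_char vv_zero).
  exact: (block_fan fanS uniqV VP MP M_ex wall wall_degree iota_gt0 sizeV iotaE rd
    vv_sum vv_char vvP).
move=> p; have [E [mE pE]] := cover p.
have [s [al [al_inj alE sal]]] := max_cone_block fanS uniqV VP iota_gt0 sizeV iotaE
  rd vv_sum vvP mE.
exists E, s, al; split=> //; last by move=> i; apply/sal; exists i.
by split=> //; exact: (block_cone R al_inj alE sal).
Qed.

Close Scope ring_scope.
Close Scope classical_set_scope.

Theorem mainTheorem2 (R : realType) (X : fspace R[i]) (n iota rho : nat)
  (hX : toric_fano_manifold X n)
  (hiota : pseudo_index X n iota)
  (hrho : picard_number X rho)
  (h : (n + 3 <= 3 * iota)%N) :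
  ((rho * (iota - 1) <= n)%N /\ (rho <= 3)%N) /\
  ((rho * (iota - 1))%N = n -> isomorphic X (proj_pow R[i] (iota - 1) rho)).
Proof.
have [mX _ [d [Sg [fanS isoX]]]] := hX.
have [phi [psi [phiK psiK EX]]] := toric_transport isoX.
move: phi psi phiK psiK EX mX hiota hrho; case: X {hX isoX} => T o r /= phi psi phiK psiK.
move=> -> mX hiota hrho.
exact: (toric_pseudo_index_bound fanS phiK psiK mX hiota hrho h).
Qed.
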